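(* Let $n\ge 2$, let $\Omega\subset\mathbb{R}^n$ be a nonempty, bounded, open, connected set of class $C^2$, and let $f\in L^\infty(\Omega)$ with $f\ge 0$. Let $h\colon\mathbb{R}^n\to[0,+\infty]$ be a Borel function such that the set $K:=\operatorname{co}\{\xi\in\mathbb{R}^n:\ h(\xi)=0\}$ (convex hull) is a compact convex set containing $0$ as an interior point, with boundary $\partial K$ of class $C^2$ and strictly positive principal curvatures. Let $$\Lambda:=\sup\{\lambda\ge 0:\ h(\xi)\ge\lambda(\rho(\xi)-1)\ \ \forall \xi\in\mathbb{R}^n\}\in[0,+\infty],$$ where $\rho$ is the gauge function of $K$, and assume that there exists $H^*\le H_0$ such that $c(H^*,r_\Omega)\,\|f\|_{\infty}\le\Lambda$. Let $$J(u)=\int_\Omega [h(Du)-f\,u]\,dx,\qquad u\in W^{1,1}_0(\Omega).$$ Then the Minkowski distance $d$ from $\partial\Omega$ associated to $K$ is the unique minimizer of $J$ in $W^{1,1}_0(\Omega)$ if and only if $\Sigma\subset\operatorname{supp}(f)$, where $\Sigma$ is the set of points of $\Omega$ at which $d$ is not differentiable.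
   Context: Gauges: $\rho(\xi)=\inf\{t\ge0:\ \xi\in tK\}$; $K^0=\{p\in\mathbb{R}^n:\ \langle p,x\rangle\le1\ \forall x\in K\}$ is the polar set of $K$ and $\rho^0$ denotes the gauge function of $K^0$. Under the assumptions on $K$, $\rho$ and $\rho^0$ are of class $C^2$ in $\mathbb{R}^n\setminus\{0\}$. Minkowski distance: $d(x)=\min_{y\in\partial\Omega}\rho^0(x-y)$ for $x\in\overline\Omega$. The inradius is $r_\Omega=\max_{x\in\Omega}d(x)$. Support: $\operatorname{supp}(f)$ is the essential support of $f$ in $\overline\Omega$, i.e. the intersection of all closed sets $C\subseteq\overline\Omega$ such that $f=0$ a.e. in $\Omega\setminus C$. Anisotropic curvatures: the signed distance $d^s$ is $d^s=d$ on $\overline\Omega$ and $d^s(x)=-\min_{z\in\overline\Omega}\rho^0(z-x)$ for $x\in\mathbb{R}^n\setminus\Omega$; it is of class $C^2$ in a tubular neighborhood $\mathcal U$ of $\partial\Omega$. The Cahn–Hoffman field is $n_\rho(x)=-D\rho(Dd^s(x))$, $x\in\mathcal U$. For $y\in\partial\Omega$ the restriction of $Dn_\rho(y)$ to the tangent space $T_y$ of $\partial\Omega$ at $y$ is a linear map $T_y\to T_y$ with $n-1$ real eigenvalues $\tilde\kappa_1(y),\dots,\tilde\kappa_{n-1}(y)$ (the principal $\rho$-curvatures). Set $\widetilde H(y)=\frac1{n-1}\sum_{i=1}^{n-1}\tilde\kappa_i(y)$ and $H_0=\min_{y\in\partial\Omega}\widetilde H(y)$. The function $c\colon\mathbb{R}\times(0,\infty)\to\mathbb{R}$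 is $c(t,r)=\frac{1-(1-tr)^n}{nt}$ if $t\ne0$, and $c(0,r)=r$. *)

(* Defs.v *)
From HB Require Import structures.
From mathcomp Require Import all_boot all_order all_algebra.
From mathcomp Require Import all_classical all_reals all_analysis.
From mathcomp Require Import measurable_realfun.

Set Implicit Arguments.
Unset Strict Implicit.
Unset Printing Implicit Defensive.

Import Order.TTheory GRing.Theory Num.Theory.
Import numFieldNormedType.Exports.

Local Open Scope classical_set_scope.
Local Open Scope ring_scope.

(* [matrix] has no measurable structure in the library: we use the Borel
   sigma-algebra. Lebesgue measure is the image, under tuple -> row, of the
   iterated product of the one-dimensional one. *)

Definition matrix_display : measure_display. Proof. exact. Qed.

HB.instance Definition _ (R : realType) (m n : nat) :=
  @isMeasurable.Build matrix_display 'M[R]_(m, n) <<s @open 'M[R]_(m, n) >>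
    (@sigma_algebra0 _ setT _) (@sigma_algebraC _ _)
    (@sigma_algebra_bigcup _ setT _).


Section cons_measure.
Context (R : realType) (n : nat).
Local Notation T := (measurableTypeR R).

Definition tuple_cons (p : T * n.-tuple T) : n.+1.-tuple T :=
  [tuple of p.1 :: p.2].

Definition tuple_uncons (t : n.+1.-tuple T) : T * n.-tuple T :=
  (thead t, [tuple of behead t]).

Lemma measurable_tuple_cons : measurable_fun setT tuple_cons.
Proof. exact: measurable_cons. Qed.

Lemma measurable_tuple_uncons : measurable_fun setT tuple_uncons.
Proof.
apply/measurable_fun_pair; last exact: measurable_behead.
exact: measurable_tnth.
Qed.

Lemma tuple_consK : cancel tuple_cons tuple_uncons.
Proof.
by move=> [x t]; congr pair; apply: val_inj.
Qed.

Variable mu : {sigma_finite_measure set (n.-tuple T) -> \bar R}.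

Definition cons_measure : set (n.+1.-tuple T) -> \bar R :=
  pushforward (lebesgue_measure \x mu)%E tuple_cons.

Let cons_measure0 : cons_measure set0 = 0%E.
Proof. by rewrite /cons_measure /pushforward preimage_set0 measure0. Qed.

Let cons_measure_ge0 A : (0 <= cons_measure A)%E.
Proof. by rewrite /cons_measure /pushforward. Qed.

Let cons_measure_sigma_additive : semi_sigma_additive cons_measure.
Proof.
move=> F mF tF mUF.
have mpre A : measurable A -> measurable (tuple_cons @^-1` A).
  by move=> mA; rewrite -[X in measurable X]setTI; exact: measurable_tuple_cons.
rewrite /cons_measure /pushforward preimage_bigcup.
apply: measure_semi_sigma_additive => [k||]; first exact: mpre.
- apply/trivIsetP => i j _ _ ij; rewrite -preimage_setI.
  by move/trivIsetP : tF => /(_ _ _ _ _ ij) -> //; rewrite preimage_set0.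
- by rewrite -preimage_bigcup; exact: mpre.
Qed.

HB.instance Definition _ := isMeasure.Build _ _ _ cons_measure
  cons_measure0 cons_measure_ge0 cons_measure_sigma_additive.

Let cons_measure_sigma_finite : sigma_finite setT cons_measure.
Proof.
have /sigma_finiteP[F [TF ndF Foo]] := sigma_finiteT (@lebesgue_measure R).
have /sigma_finiteP[G [TG ndG Goo]] := sigma_finiteT mu.
have FGE k : tuple_cons @^-1` (tuple_uncons @^-1` (F k `*` G k)) = F k `*` G k.
  by rewrite -comp_preimage (_ : _ \o _ = id) ?preimage_id //;
    apply/funext => x /=; rewrite tuple_consK.
exists (fun k => tuple_uncons @^-1` (F k `*` G k)).
  rewrite -preimage_bigcup -[LHS](preimage_setT tuple_uncons); congr (_ @^-1` _).
  rewrite -setXTT TF TG predeqE => -[x y]; split.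
    move=> [/= [p _ Fpx] [q _ Gqy]]; exists (maxn p q) => //; split.
    - by move: x Fpx; exact/subsetPset/ndF/leq_maxl.
    - by move: y Gqy; exact/subsetPset/ndG/leq_maxr.
  by move=> [p _ []/= ? ?]; split; exists p.
move=> k; have [mF Fk] := Foo k; have [mG Gk] := Goo k; split.
  rewrite -[X in measurable X]setTI; apply: measurable_tuple_uncons => //.
  exact: measurableX.
rewrite /cons_measure /pushforward FGE product_measure1E //.
by rewrite lte_mul_pinfty // ge0_fin_numE.
Qed.

HB.instance Definition _ := Measure_isSigmaFinite.Build _ _ _ cons_measure
  cons_measure_sigma_finite.

End cons_measure.

Fixpoint lebesgue_tuple (R : realType) (n : nat) :
    {sigma_finite_measure set (n.-tuple (measurableTypeR R)) -> \bar R} :=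
  if n is n'.+1 then cons_measure (lebesgue_tuple R n')
  else dirac [tuple].

Section lebesgue_rV.
Context (R : realType) (n : nat).
Local Notation T := (measurableTypeR R).

Definition row_of_tuple (t : n.-tuple T) : 'rV[R]_n :=
  \row_i (tnth t i : R).

Lemma measurable_row_of_tuple : measurable_fun setT row_of_tuple.
Proof.
pose B (p : 'rV[rat]_n * nat) : set 'rV[R]_n :=
  ball (map_mx (@ratr R) p.1 : 'rV[R]_n) (p.2.+1%:R^-1 : R).
have mB p : measurable (row_of_tuple @^-1` B p).
  have -> : row_of_tuple @^-1` B p =
      \bigcap_(i in [set: 'I_n])
        (@tnth _ T ^~ i @^-1` ball (ratr (p.1 ord0 i) : R) (p.2.+1%:R^-1)).
    apply/seteqP; split => t /=.
      by move=> [_ /(_ ord0) H] i _ /=; have := H i; rewrite !mxE.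
    move=> H; split; first by rewrite invr_gt0.
    by move=> i j; rewrite !mxE ord1; exact: H.
  apply: fin_bigcap_measurable => // i _.
  rewrite -[X in measurable X]setTI; apply: measurable_tnth => //.
  by exact: measurable_ball.
apply: (@measurability _ _ _ _ _ _ (@open 'rV[R]_n)) => // _ [U oU <-].
rewrite setTI.
have -> : U = \bigcup_(p in [set p | B p `<=` U]) B p.
  apply/seteqP; split => [x Ux|x [p /= BU]]; last exact: BU.
  have /nbhs_ballP[e /= e0 xeU] : nbhs x U by exact: open_nbhs_nbhs.
  have [k ke] : exists k : nat, (k.+1%:R^-1 : R) < e / 2.
    have [k _ /(_ k (leqnn k)) h] := near_infty_natSinv_lt (PosNum (divr_gt0 e0 (ltr0n _ 2))).
    by exists k.
  have k0 : 0 < (k.+1%:R^-1 : R) by rewrite invr_gt0.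
  have oB i := @ball_open _ _ (x ord0 i) (k.+1%:R^-1 : R).
  have H i : exists q : rat, ball (x ord0 i) (k.+1%:R^-1 : R) (ratr q).
    have [|q [? [r _ ?]]] := @dense_rat R (ball (x ord0 i) (k.+1%:R^-1 : R)) _ (oB i).
      by exists (x ord0 i); exact: ballxx.
    by exists r; subst q.
  have [q Hq] := choice H.
  have xB : ball (map_mx (@ratr R) (\row_i q i) : 'rV[R]_n) (k.+1%:R^-1 : R) x.
    by split => // i j; rewrite !mxE ord1; exact/ball_sym/Hq.
  exists (\row_i q i, k) => //= y qy; apply: xeU.
  rewrite (splitr e); apply: (@ball_triangle _ _ (map_mx (@ratr R) (\row_i q i) : 'rV[R]_n)).
    exact/ball_sym/(le_ball (ltW ke)).
  exact: le_ball (ltW ke) _ qy.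
rewrite preimage_bigcup bigcup_mkcond.
apply: countable_bigcupT_measurable => [|p]; first exact: countableP.
by case: ifP.
Qed.

Definition lebesgue_rV : set 'rV[R]_n -> \bar R :=
  pushforward (lebesgue_tuple R n) row_of_tuple.

Let lebesgue_rV0 : lebesgue_rV set0 = 0%E.
Proof. by rewrite /lebesgue_rV /pushforward preimage_set0 measure0. Qed.

Let lebesgue_rV_ge0 A : (0 <= lebesgue_rV A)%E.
Proof. by rewrite /lebesgue_rV /pushforward. Qed.

Let lebesgue_rV_sigma_additive : semi_sigma_additive lebesgue_rV.
Proof.
move=> F mF tF mUF.
have mpre A : measurable A -> measurable (row_of_tuple @^-1` A).
  by move=> mA; rewrite -[X in measurable X]setTI; exact: measurable_row_of_tuple.
rewrite /lebesgue_rV /pushforward preimage_bigcup.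
apply: measure_semi_sigma_additive => [k||]; first exact: mpre.
- apply/trivIsetP => i j _ _ ij; rewrite -preimage_setI.
  by move/trivIsetP : tF => /(_ _ _ _ _ ij) -> //; rewrite preimage_set0.
- by rewrite -preimage_bigcup; exact: mpre.
Qed.

HB.instance Definition _ := isMeasure.Build _ _ _ lebesgue_rV
  lebesgue_rV0 lebesgue_rV_ge0 lebesgue_rV_sigma_additive.

End lebesgue_rV.
Arguments lebesgue_rV {R n}.

Section euclidean.
Context {R : realType} {n : nat}.
Local Notation E := 'rV[R]_n.
Implicit Types (A V K : set E) (phi : E -> R) (x y xi : E).

Definition dotv x y : R := \sum_i x ord0 i * y ord0 i.

Definition partial (i : 'I_n) phi : E -> R := 'D_(delta_mx ord0 i) phi.

Definition grad phi x : E := \row_i partial i phi x.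

(* [V] is meant to be open. *)
Fixpoint classC (k : nat) V phi : Prop :=
  if k is k'.+1 then
    forall i, (forall x, V x -> derivable phi x (delta_mx ord0 i)) /\
              classC k' V (partial i phi)
  else forall x, V x -> {for x, continuous phi}.

Definition boundary A : set E := closure A `\` A°.

Definition conv_hull A : set E := smallest (@convex_set R E) A.

Definition gauge K xi : R :=
  inf [set t | 0 <= t /\ exists2 x, K x & xi = t *: x].

Definition polar K : set E := [set p | forall x, K x -> dotv p x <= 1].

(* Local C^2 defining function at a boundary point [y], negative inside, so
   that its gradient is an outer normal. *)
Definition C2_defining A y phi : Prop :=
  exists V, [/\ open V, V y, classC 2 V phi, grad phi y != 0
    & forall x, V x -> (A° x <-> phi x < 0) /\ (boundary A x <-> phi x = 0)].

Definition class_C2 A : Prop :=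
  forall y, boundary A y -> exists phi, C2_defining A y phi.

Definition tangent_space A y : set E :=
  [set v | exists2 phi, C2_defining A y phi & dotv (grad phi y) v = 0].

Definition unit_normal phi x : E :=
  (Num.sqrt (dotv (grad phi x) (grad phi x)))^-1 *: grad phi x.

(* Eigenvalues of the Weingarten map, i.e. of the differential of the outer
   unit normal on the tangent space (positive for spheres). *)
Definition principal_curvature A y (kappa : R) : Prop :=
  exists phi v, [/\ C2_defining A y phi, v != 0, dotv (grad phi y) v = 0
    & 'd (unit_normal phi) y v = kappa *: v].

End euclidean.

Section minkowski_distance.
Context {R : realType} {n : nat}.
Local Notation E := 'rV[R]_n.
Implicit Types (K Omega : set E) (x y : E).

(* The minima and maxima below are attained for compact [K] and bounded [Omega];
   they are written with [inf] and [sup]. *)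
Definition minkowski_dist K Omega x : R :=
  inf [set gauge (polar K) (x - y) | y in boundary Omega].

Definition sdist K Omega x : R :=
  if `[< closure Omega x >] then minkowski_dist K Omega x
  else - inf [set gauge (polar K) (z - x) | z in closure Omega].

Definition inradius K Omega : R := sup [set minkowski_dist K Omega x | x in Omega].

Definition cahn_hoffman K Omega x : E :=
  - grad (gauge K) (grad (sdist K Omega) x).

(* The rows of [B] form a basis of the tangent space, in which [M] is the matrix
   of the restriction of the differential of [cahn_hoffman]; as for ['J], it acts
   on row vectors by right multiplication. The [kappa ord0 i] are its eigenvalues
   with their algebraic multiplicities. *)
Definition is_rho_curvatures K Omega y (kappa : 'rV[R]_n.-1) : Prop :=
  exists (B : 'M[R]_(n.-1, n)) (M : 'M[R]_n.-1),
    [/\ row_free B,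
        forall v : E, (v <= B)%MS <-> tangent_space Omega y v,
        B *m 'J (cahn_hoffman K Omega) y = M *m B
      & char_poly M = \prod_i ('X - (kappa ord0 i)%:P)].

Definition rho_curvatures K Omega y : 'rV[R]_n.-1 :=
  get (is_rho_curvatures K Omega y).

Definition mean_rho_curvature K Omega y : R :=
  n.-1%:R^-1 * \sum_i rho_curvatures K Omega y ord0 i.

Definition min_mean_rho_curvature K Omega : R :=
  inf [set mean_rho_curvature K Omega y | y in boundary Omega].

End minkowski_distance.

Definition cfun {R : realType} (n : nat) (t r : R) : R :=
  if t == 0 then r else (1 - (1 - t * r) ^+ n) / (n%:R * t).

Section sobolev.
Context {R : realType} {n : nat}.
Local Notation E := 'rV[R]_n.
Local Notation mu := (@lebesgue_rV R n).
Implicit Types (Omega : set E) (u phi : E -> R) (g : E -> E).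

Definition test_function Omega phi : Prop :=
  [/\ forall k, classC k setT phi, compact (closure [set x | phi x != 0])
    & closure [set x | phi x != 0] `<=` Omega].

Definition is_weak_grad Omega u g : Prop :=
  [/\ mu.-integrable Omega (EFin \o u),
      forall i, mu.-integrable Omega (fun x => (g x ord0 i)%:E)
    & forall phi i, test_function Omega phi ->
      (\int[mu]_(x in Omega) (u x * partial i phi x)%:E =
       - \int[mu]_(x in Omega) (g x ord0 i * phi x)%:E)%E].

Definition W11 Omega u : Prop := exists g, is_weak_grad Omega u g.

(* Chosen among the weak gradients, which agree almost everywhere in [Omega]. *)
Definition weak_grad Omega u : E -> E := get (is_weak_grad Omega u).

Definition W11_0 Omega u : Prop :=
  W11 Omega u /\ exists phi : nat -> E -> R,
    (forall k, test_function Omega (phi k)) /\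
    (fun k => \int[mu]_(x in Omega) `|phi k x - u x|%:E +
      \sum_(i < n) \int[mu]_(x in Omega)
        `|partial i (phi k) x - weak_grad Omega u x ord0 i|%:E)%E
      @ \oo --> 0%E.

Definition functional (h : E -> \bar R) (f : E -> R) Omega u : \bar R :=
  (\int[mu]_(x in Omega) (h (weak_grad Omega u x) - (f x * u x)%:E))%E.

(* Functions in [W11_0] are identified when they agree almost everywhere. *)
Definition unique_minimizer Omega (J : (E -> R) -> \bar R) u : Prop :=
  [/\ W11_0 Omega u,
      forall v, W11_0 Omega v -> (J u <= J v)%E
    & forall v, W11_0 Omega v -> (forall w, W11_0 Omega w -> (J v <= J w)%E) ->
      ae_eq mu Omega v u].

Definition Linfty_norm Omega (f : E -> R) : \bar R :=
  Lnorm mu +oo (EFin \o (f \_ Omega)).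

Definition ess_support Omega (f : E -> R) : set E :=
  \bigcap_(C in [set C | [/\ closed C, C `<=` closure Omega
    & {ae mu, forall x, (Omega `\` C) x -> f x = 0}]]) C.

Definition growth_constant (h : E -> \bar R) (K : set E) : \bar R :=
  ereal_sup [set l%:E | l in [set l : R | 0 <= l /\
    forall xi, ((l * (gauge K xi - 1))%:E <= h xi)%E]].

Definition singular_set (K Omega : set E) : set E :=
  [set x | Omega x /\ ~ differentiable (minkowski_dist K Omega) x].

End sobolev.

(* Main.v *)
(* Write [rho] for the gauge of [K] and [b = D rho]. As [h = 0] at the exposed points of [K], [J d] is [- int f d];
the hypothesis on [f] gives [h >= c(H, r) |f|_oo (rho - 1)^+]. Everything rests on the inequality
 int (u - d)^+ <= c(H, r) int (rho(Du) - 1)^+ - (1 / n) int d (rho(Du) - 1)^+ ,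
which yields minimality of [d]. It follows from the weak bound [- div b(Dd) >= (n - 1) H / (1 - d H)], tested with
[Phi(d) (u - d)^+] where [Phi] solves an ordinary differential equation; that bound is proved with a soft minimum of
smooth upper barriers of [d], whose second order data come from the curvatures at the projection on the boundary.
A second minimizer [u] has [rho(Du) <= 1] a.e., so it is 1-Lipschitz for the Minkowski distance, [u <= d], and [u = d]
on the support of [f]; every transport ray ends in the closure of [Sigma], so [u = d]. Conversely, if [x0] is in
[Sigma] but off the support, then [min(d, d(x0) - eps + rho0(. - x0))] is another minimizer. *)
Require Import Defs.
From HB Require Import structures.
From mathcomp Require Import all_boot all_order all_algebra.
From mathcomp Require Import all_classical all_reals all_analysis.
From mathcomp Require Import measurable_realfun.
From mathcomp Require Import ring lra complex.

Import Order.TTheory GRing.Theory Num.Theory.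
Import numFieldNormedType.Exports.

Set Implicit Arguments.
Unset Strict Implicit.
Unset Printing Implicit Defensive.

Local Open Scope classical_set_scope.
Local Open Scope ring_scope.

Local Notation min := Num.min.
Local Notation max := Num.max.
Local Notation mfun := (measurable_fun setT).
Local Notation "x $ i" := (x ord0 i) (at level 12, left associativity, i at level 9, format "x $ i").

(** Two obstacles shape the proof. The distance is only Lipschitz, and neither its regularity near
    the boundary nor the size of its singular set is studied: curvature enters only through
    one-sided quadratic bounds, and differentiability almost everywhere follows from comparing
    forward and backward difference quotients of an infimum. Moreover a minimum of barriers is not
    smooth and [b] is nonlinear. The values of [b] at the gradients of the barriers are therefore
    averaged with Gibbs weights; differentiating the weights adds minus a covariance, whose sign is
    known since [b] is monotone. All error terms are paid by a strict inequality [H < H^*], which is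
    relaxed only in the final scalar inequality, where [c] is polynomial in [H]. The function [Phi]
    is fixed by [(n - 1) H / (1 - t H) Phi - Phi' = 1] and [Phi(r) = 0]. It equals [c(H, r)] at
    [t = 0] and satisfies [Phi(t) <= c(H, r) - t / n]: this gives both the constant of the
    hypothesis and the extra term with the factor [1 / n], whose vanishing forces [rho(Du) <= 1] for
    a second minimizer. *)

Lemma le_eq d (T : porderType d) (x y : T) : x = y -> (x <= y)%O.
Proof. by move=> ->. Qed.

(** Positivity by structure, the leaves being left to [t]. [pos] falls back on [lra], hence also
    closes linear goals; [posn] relies on the structure alone. *)
Ltac pos_or t := first [done | assumption | match goal with
 | |- is_true (0 < _ * _) => apply: mulr_gt0; pos_or t
 | |- is_true (0 <= _ * _) => apply: mulr_ge0; pos_or t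
 | |- is_true (0 < _^-1) => rewrite invr_gt0; pos_or t
 | |- is_true (0 <= _^-1) => rewrite invr_ge0; pos_or t
 | |- is_true (0 < _ ^+ _) => apply: exprn_gt0; pos_or t
 | |- is_true (0 <= _ ^+ _) => apply: exprn_ge0; pos_or t
 | |- is_true (0 < _ + _) => first [apply: addr_gt0; pos_or t | apply: ltr_wpDl; pos_or t | apply: ltr_wpDr; pos_or t]
 | |- is_true (0 <= _ + _) => apply: addr_ge0; pos_or t
 | |- is_true (_ < min _ _) => rewrite lt_min; pos_or t
 | |- is_true (_ && _) => apply/andP; split; pos_or t
 | |- is_true (0 < `|_|) => rewrite normr_gt0; pos_or t
 | |- is_true (_ != 0) => apply: lt0r_neq0; pos_or t
 | |- is_true (0 < _%:R) => rewrite ltr0n; pos_or t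
 | |- is_true (0 <= _) => apply: ltW; pos_or t end | t].
Ltac pos := pos_or ltac:(lra).
Ltac posn := pos_or fail.

(** * Calculus along lines *)

Section lines.
Context {R : realType} {V W : normedModType R}.
Implicit Types (f : V -> W).

Lemma der_lineP f x v t d : is_derive (x + t *: v) v f d <-> is_derive t 1 (fun s : R => f (x + s *: v)) d.
Proof.
have e : (fun h : R => h^-1 *: ((f \o shift (x + t *: v)) (h *: v) - f (x + t *: v))) =
 (fun h : R => h^-1 *: (((fun s : R => f (x + s *: v)) \o shift t) (h *: 1) - f (x + t *: v))).
 apply/funext => h /=; congr (_ *: (f _ - _)).
 by rewrite scalerDl [h%:A]mulr1 addrCA.
by split=> -[]; rewrite /derivable /derive ?e => h1 h2; apply: DeriveDef; rewrite /derivable /derive ?e.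
Qed.

Lemma is_derive_line f x v t d : is_derive (x + t *: v) v f d -> is_derive t 1 (fun s : R => f (x + s *: v)) d.
Proof. by move/der_lineP. Qed.

End lines.

Section calc1.
Context {R : realType}.

Lemma MVT01 (f df : R -> R) : (forall t : R, 0 <= t <= 1 -> is_derive t 1 f (df t)) ->
 exists2 c, 0 <= c <= 1 & f 1 - f 0 = df c.
Proof.
move=> h; have [|||c] := @MVT_segment R f df 0 1; rewrite ?ler01//.
- by move=> x; rewrite in_itv/= => /andP[x0 x1]; apply: h; rewrite !ltW.
- apply: derivable_within_continuous => x; rewrite in_itv/= => x01.
 by have [] := h _ x01.
- by rewrite in_itv/= => c01; rewrite subr0 mulr1 => e; exists c.
Qed.

End calc1.

Section calc.
Context {R : realType} {V : normedModType R}.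

Lemma is_derive_comp1 (f : V -> R) (g : R -> R) x v a b :
 is_derive x v f a -> is_derive (f x) 1 g b -> is_derive x v (g \o f) (b * a).
Proof.
move=> hf hg; rewrite -[x]addr0 -(scale0r v).
apply/(@der_lineP _ _ _ (g \o f) x v 0 (b * a)).
apply: (@is_derive1_comp _ g (fun s : R => f (x + s *: v)) 0 b a).
 by rewrite scale0r addr0.
by apply/(@der_lineP _ _ _ f x v 0 a); rewrite scale0r addr0.
Qed.

Lemma MVTv (f : V -> R) x v (df : R -> R) : (forall t : R, 0 <= t <= 1 -> is_derive (x + t *: v) v f (df t)) ->
 exists2 c, 0 <= c <= 1 & f (x + v) - f x = df c.
Proof.
move=> h; have [t t01|c c01] := @MVT01 _ (fun s => f (x + s *: v)) df.
 exact/(@der_lineP _ _ _ f x v t)/h.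
by rewrite scale1r scale0r addr0 => e; exists c.
Qed.

(** The segment is parametrised by [t] in [[0, 1]], so that [s] may have either sign or vanish. *)
Lemma MVTvs (f : V -> R) x v (s : R) (df : R -> R) :
 (forall t : R, 0 <= t <= 1 -> is_derive (x + (t * s) *: v) v f (df t)) ->
 exists2 c, 0 <= c <= 1 & f (x + s *: v) - f x = s * df c.
Proof.
move=> h; have [t t01|c c01] := @MVT01 _ (fun u => f (x + (u * s) *: v)) (fun t => s * df t).
 rewrite [s * _]mulrC.
 apply: (@is_derive1_comp _ (fun w : R => f (x + w *: v)) (fun u => u * s) t (df t) s).
  exact/(@der_lineP _ _ _ f x v (t * s))/h.
 have := is_deriveM (is_derive_id t (1:R)) (is_derive_cst s t (1:R)).
 by move=> /is_derive_eq; apply; rewrite scaler0 add0r; exact: mulr1.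
by rewrite mul1r mul0r scale0r addr0 => e; exists c.
Qed.

End calc.

Lemma addr_subK (V : zmodType) (x v : V) : x + v - x = v.
Proof. by rewrite addrC addKr. Qed.

Lemma half_sub_le (R : realFieldType) (M X Y Z : R) : M * Z <= Y -> - (M / 2 * Z) <= X - Y -> M / 2 * Z <= X.
Proof. lra. Qed.

Lemma sqr_mono (R : realDomainType) (a b : R) : 0 <= a -> a <= b -> a ^+ 2 <= b ^+ 2.
Proof. by move=> a0 ab; rewrite !expr2 ler_pM. Qed.

Lemma half_dist_le (R : realFieldType) (r s : R) : `|r - s| <= s / 2 -> s / 2 <= r.
Proof. by rewrite ler_norml => /andP[]; lra. Qed.

(** * Scalar product, gradients and the classes C^k *)

Section first_order.
Context {R : realType} {n : nat}.
Notation E := 'rV[R]_n.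

Section dot.
Implicit Types (x y z v : E) (k : R).

Lemma dotvC x y : dotv x y = dotv y x.
Proof. by apply: eq_bigr => i _; rewrite mulrC. Qed.

Lemma dotvDl x y z : dotv (x + y) z = dotv x z + dotv y z.
Proof. by rewrite /dotv -big_split; apply: eq_bigr => i _; rewrite !mxE mulrDl. Qed.

Lemma dotvDr x y z : dotv x (y + z) = dotv x y + dotv x z.
Proof. by rewrite dotvC dotvDl ![dotv _ x]dotvC. Qed.

Lemma dotvZl k x y : dotv (k *: x) y = k * dotv x y.
Proof. by rewrite /dotv mulr_sumr; apply: eq_bigr => i _; rewrite !mxE mulrA. Qed.

Lemma dotvZr k x y : dotv x (k *: y) = k * dotv x y.
Proof. by rewrite dotvC dotvZl dotvC. Qed.

Lemma dotvNl x y : dotv (- x) y = - dotv x y.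
Proof. by rewrite -scaleN1r dotvZl mulN1r. Qed.

Lemma dotvNr x y : dotv x (- y) = - dotv x y.
Proof. by rewrite dotvC dotvNl dotvC. Qed.

Lemma dotvBl x y z : dotv (x - y) z = dotv x z - dotv y z.
Proof. by rewrite dotvDl dotvNl. Qed.

Lemma dotvBr x y z : dotv x (y - z) = dotv x y - dotv x z.
Proof. by rewrite dotvDr dotvNr. Qed.

Lemma dotv0l x : dotv 0 x = 0.
Proof. by rewrite -(scale0r 0) dotvZl mul0r. Qed.

Lemma dotv0r x : dotv x 0 = 0.
Proof. by rewrite dotvC dotv0l. Qed.

Lemma dotv_suml I (r : seq I) (P : pred I) (F : I -> E) x :
 dotv (\sum_(i <- r | P i) F i) x = \sum_(i <- r | P i) dotv (F i) x.
Proof.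
apply: (big_morph (fun z => dotv z x)) => [y z|]; first exact: dotvDl.
exact: dotv0l.
Qed.

Lemma dotv_delta x i : dotv x (delta_mx ord0 i) = x$i.
Proof.
rewrite /dotv (bigD1 i)//= big1 ?addr0 => [|j ji].
 by rewrite mxE !eqxx mulr1.
by rewrite mxE (negbTE ji) andbF mulr0.
Qed.

Lemma dotvv_ge0 x : 0 <= dotv x x.
Proof. by apply: sumr_ge0 => i _; rewrite -expr2 sqr_ge0. Qed.

Lemma coord_le_norm x i : `|x$i| <= `|x|.
Proof.
rewrite /Num.norm/= mx_normrE.
by apply: (@le_trans _ _ `|x (ord0, i).1 (ord0, i).2|) => //; exact: le_bigmax.
Qed.

Lemma norm_le_coord x k : 0 <= k -> (forall i, `|x$i| <= k) -> `|x| <= k.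
Proof.
move=> k0 h; rewrite /Num.norm/= mx_normrE; apply: bigmax_le => //= -[i j] _ /=.
by rewrite ord1.
Qed.

Lemma norm_lt_coord x k : 0 < k -> (forall i, `|x$i| < k) -> `|x| < k.
Proof.
move=> k0 h; rewrite /Num.norm/= mx_normrE; apply: bigmax_lt => //= -[i j] _ /=.
by rewrite ord1.
Qed.

Lemma norm_delta i : `|delta_mx ord0 i : E| = 1.
Proof.
apply/le_anti/andP; split; last first.
 by have := coord_le_norm (delta_mx ord0 i) i; rewrite mxE !eqxx normr1.
by apply: norm_le_coord => // j; rewrite mxE; case: (_ && _); rewrite ?normr1 ?normr0.
Qed.

Lemma sum_delta x : x = \sum_i x$i *: delta_mx ord0 i.
Proof. exact: row_sum_delta. Qed.

(** The norm of row vectors is the maximum norm, so the Cauchy-Schwarz bound costs a factor [n];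
    [norm_sq_le] is the comparison in the other direction. *)
Lemma dotv_le x y : `|dotv x y| <= n%:R * (`|x| * `|y|).
Proof.
rewrite /dotv (le_trans (ler_norm_sum _ _ _))//.
rewrite -[n in n%:R]card_ord mulr_natl -sumr_const; apply: ler_sum => i _.
by rewrite normrM ler_pM// coord_le_norm.
Qed.

Lemma norm_sq_le x : `|x| ^+ 2 <= dotv x x.
Proof.
have [->|x0] := eqVneq x 0; first by rewrite normr0 expr0n/= dotv0l.
have [i xi] : exists i, `|x| = `|x$i|.
 have [|i hi] := @mx_norm_neq0 _ _ _ x; first by rewrite -[mx_norm _]/(`|x|) normr_eq0.
 by exists i.2; rewrite {1}/Num.norm /= hi ord1.
rewrite xi -normrX ger0_norm ?sqr_ge0// /dotv (bigD1 i)//= -expr2 lerDl.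
by apply: sumr_ge0 => j _; rewrite -expr2 sqr_ge0.
Qed.

Lemma dotvv_eq0 x : (dotv x x == 0) = (x == 0).
Proof.
apply/eqP/eqP => [h|->]; last exact: dotv0l.
have : `|x| ^+ 2 == 0 by rewrite eq_le sqr_ge0 andbT -h norm_sq_le.
by rewrite expf_eq0/= normr_eq0 => /eqP.
Qed.

Lemma dotvv_gt0 x : x != 0 -> 0 < dotv x x.
Proof. by move=> x0; rewrite lt_def dotvv_eq0 x0 dotvv_ge0. Qed.

Definition bilin (M : 'M[R]_n) x y := dotv (x *m M) y.

Lemma dotv_mulmx (M : 'M[R]_n) x y : dotv (x *m M) y = dotv x (y *m M^T).
Proof.
rewrite /dotv.
transitivity (\sum_i \sum_j x$j * M j i * y$i).
 by apply: eq_bigr => i _; rewrite mxE mulr_suml.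
rewrite exchange_big; apply: eq_bigr => j _ /=.
by rewrite mxE mulr_sumr; apply: eq_bigr => i _; rewrite mxE -mulrA; congr (_ * _); rewrite mulrC.
Qed.

Lemma bilinDl M x y z : bilin M (x + y) z = bilin M x z + bilin M y z.
Proof. by rewrite /bilin mulmxDl dotvDl. Qed.
Lemma bilinDr M x y z : bilin M x (y + z) = bilin M x y + bilin M x z.
Proof. exact: dotvDr. Qed.
Lemma bilinZl M k x y : bilin M (k *: x) y = k * bilin M x y.
Proof. by rewrite /bilin -scalemxAl dotvZl. Qed.
Lemma bilinZr M k x y : bilin M x (k *: y) = k * bilin M x y.
Proof. exact: dotvZr. Qed.

Lemma bilin_sym (M : 'M[R]_n) x y : M^T = M -> bilin M x y = bilin M y x.
Proof. by move=> MT; rewrite /bilin dotv_mulmx MT dotvC. Qed.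

Lemma norm_mulmx_le (M : 'M[R]_n) k x : 0 <= k -> (forall i j, `|M i j| <= k) -> `|x *m M| <= n%:R * k * `|x|.
Proof.
move=> k0 Mk; apply: norm_le_coord => [|i]; first by pos.
rewrite mxE (le_trans (ler_norm_sum _ _ _))// -mulrA.
rewrite -[n in n%:R]card_ord mulr_natl -sumr_const; apply: ler_sum => j _.
by rewrite normrM mulrC ler_pM// coord_le_norm.
Qed.

Lemma bilin_le (M : 'M[R]_n) k x y : 0 <= k -> (forall i j, `|M i j| <= k) ->
 `|bilin M x y| <= n%:R ^+ 2 * k * (`|x| * `|y|).
Proof.
move=> k0 Mk; rewrite /bilin (le_trans (dotv_le _ _))// expr2 -!mulrA ler_wpM2l//.
by rewrite !mulrA ler_wpM2r// norm_mulmx_le.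
Qed.

Lemma ball_rowP (x y : E) (e : R) : ball x e y <-> `|y - x| < e.
Proof. by rewrite -ball_normE /= distrC. Qed.

Lemma nbhs_rowP (x : E) (A : set E) : nbhs x A <-> exists2 e : R, 0 < e & forall y, `|y - x| < e -> A y.
Proof.
split=> [/nbhs_ballP[e e0 h]|[e e0 h]]; first by exists e => // y /ball_rowP/h.
by apply/nbhs_ballP; exists e => // y /ball_rowP/h.
Qed.

Lemma contNP (f : E -> R) x : {for x, continuous f} <->
 forall e : R, 0 < e -> exists2 d : R, 0 < d & forall y, `|y - x| < d -> `|f y - f x| < e.
Proof.
split=> [/cvgrPdist_lt h e e0|h].
 by have /nbhs_rowP[d d0 hd] := h _ e0; exists d => // y /hd; rewrite distrC.
rewrite /continuous_at; apply/(@cvgrPdist_lt _ _ _ (nbhs x)) => e e0.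
have [d d0 hd] := h _ e0.
by apply/nbhs_rowP; exists d => // y /hd; rewrite distrC.
Qed.

Lemma openNP (A : set E) : open A <-> forall x, A x -> exists2 e : R, 0 < e & forall y, `|y - x| < e -> A y.
Proof.
rewrite openE; split=> h x Ax; first exact/nbhs_rowP/h.
exact/nbhs_rowP/h.
Qed.

Lemma closureNP (A : set E) x : closure A x <-> forall e : R, 0 < e -> exists2 y, A y & `|y - x| < e.
Proof.
split=> [cA e e0|h B /nbhs_rowP[e e0 hB]].
 have /cA[y [Ay yx]] : nbhs x [set y | `|y - x| < e] by apply/nbhs_rowP; exists e.
 by exists y.
by have [y Ay yx] := h _ e0; exists y; split=> //; exact: hB.
Qed.

Lemma dotv_continuous x : continuous (dotv x).
Proof.
move=> y; apply/contNP => e e0; pose c := n%:R * `|x| + 1.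
have c0 : 0 < c by rewrite ltr_wpDl// mulr_ge0.
exists (e / c) => [|z zy]; first by pos.
rewrite -dotvBr (le_lt_trans (dotv_le _ _))// mulrA.
rewrite (@le_lt_trans _ _ (c * `|z - y|))//; last by rewrite mulrC -ltr_pdivlMr.
by rewrite ler_wpM2r// lerDl.
Qed.

(** Passage from local constants to a uniform one on a compact set, for a property that persists
    when [d] shrinks. The near-covering form of compactness is applied to the right neighbourhoods
    of 0. *)
Lemma compact_unif (A : set E) (P : R -> E -> Prop) : compact A -> (forall d d' x, d' <= d -> P d x -> P d' x) ->
 (forall a, A a -> exists2 d : R, 0 < d & forall b, A b -> `|b - a| < d -> P d b) ->
 exists2 d : R, 0 < d & forall b, A b -> P d b.
Proof.
move=> /compact_near_coveringP cA mono loc.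
have := cA R (0 : R)^'+ (fun d x => A x -> P d x) _.
case=> [x Ax|].
 have [d d0 hd] := loc _ Ax.
 exists ([set y | `|y - x| < d], [set e | 0 < e <= d]) => /=.
  split; first by apply/nbhs_rowP; exists d.
  near=> e; apply/andP; split=> //; near: e; exact: nbhs_right_le.
 by move=> [y e] /= [yx /andP[e0 ed]] Ay; exact: mono ed (hd _ Ay yx).
move=> e /= e0 he; have e20 : 0 < e / 2 by pos.
exists (e / 2) => // b Ab; apply: (he (e / 2)) => //=.
by rewrite sub0r normrN gtr0_norm// ltr_pdivrMr// ltr_pMr// ltr1n.
Unshelve. all: by end_near. Qed.

(** A bound [C] is encoded as the small parameter [1 / C]; the disjunct [d <= 0] makes the predicate
    monotone over all real [d]. *)
Lemma compact_sup_bound (A : set E) (f : E -> R) : compact A ->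
 (forall a, A a -> exists d C, 0 < d /\ forall b, A b -> `|b - a| < d -> f b <= C) ->
 exists C, forall b, A b -> f b <= C.
Proof.
move=> cA h.
have [||d d0 hd] := @compact_unif A (fun d x => d <= 0 \/ f x <= d^-1) cA.
- move=> d d' x d'd [d0|fx]; first by left; exact: le_trans d0.
 have [d'0|d'0] := leP d' 0; first by left.
 by right; rewrite (le_trans fx)// lef_pV2 ?posrE// (lt_le_trans d'0).
- move=> a /h[d [C [d0 hC]]]; pose C' := max C 1.
 have C'0 : 0 < C' by rewrite lt_max ltr01 orbT.
 exists (min d C'^-1); first by pos.
 move=> b Ab; rewrite lt_min => /andP[bd _]; right.
 rewrite (le_trans (hC _ Ab bd))//.
 have : min d C'^-1 <= C'^-1 by rewrite ge_min lexx orbT.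
 rewrite -[X in _ -> _ <= X]invrK => h1.
 have h2 : 0 < min d C'^-1 by pos.
 by rewrite invrK (@le_trans _ _ C')// ?le_max ?lexx// -[X in X <= _]invrK lef_pV2 ?posrE ?invr_gt0.
exists d^-1 => b /hd[|//]; by pos.
Qed.

End dot.

Section gradient.
Implicit Types (x y v g : E) (f : E -> R).

Fact dotv_is_linear g : linear_for *%R (dotv g).
Proof. by move=> k x y; rewrite dotvDr dotvZr. Qed.

HB.instance Definition _ (g : E) := GRing.isLinear.Build R E R *%R (dotv g) (dotv_is_linear g).

(** Differentiability at [x] with gradient [g], in epsilon-delta form: gradients can then be
    compared, squeezed and localised without handling differentials. *)
Definition hgrad f x g := forall e : R, 0 < e -> exists2 d : R, 0 < d &
 forall v, `|v| < d -> `|f (x + v) - f x - dotv g v| <= e * `|v|.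

Lemma hgrad_diff f x g : hgrad f x g -> is_diff x f (dotv g).
Proof.
move=> h.
have c : continuous (dotv g) by exact: dotv_continuous.
have o : f \o shift x = cst (f x) + (dotv g : E -> R^o) +o_ (0 : E) id.
 apply/eqaddoP => e e0; have [d d0 hd] := h _ e0.
 apply/(@nbhs_rowP 0); exists d => // y; rewrite subr0 => /hd.
 by rewrite /= !fctE /= opprD addrA [y + x]addrC.
have e : 'd f x = dotv g :> (E -> R) by exact: (@diff_unique R E R^o f (dotv g) x c o).
by apply: DiffDef => //; apply/diff_locallyP; rewrite e.
Qed.

Lemma diff_hgrad f x g : is_diff x f (dotv g) -> hgrad f x g.
Proof.
move=> [/diff_locallyP [_ +] e]; rewrite e => /eqaddoP h eps eps0.
have {h} := h _ eps0; move=> /(@nbhs_rowP 0 _)[d d0 hd]; exists d => // v vd.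
have /hd : `|v - 0| < d by rewrite subr0.
by rewrite /= !fctE /= opprD addrA [v + x]addrC.
Qed.

Lemma hgrad_derive f x g v : hgrad f x g -> is_derive x v f (dotv g v).
Proof.
move=> /hgrad_diff [df e]; apply: DeriveDef; first exact: diff_derivable.
by rewrite deriveE// e.
Qed.

Lemma hgrad_grad f x g : hgrad f x g -> grad f x = g.
Proof.
move=> h; apply/rowP => i; rewrite mxE /partial.
by have [_ ->] := hgrad_derive (delta_mx ord0 i) h; rewrite dotv_delta.
Qed.

Lemma differentiable_hgrad f x : differentiable f x -> hgrad f x (grad f x).
Proof.
move=> df; apply: diff_hgrad; apply: DiffDef => //; apply/funext => v.
rewrite [in LHS](sum_delta v) linear_sum [RHS]dotvC /dotv; apply: eq_bigr => i _.
by rewrite linearZ mxE /partial deriveE.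
Qed.

Lemma hgrad_differentiable f x g : hgrad f x g -> differentiable f x.
Proof. by move=> /hgrad_diff[]. Qed.

Lemma hgrad_unique f x g g' : hgrad f x g -> hgrad f x g' -> g = g'.
Proof. by move=> /hgrad_grad <- /hgrad_grad <-. Qed.

Lemma hgrad_cont f x g : hgrad f x g -> {for x, continuous f}.
Proof. by move=> /hgrad_differentiable; exact: differentiable_continuous. Qed.

Lemma hgradD f1 f2 x g1 g2 : hgrad f1 x g1 -> hgrad f2 x g2 -> hgrad (fun z => f1 z + f2 z) x (g1 + g2).
Proof.
move=> /hgrad_diff h1 /hgrad_diff h2; apply: diff_hgrad.
by apply: (is_diff_eq (is_diffD h1 h2)); apply/funext => v /=; rewrite fctE dotvDl.
Qed.

Lemma hgradZ f x g (k : R) : hgrad f x g -> hgrad (fun z => k * f z) x (k *: g).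
Proof.
move=> /hgrad_diff h; apply: diff_hgrad.
by apply: (is_diff_eq (is_diffZ k h)); apply/funext => v /=; rewrite fctE dotvZl.
Qed.

Lemma hgradN f x g : hgrad f x g -> hgrad (fun z => - f z) x (- g).
Proof.
move=> h; rewrite -scaleN1r (_ : (fun z => _) = (fun z => -1 * f z)).
 exact: hgradZ.
by apply/funext => z; rewrite mulN1r.
Qed.

Lemma hgradB f1 f2 x g1 g2 : hgrad f1 x g1 -> hgrad f2 x g2 -> hgrad (fun z => f1 z - f2 z) x (g1 - g2).
Proof. by move=> h1 h2; apply: hgradD => //; exact: hgradN. Qed.

Lemma hgradM f1 f2 x g1 g2 : hgrad f1 x g1 -> hgrad f2 x g2 ->
 hgrad (fun z => f1 z * f2 z) x (f1 x *: g2 + f2 x *: g1).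
Proof.
move=> /hgrad_diff h1 /hgrad_diff h2; apply: diff_hgrad.
apply: (is_diff_eq (is_diffM h1 h2)); apply/funext => v /=.
by rewrite !fctE dotvDl !dotvZl.
Qed.

Lemma hgrad_cst (k : R) x : hgrad (fun=> k) x 0.
Proof.
by move=> e e0; exists 1 => [//|v _]; rewrite dotv0l !subrr normr0 mulr_ge0// ltW.
Qed.

Lemma hgrad_dotv x g : hgrad (dotv g) x g.
Proof.
move=> e e0; exists 1 => [//|v _].
rewrite dotvDr [_ + dotv g v]addrC addrK subrr normr0.
by pos.
Qed.

Lemma hgrad_sum I (r : seq I) (P : pred I) (F : I -> E -> R) (g : I -> E) x :
 (forall i, P i -> hgrad (F i) x (g i)) -> hgrad (fun z => \sum_(i <- r | P i) F i z) x (\sum_(i <- r | P i) g i).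
Proof.
move=> h; elim: r => [|i r IH].
 rewrite big_nil (_ : (fun z => _) = fun=> 0); first exact: hgrad_cst.
 by apply/funext => z; rewrite big_nil.
rewrite big_cons (_ : (fun z => _) = fun z => if P i then
  F i z + \sum_(i <- r | P i) F i z else \sum_(i <- r | P i) F i z).
 by case: ifP => // Pi; apply: hgradD => //; exact: h.
by apply/funext => z; rewrite big_cons.
Qed.

Lemma hgrad_comp1 f (h : R -> R) x g b : hgrad f x g -> is_derive (f x) 1 h b -> hgrad (h \o f) x (b *: g).
Proof.
move=> /hgrad_diff hf [hd hb]; apply: diff_hgrad.
have /derivable1_diffP hd' := hd.
have hh : is_diff (f x) h (fun u => u *: b).
 by apply: DiffDef => //; rewrite deriv1E// derive1E hb.
apply: (is_diff_eq (is_diff_comp hf hh)); apply/funext => v /=.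
by rewrite dotvZl mulrC.
Qed.

Lemma hgradV f x g : f x != 0 -> hgrad f x g -> hgrad (fun z => (f z)^-1) x (- (f x)^-2 *: g).
Proof.
move=> f0 hf; apply: (@hgrad_comp1 f (fun u => u^-1)) => //.
apply: DeriveDef.
 by apply: derivableV => //; exact: derivable_id.
by rewrite deriveV ?derive_id//; exact: mulr1.
Qed.

Lemma hgrad_near f1 f2 x g (d : R) : 0 < d -> (forall z, `|z - x| < d -> f1 z = f2 z) -> hgrad f1 x g -> hgrad f2 x g.
Proof.
move=> d0 hd h e e0; have [d1 d10 hd1] := h _ e0.
exists (min d d1) => [|v]; first by pos.
rewrite lt_min => /andP[vd vd1]; rewrite -!hd ?subrr ?normr0//; first exact: hd1.
by rewrite addrAC subrr add0r.
Qed.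

Lemma MVT_grad f x v (g : E -> E) : (forall t : R, 0 <= t <= 1 -> hgrad f (x + t *: v) (g (x + t *: v))) ->
 exists2 c, 0 <= c <= 1 & f (x + v) - f x = dotv (g (x + c *: v)) v.
Proof.
move=> h; apply: (@MVTv _ _ f x v (fun c => dotv (g (x + c *: v)) v)) => t t01.
exact/hgrad_derive/h.
Qed.

(** Serves for distances, which lie between two functions built on the polar gauge that touch at [x]
    with the same gradient. *)
Lemma hgrad_squeeze f lo up x g : hgrad lo x g -> hgrad up x g -> lo x = f x -> up x = f x ->
 (exists2 d : R, 0 < d & forall z, `|z - x| < d -> lo z <= f z <= up z) -> hgrad f x g.
Proof.
move=> hl hu el eu [d d0 hd] e e0.
have [d1 d10 h1] := hl _ e0; have [d2 d20 h2] := hu _ e0.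
exists (min d (min d1 d2)) => [|v]; first by pos.
rewrite !lt_min => /and3P[vd vd1 vd2].
have /hd/andP[lf fu] : `|x + v - x| < d by rewrite addrAC subrr add0r.
move: (h1 _ vd1) (h2 _ vd2); rewrite el eu !ler_norml => /andP[a1 a2] /andP[b1 b2].
by pos.
Qed.

(** Along [w = g1 - g2] the function [f1] would outgrow [f2] at the rate [dotv w w], against
    [f1 <= f2]. *)
Lemma hgrad_touch f1 f2 x g1 g2 : hgrad f1 x g1 -> hgrad f2 x g2 -> f1 x = f2 x ->
 (exists2 d : R, 0 < d & forall z, `|z - x| < d -> f1 z <= f2 z) -> g1 = g2.
Proof.
move=> h1 h2 e12 [d d0 hd]; apply/eqP; rewrite -subr_eq0 -dotvv_eq0.
have h := hgradB h2 h1; set w := g1 - g2.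
have [->//|w0] := eqVneq w 0; first by pos.
have wp := dotvv_gt0 w0; have nw : 0 < `|w| by pos.
exfalso; pose e := dotv w w / (2 * `|w|).
have e0 : 0 < e by rewrite divr_gt0// mulr_gt0.
have [d1 d10 hd1] := h _ e0.
pose s := min d d1 / (2 * `|w|).
have m0 : 0 < min d d1 by pos.
have s0 : 0 < s by rewrite divr_gt0// mulr_gt0.
have sw : `|s *: w| < min d d1.
 rewrite normrZ gtr0_norm// /s.
 rewrite [X in X < _](_ : _ = min d d1 / 2); last by field; pos.
 by pos.
move: sw; rewrite lt_min => /andP[sd sd1].
have := hd1 _ sd1; have /hd : `|x + s *: w - x| < d by rewrite addrAC subrr add0r.
have ge : g2 - g1 = - w by rewrite opprB.
rewrite e12 subrr subr0 ge ler_norml dotvZr dotvNl normrZ (gtr0_norm s0).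
move=> l /andP[_]; have -> : e * (s * `|w|) = s * dotv w w / 2.
 by rewrite /e; field; pos.
have := mulr_gt0 s0 wp; lra.
Qed.

End gradient.

Section classC.
Implicit Types (x y v g : E) (f : E -> R) (V U : set E).

Lemma partial_grad f x g i : hgrad f x g -> partial i f x = g$i.
Proof. by move=> /hgrad_grad <-; rewrite mxE. Qed.

Lemma C1_hgrad V f x : open V -> V x -> classC 1 V f -> hgrad f x (grad f x).
Proof.
move=> /openNP oV Vx cf e e0.
have e'0 : 0 < e / (n%:R + 1) by pos.
have [d1 d10 hd1] := oV _ Vx.
have [d d0 hd] : exists2 d : R, 0 < d & forall z i, `|z - x| < d ->
  `|partial i f z - partial i f x| <= e / (n%:R + 1).
 have h i : exists2 d : R, 0 < d & forall z, `|z - x| < d -> `|partial i f z - partial i f x| <= e / (n%:R + 1).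
  have [_ /= /(_ x Vx)/contNP/(_ _ e'0)[d d0 hd]] := cf i.
  by exists d => // z /hd/ltW.
 have {}h i : exists d : R, 0 < d /\ forall z, `|z - x| < d -> `|partial i f z - partial i f x| <= e / (n%:R + 1).
  by have [d d0 hd] := h i; exists d.
 have [D hD] := choice h.
 exists (\big[min/1]_i D i); first by apply: lt_bigmin => // i _; have [] := hD i.
 move=> z i zi; have [_] := hD i; apply; apply: lt_le_trans zi _.
 exact: bigmin_le.
exists (min d d1) => [|v]; first by pos.
rewrite lt_min => /andP[vd vd1].
(* [vk k] keeps the first [k] coordinates of [v], so that [f (x + v) - f x] telescopes into
   increments along single axes. *)
pose vk k : E := \row_j (if (j < k)%N then v$j else 0).
have vkS (i : 'I_n) : vk i.+1 = vk i + v$i *: delta_mx ord0 i.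
 apply/rowP => j; rewrite !mxE eqxx /= ltnS leq_eqVlt.
 have [->|ji] := eqVneq j i; first by rewrite eqxx ltnn add0r mulr1.
 by rewrite (negbTE ji : (j == i :> nat) = false) /= mulr0 addr0.
have seg (i : 'I_n) (t : R) : 0 <= t <= 1 -> `|vk i + (t * v$i) *: delta_mx ord0 i| <= `|v|.
 move=> /andP[t0 t1]; apply: norm_le_coord => // j; rewrite !mxE eqxx /=.
 have [->|ji] := eqVneq j i.
  rewrite ltnn add0r mulr1 normrM (ger0_norm t0).
  by rewrite (le_trans _ (coord_le_norm v i))// ler_piMl.
 by rewrite mulr0 addr0; case: ifP => _; rewrite ?normr0 ?coord_le_norm.
have step (i : 'I_n) : `|f (x + vk i.+1) - f (x + vk i) - partial i f x * v$i| <= e / (n%:R + 1) * `|v|.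
 have [t t01|c c01] := @MVTvs _ _ f (x + vk i) (delta_mx ord0 i) (v$i)
  (fun t => partial i f (x + vk i + (t * v$i) *: delta_mx ord0 i)).
  apply: derivableP; have [+ _] := cf i; apply; apply: hd1.
  by rewrite -(addrA x) [x + _]addrC addrK (le_lt_trans (seg _ _ t01)).
 rewrite -addrA -vkS => ->; rewrite mulrC -mulrBl normrM ler_pM ?coord_le_norm//.
 by apply: hd; rewrite -(addrA x) [x + _]addrC addrK (le_lt_trans (seg _ _ c01)).
have v0 : vk 0 = 0 by apply/rowP => j; rewrite !mxE.
have vn : vk n = v by apply/rowP => j; rewrite !mxE ltn_ord.
have -> : f (x + v) - f x - dotv (grad f x) v = \sum_(i < n) (f (x + vk i.+1) - f (x + vk i) - partial i f x * v$i).
 rewrite sumrB; congr (_ - _); last by apply: eq_bigr => i _; rewrite mxE.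
 rewrite -(big_mkord predT (fun i => f (x + vk i.+1) - f (x + vk i))).
 by rewrite telescope_sumr// v0 vn addr0.
rewrite (le_trans (ler_norm_sum _ _ _))//.
rewrite (@le_trans _ _ (\sum_(i < n) e / (n%:R + 1) * `|v|))//.
 by apply: ler_sum => i _; exact: step.
rewrite sumr_const card_ord -[X in X <= _]mulr_natl mulrA ler_wpM2r//.
rewrite mulrA ler_pdivrMr ?ltr_wpDl// mulrC ler_pM2l//.
by pos.
Qed.

Lemma classC_S k V f : open V -> classC k.+1 V f -> classC k V f.
Proof.
move=> oV; elim: k f => [|k IH] f cf.
 by move=> x Vx; exact: hgrad_cont (C1_hgrad oV Vx cf).
by move=> i; have [dfi cfi] := cf i; split => //; exact: IH.
Qed.

Lemma classC_le k m V f : open V -> (k <= m)%N -> classC m V f -> classC k V f.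
Proof.
move=> oV /subnK <-; elim: (m - k)%N => // j IH; rewrite addSn => /(classC_S oV).
exact: IH.
Qed.

Lemma classC_sub k V U f : U `<=` V -> classC k V f -> classC k U f.
Proof.
move=> UV; elim: k f => [|k IH] f cf; first by move=> x /UV; exact: cf.
by move=> i; have [dfi cfi] := cf i; split=> [x /UV|]; [exact: dfi|exact: IH].
Qed.

Lemma near_open V f1 f2 x : open V -> V x -> (forall z, V z -> f1 z = f2 z) -> \near x, f1 x = f2 x.
Proof.
move=> oV Vx e; have : nbhs x V by exact: open_nbhs_nbhs.
by apply: filterS => z; exact: e.
Qed.

Lemma classC_ext k V f1 f2 : open V -> (forall z, V z -> f1 z = f2 z) -> classC k V f1 -> classC k V f2.
Proof.
move=> oV; elim: k f1 f2 => [|k IH] f1 f2 e cf.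
 move=> x Vx; have := cf x Vx.
 move=> /contNP h; apply/contNP => r r0; have [d d0 hd] := h r r0.
 have [d1 d10 hd1] := (openNP V).1 oV x Vx.
 exists (min d d1) => [|y]; first by pos.
 by rewrite lt_min => /andP[yd /hd1 Vy]; rewrite -!e//; exact: hd.
move=> i; have [dfi cfi] := cf i; split=> [x Vx|].
 by apply: near_eq_derivable (dfi x Vx); exact: near_open e.
apply: IH cfi => z Vz; rewrite /partial; apply: near_eq_derive.
exact: near_open e.
Qed.

Lemma classC_cst k V (c : R) : classC k V (fun=> c).
Proof.
elim: k c => [|k IH] c; first by move=> x _; exact: (@cst_continuous _ _ c x).
move=> i; split=> [x _|]; first exact: derivable_cst.
rewrite (_ : partial i _ = fun=> 0); first exact: IH.
by apply/funext => x; rewrite /partial; exact: (@derive_cst _ _ R^o).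
Qed.

Lemma classC_dotv k V g : classC k V (dotv g).
Proof.
case: k => [|k]; first by move=> x _; exact: dotv_continuous.
move=> i; split=> [x _|].
 by have [] := hgrad_derive (delta_mx ord0 i) (hgrad_dotv x g).
rewrite (_ : partial i _ = fun=> g$i); first exact: classC_cst.
by apply/funext => x; rewrite (partial_grad i (hgrad_dotv x g)).
Qed.

Lemma coordE (i : 'I_n) : (fun x : E => x$i) = dotv (delta_mx ord0 i).
Proof. by apply/funext => x; rewrite dotvC dotv_delta. Qed.

Lemma classC_coord k V (i : 'I_n) : classC k V (fun x => x$i).
Proof. rewrite coordE; exact: classC_dotv. Qed.

Lemma hgrad_coord x (i : 'I_n) : hgrad (fun z : E => z$i) x (delta_mx ord0 i).
Proof. rewrite coordE; exact: hgrad_dotv. Qed.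

Lemma classCD k V f1 f2 : open V -> classC k V f1 -> classC k V f2 -> classC k V (fun z => f1 z + f2 z).
Proof.
move=> oV; elim: k f1 f2 => [|k IH] f1 f2 c1 c2.
 by move=> x Vx; exact: (continuousD (c1 _ Vx) (c2 _ Vx)).
move=> i; have [d1 p1] := c1 i; have [d2 p2] := c2 i; split=> [x Vx|].
 by apply: derivableD; [exact: d1|exact: d2].
apply: (@classC_ext _ _ (fun z => partial i f1 z + partial i f2 z)) => //.
 by move=> z Vz; rewrite /partial -deriveD//; [exact: d1|exact: d2].
exact: IH.
Qed.

Lemma classCM k V f1 f2 : open V -> classC k V f1 -> classC k V f2 -> classC k V (fun z => f1 z * f2 z).
Proof.
move=> oV; elim: k f1 f2 => [|k IH] f1 f2 c1 c2.
 by move=> x Vx; exact: (continuousM (c1 _ Vx) (c2 _ Vx)).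
move=> i; have [d1 p1] := c1 i; have [d2 p2] := c2 i; split=> [x Vx|].
 by apply: derivableM; [exact: d1|exact: d2].
apply: (@classC_ext _ _ (fun z => f1 z * partial i f2 z + f2 z * partial i f1 z)) => //.
 by move=> z Vz; rewrite /partial [RHS]deriveM//; [exact: d1|exact: d2].
by apply: classCD => //; apply: IH => //; exact: classC_S.
Qed.

Lemma classC_sum k V I (r : seq I) (P : pred I) (F : I -> E -> R) : open V ->
 (forall i, P i -> classC k V (F i)) -> classC k V (fun z => \sum_(i <- r | P i) F i z).
Proof.
move=> oV h; elim: r => [|i r IH].
 apply: (@classC_ext _ _ (fun=> 0)) => //; last exact: classC_cst.
 by move=> z _; rewrite big_nil.
apply: (@classC_ext _ _ (fun z => if P i then
  F i z + \sum_(i <- r | P i) F i z else \sum_(i <- r | P i) F i z)) => //.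
 by move=> z _; rewrite big_cons.
by have [Pi|//] := boolP (P i); apply: classCD => //; exact: h.
Qed.

Lemma classC_prod k V I (r : seq I) (P : pred I) (F : I -> E -> R) : open V ->
 (forall i, P i -> classC k V (F i)) -> classC k V (fun z => \prod_(i <- r | P i) F i z).
Proof.
move=> oV h; elim: r => [|i r IH].
 apply: (@classC_ext _ _ (fun=> 1)) => //; last exact: classC_cst.
 by move=> z _; rewrite big_nil.
apply: (@classC_ext _ _ (fun z => if P i then
  F i z * \prod_(i <- r | P i) F i z else \prod_(i <- r | P i) F i z)) => //.
 by move=> z _; rewrite big_cons.
by have [Pi|//] := boolP (P i); apply: classCM => //; exact: h.
Qed.

Lemma classCV k V f : open V -> (forall x, V x -> f x != 0) -> classC k V f -> classC k V (fun z => (f z)^-1).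
Proof.
move=> oV f0; elim: k f f0 => [|k IH] f f0 cf.
 by move=> x Vx; exact: (continuousV (f0 _ Vx) (cf _ Vx)).
move=> i; have [d1 p1] := cf i; split=> [x Vx|].
 by apply: derivableV; [exact: f0|exact: d1].
apply: (@classC_ext _ _ (fun z => (-1 * ((f z)^-1 * (f z)^-1)) * partial i f z)) => //.
 move=> z Vz; rewrite /partial [RHS](_ : _ = - (f z) ^- 2 *: 'D_(delta_mx ord0 i) f z).
  by rewrite mulN1r expr2 invfM.
 by apply: deriveV; [exact: f0|exact: d1].
have cI : classC k V (fun z => (f z)^-1) by apply: IH => //; exact: classC_S.
by apply: classCM => //; apply: classCM => //; [exact: classC_cst|exact: classCM].
Qed.

Lemma hgrad_comp f (pi : E -> E) x g (G : 'I_n -> E) : hgrad f (pi x) g ->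
 (forall i, hgrad (fun z => pi z$i) x (G i)) -> hgrad (f \o pi) x (\sum_i g$i *: G i).
Proof.
move=> hf hpi e e0.
pose L := \sum_i (n%:R * `|G i| + 1) + 1.
have L1 : 1 <= L by rewrite lerDr; apply: sumr_ge0 => i _; rewrite addr_ge0// mulr_ge0.
have L0 : 0 < L by pos.
have LG i : n%:R * `|G i| + 1 <= L.
 rewrite /L (bigD1 i)//= -addrA lerDl addr_ge0//.
 by apply: sumr_ge0 => j _; rewrite addr_ge0// mulr_ge0.
pose e1 := e / 2 / L; have e10 : 0 < e1 by rewrite !divr_gt0.
pose K := n%:R * `|g| + 1.
have K0 : 0 < K by rewrite ltr_wpDl// mulr_ge0.
pose e2 := min 1 (e / 2 / K).
have e20 : 0 < e2 by rewrite lt_min ltr01 !divr_gt0.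
have [d1 d10 hd1] := hf _ e10.
have h i : exists d : R, 0 < d /\ forall v, `|v| < d -> `|pi (x + v)$i - pi x$i - dotv (G i) v| <= e2 * `|v|.
 by have [d d0 hd] := hpi i _ e20; exists d.
have [D hD] := choice h.
pose d2 := \big[min/1]_i D i.
have d20 : 0 < d2 by apply: lt_bigmin => // i _; have [] := hD i.
have hd2 i v : `|v| < d2 -> `|pi (x + v)$i - pi x$i - dotv (G i) v| <= e2 * `|v|.
 by move=> vd; have [_] := hD i; apply; apply: lt_le_trans vd _; exact: bigmin_le.
exists (min d2 (d1 / L)) => [|v]; first by pos.
rewrite lt_min => /andP[vd2 vd1].
set w := pi (x + v) - pi x.
have wv : `|w| <= L * `|v|.
 apply: norm_le_coord => [|i]; first by pos.
 rewrite !mxE (le_trans _ (ler_wpM2r (normr_ge0 v) (LG i)))//.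
 rewrite -[X in `|X|](subrK (dotv (G i) v)) (le_trans (ler_normD _ _))//.
 rewrite mulrDl mul1r [X in _ <= X]addrC lerD//; last by rewrite -mulrA dotv_le.
 by rewrite (le_trans (hd2 _ _ vd2))// ler_piMl// ge_min lexx.
have wd : `|w| < d1 by rewrite (le_lt_trans wv)// mulrC -ltr_pdivlMr.
have := hd1 _ wd; rewrite [pi x + w]addrC subrK => h1.
have -> : (f \o pi) (x + v) - (f \o pi) x - dotv (\sum_i g$i *: G i) v = f (pi (x + v)) - f (pi x) - dotv g w +
  \sum_i g$i * (w$i - dotv (G i) v).
 have -> : \sum_i g$i * (w$i - dotv (G i) v) = dotv g w - dotv (\sum_i g$i *: G i) v.
  rewrite dotv_suml [dotv g w]/dotv -sumrB.
  by apply: eq_bigr => i _; rewrite mulrBr dotvZl.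
 by rewrite /=; ring.
rewrite (le_trans (ler_normD _ _))// [e]splitr mulrDl lerD//.
 rewrite (le_trans h1)// (le_trans (ler_wpM2l (ltW e10) wv))//.
 by rewrite mulrA /e1 divfK ?gt_eqF.
rewrite (le_trans (ler_norm_sum _ _ _))//.
rewrite (@le_trans _ _ (\sum_(i < n) `|g| * (e2 * `|v|)))//.
 apply: ler_sum => i _; rewrite normrM ler_pM ?coord_le_norm//.
 by have := hd2 i _ vd2; rewrite !mxE.
rewrite sumr_const card_ord -[X in X <= _]mulr_natl 2!mulrA ler_wpM2r//.
rewrite (@le_trans _ _ (n%:R * `|g| * (e / 2 / K)))//.
 by rewrite ler_wpM2l ?mulr_ge0// /e2 ge_min lexx orbT.
by rewrite mulrC mulrAC ler_pdivrMr// ler_wpM2l ?divr_ge0 ?ltW// /K ltrDl.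
Qed.

Lemma classC_comp k V U f (pi : E -> E) : open V -> open U -> (forall x, U x -> V (pi x)) -> classC k V f ->
 (forall i, classC k U (fun z => pi z$i)) -> classC k U (f \o pi).
Proof.
move=> oV oU UV; elim: k f => [|k IH] f cf cpi.
 move=> x Ux; apply/contNP => e e0.
 have /contNP/(_ _ e0)[d d0 hd] := cf _ (UV _ Ux).
 have h i : exists r : R, 0 < r /\ forall z, `|z - x| < r -> `|pi z$i - pi x$i| < d.
  by have /contNP/(_ _ d0)[r r0 hr] := cpi i _ Ux; exists r.
 have [D hD] := choice h; exists (\big[min/1]_i D i).
  by apply: lt_bigmin => // i _; have [] := hD i.
 move=> y yx; apply: hd; apply: norm_lt_coord => // i; rewrite !mxE.
 by have [_] := hD i; apply; apply: lt_le_trans yx _; exact: bigmin_le.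
have hg x : U x -> hgrad (f \o pi) x (\sum_i grad f (pi x)$i *: grad (fun z => pi z$i) x).
 move=> Ux; apply: hgrad_comp => [|i].
  by apply: (C1_hgrad oV (UV _ Ux)); exact: classC_le cf.
 by apply: (C1_hgrad oU Ux); exact: classC_le (cpi i).
move=> j; split=> [x Ux|]; first by have [] := hgrad_derive (delta_mx ord0 j) (hg x Ux).
apply: (@classC_ext _ _ (fun z => \sum_i (partial i f \o pi) z * partial j (fun y => pi y$i) z)) => //.
 move=> z Uz; rewrite (partial_grad j (hg z Uz)) summxE; apply: eq_bigr => i _.
 by rewrite !mxE.
apply: classC_sum => // i _; apply: classCM => //.
 apply: IH; first by have [] := cf i.
 by move=> l; exact: classC_S.
by have [] := cpi i j.
Qed.

End classC.

End first_order.

(* Locked, as unification otherwise unfolds iterated derivatives. *)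
HB.lock Definition hess {R : realType} {n : nat} (f : 'rV[R]_n -> R) x : 'M[R]_n :=
 \matrix_(i, j) partial j (partial i f) x.

Lemma gradE {R : realType} {n : nat} (f : 'rV[R]_n -> R) x i : grad f x$i = partial i f x.
Proof. by rewrite mxE. Qed.

Opaque grad partial.

Definition convex_body {R : realType} {n : nat} (K : set 'rV[R]_n) :=
 [/\ compact K, K° 0 & forall x y (t : R), 0 <= t <= 1 -> K x -> K y -> K (t *: x + (1 - t) *: y)].

(** * Hessians, Taylor expansions and extrema on compact sets *)

Section second_order.
Context {R : realType} {n : nat}.
Notation E := 'rV[R]_n.

Section hessian.
Implicit Types (x y v g : E) (f : E -> R) (V U : set E).

Lemma hessE f x i j : hess f x i j = partial j (partial i f) x.
Proof. by rewrite hess.unlock mxE. Qed.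

Lemma rowB_coord (A B : 'M[R]_n) i j : (row i A - row i B)$j = A i j - B i j.
Proof. by rewrite !mxE. Qed.

Lemma bilin0r M x : bilin M x 0 = 0 :> R.
Proof. exact: dotv0r. Qed.

Lemma dist_le2 (a b c e : R) : `|a - c| <= e -> `|b - c| <= e -> `|a - b| <= 2 * e.
Proof.
by rewrite !ler_norml => /andP[? ?] /andP[? ?]; apply/andP; split; lra.
Qed.

Lemma mx_entry_bound (M : 'M[R]_n) : exists2 k : R, 0 <= k & forall i j, `|M i j| <= k.
Proof.
exists (\sum_i \sum_j `|M i j|); first by apply: sumr_ge0 => i _; exact: sumr_ge0.
move=> i j; rewrite (bigD1 i)//= (bigD1 j)//= -addrA lerDl addr_ge0//.
 exact: sumr_ge0.
by apply: sumr_ge0 => k _; exact: sumr_ge0.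
Qed.

Lemma bilinBl M x y z : bilin M (x - y) z = bilin M x z - bilin M y z :> R.
Proof. by rewrite -scaleN1r bilinDl bilinZl mulN1r. Qed.

Lemma hgrad_quad (M : 'M[R]_n) a x : M^T = M -> hgrad (fun z => 2^-1 * bilin M (z - a) (z - a)) x ((x - a) *m M).
Proof.
move=> MT e e0; have [k k0 kM] := mx_entry_bound M.
pose K := n%:R ^+ 2 * k + 1; have K0 : 0 < K by rewrite ltr_wpDl// mulr_ge0// exprn_ge0.
exists (e / K) => [|v vd]; first by pos.
have -> : 2^-1 * bilin M (x + v - a) (x + v - a) - 2^-1 * bilin M (x - a) (x - a) -
  dotv ((x - a) *m M) v = 2^-1 * bilin M v v.
 rewrite -[dotv _ v]/(bilin M (x - a) v) [x + v - a]addrAC.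
 move: (x - a) => y; rewrite !bilinDl !bilinDr (bilin_sym v y MT).
 by field.
rewrite normrM (ger0_norm _) ?invr_ge0//.
rewrite (@le_trans _ _ `|bilin M v v|)//.
 by rewrite ler_piMl// invf_le1// ler1n.
rewrite (le_trans (bilin_le _ _ k0 kM))// mulrA ler_wpM2r//.
rewrite (@le_trans _ _ (K * `|v|))//; first by rewrite ler_wpM2r// lerDl.
by rewrite mulrC -ler_pdivlMr// ltW.
Qed.

Lemma hgrad_gradi V f x i : open V -> V x -> classC 2 V f -> hgrad (fun z => grad f z$i) x (row i (hess f x)).
Proof.
move=> oV Vx cf; have [_ ci] := cf i.
have -> : (fun z => grad f z$i) = partial i f by apply/funext => z; rewrite gradE.
have := C1_hgrad oV Vx ci; congr (hgrad _ _ _).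
by apply/rowP => j; rewrite gradE [RHS]mxE hessE.
Qed.

Lemma hess_cont V f x0 (e : R) : open V -> V x0 -> classC 2 V f -> 0 < e ->
 exists2 d : R, 0 < d & forall x, `|x - x0| < d -> V x /\ forall i j, `|hess f x i j - hess f x0 i j| <= e.
Proof.
move=> oV Vx cf e0; have [d1 d10 hd1] := (openNP V).1 oV _ Vx.
have h ij : exists d : R, 0 < d /\ forall x, `|x - x0| < d -> `|hess f x ij.1 ij.2 - hess f x0 ij.1 ij.2| <= e.
 have [_ ci] := cf ij.1; have [_ /= /(_ x0 Vx)/contNP/(_ _ e0)[d d0 hd]] := ci ij.2.
 exists d; split; first exact: d0.
 by move=> x /hd/ltW; rewrite -!hessE.
have [D hD] := choice h.
exists (min d1 (\big[min/1]_ij D ij)).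
 by rewrite lt_min d10 /=; apply: lt_bigmin => // i _; have [] := hD i.
move=> x; rewrite lt_min => /andP[xd1 xd]; split; first exact: hd1.
move=> i j; have [_] := hD (i, j); apply; apply: lt_le_trans xd _.
exact: bigmin_le.
Qed.

Lemma hess_sym V f x : open V -> V x -> classC 2 V f -> (hess f x)^T = hess f x.
Proof.
move=> oV Vx cf.
have der i j z : V z -> is_derive z (delta_mx ord0 j) (partial i f) (hess f z i j).
 by move=> Vz; have [_ /(_ j)[/(_ z Vz) + _]] := cf i; move=> /derivableP; rewrite hessE.
have derf i z : V z -> is_derive z (delta_mx ord0 i) f (partial i f z).
 by move=> Vz; have [/(_ z Vz)/derivableP] := cf i.
pose dl (i : 'I_n) : E := delta_mx ord0 i.
(* Two successive mean value arguments turn the second difference into [s * s] times a mixed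
   derivative at a nearby point; the second difference itself is symmetric in [i] and [j]. *)
have key (s : R) i j : 0 < s -> (forall z, `|z - x| <= 2 * s -> V z) ->
  exists2 z, `|z - x| <= 2 * s & f (x + s *: dl j + s *: dl i) - f (x + s *: dl j) -
   (f (x + s *: dl i) - f x) = s * (s * hess f z i j).
 move=> s0 hV.
 have nb (a b : R) : 0 <= a <= 1 -> 0 <= b <= 1 -> `|x + (a * s) *: dl j + (b * s) *: dl i - x| <= 2 * s.
  move=> /andP[a0 a1] /andP[b0 b1]; rewrite -(addrA x) [x + _]addrC addrK.
  rewrite (le_trans (ler_normD _ _))// !normrZ !norm_delta !mulr1 mulr2n mulrDl !mul1r.
  by rewrite !ger0_norm ?mulr_ge0// ?(ltW s0)// lerD// ler_piMl// ltW.
 have z1 : 0 <= (1 : R) <= 1 by pos.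
 have z0 : 0 <= (0 : R) <= 1 by pos.
 pose F z := f (z + s *: dl j) - f z.
 have [t t01|c c01] := @MVTvs _ _ F x (dl i) s
   (fun t => partial i f (x + s *: dl j + (t * s) *: dl i) - partial i f (x + (t * s) *: dl i)).
  have h1 : is_derive (x + (t * s) *: dl i) (dl i) f (partial i f (x + (t * s) *: dl i)).
   by apply: derf; apply: hV; have := nb 0 t z0 t01; rewrite mul0r scale0r addr0.
  have h2 : is_derive (x + (t * s) *: dl i) (dl i) (fun z => f (z + s *: dl j))
    (partial i f (x + s *: dl j + (t * s) *: dl i)).
   apply/(@der_lineP _ _ _ (fun z => f (z + s *: dl j)) x (dl i)).
   have := @is_derive_line _ _ _ f (x + s *: dl j) (dl i) (t * s) _
    (derf i _ (hV _ _)); rewrite -{1}[s]mul1r => /(_ (nb 1 t z1 t01)).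
   by congr is_derive; apply/funext => u; rewrite addrAC.
  exact: is_deriveB.
 rewrite /F => eF.
 have -> : f (x + s *: dl j + s *: dl i) - f (x + s *: dl j) - (f (x + s *: dl i) - f x) =
   f (x + s *: dl i + s *: dl j) - f (x + s *: dl i) - (f (x + s *: dl j) - f x).
  by rewrite (addrAC x); ring.
 rewrite eF.
 have [t t01|c' c'01] := @MVTvs _ _ (partial i f) (x + (c * s) *: dl i) (dl j) s
   (fun t => hess f (x + (c * s) *: dl i + (t * s) *: dl j) i j).
  by apply: der; apply: hV; rewrite (addrAC x); exact: nb.
 rewrite (addrAC x) => ->; exists (x + (c * s) *: dl i + (c' * s) *: dl j) => //.
 by rewrite (addrAC x); exact: nb.
apply/matrixP => i j; rewrite mxE; apply/eqP; rewrite -subr_eq0 -normr_eq0.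
apply/eqP/le_anti; rewrite normr_ge0 andbT; apply/ler_addgt0Pr => e e0; rewrite add0r.
have e20 : 0 < e / 2 by pos.
have [d d0 hd] := hess_cont oV Vx cf e20.
pose s := d / 4; have s0 : 0 < s by rewrite divr_gt0.
have sd z : `|z - x| <= 2 * s -> `|z - x| < d.
 by move=> h; apply: le_lt_trans h _; rewrite /s; lra.
have hV z : `|z - x| <= 2 * s -> V z by move=> /sd/hd[].
have [z1 zx1 e1] := key s i j s0 hV; have [z2 zx2 e2] := key s j i s0 hV.
have e12 : hess f z1 i j = hess f z2 j i.
 apply: (mulfI (lt0r_neq0 s0)); apply: (mulfI (lt0r_neq0 s0)).
 by rewrite -e1 -e2 (addrAC x); ring.
have [_ /(_ i j) h1] := hd _ (sd _ zx1); have [_ /(_ j i) h2] := hd _ (sd _ zx2).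
rewrite distrC in h1; rewrite e12 in h1; rewrite distrC in h2.
by have := dist_le2 h2 h1; rewrite mulrC divfK.
Qed.

(** The expansion holds at every [x] near [x0], with the Hessian at [x] itself: this uniformity in
    the base point is what the compactness arguments use. *)
Lemma taylor2 V f x0 (e : R) : open V -> V x0 -> classC 2 V f -> 0 < e ->
 exists2 d : R, 0 < d & forall x v, `|x - x0| < d -> `|v| < d ->
  [/\ V (x + v), `|grad f (x + v) - grad f x - v *m hess f x| <= e * `|v|
   & `|f (x + v) - f x - dotv (grad f x) v - 2^-1 * bilin (hess f x) v v| <= e * `|v| ^+ 2].
Proof.
move=> oV Vx cf e0.
have [e1 e10 ee] : exists2 e1 : R, 0 < e1 & n%:R ^+ 2 * (2 * e1) <= e.
 exists (e / (2 * (n%:R ^+ 2 + 1))); first by pos.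
 rewrite [X in X <= _](_ : _ = e * (n%:R ^+ 2 / (n%:R ^+ 2 + 1))).
  by rewrite ger_pMr// ler_pdivrMr// mul1r lerDl.
 by pos.
have [d d0 hd] := hess_cont oV Vx cf e10.
exists (d / 2) => [|x v xd vd]; first by pos.
have seg (t : R) : 0 <= t <= 1 -> `|x + t *: v - x0| < d.
 move=> /andP[t0 t1]; rewrite addrAC [d]splitr (le_lt_trans (ler_normD _ _))// ltrD//.
 by rewrite normrZ ger0_norm// (le_lt_trans _ vd)// ler_piMl.
have z0 : 0 <= (0 : R) <= 1 by pos.
have Vt t : 0 <= t <= 1 -> V (x + t *: v) by move=> /seg/hd[].
have Vx' : V x by have := Vt _ z0; rewrite scale0r addr0.
have Hd t i j : 0 <= t <= 1 -> `|hess f (x + t *: v) i j - hess f x i j| <= 2 * e1.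
 move=> t01; have [_ /(_ i j) h1] := hd _ (seg _ t01).
 have [_ /(_ i j) h2] := hd _ (seg _ z0); move: h2; rewrite scale0r addr0 => h2.
 exact: dist_le2 h1 h2.
have G t : 0 <= t <= 1 -> `|grad f (x + t *: v) - grad f x - (t *: v) *m hess f x| <= n%:R * (2 * e1) * `|v|.
 move=> /andP[t0 t1]; apply: norm_le_coord => [|i].
  by pos.
 have [u u01|c /andP[c0 c1] ec] := @MVT_grad _ _ (fun z => grad f z$i) x (t *: v) (fun z => row i (hess f z)).
  apply: (@hgrad_gradi V) => //; rewrite scalerA; apply: Vt.
  by case/andP: u01 => u0 u1; rewrite mulr_ge0// mulr_ile1.
 have ei : ((t *: v) *m hess f x)$i = dotv (row i (hess f x)) (t *: v).
  rewrite mxE /dotv; apply: eq_bigr => j _; rewrite [in RHS]mxE mulrC; congr (_ * _).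
  by rewrite -[in LHS](hess_sym oV Vx' cf) mxE.
 have -> : (grad f (x + t *: v) - grad f x - (t *: v) *m hess f x)$i =
   (grad f (x + t *: v)$i - grad f x$i) - ((t *: v) *m hess f x)$i.
  by rewrite !mxE.
 rewrite ec ei.
 rewrite -dotvBl (le_trans (dotv_le _ _))// -!mulrA ler_wpM2l//.
 rewrite mulrA ler_pM//; last by rewrite normrZ ger0_norm// ler_piMl.
 apply: norm_le_coord => [|j]; first by pos.
 by rewrite rowB_coord scalerA Hd// mulr_ge0// mulr_ile1.
have z1 : 0 <= (1 : R) <= 1 by pos.

split; first by have := Vt _ z1; rewrite scale1r.
 have := G _ z1; rewrite scale1r => /le_trans; apply; rewrite ler_wpM2r//.
 rewrite (le_trans _ ee)// ler_wpM2r ?mulr_ge0// ?(ltW e10)//.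
 have [->|n0] := posnP n; first by pos.
 by rewrite expr2 ler_peMl// ler1n.
pose F z := f z - dotv (grad f x) z - 2^-1 * bilin (hess f x) (z - x) (z - x).
have hF t : 0 <= t <= 1 -> hgrad F (x + t *: v) (grad f (x + t *: v) - grad f x - (x + t *: v - x) *m hess f x).
 move=> t01; apply: hgradB; last exact/hgrad_quad/(hess_sym oV Vx' cf).
 apply: hgradB; last exact: hgrad_dotv.
 by apply: (C1_hgrad oV); [exact: Vt|exact: (classC_le oV _ cf)].
have [t t01|c c01] := @MVT_grad _ _ F x v (fun z => grad f z - grad f x - (z - x) *m hess f x); first exact: hF.
have -> : F (x + v) - F x = f (x + v) - f x - dotv (grad f x) v - 2^-1 * bilin (hess f x) v v.
 rewrite /F addr_subK subrr dotvDr bilin0r.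
 by move: (f _) (f x) (dotv _ x) (dotv _ v) (bilin _ _ _) => a b a' b' k; ring.
rewrite addr_subK => ->; rewrite (le_trans (dotv_le _ _))//.
rewrite (@le_trans _ _ (n%:R * (n%:R * (2 * e1) * `|v| * `|v|)))//.
 by rewrite ler_wpM2l// ler_wpM2r// G.
rewrite [X in X <= _](_ : _ = n%:R ^+ 2 * (2 * e1) * `|v| ^+ 2); last by ring.
by rewrite ler_wpM2r// exprn_ge0.
Qed.

End hessian.

Section evt.
Lemma compact_argmax (A : set E) (f : E -> R) : A !=set0 -> compact A -> (forall x, A x -> {for x, continuous f}) ->
 exists2 c, A c & forall t, A t -> f t <= f c.
Proof.
move=> A0 cA cf; have [|c cAc hc] := @EVT_max_rV R n f A A0 cA.
 by apply: continuous_in_subspaceT => x /set_mem; exact: cf.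
by exists c; [exact: set_mem|move=> t At; apply: hc; exact: mem_set].
Qed.

Lemma compact_argmin (A : set E) (f : E -> R) : A !=set0 -> compact A -> (forall x, A x -> {for x, continuous f}) ->
 exists2 c, A c & forall t, A t -> f c <= f t.
Proof.
move=> A0 cA cf.
have [|c Ac hc] := @compact_argmax A (fun x => - f x) A0 cA.
 by move=> x Ax; apply: continuousN; exact: cf.
by exists c => // t At; rewrite -lerN2; exact: hc.
Qed.

Lemma compact_bd (A : set E) : compact A -> exists2 C : R, 0 < C & forall x, A x -> `|x| <= C.
Proof.
move=> /compact_bounded/ex_strict_bound_gt0[C C0 hC]; exists C => // x Ax.
exact/ltW/hC.
Qed.

Lemma compact_closed_row (A : set E) : compact A -> closed A.
Proof. by move=> cA; apply: compact_closed => //; exact: norm_hausdorff. Qed.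

Lemma closed_normP (A : set E) x : closed A -> (forall e : R, 0 < e -> exists2 y, A y & `|y - x| < e) -> A x.
Proof. by move=> cA h; apply: cA; apply/closureNP. Qed.

Lemma boundary_closed (A : set E) : closed (boundary A).
Proof. by rewrite /boundary setDE; apply: closedI; [exact: closed_closure|apply: open_closedC; exact: open_interior]. Qed.

Lemma norm_rescale (r : R) (x : E) : 0 <= r -> x != 0 -> `|(r / `|x|) *: x| = r.
Proof.
by move=> r0 x0; rewrite normrZ ger0_norm ?divr_ge0// divfK// normr_eq0.
Qed.

Lemma conv_hull_convex (A : set E) x y (t : R) : 0 <= t <= 1 ->
 conv_hull A x -> conv_hull A y -> conv_hull A (t *: x + (1 - t) *: y).
Proof.
move=> t01 hx hy B [cB AB].
have [t0 t1] := andP t01.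
have xB : x \in (B : set (convex_lmodType E)) by apply/mem_set; exact: hx.
have yB : y \in (B : set (convex_lmodType E)) by apply/mem_set; exact: hy.
have := cB x y (Itv01 t0 t1) xB yB.
by rewrite /conv/= => /set_mem.
Qed.

Lemma conv_hull_min (A B : set E) : (forall x y (t : R), 0 <= t <= 1 -> B x -> B y -> B (t *: x + (1 - t) *: y)) ->
 A `<=` B -> conv_hull A `<=` B.
Proof.
move=> cB AB x; apply; split=> // a b l /set_mem Ba /set_mem Bb; apply/mem_set.
have h : B (l%:num *: a + (1 - l%:num) *: b).
 by apply: cB => //; apply/andP; split; [exact: ge0|exact: le1].
exact: h.
Qed.

Lemma lip_cont (f : E -> R) (C : R) : (forall x y, `|f x - f y| <= C * `|x - y|) -> continuous f.
Proof.
move=> h x; apply/contNP => e e0; exists (e / (`|C| + 1)).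
 by pos.
move=> y; rewrite ltr_pdivlMr ?ltr_wpDl// => hy.
apply: le_lt_trans (h _ _) _; apply: le_lt_trans hy.
by rewrite mulrC ler_wpM2l// (le_trans (ler_norm _))// lerDl.
Qed.

End evt.

Section calc_more.
Implicit Types (x y v g : E) (f : E -> R) (V U : set E).

Lemma classC_local k V f : (forall x, V x -> exists U, [/\ open U, U x & classC k U f]) -> classC k V f.
Proof.
elim: k f => [|k IH] f h; first by move=> x /h[U [_ Ux]]; exact.
move=> i; split=> [x /h[U [oU Ux /(_ i)[d _]]]|]; first exact: d.
by apply: IH => x /h[U [oU Ux /(_ i)[_ c]]]; exists U.
Qed.

Lemma hgrad_row (f : E -> E) x (A : 'M[R]_n) : (forall i, hgrad (fun z => f z$i) x (row i A)) ->
 differentiable f x /\ ('d f x = (fun v => v *m A^T) :> (E -> E)).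
Proof.
move=> h; pose L : {linear E -> E} := mulmxr A^T.
have LE v i : (v *m A^T)$i = dotv (row i A) v.
 by rewrite mxE /dotv; apply: eq_bigr => j _; rewrite !mxE mulrC.
have c : continuous L.
 move=> y; apply/(@cvgrPdist_lt _ _ _ (nbhs y)) => e e0.
 have [k k0 kA] := mx_entry_bound A^T.
 pose K := n%:R * k + 1; have K0 : 0 < K by rewrite ltr_wpDl// mulr_ge0.
 apply/(@nbhs_rowP R n y); exists (e / K) => [|z zy]; first by pos.
 rewrite distrC -linearB/= (le_lt_trans (norm_mulmx_le _ k0 kA))//.
 rewrite (@le_lt_trans _ _ (K * `|z - y|))//; last by rewrite mulrC -ltr_pdivlMr.
 by rewrite ler_wpM2r// lerDl.
have o : f \o shift x = cst (f x) + L +o_ (0 : E) id.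
 apply/eqaddoP => e e0.
 have hh i : exists d : R, 0 < d /\ forall v, `|v| < d -> `|f (x + v)$i - f x$i - dotv (row i A) v| <= e * `|v|.
  by have [d d0 hd] := h i _ e0; exists d.
 have [D hD] := choice hh; apply/(@nbhs_rowP R n 0).
 exists (\big[min/1]_i D i) => [|v]; first by apply: lt_bigmin => // i _; have [] := hD i.
 rewrite subr0 => vd; apply: norm_le_coord => [|i]; first by pos.
 have [_] := hD i; rewrite /= !fctE /= => /(_ v).
 rewrite !mxE -LE [v + x]addrC opprD addrA !mxE; apply.
 by apply: lt_le_trans vd _; exact: bigmin_le.
have e : 'd f x = L :> (E -> E) by exact: (@diff_unique R E E f L x c o).
by split=> //; apply/diff_locallyP; rewrite e.
Qed.

Lemma hgrad_homog f x g (t : R) : (forall (k : R) z, 0 <= k -> f (k *: z) = k * f z) ->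
 0 < t -> hgrad f x g -> hgrad f (t *: x) g.
Proof.
move=> hom t0 h e e0; have [d d0 hd] := h _ e0; exists (t * d) => [|v vd]; first by pos.
have : `|t^-1 *: v| < d by rewrite normrZ gtr0_norm ?invr_gt0// mulrC ltr_pdivrMr// mulrC.
move=> /hd.
have -> : t *: x + v = t *: (x + t^-1 *: v).
 by rewrite scalerDr scalerA mulfV ?scale1r// gt_eqF.
rewrite !hom ?(ltW t0)// normrZ gtr0_norm ?invr_gt0// dotvZr => h1.
rewrite -mulrBr [X in `|X|](_ : _ = t * (f (x + t^-1 *: v) - f x - t^-1 * dotv g v)); last by field; pos.
by rewrite normrM gtr0_norm// -ler_pdivlMl// mulrCA.
Qed.

End calc_more.

Section directional.
Implicit Types (x y v g : E) (f : E -> R) (V U : set E).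

Lemma hgrad_dir_le f x g q (c : R) : hgrad f x g ->
 (exists2 d : R, 0 < d & forall t, 0 < t < d -> f (x + t *: q) - f x <= t * c) -> dotv g q <= c.
Proof.
move=> hf [d d0 hd]; apply/ler_addgt0Pr => e e0.
pose k := `|q| + 1; have k0 : 0 < k by rewrite ltr_wpDl.
have ek : 0 < e / k by pos.
have [d1 d10 hd1] := hf _ ek.
have [t [t0 td td1]] : exists t, [/\ 0 < t, t < d & t < d1 / k].
 have m0 : 0 < min d (d1 / k) by pos.
 have : min d (d1 / k) / 2 < min d (d1 / k).
  by pos.
 rewrite lt_min => /andP[? ?]; exists (min d (d1 / k) / 2); split=> //.
 by pos.
have /hd1 : `|t *: q| < d1.
 rewrite normrZ gtr0_norm// (le_lt_trans (y := t * k))//.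
  by rewrite ler_pM2l// /k lerDl.
 by rewrite -ltr_pdivlMr.
have := hd t; rewrite t0 td => /(_ isT) h1.
rewrite dotvZr normrZ gtr0_norm// ler_norml => /andP[h2 _].
have h3 : e / k * (t * `|q|) <= t * e.
 rewrite mulrAC ler_pdivrMr// [t * e]mulrC -!mulrA ler_pM2l// ler_pM2l//.
 by rewrite lerDl.
by rewrite -(ler_pM2l t0) mulrDr; lra.
Qed.

Lemma hgrad_dir_eq f x g q (c : R) : hgrad f x g ->
 (exists2 d : R, 0 < d & forall t, 0 < t < d -> f (x + t *: q) - f x = t * c) -> dotv g q = c.
Proof.
move=> hf [d d0 hd]; apply/le_anti/andP; split.
 by apply: (hgrad_dir_le hf); exists d => // t /hd ->.
rewrite -lerN2 -dotvNl; apply: (hgrad_dir_le (hgradN hf)).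
by exists d => // t /hd h; rewrite mulrN -h opprB opprK addrC.
Qed.

Lemma dotv_mulmx_row (A : 'M[R]_n) x i : A^T = A -> (x *m A)$i = dotv (row i A) x.
Proof.
move=> AT; rewrite mxE /dotv; apply: eq_bigr => j _; rewrite mxE mulrC; congr (_ * _).
by rewrite -{1}AT mxE.
Qed.

End directional.

Section posdef.
Implicit Types (M : 'M[R]_n) (x y u v q : E).

Lemma posdef_unit M : (forall v, v != 0 -> 0 < bilin M v v) -> M \in unitmx.
Proof.
move=> h; rewrite -row_free_unit -kermx_eq0; apply/rowV0P => v /sub_kermxP vM.
by apply/eqP; apply: contraTT isT => /h; rewrite /bilin vM dotv0l ltxx.
Qed.

Lemma invmx_sym M : M^T = M -> (invmx M)^T = invmx M.
Proof. by move=> MT; rewrite trmx_inv MT. Qed.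

Lemma bilin_inv M u v : M \in unitmx -> M^T = M -> bilin M (u *m invmx M) v = dotv u v.
Proof. by move=> uM MT; rewrite /bilin mulmxKV. Qed.

(** Expand [bilin M] at [q - u *m invmx M], where it is nonnegative. *)
Lemma young_posdef M q u : M^T = M -> (forall v, v != 0 -> 0 < bilin M v v) ->
 dotv q u <= 2^-1 * bilin M q q + 2^-1 * bilin (invmx M) u u.
Proof.
move=> MT h; have uM := posdef_unit h; set z := u *m invmx M.
have h0 v : 0 <= bilin M v v.
 by have [->|/h/ltW//] := eqVneq v 0; rewrite bilin0r.
have := h0 (q - z); rewrite bilinBl [bilin M q _]dotvBr [bilin M z _]dotvBr.
rewrite -!/(bilin _ _ _) (bilin_sym q z MT) !bilin_inv// (dotvC u q) (dotvC u z).
by pos.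
Qed.

Lemma bilin_inv_le M u (m : R) : 0 < m -> M^T = M -> (forall v, m * `|v| ^+ 2 <= bilin M v v) ->
 0 <= bilin (invmx M) u u <= n%:R ^+ 2 / m * `|u| ^+ 2.
Proof.
move=> m0 MT h.
have hp v : v != 0 -> 0 < bilin M v v.
 by move=> v0; apply: lt_le_trans (h v); rewrite mulr_gt0// exprn_gt0// normr_gt0.
have uM := posdef_unit hp; set z := u *m invmx M.
have zE : bilin (invmx M) u u = bilin M z z by rewrite bilin_inv// dotvC.
have := h z; rewrite zE; have := dotv_le u z; rewrite -(bilin_inv _ _ uM MT) -/z => h1 h2.
have h3 : bilin M z z <= n%:R * (`|u| * `|z|) by exact: le_trans (ler_norm _) h1.
have h4 : m * `|z| <= n%:R * `|u|.
 have [->|z0] := eqVneq z 0; first by rewrite normr0 mulr0 mulr_ge0.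
 have nz : 0 < `|z| by pos.
 by rewrite -(ler_pM2r nz) -mulrA -expr2 -mulrA (le_trans h2).
apply/andP; split; first by apply: le_trans h2; rewrite mulr_ge0 ?exprn_ge0// ltW.
apply: (le_trans h3); rewrite mulrAC ler_pdivlMr// expr2 expr2.
have := ler_wpM2l (mulr_ge0 (ler0n _ n) (normr_ge0 u)) h4; lra.
Qed.

End posdef.

Section halfspace.
Implicit Types (f : E -> R) (x g a v : E).

(** Let [t] be the part of [a] orthogonal to [g]. Since [s *: g - t] is in the open half space for
    all [s > 0], letting [s] tend to 0 gives [dotv a t <= 0], while [dotv a t = dotv t t]. *)
Lemma halfspace_colinear a g : g != 0 -> (forall v, 0 < dotv g v -> 0 <= dotv a v) -> exists2 c, 0 <= c & a = c *: g.
Proof.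
move=> g0 h; have gg : 0 < dotv g g by rewrite dotvv_gt0.
pose c := dotv a g / dotv g g.
exists c; first by rewrite divr_ge0 ?(ltW gg)// h.
pose t := a - c *: g.
have gt : dotv g t = 0 by rewrite dotvBr dotvZr (dotvC g a) /c divfK ?subrr// gt_eqF.
have at0 : dotv a t <= 0.
 apply/ler_addgt0Pr => e e0; rewrite add0r.
 pose s := e / (dotv a g + 1).
 have ag : 0 <= dotv a g by exact: h.
 have s0 : 0 < s by rewrite divr_gt0// ltr_wpDl.
 have := h (s *: g - t); rewrite dotvBr gt subr0 dotvZr mulr_gt0// => /(_ isT).
 rewrite dotvBr dotvZr subr_ge0 => h1; apply: le_trans h1 _.
 by rewrite /s mulrAC ler_pdivrMr ?ltr_wpDl// ler_wpM2l ?(ltW e0)// lerDl.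
have : dotv t t = dotv a t by rewrite {1}/t dotvBl dotvZl gt mulr0 subr0.
move=> tt; have /eqP : dotv t t = 0 by apply/le_anti; rewrite dotvv_ge0 tt at0.
by rewrite dotvv_eq0 subr_eq0 => /eqP.
Qed.

Lemma hgrad_dir_pos f x g v : hgrad f x g -> 0 < dotv g v ->
 exists2 d : R, 0 < d & forall t, 0 < t < d -> f x < f (x + t *: v).
Proof.
move=> hf gv; have v0 : v != 0 by apply: contraTneq gv => ->; rewrite dotv0r ltxx.
have nv : 0 < `|v| by pos.
have e0 : 0 < dotv g v / (2 * `|v|) by pos.
have [d d0 hd] := hf _ e0; exists (d / `|v|); first by pos.
move=> t /andP[t0 td]; have /hd : `|t *: v| < d by rewrite normrZ gtr0_norm// -ltr_pdivlMr.
rewrite dotvZr normrZ gtr0_norm// ler_norml => /andP[h _].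
have e : dotv g v / (2 * `|v|) * (t * `|v|) = t * dotv g v / 2 by field; pos.
by rewrite e in h; have := mulr_gt0 t0 gv; lra.
Qed.

Lemma hgrad_sub_l f a x g : hgrad f (a - x) g -> hgrad (fun z => f (a - z)) x (- g).
Proof.
move=> h e e0; have [d d0 hd] := h e e0; exists d => // v vd.
rewrite opprD addrA dotvNl opprK.
have := hd (- v); rewrite normrN dotvNr opprK; exact.
Qed.

Lemma hgrad_sub_r f a x g : hgrad f (x - a) g -> hgrad (fun z => f (z - a)) x g.
Proof.
move=> h e e0; have [d d0 hd] := h e e0; exists d => // v vd.
by rewrite (addrAC x); exact: hd.
Qed.

End halfspace.

Section product.
(** Where the first factor vanishes the second need only be continuous. This is used for products
    with test functions off [Omega] and for the Jacobian of the Cahn-Hoffman field, whose second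
    factor is not known to be differentiable. *)
Lemma hgradM0 (f k : E -> R) x g : hgrad f x g -> f x = 0 -> {for x, continuous k} ->
 hgrad (fun z => f z * k z) x (k x *: g).
Proof.
move=> hf fx /contNP hk e e0.
pose L := n%:R * `|g| + 1; have L0 : 0 < L by rewrite ltr_wpDl// mulr_ge0.
pose Q := `|k x| + 1; have Q0 : 0 < Q by rewrite ltr_wpDl.
have e1 : 0 < min 1 (e / (2 * L)) by pos.
have [d1 d10 h1] := hk _ e1.
have e2 : 0 < e / (2 * Q) by pos.
have [d2 d20 h2] := hf _ e2.
exists (min d1 d2); first by pos.
move=> v; rewrite lt_min => /andP[v1 v2].
have := h1 (x + v); rewrite addr_subK => /(_ v1); rewrite lt_min => /andP[k1 k2].
have f2 := h2 _ v2; rewrite fx subr0 in f2.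
rewrite fx mul0r subr0 dotvZl.
have -> : f (x + v) * k (x + v) - k x * dotv g v =
  (f (x + v) - dotv g v) * k (x + v) + dotv g v * (k (x + v) - k x) by ring.
rewrite (le_trans (ler_normD _ _))// !normrM.
have -> : e * `|v| = e / (2 * Q) * `|v| * Q + L * `|v| * (e / (2 * L)).
 by field; pos.
rewrite lerD// ler_pM//.
- rewrite -[k (x + v)](subrK (k x)) (le_trans (ler_normD _ _))// addrC lerD// ltW//.
- rewrite (le_trans (dotv_le _ _))// mulrA ler_wpM2r// /L lerDl//.
- by pos.
Qed.

End product.

End second_order.

(** * Self-adjoint operators and the abstract shape operator *)

Section selfadjoint.
Context {R : realType}.

(** [x + i y] is a complex eigenvector for [a + i c]. Computing the symmetric form of [M *m S] at
    [(x, y)] in two ways gives [c (S(x, x) + S(y, y)) = 0]. *)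
Lemma selfadjoint_root_real k (M S : 'M[R]_k) (x y : 'rV[R]_k) (a c : R) :
 S^T = S -> (M *m S)^T = M *m S -> (forall v, v != 0 -> 0 < bilin S v v) ->
 x *m M = a *: x - c *: y -> y *m M = c *: x + a *: y -> (x != 0) || (y != 0) -> c = 0.
Proof.
move=> Ss MSs Sp xM yM xy.
have e : bilin (M *m S) x y = bilin (M *m S) y x by exact: bilin_sym.
have b1 : bilin (M *m S) x y = a * bilin S x y - c * bilin S y y.
 by rewrite /bilin mulmxA xM mulmxBl -!scalemxAl dotvBl !dotvZl.
have b2 : bilin (M *m S) y x = c * bilin S x x + a * bilin S y x.
 by rewrite /bilin mulmxA yM mulmxDl -!scalemxAl dotvDl !dotvZl.
have {}e : c * (bilin S x x + bilin S y y) = 0.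
 by move: e; rewrite b1 b2 (bilin_sym y x Ss) mulrDr; lra.
have ge0 v : 0 <= bilin S v v.
 by have [->|/Sp/ltW//] := eqVneq v 0; rewrite bilin0r.
apply/eqP; move/eqP: e; rewrite mulf_eq0 => /orP[//|]; rewrite paddr_eq0// => /andP[/eqP e1 /eqP e2].
by case/orP: xy => /Sp; rewrite ?e1 ?e2 ltxx.
Qed.

Lemma Re_mulC (z : complex.complex R) (r : R) :
 complex.Re (z * complex.real_complex_def (Phant R) r) = complex.Re z * r.
Proof. by case: z => a c; rewrite /= mulr0 subr0. Qed.

Lemma Im_mulC (z : complex.complex R) (r : R) :
 complex.Im (z * complex.real_complex_def (Phant R) r) = complex.Im z * r.
Proof. by case: z => a c; rewrite /= mulr0 add0r. Qed.

(** [rho_curvatures] is chosen by [get], which is meaningful only once a real factorisation exists: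
    the polynomial is split over the complex numbers and its roots are shown to be real. *)
Lemma char_poly_selfadjoint k (M S : 'M[R]_k) :
 S^T = S -> (M *m S)^T = M *m S -> (forall v, v != 0 -> 0 < bilin S v v) ->
 exists kappa : 'rV[R]_k, char_poly M = \prod_i ('X - (kappa$i)%:P).
Proof.
move=> Ss MSs Sp.
pose toC := @complex.real_complex_def R (Phant R) : {rmorphism R -> complex.complex R}.
have [r rE] := closed_field_poly_normal (char_poly (map_mx toC M)).
rewrite (monicP (char_poly_monic _)) scale1r in rE.
have rr z : z \in r -> z = toC (complex.Re z).
 move=> zr; have : root (char_poly (map_mx toC M)) z by rewrite rE root_prod_XsubC.
 rewrite -eigenvalue_root_char => /eigenvalueP[v vM v0].
 suff : complex.Im z = 0 by case: z {zr vM} => a c /= ->.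
 pose x : 'rV[R]_k := map_mx (@complex.Re R) v.
 pose y : 'rV[R]_k := map_mx (@complex.Im R) v.
 apply: (@selfadjoint_root_real _ M S x y (complex.Re z)) => //.
 - apply/rowP => j; move/rowP/(_ j) : vM => /(congr1 (@complex.Re R)).
  rewrite !mxE raddf_sum/= => e.
  transitivity (\sum_i complex.Re (v 0 i * (map_mx toC M) i j)).
   by apply: eq_bigr => i _; rewrite !mxE Re_mulC.
  by rewrite e; case: (z) => a c; case: (v 0 j).
 - apply/rowP => j; move/rowP/(_ j) : vM => /(congr1 (@complex.Im R)).
  rewrite !mxE raddf_sum/= => e.
  transitivity (\sum_i complex.Im (v 0 i * (map_mx toC M) i j)).
   by apply: eq_bigr => i _; rewrite !mxE Im_mulC.
  by rewrite e; case: (z) => a c; case: (v 0 j) => f g /=; rewrite addrC.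
 - apply: contraNT v0; rewrite negb_or !negbK => /andP[/eqP x0 /eqP y0].
  apply/eqP/rowP => j; rewrite mxE; move/rowP/(_ j) : x0; move/rowP/(_ j) : y0.
  by rewrite !mxE; case: (v 0 j) => f g /= -> ->.
have sr : size r = k.
 have := size_char_poly (map_mx toC M); rewrite rE size_prod_XsubC; by case.
exists (\row_i complex.Re (nth 0 r i)).
apply: (map_poly_inj toC); rewrite map_char_poly rE rmorph_prod /=.
rewrite (big_nth 0) sr big_mkord; apply: eq_bigr => i _.
by rewrite rmorphB /= map_polyX map_polyC /= mxE -rr// mem_nth// sr.
Qed.

Lemma mxtrace_char_poly k (M : 'M[R]_k) (kappa : 'rV[R]_k) :
 char_poly M = \prod_i ('X - (kappa$i)%:P) -> \tr M = \sum_i kappa$i.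
Proof.
move=> h; case: k => [|k] in M kappa h *; first by rewrite /mxtrace !big_ord0.
have := char_poly_trace M (ltn0Sn _); rewrite h.
have -> : \prod_i ('X - (kappa$i)%:P) = \prod_(z <- [seq kappa$i | i <- enum 'I_k.+1]) ('X - z%:P).
 by rewrite big_map big_enum.
have sz : size [seq kappa$i | i <- enum 'I_k.+1] = k.+1 by rewrite size_map size_enum_ord.
have := @coefPn_prod_XsubC R [seq kappa$i | i <- enum 'I_k.+1]; rewrite sz => -> // /oppr_inj <-.
by rewrite big_map big_enum.
Qed.

Lemma char_poly_eigen k (M : 'M[R]_k) (kappa : 'rV[R]_k) i : char_poly M = \prod_i ('X - (kappa$i)%:P) ->
 exists2 v : 'rV[R]_k, v != 0 & v *m M = kappa$i *: v.
Proof.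
move=> h; have : root (char_poly M) (kappa$i).
 by rewrite h /root horner_prod (bigD1 i)//= hornerXsubC subrr mul0r.
by rewrite -eigenvalue_root_char => /eigenvalueP[v vM v0]; exists v.
Qed.

End selfadjoint.

Lemma mul_row_tr {R : realType} {n : nat} (u v : 'rV[R]_n) : u *m v^T = (dotv u v)%:M.
Proof.
apply/matrixP => i j; rewrite !ord1 !mxE eqxx mulr1n; apply: eq_bigr => k _.
by rewrite mxE.
Qed.

Lemma dotv_mulmx_rect {R : realType} {m n : nat} (A : 'M[R]_(m, n)) (x : 'rV[R]_m) (y : 'rV[R]_n) :
 dotv (x *m A) y = dotv x (y *m A^T).
Proof.
have : (dotv (x *m A) y)%:M = (dotv x (y *m A^T))%:M :> 'M[R]_1.
 by rewrite -!mul_row_tr trmx_mul trmxK mulmxA.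
by move=> /matrixP/(_ ord0 ord0); rewrite !mxE eqxx !mulr1n.
Qed.

Section shape_operator.
Context {R : realType} {n : nat}.
Variables (p w : 'rV[R]_n) (G H : 'M[R]_n).
Hypotheses (pw : dotv p w = 1) (pG : p *m G = 0) (Gs : G^T = G) (Hs : H^T = H).
(** In the application [p] is the conormal, [w = b p], [G] the Hessian of the gauge at [p] and [H]
    the second fundamental form. [G] kills [p]; the added rank one term makes it invertible, and the
    inverse [N] satisfies [G N = 1 - w^T p]. Hence [N] inverts [G] on the tangent space, and it is
    the metric for which [H G] is self-adjoint there. *)
Let Gh := G + w^T *m w.
Hypothesis Ghp : forall v, v != 0 -> 0 < bilin Gh v v.
Let N := invmx Gh.
Let J := (1%:M - p^T *m w) *m H *m G.

Let Ghu : Gh \in unitmx. Proof. exact: posdef_unit. Qed.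
Let Ghs : Gh^T = Gh.
Proof. by rewrite /Gh linearD /= trmx_mul trmxK Gs. Qed.
Let Ns : N^T = N. Proof. exact: invmx_sym. Qed.

Let pGh : p *m Gh = w.
Proof. by rewrite mulmxDr pG add0r mulmxA mul_row_tr pw mul1mx. Qed.

Lemma dual_normal : w *m N = p.
Proof. by rewrite -pGh mulmxK. Qed.

Let GN : G *m N = 1%:M - w^T *m p.
Proof.
have -> : G = Gh - w^T *m w by rewrite addrK.
by rewrite mulmxBl mulmxV// -mulmxA dual_normal.
Qed.

Let Gp : G *m p^T = 0.
Proof. by apply: trmx_inj; rewrite trmx_mul trmxK Gs pG trmx0. Qed.

Lemma trace_metric : \tr (G *m N) = n%:R - 1.
Proof.
by rewrite GN linearB /= mxtrace_scalar mxtrace_mulC mul_row_tr mxtrace_scalar pw.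
Qed.

Lemma inv_metric_ge0 (t : 'rV[R]_n) : t != 0 -> 0 < bilin N t t.
Proof.
move=> t0; have u0 : t *m N != 0.
 by apply: contra_neq t0 => e; rewrite -[t]mulmx1 -(mulVmx Ghu) mulmxA e mul0mx.
have := Ghp u0; rewrite bilin_inv// dotvC /bilin; exact.
Qed.

Section tangent_basis.
Variable B : 'M[R]_(n.-1, n).
Hypotheses (Bf : row_free B) (BT : forall v : 'rV[R]_n, (v <= B)%MS <-> dotv p v = 0).

Let Bp : B *m p^T = 0.
Proof.
apply/row_matrixP => i; rewrite row_mul row0 mul_row_tr dotvC (BT _).1 ?row_sub//.
by apply/matrixP => a c; rewrite !mxE mul0rn.
Qed.

Let subB k (A : 'M[R]_(k, n)) : A *m p^T = 0 -> (A <= B)%MS.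
Proof.
move=> A0; apply/row_subP => i; apply/BT; have : row i A *m p^T = 0 by rewrite -row_mul A0 row0.
by rewrite mul_row_tr dotvC => /matrixP/(_ ord0 ord0); rewrite !mxE eqxx mulr1n.
Qed.

Let Jp : J *m p^T = 0.
Proof. by rewrite -mulmxA Gp mulmx0. Qed.

Let BJ : B *m J = B *m H *m G.
Proof. by rewrite /J !mulmxA mulmxBr mulmx1 mulmxA Bp mul0mx subr0. Qed.

Lemma shape_matrix : exists M, B *m J = M *m B /\
 exists kappa : 'rV[R]_n.-1, char_poly M = \prod_i ('X - (kappa$i)%:P).
Proof.
have sJ : (B *m J <= B)%MS by apply: subB; rewrite -mulmxA Jp mulmx0.
exists (B *m J *m pinvmx B); rewrite mulmxKpV//; split=> //.
(* The metric is [N] in the basis [B]; the product of the operator with it collapses to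
   [B *m H *m B^T]. *)
apply: (@char_poly_selfadjoint _ _ _ (B *m N *m B^T)).
- by rewrite !trmx_mul trmxK Ns mulmxA.
- have -> : B *m J *m pinvmx B *m (B *m N *m B^T) = B *m H *m B^T.
  rewrite -(mulmxA B N) mulmxA mulmxKpV// BJ !mulmxA -(mulmxA _ G N) GN mulmxBr mulmx1 mulmxBl.
  have pB : p *m B^T = 0 by apply: trmx_inj; rewrite trmx_mul trmxK Bp trmx0.
  by rewrite -!mulmxA pB !mulmx0 subr0.
 by rewrite !trmx_mul trmxK Hs mulmxA.
- move=> v v0; have -> : bilin (B *m N *m B^T) v v = bilin N (v *m B) (v *m B).
  by rewrite /bilin !mulmxA dotv_mulmx_rect trmxK.
 by apply: inv_metric_ge0; apply: contra_neq v0 => e; apply: (row_free_inj Bf); rewrite e mul0mx.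
Qed.

(** [J] maps the whole space into the tangent space, so its trace is that of the restriction;
    cyclicity then removes the projection, since [G] kills [p]. *)
Lemma shape_trace M : B *m J = M *m B -> \tr M = \tr (H *m G).
Proof.
move=> h; have BpB : B *m pinvmx B = 1%:M.
 by rewrite mulmxVp.
have -> : \tr M = \tr J.
 rewrite -[M]mulmx1 -BpB mulmxA -h -mulmxA mxtrace_mulC.
 by rewrite mulmxKpV// subB.
rewrite /J -mulmxA mxtrace_mulC mulmxBr mulmx1 mulmxA -(mulmxA _ G) Gp mulmx0 mul0mx subr0//.
Qed.

(** For a tangent eigenvector [t], multiplying [t H G = kappa t] by [N] and pairing with [t] gives
    [H(t, t) = kappa N(t, t)]. *)
Lemma shape_eigen_le M (kappa : 'rV[R]_n.-1) (k : R) i : B *m J = M *m B ->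
 char_poly M = \prod_i ('X - (kappa$i)%:P) ->
 (forall t, dotv p t = 0 -> bilin H t t <= k * bilin N t t) -> kappa$i <= k.
Proof.
move=> h hM hk; have [v v0 vM] := char_poly_eigen i hM.
have t0 : v *m B != 0.
 by apply: contra_neq v0 => e; apply: (row_free_inj Bf); rewrite e mul0mx.
have pt : dotv p (v *m B) = 0 by apply/BT; exact: submxMl.
have := hk _ pt; suff -> : bilin H (v *m B) (v *m B) = kappa$i * bilin N (v *m B) (v *m B).
 by rewrite ler_pM2r// inv_metric_ge0.
have e : v *m B *m H *m G = kappa$i *: (v *m B).
 by rewrite -2!mulmxA [B *m _]mulmxA -BJ h mulmxA vM scalemxAl.
rewrite /bilin -dotvZl scalemxAl -e -(mulmxA _ G N) GN mulmxBr mulmx1 dotvBl.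
have -> : v *m B *m H *m (w^T *m p) = dotv (v *m B *m H) w *: p.
 by rewrite mulmxA mul_row_tr mul_scalar_mx.
by rewrite dotvZl pt mulr0 subr0.
Qed.

End tangent_basis.

Lemma tangent_basis : (0 < n)%N -> exists B : 'M[R]_(n.-1, n), row_free B /\
 forall v : 'rV[R]_n, (v <= B)%MS <-> dotv p v = 0.
Proof.
move=> n0.
have rk : \rank (kermx p^T) = n.-1.
 rewrite mxrank_ker mxrank_tr rank_rV; case: eqVneq => [p0|_]; last by rewrite subn1.
 by move: pw; rewrite p0 dotv0l => /eqP; rewrite eq_sym oner_eq0.
rewrite -rk; exists (row_base (kermx p^T)); split; first exact: row_base_free.
move=> v; rewrite eq_row_base; split=> [/sub_kermxP|h].
 by rewrite mul_row_tr dotvC => /matrixP/(_ ord0 ord0); rewrite !mxE eqxx mulr1n.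
apply/sub_kermxP; rewrite mul_row_tr dotvC h.
by apply/matrixP => a c; rewrite !mxE mul0rn.
Qed.

End shape_operator.

Lemma mulmx_entry_le {R : realType} {n : nat} (A B : 'M[R]_n) (c1 c2 : R) : 0 <= c1 ->
 (forall i j, `|A i j| <= c1) -> (forall i j, `|B i j| <= c2) -> forall i j, `|(A *m B) i j| <= n%:R * (c1 * c2).
Proof.
move=> c10 hA hB i j; rewrite mxE (le_trans (ler_norm_sum _ _ _))//.
have -> : n%:R * (c1 * c2) = \sum_(k < n) c1 * c2 by rewrite sumr_const card_ord mulr_natl.
by apply: ler_sum => k _; rewrite normrM ler_pM.
Qed.

Lemma bilin_scale {R : realType} {n : nat} (k : R) (A : 'M[R]_n) u v : bilin (k *: A) u v = k * bilin A u v.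
Proof. by rewrite /bilin -scalemxAr dotvZl. Qed.

(** Linear arithmetic of [exit_local], kept apart so that [lra] meets atoms instead of Hessians. *)
Lemma exit_scalar (R : realFieldType) (Z W M1 Y Y' P mk mB mS : R) :
 - Z <= P + mk - 2^-1 * mB -> mS - W <= mB -> Z <= Y -> W <= Y -> Y' <= M1 -> 0 < Y ->
 Y' = 4 * Y -> mk = mS / 2 - M1 -> P < 0 -> False.
Proof. lra. Qed.

(** Polarisation with the vectors [e_i + e_j] and [e_i - e_j], of norm at most 2. *)
Lemma psd_entry_le {R : realType} {n : nat} (A : 'M[R]_n) (c : R) : A^T = A ->
 (forall u, 0 <= bilin A u u <= c * `|u| ^+ 2) -> forall i j, `|A i j| <= c.
Proof.
move=> As h i j; pose e k : 'rV[R]_n := delta_mx ord0 k.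
have AE : A i j = bilin A (e i) (e j) by rewrite /bilin dotv_delta -rowE mxE.
have nb (u : 'rV[R]_n) : `|u| <= 2 -> 0 <= bilin A u u <= c * 4.
 move=> u2; have /andP[h0 h1] := h u; rewrite h0 (le_trans h1)//.
 have c0 : 0 <= c.
  have /andP[g0 g1] := h (e i); have := le_trans g0 g1.
  by rewrite norm_delta expr1n mulr1.
 rewrite ler_wpM2l//; have -> : (4 : R) = 2 ^+ 2 by pos.
 by apply: sqr_mono.
have n1 k : `|e k| = 1 by exact: norm_delta.
have /nb h1 : `|e i + e j| <= 2 by rewrite (le_trans (ler_normD _ _))// !n1; lra.
have /nb h2 : `|e i - e j| <= 2 by rewrite (le_trans (ler_normB _ _))// !n1; lra.
move: h1 h2; rewrite AE bilinBl !bilinDl !bilinDr -scaleN1r !bilinZr (bilin_sym (e j) (e i) As).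
by rewrite ler_norml; move: (bilin A (e i) (e j)) (bilin A (e i) (e i)) (bilin A (e j) (e j)) => X Y Z; lra.
Qed.

(** * Borel sets of row vectors, open boxes and their volume *)

Section boxes.
Context {R : realType} {n : nat}.
Notation E := 'rV[R]_n.
Notation mu := (@lebesgue_rV R n).
Implicit Types (x y v a b c : E) (A U : set E).

Definition obox a b : set E := [set x | forall i, a$i < x$i < b$i].

Lemma obox_open a b : open (obox a b).
Proof.
apply/openNP => x hx.
exists (\big[min/1]_i min (x$i - a$i) (b$i - x$i)).
 by apply: lt_bigmin => // i _; have /andP[h1 h2] := hx i; rewrite lt_min !subr_gt0 h1.
move=> y yx i; have : `|(y - x)$i| < min (x$i - a$i) (b$i - x$i).
 by apply: le_lt_trans (coord_le_norm _ _) _; apply: lt_le_trans yx _; exact: bigmin_le.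
by rewrite !mxE lt_min !ltr_norml => /andP[/andP[h1 h2] /andP[h3 h4]]; lra.
Qed.

Lemma oboxI a b a' b' : obox a b `&` obox a' b' = obox (\row_i max (a$i) (a'$i)) (\row_i min (b$i) (b'$i)).
Proof.
apply/seteqP; split => [x [h h'] i|x h].
 rewrite !mxE gt_max lt_min; have /andP[-> ->] := h i; by have /andP[-> ->] := h' i.
by split=> i; have := h i; rewrite !mxE gt_max lt_min => /andP[/andP[h1 h2] /andP[h3 h4]]; rewrite ?h1 ?h2 ?h3 ?h4.
Qed.

Lemma ball_obox c (r : R) : 0 < r -> ball c r = obox (c - const_mx r) (c + const_mx r).
Proof.
move=> r0; apply/seteqP; split => [x /ball_rowP h i|x h].
 have : `|(x - c)$i| < r by apply: le_lt_trans h; exact: coord_le_norm.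
 by rewrite !mxE ltr_norml => /andP[h1 h2]; lra.
apply/ball_rowP/norm_lt_coord => // i; have := h i.
by rewrite !mxE ltr_norml => /andP[h1 h2]; lra.
Qed.

Lemma open_meas A : open A -> measurable A.
Proof. by move=> oA; exact: sub_sigma_algebra. Qed.

Lemma closed_meas A : closed A -> measurable A.
Proof.
by move=> cA; rewrite -[A]setCK; apply: measurableC; apply: open_meas; exact: closed_openC.
Qed.

Let G := [set A | exists a b, A = obox a b].

Lemma rat_balls U : open U -> U = \bigcup_(p in [set p : 'rV[rat]_n * nat |
   ball (map_mx (@ratr R) p.1 : E) (p.2.+1%:R^-1 : R) `<=` U]) ball (map_mx (@ratr R) p.1 : E) (p.2.+1%:R^-1 : R).
Proof.
move=> oU; apply/seteqP; split => [x Ux|x [p /= BU]]; last exact: BU.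
have [e e0 xe] := (openNP U).1 oU x Ux.
have [k ke] : exists k : nat, (k.+1%:R^-1 : R) < e / 2.
 have [k _ /(_ k (leqnn k)) h] := near_infty_natSinv_lt (PosNum (divr_gt0 e0 (ltr0n _ 2))).
 by exists k.
have H i : exists q : rat, `|ratr q - x$i| < (k.+1%:R^-1 : R).
 have oB := @ball_open _ _ (x$i) (k.+1%:R^-1 : R).
 have [|q [hq [r _ rE]]] := @dense_rat R (ball (x$i) (k.+1%:R^-1 : R)) _ oB.
  by exists (x$i); exact: ballxx.
 by exists r; move: hq; rewrite -rE /ball /= distrC.
have [q Hq] := choice H.
have qx : `|(map_mx (@ratr R) (\row_i q i) : E) - x| < (k.+1%:R^-1 : R).
 by apply: norm_lt_coord => // i; rewrite !mxE; exact: Hq.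
exists (\row_i q i, k) => /=; last by apply/ball_rowP; rewrite distrC.
move=> y /ball_rowP qy; apply: xe.
have -> : y - x = (y - (map_mx (@ratr R) (\row_i q i) : E)) + ((map_mx (@ratr R) (\row_i q i) : E) - x).
 by rewrite addrA subrK.
by rewrite (le_lt_trans (ler_normD _ _))// (splitr e) ltrD// (lt_trans _ ke).
Qed.

Lemma measurable_obox : @measurable _ E = <<s G >>.
Proof.
apply/seteqP; split; last first.
 apply: smallest_sub; first exact: smallest_sigma_algebra.
 by move=> _ [a [b ->]]; apply: sub_sigma_algebra; exact: obox_open.
apply: smallest_sub; first exact: smallest_sigma_algebra.
move=> U oU; rewrite (rat_balls oU) bigcup_mkcond.
apply: (@countable_bigcupT_measurable _ (g_sigma_algebraType G)) => [|p].
 exact: countableP.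
case: ifP => _; last exact: measurable0.
apply: sub_sigma_algebra; rewrite ball_obox ?invr_gt0//.
by eexists; eexists.
Qed.

Lemma oboxI_closed : setI_closed G.
Proof. by move=> _ _ [a [b ->]] [a' [b' ->]]; rewrite oboxI; eexists; eexists. Qed.

Lemma nat_gt (r : R) : exists k : nat, r < k%:R.
Proof.
have := archi_boundP (normr_ge0 r) => h; exists (Num.bound `|r|).
exact: le_lt_trans (ler_norm _) h.
Qed.

Lemma obox_cover : \bigcup_k obox (- const_mx k%:R) (const_mx k%:R) = [set: E].
Proof.
apply/seteqP; split => // x _; have [k hk] := nat_gt `|x|; exists k => // i.
rewrite !mxE -ltr_norml; exact: le_lt_trans (coord_le_norm _ _) hk.
Qed.

Lemma measure_unique_obox (m1 m2 : {measure set E -> \bar R}) :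
 (forall a b, m1 (obox a b) = m2 (obox a b)) -> (forall a b, (m1 (obox a b) < +oo)%E) ->
 forall A, measurable A -> m1 A = m2 A.
Proof.
move=> h hf A mA.
apply: (measure_unique G (fun k => obox (- const_mx k%:R) (const_mx k%:R)) measurable_obox) => //.
- exact: oboxI_closed.
- by move=> k; eexists; eexists.
- exact: obox_cover.
- by move=> _ [a [b ->]].
Qed.

Lemma cont_meas (f : E -> R) : continuous f -> mfun f.
Proof.
move=> cf; apply: (measurability _ (RGenOInfty.measurableE R)) => _ [_ [r ->] <-].
rewrite setTI; apply: open_meas; apply: open_comp => [x _|]; first exact: cf.
by pos.
Qed.

Lemma meas_coord (i : 'I_n) : mfun (fun x : E => x$i).
Proof.
apply: cont_meas => x.
exact: hgrad_cont (hgrad_coord x i).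
Qed.

End boxes.

Lemma meas_row {R : realType} {n : nat} d (T : measurableType d) (D : set T) (g : T -> 'rV[R]_n) :
 measurable D -> (forall i, measurable_fun D (fun x => g x$i)) -> measurable_fun D g.
Proof.
move=> mD mg; apply: (@measurability _ _ _ _ _ _ _ (@measurable_obox R n)) => _ [_ [a [b ->]] <-].
have -> : D `&` g @^-1` obox a b = D `&` \bigcap_(i in [set: 'I_n])
  (D `&` (fun x => g x$i) @^-1` `]a$i, b$i[%classic).
 apply/seteqP; split => [x [Dx h]|x [Dx h]]; split=> // i.
  by move=> _; split=> //=; rewrite in_itv /=; exact: h.
 by have [_ /=] := h i I; rewrite in_itv.
apply: measurableI => //; apply: fin_bigcap_measurable => // i _.
by apply: mg => //; exact: measurable_itv.
Qed.

Section box_measure.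
Context {R : realType}.

Definition tbox n (a b : 'I_n -> R) : set (n.-tuple (measurableTypeR R)) := [set t | forall i, a i < tnth t i < b i].

Lemma measurable_tbox n (a b : 'I_n -> R) : measurable (tbox a b).
Proof.
have -> : tbox a b = \bigcap_(i in [set: 'I_n]) ((@tnth n (measurableTypeR R) ^~ i) @^-1` `]a i, b i[%classic).
 apply/seteqP; split => [t h i _ /=|t h i]; first by rewrite in_itv /=; exact: h.
 by have := h i I; rewrite /= in_itv.
apply: fin_bigcap_measurable => // i _; rewrite -[X in measurable X]setTI.
by apply: measurable_tnth => //; exact: measurable_itv.
Qed.

Lemma tbox_measure n (a b : 'I_n -> R) : (forall i, a i < b i) ->
 lebesgue_tuple R n (tbox a b) = (\prod_i (b i - a i))%:E.
Proof.
elim: n a b => [|n IH] a b ab.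
 rewrite big_ord0 /= diracE mem_set//.
 by move=> i; case: i.
rewrite /= /cons_measure /pushforward.
have -> : @tuple_cons R n @^-1` tbox a b = `]a ord0, b ord0[%classic `*` tbox (a \o lift ord0) (b \o lift ord0).
 apply/seteqP; split => [[x t] h|[x t] [/= h1 h2] i].
  split => /=; first by have := h ord0; rewrite in_itv /= tnth0.
  by move=> i; have := h (lift ord0 i); rewrite /tuple_cons /= tnthS.
 case: (unliftP ord0 i) => [j ->|->]; rewrite /tuple_cons /= ?tnthS ?tnth0//.
 exact: h2.
rewrite product_measure1E; [|exact: measurable_itv|exact: measurable_tbox].
rewrite IH => [|i /=]; last exact: ab.
have e : lebesgue_measure (`]a ord0, b ord0[%classic : set R) = (b ord0 - a ord0)%:E.
 by rewrite lebesgue_measure_itv /= lte_fin ab -EFinD.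
rewrite big_ord_recl EFinM; congr (_ * _)%E; exact: e.
Qed.

Lemma lebesgue_obox n (a b : 'rV[R]_n) : (forall i, a$i < b$i) -> lebesgue_rV (obox a b) = (\prod_i (b$i - a$i))%:E.
Proof.
move=> ab; rewrite /lebesgue_rV /pushforward -tbox_measure//; congr (lebesgue_tuple R n _).
by apply/seteqP; split => t h i; have := h i; rewrite mxE.
Qed.

Lemma obox_empty n (a b : 'rV[R]_n) i : b$i <= a$i -> obox a b = set0.
Proof.
move=> h; apply/seteqP; split => // x /(_ i) /andP[h1 h2].
by have := lt_trans h1 h2; rewrite ltNge h.
Qed.

Lemma lebesgue_obox_fin n (a b : 'rV[R]_n) : (lebesgue_rV (obox a b) < +oo)%E.
Proof.
have [h|] := pselect (forall i, a$i < b$i); first by rewrite lebesgue_obox// ltry.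
move=> /existsNP[i /negP]; rewrite -leNgt => h.
by rewrite (obox_empty h) measure0.
Qed.

End box_measure.

Section scalar_bounds.
Context {R : realFieldType}.

Lemma one_sub_abs (a A : R) : 0 < a -> a <= A -> 1 <= A -> `|1 - a| <= A.
Proof. by move=> *; rewrite ler_norml; lra. Qed.

Lemma shift_half (tau eta r c k : R) : tau <= r -> eta <= tau / 2 -> `|c - k| <= eta -> tau / 2 <= r + c - k.
Proof. by move=> ? ?; rewrite ler_norml => /andP[]; lra. Qed.

Lemma trace_scalar (W s1 X1 X2 X3 X4 : R) : W <= s1 / 2 -> X3 <= X4 -> s1 <= X3 - X2 ->
 X1 - X4 + W <= - (X2 - X1) - s1 / 2.
Proof. lra. Qed.

End scalar_bounds.

(** * Flat functions for smooth cutoffs *)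

Section flat.
Context {R : realType}.
Implicit Types (t x : R).

(** The powers of [1 / t] make the family stable under differentiation: the derivative of [flat m]
    is [flat m.+2 - m flat m.+1]. Smoothness then follows by induction. *)
Definition flat m t : R := if 0 < t then t ^- m * expR (- t^-1) else 0.

Lemma flat_pos m t : 0 < t -> flat m t = t ^- m * expR (- t^-1).
Proof. by rewrite /flat => ->. Qed.

Lemma flat_neg m t : t <= 0 -> flat m t = 0.
Proof. by rewrite /flat leNgt => /negbTE ->. Qed.

Lemma flat_ge0 m t : 0 <= flat m t.
Proof.
have [t0|t0] := leP t 0; first by rewrite flat_neg.
by rewrite flat_pos// mulr_ge0 ?expR_ge0// invr_ge0 exprn_ge0// ltW.
Qed.

Lemma flat_gt0 m t : 0 < t -> 0 < flat m t.
Proof. by move=> t0; rewrite flat_pos// mulr_gt0 ?expR_gt0// invr_gt0 exprn_gt0. Qed.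

Lemma expR_ge_pow m (s : R) : 0 < s -> s ^+ m.+1 <= m.+1%:R ^+ m.+1 * expR s.
Proof.
move=> s0; have m0 : 0 < m.+1%:R :> R by [].
have -> : expR s = expR (s / m.+1%:R) ^+ m.+1.
 by rewrite -expRM_natl; congr expR; rewrite mulrC divfK// gt_eqF.
have k0 : 0 <= m.+1%:R * expR (s / m.+1%:R) by pos.
rewrite -exprMn; apply: lerXn2r => //; first by rewrite nnegrE ltW.
rewrite mulrC -ler_pdivrMr//; apply: le_trans (expR_ge1Dx _).
by rewrite lerDr.
Qed.

(** The quadratic bound yields the derivative 0 at the junction [t = 0]. *)
Lemma flat_quad m : exists2 C : R, 0 < C & forall t, flat m t <= C * t ^+ 2.
Proof.
exists (m.+2%:R ^+ m.+2); first by pos.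
move=> t; have [t0|t0] := leP t 0; first by rewrite flat_neg// mulr_ge0 ?sqr_ge0// exprn_ge0.
have ti : 0 < t^-1 by pos.
have := expR_ge_pow m.+1 ti; rewrite flat_pos// expRN => h.
rewrite ler_pdivrMr ?expR_gt0// mulrAC -ler_pdivrMr ?exprn_gt0// -exprVn -exprVn -exprD.
by rewrite addn2.
Qed.

Lemma is_derive_flat m t : 0 < t ->
 is_derive t 1 (fun s => s ^- m * expR (- s^-1)) (flat m.+2 t - m%:R * flat m.+1 t).
Proof.
move=> t0; have tn : t != 0 by pos.
have hX : is_derive t^-1 1 (fun s : R => s ^+ m) (m%:R * t^-1 ^+ m.-1).
 have := @is_deriveX R R^o id m (t^-1) 1 1 (is_derive_id _ _).
 rewrite (_ : (fun s : R => s ^+ m) = id ^+ m); last by apply/funext => s; rewrite exprfctE.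
 by rewrite /GRing.scale /= mulr1.
have hE : is_derive t^-1 1 (fun s : R => expR (- s)) (- expR (- t^-1)).
 have h := is_derive_comp1 (is_deriveN (is_derive_id (t^-1 : R^o) 1)) (is_derive_expR (- t^-1)).
 by apply: is_derive_eq h _; rewrite mulrN1.
have hV : is_derive t 1 (fun s : R => s^-1) (- t ^- 2).
 have h := is_deriveV tn (is_derive_id (t : R^o) 1).
 by apply: is_derive_eq h _; rewrite /GRing.scale /= mulr1.
have h := is_derive_comp1 hV (is_deriveM hX hE).
have -> : (fun s : R => s ^- m * expR (- s^-1)) = ((fun s => s ^+ m) * (fun s => expR (- s)))%R \o (fun s => s^-1).
 by apply/funext => s; rewrite -[RHS]/(s^-1 ^+ m * expR (- s^-1)) exprVn.
apply: is_derive_eq h _; rewrite !flat_pos// /GRing.scale /= -!exprVn.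
by case: m {hX} => [|m] /=; rewrite ?mul0r ?expr0 !exprS; ring.
Qed.

End flat.

(** * Translation invariance and integration on row vectors *)

Section euclidean_measure.
Context {R : realType} {n : nat}.
Notation E := 'rV[R]_n.
Notation mu := (@lebesgue_rV R n).

Section translation.
Implicit Types (x y v a b c : E) (A U : set E).

Definition shiftv v x := x + v.

Lemma meas_shiftv v : mfun (shiftv v).
Proof.
apply: meas_row => // i; apply: cont_meas => x.
have -> : (fun x : E => shiftv v x$i) = (fun x => x$i + v$i).
 by apply/funext => z; rewrite mxE.
exact: (hgrad_cont (hgradD (hgrad_coord x i) (hgrad_cst _ x))).
Qed.

HB.instance Definition _ v := isMeasurableFun.Build _ _ _ _ (shiftv v) (meas_shiftv v).

Lemma lebesgue_shift v A : measurable A -> mu (shiftv v @^-1` A) = mu A.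
Proof.
move=> mA; apply: esym.
apply: (measure_unique_obox (m1 := mu) (m2 := pushforward mu (shiftv v))) => // a b; last exact: lebesgue_obox_fin.
rewrite [RHS](_ : _ = mu (shiftv v @^-1` obox a b))//.
have -> : shiftv v @^-1` obox a b = obox (a - v) (b - v).
 by apply/seteqP; split => x h i; have := h i; rewrite !mxE => /andP[h1 h2]; lra.
have [h|] := pselect (forall i, a$i < b$i).
 apply: (eq_trans (lebesgue_obox h)); rewrite lebesgue_obox; last by move=> i; rewrite !mxE ltrD2r.
 by congr (_%:E); apply: eq_bigr => i _; rewrite !mxE; ring.
move=> /existsNP[i /negP]; rewrite -leNgt => h.
by rewrite (obox_empty h) (@obox_empty _ _ (a - v) (b - v) i)// !mxE lerD2r.
Qed.

Lemma lebesgue_sigma_finite : sigma_finite setT mu.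
Proof.
exists (fun k => obox (- const_mx k%:R) (const_mx k%:R)); first by rewrite obox_cover.
move=> k; split; last exact: lebesgue_obox_fin.
by apply: open_meas; exact: obox_open.
Qed.

HB.instance Definition _ := Measure_isSigmaFinite.Build _ _ _ mu lebesgue_sigma_finite.

Lemma lebesgue_bounded A (M : R) : measurable A -> (forall x, A x -> `|x| <= M) -> (mu A < +oo)%E.
Proof.
move=> mA h; have [k hk] := nat_gt M.
apply: (@le_lt_trans _ _ (mu (obox (- const_mx k%:R) (const_mx k%:R)))); last exact: lebesgue_obox_fin.
apply: le_measure; rewrite ?inE//; first by apply: open_meas; exact: obox_open.
move=> x /h xM i; rewrite !mxE -ltr_norml.
exact: le_lt_trans (coord_le_norm _ _) (le_lt_trans xM hk).
Qed.

Lemma lebesgue_open_gt0 U x : open U -> U x -> (0 < mu U)%E.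
Proof.
move=> oU Ux; have [r r0 hr] := (openNP U).1 oU x Ux.
have sub : obox (x - const_mx r) (x + const_mx r) `<=` U.
 by rewrite -ball_obox// => y /ball_rowP; exact: hr.
apply: (@lt_le_trans _ _ (mu (obox (x - const_mx r) (x + const_mx r)))).
 rewrite lebesgue_obox => [|i]; last by rewrite !mxE; lra.
 by rewrite lte_fin prodr_gt0// => i _; rewrite !mxE; lra.
apply: le_measure; rewrite ?inE//; apply: open_meas => //; exact: obox_open.
Qed.

End translation.

Section integral.
Implicit Types (f g : E -> R) (x v : E) (A D : set E).

Definition ible f : Prop := mu.-integrable setT (EFin \o f).
Definition intg f : R := fine (\int[mu]_x (f x)%:E)%E.

Lemma ible_meas f : ible f -> mfun f.
Proof. by move=> /measurable_int/measurable_EFinP. Qed.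

Lemma intE f : ible f -> (\int[mu]_x (f x)%:E)%E = (intg f)%:E.
Proof. by move=> h; rewrite fineK//; exact: integrable_fin_num. Qed.

Lemma ibleD f g : ible f -> ible g -> ible (fun x => f x + g x).
Proof. by move=> hf hg; have := integrableD measurableT hf hg. Qed.

Lemma ibleZ (k : R) f : ible f -> ible (fun x => k * f x).
Proof. by move=> hf; have := integrableZl measurableT k hf. Qed.

Lemma ibleN f : ible f -> ible (fun x => - f x).
Proof. by move=> /(ibleZ (-1)); under eq_fun do rewrite mulN1r. Qed.

Lemma ibleB f g : ible f -> ible g -> ible (fun x => f x - g x).
Proof. by move=> hf /ibleN; exact: ibleD. Qed.

Lemma ible0 : ible (fun=> 0).
Proof. exact: integrable0. Qed.

Lemma ible_sum I (r : seq I) (F : I -> E -> R) : (forall i, ible (F i)) -> ible (fun x => \sum_(i <- r) F i x).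
Proof.
move=> h; elim: r => [|i r IH].
 by under eq_fun do rewrite big_nil; exact: ible0.
by under eq_fun do rewrite big_cons; exact: ibleD.
Qed.

Lemma ible_norm f : ible f -> ible (fun x => `|f x|).
Proof. by move=> /integrable_abse; apply: eq_integrable. Qed.

Lemma intD f g : ible f -> ible g -> intg (fun x => f x + g x) = intg f + intg g.
Proof. by move=> hf hg; exact: RintegralD. Qed.

Lemma intZ (k : R) f : ible f -> intg (fun x => k * f x) = k * intg f.
Proof. by move=> hf; exact: RintegralZl. Qed.

Lemma intN f : ible f -> intg (fun x => - f x) = - intg f.
Proof. by move=> h; rewrite -mulN1r -intZ//; congr intg; apply/funext => x; rewrite mulN1r. Qed.

Lemma intB f g : ible f -> ible g -> intg (fun x => f x - g x) = intg f - intg g.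
Proof. by move=> hf hg; rewrite intD ?intN//; exact: ibleN. Qed.

Lemma int0 : intg (fun=> 0) = 0.
Proof. by rewrite /intg integral0. Qed.

Lemma int_sum I (r : seq I) (F : I -> E -> R) : (forall i, ible (F i)) ->
 intg (fun x => \sum_(i <- r) F i x) = \sum_(i <- r) intg (F i).
Proof.
move=> h; elim: r => [|i r IH].
 by rewrite big_nil -[RHS]int0; congr intg; apply/funext => x; rewrite big_nil.
rewrite big_cons -IH -intD//; last exact: ible_sum.
by congr intg; apply/funext => x; rewrite big_cons.
Qed.

Lemma ible_ae_le f g : mfun f -> ible g -> {ae mu, forall x, `|f x| <= g x} -> ible f.
Proof.
move=> mf hg h; apply/integrableP; split; first exact/measurable_EFinP.
have [mg ig] := integrableP _ _ _ (ible_norm hg).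
apply: le_lt_trans ig; apply: ae_ge0_le_integral => //.
- by apply: measurableT_comp => //; exact/measurable_EFinP.
- by apply: measurableT_comp.
- by apply: filterS h => x h _ /=; rewrite normr_id lee_fin (le_trans h)// ler_norm.
Qed.

Lemma ible_le f g : mfun f -> ible g -> (forall x, `|f x| <= g x) -> ible f.
Proof. by move=> mf hg h; apply: ible_ae_le hg _ => //; exact: aeW. Qed.

Lemma int_ge0 f : (forall x, 0 <= f x) -> 0 <= intg f.
Proof. by move=> h; apply: fine_ge0; apply: integral_ge0 => x _; rewrite lee_fin. Qed.

Lemma int_ae_eq f g : mfun f -> mfun g -> {ae mu, forall x, f x = g x} -> intg f = intg g.
Proof.
move=> mf mg h; congr fine; apply: ae_eq_integral => //; try exact/measurable_EFinP.
by apply: filterS h => x -> _.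
Qed.

Lemma int_ae_ge0 f : ible f -> {ae mu, forall x, 0 <= f x} -> 0 <= intg f.
Proof.
move=> hf h; rewrite (@int_ae_eq f (fun x => `|f x|)).
- by apply: int_ge0 => x.
- exact: ible_meas.
- by apply: ible_meas; exact: ible_norm.
- by apply: filterS h => x h; rewrite ger0_norm.
Qed.

Lemma int_ae_le f g : ible f -> ible g -> {ae mu, forall x, f x <= g x} -> intg f <= intg g.
Proof.
move=> hf hg h; rewrite -subr_ge0 -intB//; apply: int_ae_ge0; first exact: ibleB.
by apply: filterS h => x; rewrite subr_ge0.
Qed.

Lemma int_le f g : ible f -> ible g -> (forall x, f x <= g x) -> intg f <= intg g.
Proof. by move=> hf hg h; apply: int_ae_le => //; exact: aeW. Qed.

Lemma int_norm f : ible f -> `|intg f| <= intg (fun x => `|f x|).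
Proof.
move=> hf; have hn := ible_norm hf; rewrite ler_norml lerNl -intN//; apply/andP; split.
 by apply: int_le => [||x]; [exact: ibleN | | rewrite -normrN ler_norm].
by apply: int_le => // x; exact: ler_norm.
Qed.

Lemma int_eq0_ae f : ible f -> {ae mu, forall x, 0 <= f x} -> intg f <= 0 -> {ae mu, forall x, f x = 0}.
Proof.
move=> hf h f0; have mf := ible_meas hf.
have e : intg (fun x => `|f x|) = 0.
 rewrite -(@int_ae_eq f).
 - by apply/le_anti; rewrite f0 int_ae_ge0.
 - exact: mf.
 - by apply: ible_meas; exact: ible_norm.
 - by apply: filterS h => x h; rewrite ger0_norm.
have : (\int[mu]_x `|(f x)%:E|)%E = 0%E.
 by under eq_integral do rewrite abse_EFin; rewrite (intE (ible_norm hf)) e.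
move=> /ae_eq_integral_abs; move=> /(_ measurableT) h'.
have /h' : mfun (EFin \o f) by exact/measurable_EFinP.
by apply: filterS => x /(_ I) [].
Qed.

Lemma int_dct (f_ : nat -> E -> R) f g : (forall k, mfun (f_ k)) ->
 mfun f -> {ae mu, forall x, f_ k x @[k --> \oo] --> f x} -> ible g ->
 {ae mu, forall x, forall k, `|f_ k x| <= g x} ->
 [/\ ible f, intg (fun x => `|f_ k x - f x|) @[k --> \oo] --> 0 & intg (f_ k) @[k --> \oo] --> intg f].
Proof.
move=> mf_ mf cv hg hb.
have mE k : mfun (EFin \o f_ k) by exact/measurable_EFinP.
have mE' : mfun (EFin \o f) by exact/measurable_EFinP.
have cv' : \forall x \ae mu, setT x -> (EFin \o f_ k) x @[k --> \oo] --> (EFin \o f) x.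
 by apply: filterS cv => x h _; apply: cvg_EFin => //; exact: nearW.
have hb' : \forall x \ae mu, forall k, setT x -> (`|(EFin \o f_ k) x| <= (EFin \o g) x)%E.
 by apply: filterS hb => x h k _; rewrite /= lee_fin.
have [h1 h2 h3] := dominated_convergence measurableT mE mE' cv' hg hb'.
have h3' := h3; rewrite [X in _ --> X](intE h1) in h3'.
split=> //; last exact: (fine_cvg h3').
have -> : (fun k => intg (fun x => `|f_ k x - f x|)) =
  fine \o (fun k => \int[mu]_x `|(EFin \o f_ k) x - (EFin \o f) x|)%E.
 by pos.
exact: (fine_cvg h2).
Qed.

Lemma closed_norm_ball (M : R) : closed [set x : E | `|x| <= M].
Proof.
rewrite -[X in closed X]setCK; apply: open_closedC.
apply/openNP => x /negP; rewrite -ltNge => Mx; exists (`|x| - M); first by pos.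
move=> y yx; apply/negP; rewrite -ltNge.
by have := ler_distD y x 0; rewrite !subr0 (distrC x); lra.
Qed.

Lemma ible_bdd f (C M : R) : mfun f -> (forall x, `|f x| <= C) -> (forall x, M < `|x| -> f x = 0) -> ible f.
Proof.
move=> mf hC hM; have mB : measurable [set x : E | `|x| <= M].
 by apply: closed_meas; exact: closed_norm_ball.
pose B := [set x : E | `|x| <= M]; rewrite -/B in mB.
have iB : mu.-integrable B (EFin \o f).
 apply: measurable_bounded_integrable => //.
 - by apply: lebesgue_bounded => // x; exact.
 - exact: measurable_funS mf.
 - exists C; split; first exact: num_real.
  by move=> c Cc x _ /=; rewrite (le_trans (hC x))// ltW.
have := (integrable_mkcond (EFin \o f) mB).1 iB; apply: eq_integrable => // x _.
rewrite patchE; case: ifPn => //; rewrite notin_setE /B /= => /negP; rewrite -ltNge => /hM h.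
by rewrite /= h.
Qed.

Lemma ible_shift v f : ible f -> ible (fun x => f (x + v)).
Proof.
move=> hf; have mf := ible_meas hf.
have [_ ig] := integrableP _ _ _ hf; apply/integrableP; split.
 by apply/measurable_EFinP; exact: (measurableT_comp mf (meas_shiftv v)).
apply: le_lt_trans ig; apply: le_eq.
have mE : mfun (abse \o (EFin \o f)).
 by apply: measurableT_comp => //; exact/measurable_EFinP.
have := @ge0_integral_pushforward _ _ _ _ R (shiftv v) (meas_shiftv v) mu setT
 (abse \o (EFin \o f)) measurableT mE (fun _ _ => abse_ge0 _).
rewrite preimage_setT => <-; apply: eq_measure_integral => A mA _; exact: lebesgue_shift.
Qed.

Lemma int_shift v f : ible f -> intg (fun x => f (x + v)) = intg f.
Proof.
move=> hf; have hs := ible_shift v hf; congr fine.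
have mE : mfun (EFin \o f) by apply/measurable_EFinP; exact: ible_meas.
have := @integral_pushforward _ _ _ _ R (shiftv v) (meas_shiftv v) mu setT
 (EFin \o f) mE; rewrite preimage_setT => /(_ hs measurableT) <-.
by apply: eq_measure_integral => A mA _; exact: lebesgue_shift.
Qed.

Lemma ible_restrict D f : measurable D -> mu.-integrable D (EFin \o f) <-> ible (f \_ D).
Proof. by move=> mD; rewrite /ible -restrict_EFin; exact: integrable_mkcond. Qed.

Lemma int_restrict D f : (\int[mu]_(x in D) (f x)%:E)%E = (\int[mu]_x ((f \_ D) x)%:E)%E.
Proof. by rewrite integral_mkcond restrict_EFin. Qed.

End integral.

Notation "'I{' x , F }" := (intg (fun x => F)) (at level 0, x name).

(** * Difference quotients and integrals of derivatives *)

Section differences.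
Implicit Types (u f : E -> R) (x v : E).

Definition step k : R := k.+1%:R^-1.

Lemma step_gt0 k : 0 < step k. Proof. by rewrite invr_gt0. Qed.
Lemma step_le1 k : step k <= 1. Proof. by rewrite invf_le1// ler1n. Qed.

Lemma step_small (e : R) : 0 < e -> exists N, forall k, (N <= k)%N -> step k < e.
Proof.
move=> e0; have [N hN] := nat_gt e^-1; exists N => k Nk.
rewrite /step -[e]invrK ltf_pV2 ?posrE ?invr_gt0//.
by apply: lt_trans hN _; rewrite ltr_nat ltnS.
Qed.

Definition hstep k i : E := step k *: delta_mx ord0 i.

Lemma norm_hstep k i : `|hstep k i| = step k.
Proof. by rewrite normrZ norm_delta mulr1 gtr0_norm// step_gt0. Qed.

Definition dq i u k x : R := k.+1%:R * (u (x + hstep k i) - u x).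

Lemma cvg_seqP (w : nat -> R) (l : R) : (w k @[k --> \oo] --> l) <->
 forall e : R, 0 < e -> exists N, forall k, (N <= k)%N -> `|w k - l| <= e.
Proof.
split=> [/cvgrPdist_le h e e0|h].
 have [N _ hN] := h _ e0; exists N => k Nk; rewrite distrC; exact: hN.
by apply/cvgrPdist_le => e e0; have [N hN] := h _ e0; exists N => // k Nk; rewrite distrC; exact: hN.
Qed.

Lemma hgrad_dq u x (g : E) i : hgrad u x g -> dq i u k x @[k --> \oo] --> g$i.
Proof.
move=> h; apply/cvg_seqP => e e0; have [d d0 hd] := h _ e0.
have [N hN] := step_small d0; exists N => k Nk.
have := hd (hstep k i); rewrite norm_hstep => /(_ (hN _ Nk)).
rewrite dotvZr dotv_delta -/(step k) => h1.
rewrite -(ler_pM2r (step_gt0 k)) -[X in _ * X]gtr0_norm ?step_gt0// -normrM mulrBl /dq mulrAC /step mulfV ?mul1r ?gt_eqF//.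
by rewrite [_ * _^-1]mulrC.
Qed.

Definition lipfun u (L : R) := forall x y, `|u x - u y| <= L * `|x - y|.

Lemma lip_dq u L i k x : lipfun u L -> `|dq i u k x| <= L.
Proof.
move=> h; rewrite /dq normrM gtr0_norm//.
have := h (x + hstep k i) x; rewrite addr_subK norm_hstep => h1.
by rewrite -ler_pdivlMl// mulrC -/(step k).
Qed.

Lemma lip_meas u L : lipfun u L -> mfun u.
Proof. by move=> /lip_cont; exact: cont_meas. Qed.

Lemma meas_shift u v : mfun u -> mfun (fun x => u (x + v)).
Proof. by move=> mu0; exact: (measurableT_comp mu0 (meas_shiftv v)). Qed.

Lemma meas_dq u i k : mfun u -> mfun (dq i u k).
Proof.
move=> mu0; apply: measurable_funM; first exact: measurable_cst.
by apply: measurable_funB => //; exact: meas_shift.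
Qed.

Lemma bounded_support_ge0 u (M : R) : (forall x, M < `|x| -> u x = 0) ->
 exists2 M' : R, 0 <= M' & forall x, M' < `|x| -> u x = 0.
Proof.
move=> h; exists `|M| => // x hx; apply: h; exact: le_lt_trans (ler_norm _) hx.
Qed.

Lemma ball_cutoff (C M : R) : exists2 g : E -> R, ible g &
 (forall x, `|x| <= M -> g x = C) /\ (forall x, M < `|x| -> g x = 0).
Proof.
pose A := [set x : E | `|x| <= M].
have mA : measurable A.
 by apply: closed_meas; exact: closed_norm_ball.
have h1 x : `|x| <= M -> ((cst C : E -> R) \_ A) x = C by move=> h; rewrite patchE mem_set.
have h2 x : M < `|x| -> ((cst C : E -> R) \_ A) x = 0.
 by move=> h; rewrite patchE memNset// /A /=; apply/negP; rewrite -ltNge.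
exists ((cst C : E -> R) \_ A) => //; apply: (@ible_bdd _ `|C| M) => //.
- by apply: (measurable_restrictT (cst C) mA).1; exact: measurable_cst.
- by move=> x; rewrite patchE; case: ifP => // _; rewrite normr0.
Qed.

Lemma lip_ible u L (M : R) : lipfun u L -> (forall x, M < `|x| -> u x = 0) -> ible u.
Proof.
move=> hL hM; have [M' M0 {}hM] := bounded_support_ge0 hM.
have [C hC] : exists C : R, forall x, `|x| <= M' -> `|u x| <= C.
 exists (`|u 0| + `|L| * M') => x xM; have := hL x 0; rewrite subr0 => h.
 rewrite -[u x](subrK (u 0)) (le_trans (ler_normD _ _))// addrC lerD2l (le_trans h)//.
 by rewrite (@le_trans _ _ (`|L| * `|x|))// ?ler_wpM2r ?ler_norm// ler_wpM2l.
apply: (@ible_bdd _ `|C| M') => //; first exact: lip_meas hL.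
move=> x; have [/hC h|/hM ->] := leP `|x| M'; last by rewrite normr0.
exact: le_trans h (ler_norm _).
Qed.

Lemma int_dq u i k : ible u -> intg (dq i u k) = 0.
Proof.
move=> h; have hs := ible_shift (hstep k i) h.
by rewrite /dq intZ ?intB// ?int_shift// ?subrr ?mulr0//; exact: ibleB.
Qed.

Lemma dq_support u i k (M : R) : (forall x, M < `|x| -> u x = 0) -> forall x, M + 1 < `|x| -> dq i u k x = 0.
Proof.
move=> h x hx; rewrite /dq !h ?subrr ?mulr0//.
 by pos.
have := ler_normB (x + hstep k i) (hstep k i); rewrite addrK norm_hstep.
by have := step_le1 k; lra.
Qed.

(** The source of every integration by parts below. By translation invariance a difference quotient
    has integral 0, and dominated convergence passes to the derivative; only its existence almost
    everywhere is assumed. *)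
Lemma int_deriv u L (M : R) i (g : E -> R) : lipfun u L -> (forall x, M < `|x| -> u x = 0) ->
 mfun g -> {ae mu, forall x, dq i u k x @[k --> \oo] --> g x} -> ible g /\ intg g = 0.
Proof.
move=> hL hM mg cv; have iu := lip_ible hL hM; have mu0 := ible_meas iu.
have [B iB [B1 B2]] := ball_cutoff L (M + 1).
have hb : {ae mu, forall x, forall k, `|dq i u k x| <= B x}.
 apply: aeW => x k; have [xM|xM] := leP `|x| (M + 1).
  by rewrite B1//; exact: lip_dq.
 by rewrite (dq_support i k hM)// B2// normr0.
have [h1 _ h2] := int_dct (fun k => meas_dq i k mu0) mg cv iB hb.
split=> //; apply/esym; have := h2; under eq_fun do rewrite int_dq//.
by move=> /(cvg_unique _ (@cvg_cst _ _ _ _ _)) ->.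
Qed.

Lemma limn_einf_ge (w : nat -> R) (dl : R) N : (forall k, (N <= k)%N -> dl <= w k) ->
 (dl%:E <= limn_einf (fun k => (w k)%:E))%E.
Proof.
move=> h; rewrite limn_einf_lim; apply: lime_ge.
 exact: is_cvg_einfs.
exists N => // k /= Nk; apply: le_ereal_inf_tmp => _ [m /= km <-].
by rewrite lee_fin h// (leq_trans Nk).
Qed.

(** Convergence to 0 in mean, turned by Fatou's lemma into arbitrarily late small values at almost
    every point. *)
Lemma fatou0 (f : nat -> E -> R) : (forall k, ible (f k)) -> (forall k x, 0 <= f k x) ->
 intg (f k) @[k --> \oo] --> 0 -> {ae mu, forall x, forall (dl : R) N, 0 < dl -> exists2 k, (N <= k)%N & f k x < dl}.
Proof.
move=> hf f0 cv.
have mE k : mfun (EFin \o f k) by apply/measurable_EFinP; exact: ible_meas.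
have fE k x : setT x -> (0 <= (EFin \o f k) x)%E by move=> _; rewrite lee_fin.
have := fatou mu measurableT mE fE.
pose F x := limn_einf (fun k => (EFin \o f k) x).
have F0 x : (0 <= F x)%E by apply: (@limn_einf_ge (fun k => f k x) 0 0%N) => k _.
have mF : mfun F.
 have -> : F = (fun x => - limn_esup (fun k => - (EFin \o f k) x))%E.
  by pos.
 apply: (measurableT_comp (@oppe_measurable R setT)).
 by apply: measurable_fun_limn_esup => k; exact: (measurableT_comp (@oppe_measurable R setT)).
have -> : (fun k => \int[mu]_x (EFin \o f k) x)%E = (fun k => (intg (f k))%:E).
 by apply/funext => k; exact: intE.
have cvE : (intg (f k))%:E @[k --> \oo] --> 0%:E.
 by apply: cvg_EFin => //; exact: nearW.
have [-> _] := cvg_limn_einf_sup cvE.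
move=> h; have e : (\int[mu]_x `|F x|)%E = 0%E.
 under eq_integral do rewrite gee0_abs//.
 by apply/le_anti; rewrite h integral_ge0.
have := (ae_eq_integral_abs mu measurableT mF).1 e; apply: filterS => x /(_ I) /= Fx dl N dl0.
apply: contrapT => hn; have : (dl%:E <= F x)%E.
 apply: (@limn_einf_ge (fun k => f k x) dl N) => k Nk; rewrite leNgt; apply/negP => fk.
 by apply: hn; exists k.
by rewrite Fx lee_fin leNgt dl0.
Qed.

(* Upper limits of difference quotients: a measurable choice of the gradient. *)
Definition lgrad u x : E := \row_i limn_sup (fun k => dq i u k x).

Lemma hgrad_lgrad u x g : hgrad u x g -> lgrad u x = g.
Proof.
move=> h; apply/rowP => i; rewrite mxE.
by have [_ ->] := cvg_limn_inf_sup (@hgrad_dq _ _ _ i h).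
Qed.

Lemma meas_lgrad u L i : lipfun u L -> mfun (fun x => lgrad u x$i).
Proof.
move=> hL; have mu0 := lip_meas hL.
under eq_fun do rewrite mxE.
apply: measurable_fun_limn_sup => [x _|x _|k]; last exact: meas_dq.
 by exists L => _ [k _ <-]; apply: le_trans (ler_norm _) (lip_dq i k x hL).
exists (- L) => _ [k _ <-]; rewrite lerNl (le_trans (ler_norm _))// normrN.
exact: lip_dq.
Qed.

End differences.

(** * Smooth cutoffs and test functions *)

Section smooth.
Implicit Types (x y v g : E) (f : E -> R).

Lemma hgrad_affine (lam c : R) i x : hgrad (fun z : E => lam * z$i + c) x (lam *: delta_mx ord0 i).
Proof.
have := hgradD (hgradZ lam (hgrad_coord x i)) (hgrad_cst c x).
by rewrite addr0.
Qed.

Lemma hgrad_flat m (lam c : R) i x : hgrad (fun z : E => flat m (lam * z$i + c)) x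
 ((flat m.+2 (lam * x$i + c) - m%:R * flat m.+1 (lam * x$i + c)) *: (lam *: delta_mx ord0 i)).
Proof.
have ha := hgrad_affine lam c i x.
have /contNP ca := hgrad_cont ha.
case: (ltgtP 0 (lam * x$i + c)) => t0.
- have h := hgrad_comp1 ha (is_derive_flat m t0).
 have [d d0 hd] := ca _ t0; apply: (hgrad_near d0 _ h) => z /hd.
 by rewrite ltr_norml => /andP[h1 _]; rewrite /= flat_pos//; lra.
- have t1 : 0 < - (lam * x$i + c) by pos.
 have [d d0 hd] := ca _ t1; rewrite !flat_neg ?ltW// mulr0 subr0 scale0r.
 apply: (hgrad_near d0 _ (hgrad_cst 0 x)) => z /hd.
 by rewrite ltr_norml => /andP[_ h1]; rewrite /= flat_neg//; lra.
rewrite -t0 !flat_neg// mulr0 subr0 scale0r => e e0.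
have [C C0 hC] := @flat_quad R m.
have cl : 0 < C * lam ^+ 2 + 1 by rewrite ltr_wpDl// mulr_ge0 ?sqr_ge0// ltW.
exists (e / (C * lam ^+ 2 + 1)); first by pos.
move=> v; rewrite ltr_pdivlMr// => vd.
rewrite -t0 (flat_neg m (lexx 0)) subr0 dotv0l subr0 ger0_norm ?flat_ge0//.
have -> : lam * (x + v)$i + c = lam * v$i by rewrite mxE mulrDr addrAC -t0 add0r.
rewrite (le_trans (hC _))// exprMn mulrA.
have vi := coord_le_norm v i.
have v2 : v$i ^+ 2 <= `|v| ^+ 2.
 by rewrite -[X in X <= _]real_normK ?num_real// lerXn2r// nnegrE.
apply: (@le_trans _ _ (C * lam ^+ 2 * `|v| ^+ 2)).
 by rewrite ler_wpM2l// mulr_ge0 ?sqr_ge0// ltW.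
rewrite [`|v| ^+ 2]expr2 mulrA ler_wpM2r// (le_trans _ (ltW vd))// mulrC ler_wpM2l// lerDl//.
Qed.

Definition smooth f := forall k, classC k setT f.

Lemma openTE : open [set: E]. Proof. exact: openT. Qed.

Lemma smooth_flat m (lam c : R) i : smooth (fun z : E => flat m (lam * z$i + c)).
Proof.
move=> k; elim: k m => [|k IH] m /=.
 by move=> x _; exact: (hgrad_cont (hgrad_flat m lam c i x)).
move=> j; split.
 by move=> x _; have [] := hgrad_derive (delta_mx ord0 j) (hgrad_flat m lam c i x).
have -> : partial j (fun z : E => flat m (lam * z$i + c)) =
 (fun z => (flat m.+2 (lam * z$i + c) + - m%:R * flat m.+1 (lam * z$i + c)) * (lam * (i == j)%:R)).
 apply/funext => x; rewrite (partial_grad j (hgrad_flat m lam c i x)) !mxE eqxx /=.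
 by rewrite mulNr eq_sym.
apply: classCM openTE _ (classC_cst _ _ _); apply: classCD openTE (IH _) _.
exact: classCM openTE (classC_cst _ _ _) (IH _).
Qed.

Lemma smooth_cst (c : R) : smooth (fun=> c).
Proof. by move=> k; exact: classC_cst. Qed.

Lemma smoothM f1 f2 : smooth f1 -> smooth f2 -> smooth (fun x => f1 x * f2 x).
Proof. by move=> h1 h2 k; exact: classCM openTE (h1 k) (h2 k). Qed.

Lemma smooth_coord i : smooth (fun x : E => x$i).
Proof. by move=> k; exact: classC_coord. Qed.

Lemma smooth_grad f x : smooth f -> hgrad f x (grad f x).
Proof. by move=> h; exact: (C1_hgrad openTE I (h 1%N)). Qed.

Lemma smooth_partial f i : smooth f -> smooth (partial i f).
Proof. by move=> h k; have /= /(_ i)[_] := h k.+1. Qed.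

Definition sstep t : R := flat 0 t / (flat 0 t + flat 0 (1 - t)).

Lemma sstep_den t : 0 < flat 0 t + flat 0 (1 - t) :> R.
Proof.
have [t0|t0] := leP t 0.
 by rewrite ltr_wpDl ?flat_ge0// flat_gt0//; lra.
by rewrite ltr_wpDr ?flat_ge0// flat_gt0.
Qed.

Lemma sstep_ge0 t : 0 <= sstep t.
Proof. by rewrite divr_ge0 ?flat_ge0// ltW// sstep_den. Qed.

Lemma sstep_le1 t : sstep t <= 1.
Proof. by rewrite ler_pdivrMr ?sstep_den// mul1r lerDl flat_ge0. Qed.

Lemma sstep0 t : t <= 0 -> sstep t = 0.
Proof. by move=> t0; rewrite /sstep flat_neg// mul0r. Qed.

Lemma sstep_gt0 t : 0 < t -> 0 < sstep t.
Proof. by move=> t0; rewrite divr_gt0 ?sstep_den// flat_gt0. Qed.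

Lemma sstep1 t : 1 <= t -> sstep t = 1.
Proof.
move=> t1; rewrite /sstep (@flat_neg _ _ (1 - t)) ?subr_le0// addr0 mulfV// gt_eqF// flat_gt0//.
exact: lt_le_trans t1.
Qed.

Lemma smooth_sstep (lam c : R) i : smooth (fun z : E => sstep (lam * z$i + c)).
Proof.
move=> k; apply: classCM openTE (smooth_flat _ _ _ _ _) _; apply: classCV openTE _ _.
 by move=> x _; rewrite gt_eqF// sstep_den.
apply: classCD openTE (smooth_flat _ _ _ _ _) _.
have -> : (fun z : E => flat 0 (1 - (lam * z$i + c))) = (fun z => flat 0 ((- lam) * z$i + (1 - c))).
 by apply/funext => z; congr flat; ring.
exact: smooth_flat.
Qed.

(** A product of one-dimensional plateaus suits the maximum norm: it is 1 on the ball of radius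
    [r / 2] and vanishes off the ball of radius [r]. *)
Definition cbump (c : E) (r : R) x : R := \prod_i (sstep (2 - 2 / r * (x$i - c$i)) * sstep (2 + 2 / r * (x$i - c$i))).

Lemma smooth_bump c r : smooth (cbump c r).
Proof.
move=> k; apply: classC_prod openTE _ => i _; apply: classCM openTE _ _.
 have -> : (fun z : E => sstep (2 - 2 / r * (z$i - c$i))) = (fun z => sstep ((- (2 / r)) * z$i + (2 + 2 / r * c$i))).
  by apply/funext => z; congr sstep; ring.
 exact: smooth_sstep.
have -> : (fun z : E => sstep (2 + 2 / r * (z$i - c$i))) = (fun z => sstep (2 / r * z$i + (2 - 2 / r * c$i))).
 by apply/funext => z; congr sstep; ring.
exact: smooth_sstep.
Qed.

Lemma bump_ge0 c r x : 0 <= cbump c r x.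
Proof. by apply: prodr_ge0 => i _; rewrite mulr_ge0 ?sstep_ge0. Qed.

Lemma bump_le1 c r x : cbump c r x <= 1.
Proof.
have : 0 <= cbump c r x <= 1.
 rewrite /cbump; elim/big_ind: _ => [|a1 b1 /andP[a10 a11] /andP[b10 b11]|i _].
 - by pos.
 - by rewrite mulr_ge0// mulr_ile1.
 - by rewrite mulr_ge0 ?sstep_ge0// mulr_ile1 ?sstep_ge0 ?sstep_le1.
by pos.
Qed.

Lemma bump_in c (r : R) x : 0 < r -> `|x - c| <= r / 2 -> cbump c r x = 1.
Proof.
move=> r0 h; apply: big1 => i _; have := le_trans (coord_le_norm (x - c) i) h.
rewrite !mxE ler_norml => /andP[h1 h2].
have k1 : 2 / r * (x$i - c$i) <= 1.
 by rewrite mulrAC ler_pdivrMr// mul1r; lra.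
have k2 : - 1 <= 2 / r * (x$i - c$i).
 by rewrite mulrAC ler_pdivlMr//; lra.
by rewrite !sstep1 ?mulr1//; lra.
Qed.

Lemma bump_out c (r : R) x : 0 < r -> r <= `|x - c| -> cbump c r x = 0.
Proof.
move=> r0; have [n0|n0] := posnP n.
 have -> : x - c = 0 by apply/rowP => i; have := ltn_ord i; rewrite [X in (_ < X)%N]n0.
 by rewrite normr0 leNgt r0.
move=> h; have [i hi] : exists i, r <= `|(x - c)$i|.
 apply: contrapT => /forallNP hn; have : `|x - c| < r.
  by apply: norm_lt_coord => // i; rewrite ltNge; apply/negP; exact: hn.
 by pos.
apply/eqP; rewrite prodf_seq_eq0; apply/hasP; exists i; first by pos.
rewrite /= mulf_eq0; move: hi; rewrite !mxE ler_normr => /orP[hi|hi].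
 apply/orP; left; rewrite sstep0//.
 have : 2 <= 2 / r * (x$i - c$i) by rewrite mulrAC ler_pdivlMr//; lra.
 by lra.
apply/orP; right; rewrite sstep0//.
have : 2 / r * (x$i - c$i) <= - 2 by rewrite mulrAC ler_pdivrMr//; lra.
by lra.
Qed.

Lemma bump_gt0 c (r : R) x : 0 < r -> `|x - c| < r -> 0 < cbump c r x.
Proof.
move=> r0 h; apply: prodr_gt0 => i _; have := le_lt_trans (coord_le_norm (x - c) i) h.
rewrite !mxE ltr_norml => /andP[h1 h2].
have k1 : 2 / r * (x$i - c$i) < 2 by rewrite mulrAC ltr_pdivrMr//; lra.
have k2 : - 2 < 2 / r * (x$i - c$i) by rewrite mulrAC ltr_pdivlMr//; lra.
by rewrite mulr_gt0// sstep_gt0//; lra.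
Qed.

Lemma bump_scale c (r : R) x : cbump c r x = cbump 0 1 (r^-1 *: (x - c)).
Proof.
by apply: eq_bigr => i _; rewrite !mxE invr1 mulr1 subr0 !mulrA.
Qed.

Definition tfun f := smooth f /\ exists M : R, forall x, M < `|x| -> f x = 0.

Lemma bump_tfun c (r : R) : 0 < r -> tfun (cbump c r).
Proof.
move=> r0; split; first exact: smooth_bump.
exists (r + `|c|) => x h; apply: bump_out => //.
by have := ler_normB x (c - x); rewrite opprB addrA addrAC; have := ler_distD c x 0; rewrite !subr0; lra.
Qed.

Lemma partial_out f i (M : R) x : (forall z, M < `|z| -> f z = 0) -> M < `|x| -> partial i f x = 0.
Proof.
move=> hM xM; have d0 : 0 < `|x| - M by pos.
have h := hgrad_near d0 _ (hgrad_cst 0 x).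
have h2 : hgrad f x 0.
 apply: h => z zx; rewrite hM//; have := ler_distD z x 0; rewrite !subr0 distrC.
 by move: zx; lra.
by rewrite (partial_grad i h2) mxE.
Qed.

Lemma tfun_partial f i : tfun f -> tfun (partial i f).
Proof.
move=> [sf [M hM]]; split; first exact: smooth_partial.
by exists M => x; exact: partial_out.
Qed.

Lemma tfun_bounded f : tfun f -> exists2 C : R, 0 < C & forall x, `|f x| <= C.
Proof.
move=> [sf [M hM]].
have cB : compact [set x : E | `|x| <= M].
 apply: bounded_closed_compact; last exact: closed_norm_ball.
 by exists M; split; [exact: num_real | move=> t Mt x /= xM; rewrite (le_trans xM)// ltW].
have [C hC] : exists C : R, forall x, `|x| <= M -> `|f x| <= C.
 apply: (compact_sup_bound cB) => a _.
 have /contNP/(_ _ ltr01)[d d0 hd] := hgrad_cont (smooth_grad a sf).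
 exists d, (`|f a| + 1); split=> // z _ /hd h.
 by rewrite -[f z](subrK (f a)) (le_trans (ler_normD _ _))// addrC lerD2l ltW.
exists (`|C| + 1); first by pos.
move=> x; have [/hC h|/hM ->] := leP `|x| M.
 by rewrite (le_trans h)// (le_trans (ler_norm _))// lerDl.
by rewrite normr0 addr_ge0.
Qed.

Lemma tfun_grad_bounded f : tfun f -> exists2 C : R, 0 < C & forall x, `|grad f x| <= C.
Proof.
move=> tf; have h i : exists C : R, 0 < C /\ forall x, `|partial i f x| <= C.
 by have [C C0 hC] := tfun_bounded (tfun_partial i tf); exists C.
have [C hC] := choice h; exists (1 + \sum_i C i).
 by rewrite ltr_wpDr// sumr_ge0// => i _; rewrite ltW//; have [] := hC i.
move=> x; apply: norm_le_coord => [|i].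
 by rewrite addr_ge0// sumr_ge0// => i _; rewrite ltW//; have [] := hC i.
rewrite gradE; have [_ /(_ x) /le_trans] := hC i; apply.
rewrite (bigD1 i)//= addrCA lerDl addr_ge0// sumr_ge0// => j _; rewrite ltW//.
by have [] := hC j.
Qed.

Lemma tfun_lip f : tfun f -> exists2 C : R, 0 < C & lipfun f C.
Proof.
move=> tf; have [C C0 hC] := tfun_grad_bounded tf.
exists (n%:R * C + 1); first by pos.
move=> x y; have [c _] := @MVT_grad _ _ f y (x - y) (grad f) (fun t _ => smooth_grad _ tf.1).
rewrite (addrC y) subrK => ->; rewrite (le_trans (dotv_le _ _))// mulrA ler_wpM2r//.
by rewrite (@le_trans _ _ (n%:R * C))// ?ler_wpM2l// lerDl.
Qed.

Lemma tfun_taylor f : tfun f -> exists2 C : R, 0 < C & forall x v,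
 `|f (x + v) - f x - dotv (grad f x) v| <= C * `|v| ^+ 2.
Proof.
move=> tf; have h i : exists C : R, 0 < C /\ lipfun (partial i f) C.
 by have [C C0 hC] := tfun_lip (tfun_partial i tf); exists C.
have [C hC] := choice h.
have S0 : 0 <= \sum_i C i by apply: sumr_ge0 => i _; rewrite ltW//; have [] := hC i.
exists (n%:R * (\sum_i C i) + 1); first by pos.
move=> x v; have [c /andP[c0 c1] ->] := @MVT_grad _ _ f x v (grad f) (fun t _ => smooth_grad _ tf.1).
rewrite -dotvBl (le_trans (dotv_le _ _))//.
have gl : `|grad f (x + c *: v) - grad f x| <= (\sum_i C i) * `|v|.
 apply: norm_le_coord => [|i]; first by pos.
 have -> : (grad f (x + c *: v) - grad f x)$i = partial i f (x + c *: v) - partial i f x.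
  by rewrite -!gradE; move: (grad f _) (grad f x) => A B; rewrite !mxE.
 have [C0 /(_ (x + c *: v) x)] := hC i; rewrite addr_subK normrZ ger0_norm// => /le_trans; apply.
 apply: ler_pM; [exact: ltW | by pos | | by rewrite ler_piMl].
 by rewrite (bigD1 i)//= lerDl sumr_ge0// => j _; rewrite ltW//; have [] := hC j.
rewrite expr2 (@le_trans _ _ (n%:R * ((\sum_i C i) * `|v| * `|v|)))//.
 by rewrite ler_wpM2l// ler_wpM2r.
by rewrite !mulrA ler_wpM2r// ler_wpM2r// lerDl.
Qed.

End smooth.

(** * Mollification *)

Section mollify.
Implicit Types (u f eta : E -> R) (x y z v g : E).

Lemma tfun_continuous f : tfun f -> continuous f.
Proof. by move=> [sf _] x; exact: hgrad_cont (smooth_grad x sf). Qed.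

Lemma tfun_meas f : tfun f -> mfun f.
Proof. by move=> /tfun_continuous; exact: cont_meas. Qed.

Lemma tfun_ible f : tfun f -> ible f.
Proof.
by move=> tf; have [L _ lf] := tfun_lip tf; have [_ [M hM]] := tf; exact: lip_ible lf hM.
Qed.

Lemma tfunM f1 f2 : smooth f1 -> tfun f2 -> tfun (fun x => f1 x * f2 x).
Proof.
move=> s1 [s2 [M hM]]; split; first exact: smoothM.
by exists M => x /hM ->; rewrite mulr0.
Qed.

Lemma tfun_int_partial f i : tfun f -> intg (partial i f) = 0.
Proof.
move=> tf; have [L _ lf] := tfun_lip tf; have [sf [M hM]] := tf.
have [] // := @int_deriv f L M i (partial i f) lf hM.
 exact: tfun_meas (tfun_partial i tf).
by apply: aeW => x; rewrite -gradE; exact/hgrad_dq/smooth_grad.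
Qed.

Lemma ibleM_bdd f (g : E -> R) (C : R) : ible f -> mfun g -> (forall x, `|g x| <= C) -> ible (fun x => f x * g x).
Proof.
move=> hf mg hg; apply: (ible_le _ (ibleZ C (ible_norm hf))).
 by apply: measurable_funM => //; exact: ible_meas hf.
by move=> x; rewrite normrM mulrC ler_wpM2r.
Qed.

Lemma ibleM_tfun u eta x : ible u -> tfun eta -> ible (fun z => u z * eta (z - x)).
Proof.
move=> hu te; have [C _ hC] := tfun_bounded te.
apply: (ibleM_bdd (C := C) hu) => //.
exact: (meas_shift (- x) (tfun_meas te)).
Qed.

(** Written as a correlation: derivatives in [x] fall on [eta], with a minus sign, and never on
    [u]. *)
Definition convol u eta x := I{z, u z * eta (z - x)}.

Lemma convE u eta x : ible u -> tfun eta -> convol u eta x = I{y, u (y + x) * eta y}.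
Proof.
move=> hu te; rewrite /convol -(int_shift x (ibleM_tfun x hu te)).
by under eq_fun do rewrite addrK.
Qed.

Lemma hgrad_conv u eta x : ible u -> tfun eta -> hgrad (convol u eta) x (\row_i - convol u (partial i eta) x).
Proof.
move=> iu te e e0; have [C C0 hC] := tfun_taylor te.
set A := I{z, `|u z|}.
have A0 : 0 <= A by apply: int_ge0.
have CA : 0 < C * A + 1 by pos.
exists (e / (C * A + 1)); first by pos.
move=> v; rewrite ltr_pdivlMr// => vd.
have hi i : ible (fun z => (- v$i) * (u z * partial i eta (z - x))).
 by apply: ibleZ; exact: ibleM_tfun (tfun_partial i te).
have -> : dotv (\row_i - convol u (partial i eta) x) v = I{z, \sum_i (- v$i) * (u z * partial i eta (z - x))}.
 rewrite int_sum//; apply: eq_bigr => i _; rewrite intZ ?mxE ?mulNr ?mulrN 1?mulrC//.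
 exact: ibleM_tfun (tfun_partial i te).
have i1 := ibleM_tfun (x + v) iu te; have i2 := ibleM_tfun x iu te.
rewrite /convol -intB// -intB; [|exact: ibleB|exact: ible_sum].
set F := (X in intg X).
have iF : ible F by apply: ibleB; [exact: ibleB|exact: ible_sum].
apply: le_trans (int_norm iF) _.
apply: (@le_trans _ _ (I{z, C * `|v| ^+ 2 * `|u z|})).
 apply: int_le; [exact: ible_norm|exact/ibleZ/ible_norm|] => z.
 have -> : F z = u z * (eta (z - x + - v) - eta (z - x) - dotv (grad eta (z - x)) (- v)).
  rewrite /F opprD addrA !mulrBr; congr (_ - _); rewrite /dotv mulr_sumr.
  by apply: eq_bigr => i _; rewrite gradE [in RHS]mxE; ring.
 rewrite normrM mulrC ler_wpM2r// (le_trans (hC _ _))// normrN//.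
rewrite intZ ?ibleZ//; last exact: ible_norm.
have -> : C * `|v| ^+ 2 * A = `|v| * (C * A) * `|v| by ring.
by rewrite ler_wpM2r// (le_trans _ (ltW vd))// ler_wpM2l// lerDl.
Qed.

Lemma smooth_conv u eta : ible u -> tfun eta -> smooth (convol u eta).
Proof.
move=> iu te k; elim: k eta te => [|k IH] eta te /=.
 by move=> x _; exact: hgrad_cont (hgrad_conv x iu te).
move=> i; split.
 by move=> x _; have [] := hgrad_derive (delta_mx ord0 i) (hgrad_conv x iu te).
have -> : partial i (convol u eta) = (fun x => -1 * convol u (partial i eta) x).
 by apply/funext => x; rewrite (partial_grad i (hgrad_conv x iu te)) mxE mulN1r.
exact: classCM openTE (classC_cst _ _ _) (IH _ (tfun_partial i te)).
Qed.

Lemma lip_grad_le f (L : R) x g i : lipfun f L -> hgrad f x g -> `|g$i| <= L.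
Proof.
move=> lf hg; apply/ler_addgt0Pr => e e0.
have /cvg_seqP/(_ _ e0)[N /(_ N (leqnn N)) h] := hgrad_dq (i := i) hg.
have := lip_dq i N x lf; have := ler_distD (dq i f N x) (g$i) 0.
by rewrite !subr0 distrC; lra.
Qed.

Section kernel.
Variables (eta : E -> R) (h : R).
Hypotheses (te : tfun eta) (eta_ge0 : forall y, 0 <= eta y) (h_gt0 : 0 < h) (eta_out : forall y, h <= `|y| -> eta y = 0)
 (eta1 : intg eta = 1).

Lemma ible_conv_fun u x : ible u -> ible (fun y => u (y + x) * eta y).
Proof.
move=> iu; have := ible_shift x (ibleM_tfun x iu te).
by under eq_fun do rewrite addrK.
Qed.

Lemma conv_near u (L : R) x : 0 <= L -> lipfun u L -> ible u -> `|convol u eta x - u x| <= L * h.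
Proof.
move=> L0 lu iu; have hc := ible_conv_fun x iu; have he := tfun_ible te.
have -> : u x = I{y, u x * eta y} by rewrite intZ// eta1 mulr1.
rewrite convE// -intB//; last exact: ibleZ.
have iF := ibleB hc (ibleZ (u x) he).
apply: le_trans (int_norm iF) _; rewrite -[L * h]mulr1 -eta1 -intZ//.
apply: int_le; [exact: ible_norm|exact: ibleZ|] => y.
rewrite -mulrBl normrM [`|eta y|]ger0_norm//.
have [/eta_out ->|yh] := leP h `|y|; first by pos.
apply: ler_wpM2r => //; apply: le_trans (lu _ _) _; rewrite addrK.
by rewrite ler_wpM2l// ltW.
Qed.

Lemma conv_lip u (L : R) : lipfun u L -> ible u -> lipfun (convol u eta) L.
Proof.
move=> lu iu x x'; have hc z := ible_conv_fun z iu.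
rewrite !convE// -intB// (le_trans (int_norm (ibleB (hc x) (hc x'))))//.
rewrite -[leRHS]mulr1 -eta1 -intZ; last exact: tfun_ible.
apply: int_le; [exact/ible_norm/ibleB|exact/ibleZ/tfun_ible|] => y.
rewrite -mulrBl normrM [`|eta y|]ger0_norm// ler_wpM2r// (le_trans (lu _ _))//.
by rewrite opprD addrACA subrr add0r.
Qed.

Lemma conv_out u x : (forall z, `|z - x| < h -> u z = 0) -> convol u eta x = 0.
Proof.
move=> hu; rewrite /convol -[RHS]int0; congr intg; apply/funext => z.
have [/eta_out ->|/hu ->] := leP h `|z - x|; first by pos.
by pos.
Qed.

(** Integrate the derivative of [y$l * eta y]. *)
Lemma int_moment i l : I{y, y$l * partial i eta y} = - (i == l)%:R.
Proof.
have tl := tfunM (@smooth_coord l) te.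
have := tfun_int_partial i tl.
have -> : partial i (fun y : E => y$l * eta y) = (fun y => y$l * partial i eta y + (i == l)%:R * eta y).
 apply/funext => y.
 rewrite (partial_grad i (hgradM (hgrad_coord y l) (smooth_grad y te.1))).
 by rewrite -(gradE eta) !mxE eqxx/= [eta y * _]mulrC.
have tp := tfunM (@smooth_coord l) (tfun_partial i te).
rewrite (intD (tfun_ible tp) (ibleZ _ (tfun_ible te))) intZ ?eta1 ?mulr1; last exact: tfun_ible.
by move/eqP; rewrite addr_eq0 => /eqP.
Qed.

(** Constants and linear functions are differentiated exactly, by [tfun_int_partial] and
    [int_moment]; only the remainder of the expansion of [u] at [x] is left. As the last integral is
    of order [1 / h], the derivatives of mollifications converge at each point where [u] is
    differentiable. *)
Lemma conv_partial_near u x g (e : R) i : ible u -> 0 <= e ->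
 (forall v, `|v| <= h -> `|u (x + v) - u x - dotv g v| <= e * `|v|) ->
 `|partial i (convol u eta) x - g$i| <= e * h * I{y, `|partial i eta y|}.
Proof.
move=> iu e0 hu; have ti := tfun_partial i te; have ii := tfun_ible ti.
rewrite (partial_grad i (hgrad_conv x iu te)) mxE convE//.
have hl l : ible (fun y => g$l * (y$l * partial i eta y)).
 by apply: ibleZ; apply: tfun_ible; apply: tfunM => //; exact: smooth_coord.
have hg : I{y, \sum_l g$l * (y$l * partial i eta y)} = - g$i.
 rewrite int_sum// (bigD1 i)//= intZ ?int_moment ?eqxx ?mulrN1; last first.
  by apply: tfun_ible; apply: tfunM => //; exact: smooth_coord.
 rewrite big1 ?addr0// => l li; rewrite intZ ?int_moment; last first.
  by apply: tfun_ible; apply: tfunM => //; exact: smooth_coord.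
 by rewrite eq_sym (negbTE li) oppr0 mulr0.
have hu0 : I{y, u x * partial i eta y} = 0.
 by rewrite intZ// tfun_int_partial// mulr0.
have h1 : ible (fun y => u (y + x) * partial i eta y).
 by have := ible_shift x (ibleM_tfun x iu ti); under eq_fun do rewrite addrK.
have -> : - I{y, u (y + x) * partial i eta y} - g$i = - I{y, u (y + x) * partial i eta y - u x * partial i eta y -
           \sum_l g$l * (y$l * partial i eta y)}.
 rewrite intB; [|by apply: ibleB => //; exact: ibleZ|exact: ible_sum].
 by rewrite intB ?hg ?hu0 ?subr0 ?opprK ?opprD//; exact: ibleZ.
have iF : ible (fun y => u (y + x) * partial i eta y - u x * partial i eta y - \sum_l g$l * (y$l * partial i eta y)).
 by apply: ibleB; [apply: ibleB => //; exact: ibleZ|exact: ible_sum].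
rewrite normrN (le_trans (int_norm iF))// -intZ; last exact: ible_norm.
apply: int_le; [exact: ible_norm|exact/ibleZ/ible_norm|] => y.
have -> : u (y + x) * partial i eta y - u x * partial i eta y - \sum_l g$l * (y$l * partial i eta y) =
  (u (x + y) - u x - dotv g y) * partial i eta y.
 rewrite !mulrBl (addrC y); congr (_ - _); rewrite /dotv mulr_suml.
 by apply: eq_bigr => l _; rewrite mulrA.
rewrite normrM; have [yh|hy] := leP `|y| h.
 by rewrite ler_wpM2r// (le_trans (hu _ yh))// ler_wpM2l.
by rewrite (@partial_out _ _ h)// ?normr0 ?mulr0// => z /ltW; exact: eta_out.
Qed.

End kernel.

Lemma ball_ible (r : R) : 0 < r -> ible (\1_(ball (0 : E) r)) /\ intg (\1_(ball (0 : E) r)) = (2 * r) ^+ n.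
Proof.
move=> r0; have mB : measurable (ball (0 : E) r).
 by rewrite ball_obox//; apply: open_meas; exact: obox_open.
split.
 apply: (@ible_bdd _ 1 r) => [|x|x xr]; first exact: measurable_indic.
  by rewrite indicE; case: (_ \in _); rewrite ?normr1 ?normr0.
 rewrite indicE memNset// => /ball_rowP; rewrite subr0 => /(lt_trans xr); by pos.
have hl : mu (ball (0 : E) r) = ((2 * r) ^+ n)%:E.
 rewrite ball_obox// lebesgue_obox; last by move=> i; rewrite !mxE add0r; lra.
 rewrite -[in RHS](card_ord n) -prodr_const/=; congr (_%:E); apply: eq_bigr => i _.
 by rewrite !mxE; ring.
transitivity (fine (mu (ball (0 : E) r))); last by rewrite hl.
by rewrite /intg; congr fine; rewrite integral_indic// setIT.
Qed.

(** A bump of radius [h] divided by its mass. The mass is at least [h ^ n], the volume of the half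
    ball for the maximum norm; the partial derivatives are at most [C1 / h] and live in a ball of
    volume [(4 h) ^ n]. This is where [C1 * 4 ^ n] comes from. *)
Lemma mollifier : exists2 C : R, 0 < C & forall h : R, 0 < h -> exists eta,
 [/\ tfun eta, forall y, 0 <= eta y, forall y, h <= `|y| -> eta y = 0, intg eta = 1 &
   forall i, I{y, `|partial i eta y|} <= C / h].
Proof.
have [C1 C10 l1] := tfun_lip (bump_tfun (0 : E) ltr01).
exists (C1 * 4 ^+ n); first by pos.
move=> h h0; have tb := bump_tfun (0 : E) h0; have ib := tfun_ible tb.
set m := intg (cbump (0 : E) h).
have hm : h ^+ n <= m.
 have h2 : 0 < h / 2 by lra.
 have [iB _] := ball_ible h2.
 have -> : h ^+ n = (2 * (h / 2)) ^+ n by congr (_ ^+ _); lra.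
 have [_ <-] := ball_ible h2.
 apply: int_le => // y; rewrite indicE; case: (boolP (y \in _)); last by rewrite bump_ge0.
 by rewrite inE => /ball_rowP yh; rewrite bump_in//; exact: ltW.
have m0 : 0 < m by apply: lt_le_trans hm; rewrite exprn_gt0.
have lb : lipfun (cbump (0 : E) h) (C1 / h).
 move=> x y; rewrite bump_scale [cbump 0 h y]bump_scale (le_trans (l1 _ _))//.
 by rewrite !subr0 -scalerBr normrZ gtr0_norm ?invr_gt0// mulrA.
exists (fun y => m^-1 * cbump (0 : E) h y); split.
- exact: tfunM (smooth_cst _) tb.
- by move=> y; rewrite mulr_ge0 ?bump_ge0// invr_ge0 ltW.
- by move=> y hy; rewrite bump_out ?subr0// mulr0.
- by rewrite intZ// mulVf// gt_eqF.
move=> i; have h2 : 0 < 2 * h by lra.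
have [iB IB] := ball_ible h2.
apply: (@le_trans _ _ (I{y, (m^-1 * (C1 / h)) * \1_(ball (0 : E) (2 * h)) y})).
 apply: int_le; last first.
 - move=> y.
  have hg := hgradZ m^-1 (smooth_grad y tb.1).
  rewrite (partial_grad i hg) mxE gradE normrM gtr0_norm ?invr_gt0// -mulrA.
  rewrite ler_wpM2l ?invr_ge0 ?(ltW m0)//.
  have hle : `|partial i (cbump (0 : E) h) y| <= C1 / h.
   by rewrite -gradE; exact: lip_grad_le lb (smooth_grad y tb.1).
  rewrite indicE; case: (boolP (y \in _)); first by rewrite mulr1.
  rewrite notin_setE => /ball_rowP/negP; rewrite subr0 -leNgt => hy.
  rewrite mulr0 (@partial_out _ _ h) ?normr0//.
   by move=> z /ltW zh; rewrite bump_out ?subr0.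
  by lra.
 - exact: ibleZ.
 by apply/ible_norm/tfun_ible/tfun_partial; exact: tfunM (smooth_cst _) tb.
rewrite intZ// IB; have hn : 0 < h ^+ n by pos.
have -> : 2 * (2 * h) = 4 * h by ring.
have -> : m^-1 * (C1 / h) * (4 * h) ^+ n = m^-1 * (C1 * 4 ^+ n / h * h ^+ n).
 by rewrite exprMn; ring.
rewrite ler_pdivrMl// [m * _]mulrC.
by rewrite ler_wpM2l// mulr_ge0 ?invr_ge0 ?mulr_ge0 ?exprn_ge0 ?(ltW h0) ?(ltW C10).
Qed.

End mollify.

(** * Fundamental lemma of the calculus of variations and uniqueness of weak gradients *)

Section fundamental.
Implicit Types (u f w phi : E -> R) (x y z v a b : E) (Omega : set E).

(** A countable base: almost-everywhere statements are proved ball by ball, and the centres later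
    provide a dense family of barriers. *)
Lemma rational_balls : exists (c : nat -> E) (r : nat -> R), (forall k, 0 < r k) /\
 forall x (e : R), 0 < e -> exists k, `|x - c k| < r k /\ forall y, `|y - c k| <= r k -> `|y - x| < e.
Proof.
pose c k : E := if unpickle k is Some p then map_mx (@ratr R) (p : 'rV[rat]_n * nat).1 else 0.
pose r k : R := if unpickle k is Some p then step (p : 'rV[rat]_n * nat).2 else 1.
exists c, r; split.
 by move=> k; rewrite /r; case: unpickle => [p|]; rewrite ?ltr01 ?step_gt0.
move=> x e e0; have e2 : 0 < e / 2 by lra.
have [N /(_ N (leqnn N)) hN] := step_small e2.
have oU : open (ball x (step N : R)) by apply: ball_open; exact: step_gt0.
have xU : ball x (step N : R) x by apply: ballxx; exact: step_gt0.
have := xU; rewrite {1}(rat_balls oU) => -[p /= pU xp].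
have cp : `|(map_mx (@ratr R) p.1 : E) - x| < step N.
 by apply/ball_rowP/pU; apply: ballxx; exact: step_gt0.
exists (pickle (p.1, N)); rewrite /c /r !pickleK /=; split; first by rewrite distrC.
move=> y yN; have := ler_distD (map_mx (@ratr R) p.1 : E) y x; lra.
Qed.

Definition bstep a b (k : nat) x : R := \prod_i (sstep (k%:R * (x$i - a$i)) * sstep (k%:R * (b$i - x$i))).

Lemma smooth_bstep a b k : smooth (bstep a b k).
Proof.
move=> m; apply: classC_prod openTE _ => i _; apply: classCM openTE _ _.
 have -> : (fun z : E => sstep (k%:R * (z$i - a$i))) = (fun z => sstep (k%:R * z$i + - (k%:R * a$i))).
  by apply/funext => z; rewrite mulrBr.
 exact: smooth_sstep.
have -> : (fun z : E => sstep (k%:R * (b$i - z$i))) = (fun z => sstep ((- k%:R) * z$i + k%:R * b$i)).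
 by apply/funext => z; congr sstep; ring.
exact: smooth_sstep.
Qed.

Lemma bstep_le1 a b k x : `|bstep a b k x| <= 1.
Proof.
have : 0 <= bstep a b k x <= 1.
 rewrite /bstep; elim/big_ind: _ => [|a1 b1 /andP[a10 a11] /andP[b10 b11]|i _].
 - by pos.
 - by rewrite mulr_ge0// mulr_ile1.
 - by rewrite mulr_ge0 ?sstep_ge0// mulr_ile1 ?sstep_ge0 ?sstep_le1.
by case/andP => h1 h2; rewrite ger0_norm.
Qed.

Lemma bstep_cvg a b x : bstep a b k x @[k --> \oo] --> (\1_(obox a b) x : R).
Proof.
apply/cvg_seqP => e e0.
suff [N hN] : exists N, forall k, (N <= k)%N -> bstep a b k x = \1_(obox a b) x.
 by exists N => k /hN ->; rewrite subrr normr0 ltW.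
case: (pselect (obox a b x)) => hx.
 have hi i : exists N, forall k, (N <= k)%N -> 1 <= k%:R * (x$i - a$i) /\ 1 <= k%:R * (b$i - x$i).
  have /andP[h1 h2] := hx i.
  have a0 : 0 < x$i - a$i by lra.
  have b0 : 0 < b$i - x$i by lra.
  have [N hN] := nat_gt ((x$i - a$i)^-1 + (b$i - x$i)^-1).
  exists N => k Nk; have Nk' : N%:R <= k%:R :> R by rewrite ler_nat.
  have ai : 0 < (x$i - a$i)^-1 by pos.
  have bi : 0 < (b$i - x$i)^-1 by pos.
  by rewrite -!ler_pdivrMr// !div1r; split; lra.
 have [N hN] := choice hi; exists (\max_i N i) => k Nk.
 rewrite indicE mem_set//; apply: big1 => i _.
 by have [h1 h2] := hN i k (leq_trans (leq_bigmax i) Nk); rewrite !sstep1 ?mulr1.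
exists 0 => k _; rewrite indicE memNset//.
have [i hi] : exists i, ~ (a$i < x$i < b$i) by apply/existsNP.
apply/eqP; rewrite prodf_seq_eq0; apply/hasP; exists i; first by pos.
rewrite /= mulf_eq0; move/negP: hi; rewrite negb_and -!leNgt => /orP[hi|hi]; apply/orP.
 by left; rewrite sstep0// mulr_ge0_le0// subr_le0.
by right; rewrite sstep0// mulr_ge0_le0// subr_le0.
Qed.

Lemma ible_indic w A : ible w -> measurable A -> ible (fun x => w x * \1_A x).
Proof.
move=> hw mA; apply: (ibleM_bdd (C := 1) hw); first exact: measurable_indic.
by move=> x; rewrite indicE; case: (_ \in _); rewrite ?normr1 ?normr0.
Qed.

Lemma int_null_indic w (s_ : nat -> E -> R) (A : set E) : ible w -> measurable A ->
 (forall k, mfun (s_ k)) -> (forall k x, `|s_ k x| <= 1) ->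
 (forall x, s_ k x @[k --> \oo] --> (\1_A x : R)) -> (forall k, I{x, w x * s_ k x} = 0) -> I{x, w x * \1_A x} = 0.
Proof.
move=> hw mA ms s1 sc s0.
have [|||||_ _ h] := @int_dct (fun k x => w x * s_ k x) (fun x => w x * \1_A x) (fun x => `|w x|).
- by move=> k; apply: measurable_funM => //; exact: ible_meas hw.
- exact: ible_meas (ible_indic hw mA).
- by apply: aeW => x; apply: cvgM; [exact: cvg_cst|exact: sc].
- exact: ible_norm.
- by apply: aeW => x k; rewrite normrM ler_piMr.
have h2 : I{x, w x * s_ k x} @[k --> \oo] --> (0 : R).
 by rewrite (_ : (fun k => _) = fun=> 0); [exact: cvg_cst | apply/funext => k; rewrite s0].
exact: (cvg_unique _ h h2).
Qed.

(* A Dynkin-system argument on the class of sets over which [w] integrates to zero. *)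
Lemma ae0_of_boxes w : ible w -> (forall a b k, I{x, w x * bstep a b k x} = 0) -> {ae mu, forall x, w x = 0}.
Proof.
move=> hw h0; pose H := [set A : set E | measurable A /\ I{x, w x * \1_A x} = 0].
have hbox a b : H (obox a b).
 split; first by apply: open_meas; exact: obox_open.
 apply: (int_null_indic (s_ := bstep a b)) => //.
 - by apply: open_meas; exact: obox_open.
 - by move=> k; apply: cont_meas => x; exact: hgrad_cont (smooth_grad x (smooth_bstep a b k)).
 - by move=> k x; exact: bstep_le1.
 - exact: bstep_cvg.
have hnd : ndseq_closed H.
 move=> F ndF hF; have mF k := (hF k).1; have mU : measurable (\bigcup_k F k) by exact: bigcup_measurable.
 split=> //; apply: (int_null_indic (s_ := fun k => \1_(F k))) => //.
 - by move=> k x; rewrite indicE; case: (_ \in _); rewrite ?normr1 ?normr0.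
 - move=> x; apply/cvg_seqP => e e0; case: (pselect ((\bigcup_k F k) x)) => [[N _ hN]|hx].
   exists N => k Nk; have /subsetPset/(_ x hN) hk := ndF _ _ Nk.
   rewrite !indicE !mem_set ?subrr ?normr0 ?ltW//; exists N => //.
  exists 0 => k _; rewrite !indicE !memNset ?subrr ?normr0 ?ltW// => hk; apply: hx; by exists k.
 - by move=> k; exact: (hF k).2.
have hT : H setT.
 rewrite -obox_cover; apply: hnd => [m k mk|k]; last exact: hbox.
 apply/subsetPset => x hx i; have := hx i; rewrite !mxE => /andP[h1 h2].
 have : m%:R <= k%:R :> R by rewrite ler_nat.
 by move=> hmk; apply/andP; split; lra.
have hL : lambda_system setT H.
 split => // A B BA [mA iA] [mB iB]; split; first exact: measurableD.
 have -> : (fun x => w x * \1_(A `\` B) x) = (fun x => w x * \1_A x - w x * \1_B x).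
  apply/funext => x; rewrite !indicE; case: (pselect (B x)) => hB.
   by rewrite (mem_set hB) (mem_set (BA _ hB)) memNset ?subrr ?mulr0// => -[].
  rewrite (memNset hB) mulr0 subr0; case: (pselect (A x)) => hA.
   by rewrite !mem_set.
  by rewrite !memNset// => -[].
 by rewrite intB ?iA ?iB ?subrr//; exact: ible_indic.
have hH A : measurable A -> I{x, w x * \1_A x} = 0.
 rewrite measurable_obox => mA.
 by have [] := lambda_system_subset (@oboxI_closed R n) hL
   (fun B '(ex_intro a (ex_intro b e)) => eq_ind_r H (hbox a b) e) (fun X _ => @subsetT _ X) mA.
have mw := ible_meas hw.
have sgn (s : R) : {ae mu, forall x, s * w x <= 0}.
 pose A := [set x | 0 < s * w x].
 have mA : measurable A.
  have ms : mfun (fun x => s * w x) by exact: measurable_funM.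
  have := ms measurableT _ (measurable_itv `]0, +oo[); rewrite setTI.
  by congr measurable; apply/seteqP; split => x /=; rewrite in_itv/= andbT.
 have iA := ibleZ s (ible_indic hw mA).
 have := int_eq0_ae iA; rewrite intZ; last exact: ible_indic.
 rewrite hH// mulr0 lexx => /(_ _ isT) h; apply: filterS (h _).
  move=> x; rewrite indicE leNgt; case: (boolP (x \in A)) => [|+ _].
   by rewrite inE /A/= => + + ; rewrite mulr1 => + h1; rewrite h1 ltxx.
  by rewrite notin_setE => /negP.
 apply: aeW => x; rewrite indicE; case: (boolP (x \in A)); last by rewrite !mulr0.
 by rewrite inE mulr1 => /ltW.
have h1 := sgn 1; have h2 := sgn (-1); apply: filterS2 h1 h2 => x.
by pos.
Qed.

Lemma nclosureP (A : set E) x : ~ closure A x -> exists2 e : R, 0 < e & forall y, `|y - x| < e -> ~ A y.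
Proof.
move=> h; apply: contrapT => hn; apply: h; apply/closureNP => e e0.
by apply: contrapT => h2; apply: hn; exists e => // y yx Ay; apply: h2; exists y.
Qed.

Lemma test_of Omega phi (M : R) : smooth phi -> (forall x, Omega x -> `|x| <= M) ->
 closure [set x | phi x != 0] `<=` Omega -> test_function Omega phi.
Proof.
move=> sp OM cl; split=> //; apply: bounded_closed_compact; last exact: closed_closure.
exists M; split; [exact: num_real | move=> t Mt x /= /cl/OM xM]; exact: le_trans xM (ltW Mt).
Qed.

Lemma test_out Omega phi x : test_function Omega phi -> ~ Omega x ->
 exists2 e : R, 0 < e & forall y, `|y - x| < e -> phi y = 0.
Proof.
move=> [_ _ cl] hx; have [e e0 he] := nclosureP (fun h => hx (cl _ h)).
by exists e => // y /he /negP; rewrite negbK => /eqP.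
Qed.

Lemma test_tfun Omega phi : test_function Omega phi -> tfun phi.
Proof.
move=> tp; have [sp cp _] := tp; split=> //.
have [C _ hC] := compact_bd cp; exists C => x Cx; apply/eqP; apply: contraTT isT => px.
have : `|x| <= C by apply: hC; exact: subset_closure.
by pos.
Qed.

Lemma test_out0 Omega phi x : test_function Omega phi -> ~ Omega x -> phi x = 0.
Proof. by move=> tp /(test_out tp)[e e0]; apply; rewrite subrr normr0. Qed.

Lemma test_hgrad0 Omega phi x : test_function Omega phi -> ~ Omega x -> hgrad phi x 0.
Proof.
move=> tp /(test_out tp)[e e0 he]; apply: (hgrad_near e0 _ (hgrad_cst 0 x)) => z /he ->//.
Qed.

Lemma int_on Omega f : ible f -> (forall x, ~ Omega x -> f x = 0) -> (\int[mu]_(x in Omega) (f x)%:E)%E = (intg f)%:E.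
Proof.
move=> hf h0; rewrite int_restrict (_ : f \_ Omega = f) ?intE//.
apply/funext => x; rewrite patchE; case: ifPn => //; rewrite notin_setE => /h0 ->//.
Qed.

(** A bump on a rational ball inside [Omega] makes its products with the [bstep] functions
    admissible, so that [ae0_of_boxes] applies to [f] times the bump; the bump is positive inside
    the ball. *)
Lemma fundamental Omega f (M : R) : open Omega -> (forall x, Omega x -> `|x| <= M) ->
 mu.-integrable Omega (EFin \o f) ->
 (forall phi, test_function Omega phi -> (\int[mu]_(x in Omega) (f x * phi x)%:E)%E = 0%E) ->
 {ae mu, forall x, Omega x -> f x = 0}.
Proof.
move=> oO OM /(ible_restrict _ (open_meas oO)) iw h0.
set w := f \_ Omega in iw.
have [c [r [r0 hcr]]] := rational_balls.
suff hk k : {ae mu, forall x, (forall y, `|y - c k| <= r k -> Omega y) -> `|x - c k| < r k -> w x = 0}.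
 have := ae_foralln hk; apply: filterS => x hx Ox.
 have [e e0 he] := (openNP Omega).1 oO _ Ox; have [k [xk hk']] := hcr x e e0.
 have := hx k (fun y yk => he _ (hk' y yk)) xk.
 by rewrite /w patchE mem_set.
have [hO|hO] := pselect (forall y, `|y - c k| <= r k -> Omega y); last by apply: aeW.
have tb := bump_tfun (c k) (r0 k); have [Cb _ hCb] := tfun_bounded tb.
have ib : ible (fun x => w x * cbump (c k) (r k) x) by exact: ibleM_bdd (tfun_meas tb) hCb.
suff hz a b m : I{x, w x * cbump (c k) (r k) x * bstep a b m x} = 0.
 apply: filterS (ae0_of_boxes ib hz) => x + _ xk.
 by move/eqP; rewrite mulf_eq0 [_ (r k) x == 0]gt_eqF ?bump_gt0// orbF => /eqP.
have tt : test_function Omega (fun x => cbump (c k) (r k) x * bstep a b m x).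
 apply: test_of OM _; first by apply: smoothM; [exact: smooth_bump|exact: smooth_bstep].
 move=> x /closureNP hx; apply: hO; apply/ler_addgt0Pr => e e0.
 have [y /= hy yx] := hx e e0.
 have yr : `|y - c k| < r k.
  by rewrite ltNge; apply: contra hy => hy; rewrite bump_out// mul0r.
 by have := ler_distD y x (c k); rewrite (distrC x y); lra.
have /= := h0 _ tt; rewrite int_restrict => hh.
have -> : (fun x => w x * cbump (c k) (r k) x * bstep a b m x) =
  (fun x => f x * (cbump (c k) (r k) x * bstep a b m x)) \_ Omega.
 by apply/funext => x; rewrite /w !patchE; case: ifP => _; rewrite ?mul0r ?mulrA.
by rewrite /intg hh.
Qed.

Lemma weak_grad_unique Omega u g g' (M : R) : open Omega -> (forall x, Omega x -> `|x| <= M) ->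
 is_weak_grad Omega u g -> is_weak_grad Omega u g' -> {ae mu, forall x, Omega x -> g x = g' x}.
Proof.
move=> oO OM [iu ig hg] [_ ig' hg'].
have mO := open_meas oO.
suff hi (i : 'I_n) : {ae mu, forall x, Omega x -> g x$i - g' x$i = 0}.
 have hT : {ae mu, forall x, forall i, Omega x -> g x$i - g' x$i = 0}.
  exact: filter_forall.
 apply: filterS hT => x hx Ox; apply/rowP => i; apply/eqP; rewrite -subr_eq0; apply/eqP; exact: hx.
apply: (fundamental oO OM).
 by have := integrableB mO (ig i) (ig' i); apply: eq_integrable.
move=> phi tp; have tf := test_tfun tp; have [C _ hC] := tfun_bounded tf.
have ip (q : E -> R) : mu.-integrable Omega (EFin \o q) -> mu.-integrable Omega (EFin \o (fun x => q x * phi x)).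
 move=> /(ible_restrict _ mO) iq; apply/(ible_restrict _ mO).
 have := ibleM_bdd iq (tfun_meas tf) hC; congr ible; apply/funext => x.
 by rewrite !patchE; case: ifP => //; rewrite mul0r.
have -> : (fun x => ((g x$i - g' x$i) * phi x)%:E) = (fun x => (g x$i * phi x)%:E - (g' x$i * phi x)%:E)%E.
 by apply/funext => x; rewrite mulrBl EFinB.
have h1 := ip _ (ig i); have h2 := ip _ (ig' i).
rewrite integralB//; have := hg phi i tp; rewrite (hg' phi i tp) => /oppe_inj ->.
by rewrite subee// integrable_fin_num.
Qed.

End fundamental.

(** * Lipschitz functions in W^{1,1}_0 *)

Section weak_lipschitz.
Implicit Types (u f w phi : E -> R) (x y z v a b : E).

Lemma lip_bounded u (L M : R) : 0 <= L -> lipfun u L -> (forall x, M < `|x| -> u x = 0) ->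
 exists2 C : R, 0 <= C & forall x, `|u x| <= C.
Proof.
move=> L0 lu hM; exists (`|u 0| + L * `|M|); first by pos.
move=> x; have [xM|/hM ->] := leP `|x| M; last by rewrite normr0 addr_ge0// mulr_ge0.
have := lu x 0; rewrite subr0 => h.
have h2 : L * `|x| <= L * `|M| by rewrite ler_wpM2l// (le_trans xM)// ler_norm.
by have := ler_distD (u 0) (u x) 0; rewrite !subr0; lra.
Qed.

Lemma lipfunM u (v0 : E -> R) (Lu Lv Cu Cv : R) : lipfun u Lu -> lipfun v0 Lv -> (forall x, `|u x| <= Cu) ->
 (forall x, `|v0 x| <= Cv) -> lipfun (fun x => u x * v0 x) (Cu * Lv + Cv * Lu).
Proof.
move=> lu lv hu hv x y.
have -> : u x * v0 x - u y * v0 y = u x * (v0 x - v0 y) + v0 y * (u x - u y) by ring.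
rewrite (le_trans (ler_normD _ _))// mulrDl !normrM -!mulrA lerD//.
 by apply: ler_pM.
by apply: ler_pM.
Qed.

Lemma row_lin (s t : R) x y i : (s *: x + t *: y)$i = s * x$i + t * y$i.
Proof. by rewrite !mxE. Qed.

Lemma lip_ge0 u (L : R) (i : 'I_n) : lipfun u L -> 0 <= L.
Proof. by move=> /(_ (delta_mx ord0 i) 0); rewrite subr0 norm_delta mulr1; exact: le_trans. Qed.

Variables (Omega : set E) (M : R).
Hypotheses (oO : open Omega) (OM : forall x, Omega x -> `|x| <= M).

Let mO : measurable Omega := open_meas oO.

Lemma dct_on (f_ : nat -> E -> R) f (C : R) : 0 <= C -> (forall k, measurable_fun Omega (f_ k)) ->
 measurable_fun Omega f -> (forall k x, Omega x -> `|f_ k x| <= C) ->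
 {ae mu, forall x, Omega x -> f_ k x @[k --> \oo] --> f x} ->
 (fun k => \int[mu]_(x in Omega) `|f_ k x - f x|%:E)%E @ \oo --> 0%E.
Proof.
move=> C0 mf_ mf fC fcv.
have [g ig [gC g0]] := @ball_cutoff C M.
have mf_' k : mfun (f_ k \_ Omega) by exact/(measurable_restrictT _ mO).
have mf' : mfun (f \_ Omega) by exact/(measurable_restrictT _ mO).
have hb k x : `|(f_ k \_ Omega) x| <= g x.
 rewrite patchE; case: ifPn => [|xO]; first by rewrite inE => Ox; rewrite gC ?OM// fC.
 by rewrite normr0; have [/gC ->|/g0 ->] := leP `|x| M.
have [||iF cN _] := @int_dct (fun k => f_ k \_ Omega) (f \_ Omega) g mf_' mf' _ ig.
- apply: filterS fcv => x hx; have [Ox|Ox] := pselect (Omega x).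
  rewrite patchE mem_set// (_ : (fun k => _) = (fun k => f_ k x)); first exact: hx.
  by apply/funext => k; rewrite patchE mem_set.
 rewrite patchE memNset// (_ : (fun k => _) = (fun k => 0)); first exact: cvg_cst.
 by apply/funext => k; rewrite patchE memNset.
- by apply: aeW => x k; exact: hb.
have -> : (fun k => \int[mu]_(x in Omega) `|f_ k x - f x|%:E)%E =
  (fun k => (I{x, `|(f_ k \_ Omega) x - (f \_ Omega) x|})%:E).
 apply/funext => k; rewrite int_restrict -intE; last first.
  by apply/ible_norm/ibleB => //; exact: ible_le (hb k).
 congr integral; apply/funext => x; rewrite !patchE; case: ifP => // _.
 by rewrite subrr normr0.
by apply: cvg_EFin; [exact: nearW | exact: cN].
Qed.

(** [int_deriv] applied to the product of [u] with a test function. *)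
Lemma is_weak_grad_lip u (L : R) : lipfun u L -> (forall x, ~ Omega x -> u x = 0) ->
 {ae mu, forall x, Omega x -> hgrad u x (lgrad u x)} -> is_weak_grad Omega u (lgrad u).
Proof.
move=> lu uO hu.
have uM x : M < `|x| -> u x = 0.
 by move=> xM; apply: uO => /OM; rewrite leNgt xM.
have iu : ible u by exact: lip_ible lu uM.
split.
- by have := integrableS measurableT mO (@subsetT _ _) iu.
- move=> i; apply/ible_restrict => //.
 have [g ig [gC g0]] := @ball_cutoff L M.
 apply: ible_ae_le ig _.
  by apply/(measurable_restrictT _ mO); apply: measurable_funTS; apply: meas_lgrad lu.
 apply: filterS hu => x hx; rewrite patchE; case: ifPn => [|xO].
  by rewrite inE => Ox; rewrite gC ?OM//; exact: lip_grad_le lu (hx Ox).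
 rewrite normr0; have [xM|xM] := leP `|x| M; last by rewrite g0.
 by rewrite gC//; exact: lip_ge0 i lu.
move=> phi i tp; have tf := test_tfun tp; have L0 := lip_ge0 i lu.
have [Cp Cp0 hCp] := tfun_bounded tf; have [Lp Lp0 hLp] := tfun_lip tf.
have [Cu Cu0 hCu] := lip_bounded L0 lu uM.
have lF := lipfunM lu hLp hCu hCp.
pose g x := u x * partial i phi x + lgrad u x$i * phi x.
have mg : mfun g.
 apply: measurable_funD; apply: measurable_funM.
 - exact: lip_meas lu.
 - exact: tfun_meas (tfun_partial i tf).
 - exact: meas_lgrad lu.
 - exact: tfun_meas tf.
have [] // := @int_deriv (fun x => u x * phi x) _ M i g lF.
- by move=> x /uM ->; rewrite mul0r.
- apply: filterS hu => x hx; have [Ox|Ox] := pselect (Omega x).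
  have := hgrad_dq (i := i) (hgradM (hx Ox) (smooth_grad x tf.1)).
  by rewrite row_lin (gradE phi) /g (mulrC (lgrad u x$i)).
 (* Off [Omega] nothing is known about derivatives of [u], but [phi] vanishes there together with
    its gradient. *)
 have h0 := test_hgrad0 tp Ox.
 have p0 := test_out0 tp Ox.
 have cu : {for x, continuous u} by exact: (lip_cont lu).
 have := hgrad_dq (i := i) (hgradM0 h0 p0 cu); rewrite scaler0 mxE.
 rewrite /g p0 (partial_grad i h0) mxE !mulr0 addr0.
 by rewrite (_ : (fun z => phi z * u z) = (fun z => u z * phi z))//; apply/funext => z; rewrite mulrC.
move=> ig g0.
have [Cd _ hCd] := tfun_bounded (tfun_partial i tf).
have i1 : ible (fun x => u x * partial i phi x).
 by apply: ibleM_bdd hCd => //; exact: tfun_meas (tfun_partial i tf).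
have i2 : ible (fun x => lgrad u x$i * phi x).
 by have := ibleB ig i1; rewrite /g; under eq_fun do rewrite addrC addKr.
rewrite int_on//; last by move=> x /uO ->; rewrite mul0r.
rewrite int_on//; last by move=> x /(test_out0 tp) ->; rewrite mulr0.
have : I{x, u x * partial i phi x} + I{x, lgrad u x$i * phi x} = 0.
 by rewrite -intD.
by move=> /eqP; rewrite addr_eq0 => /eqP ->.
Qed.

Lemma is_weak_grad_get u g : is_weak_grad Omega u g -> is_weak_grad Omega u (weak_grad Omega u).
Proof. by move=> h; apply: getPex; exists g. Qed.

Lemma weak_grad_lip u (L : R) : lipfun u L -> (forall x, ~ Omega x -> u x = 0) ->
 {ae mu, forall x, Omega x -> hgrad u x (lgrad u x)} ->
 {ae mu, forall x, Omega x -> weak_grad Omega u x = lgrad u x}.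
Proof.
move=> lu uO hu; have h := is_weak_grad_lip lu uO hu.
exact: (weak_grad_unique oO OM (is_weak_grad_get h) h).
Qed.

(** Truncation pulls the support off the boundary before mollification. *)
Definition tr (tau : R) u x : R := max (u x - tau) 0.

Lemma max0_lip (a b : R) : `|max a 0 - max b 0| <= `|a - b|.
Proof.
by case: (leP a 0) => ha; case: (leP b 0) => hb; rewrite ?subrr ?normr0 ?subr0 ?sub0r ?normrN//;
 rewrite ?[leLHS]gtr0_norm// ler_normr; lra.
Qed.

Lemma tr_lip tau u (L : R) : lipfun u L -> lipfun (tr tau u) L.
Proof.
move=> lu x y; apply: le_trans (max0_lip _ _) _; rewrite opprB addrA subrK; exact: lu.
Qed.

Lemma tr_out tau u x : 0 <= tau -> u x <= tau -> tr tau u x = 0.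
Proof. by move=> t0 h; apply/max_idPr; lra. Qed.

Lemma tr_in tau u x : tau <= u x -> tr tau u x = u x - tau.
Proof. by move=> h; apply/max_idPl; lra. Qed.

Lemma tr_near tau u x : 0 <= tau -> 0 <= u x -> `|tr tau u x - u x| <= tau.
Proof.
move=> t0 u0; rewrite /tr; case: (leP (u x - tau) 0) => h.
 by rewrite sub0r normrN ger0_norm//; lra.
by rewrite addrAC subrr add0r normrN ger0_norm.
Qed.

(** The approximations are mollifications of truncations of [u]. Convergence of their gradients is
    pointwise at points of differentiability, with the Lipschitz constant as a uniform bound. *)
Lemma lip_W11_0 u (L : R) : 0 <= L -> lipfun u L -> (forall x, ~ Omega x -> u x = 0) ->
 (forall x, Omega x -> 0 < u x) -> {ae mu, forall x, Omega x -> hgrad u x (lgrad u x)} -> W11_0 Omega u.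
Proof.
move=> L0 lu uO uO0 hu; have hw := is_weak_grad_lip lu uO hu.
split; first by exists (lgrad u).
have uM x : M < `|x| -> u x = 0 by move=> xM; apply: uO => /OM; rewrite leNgt xM.
have u0 x : 0 <= u x.
 by have [/uO0/ltW|/uO ->] := pselect (Omega x).
have [C C0 hmol] := @mollifier.
(* The radius satisfies [L h <= step / 2]: within the distance [2 h] of a point off [Omega], [u]
   stays below the truncation level, so the support remains in [Omega]. *)
pose h k : R := step k / (2 * (L + 1)).
have h0 k : 0 < h k by rewrite divr_gt0 ?step_gt0// mulr_gt0// ltr_wpDl.
have hL k : L * h k <= step k / 2.
 have s0 := step_gt0 k.
 have -> : L * h k = (L / (L + 1)) * (step k / 2).
  by rewrite /h; field; pos.
 by rewrite ler_piMl ?divr_ge0 ?ltW// ltr_pdivrMr ?ltr_wpDl// mul1r ltrDl.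
have hs k : h k <= step k.
 have s0 := step_gt0 k; rewrite /h ler_pdivrMr ?mulr_gt0 ?ltr_wpDl//.
 by rewrite ler_peMr ?ltW//; lra.
have [eta hE] := choice (fun k => hmol (h k) (h0 k)).
pose v k := tr (step k) u.
have lv k : lipfun (v k) L by exact: tr_lip.
have vM k x : M < `|x| -> v k x = 0 by move=> /uM ux; apply: tr_out; rewrite ?ux ltW// step_gt0.
have iv k : ible (v k) by exact: lip_ible (lv k) (vM k).
pose phi k := convol (v k) (eta k).
have sphi k : smooth (phi k) by have [te _ _ _ _] := hE k; exact: smooth_conv.
have lphi k : lipfun (phi k) L by have [te e0 eo e1 _] := hE k; exact: conv_lip (lv k) (iv k).
have dphi k i x : `|partial i (phi k) x| <= L.
 by rewrite -gradE; exact: lip_grad_le (lphi k) (smooth_grad x (sphi k)).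
have tphi k : test_function Omega (phi k).
 apply: test_of OM _ => // x /closureNP hx; apply: contrapT => Ox; have ux := uO _ Ox.
 have s0 := step_gt0 k; have s2 : 0 < step k / (2 * (L + 1)) := h0 k.
 have [y /= hy yx] := hx _ s2; move/negP: hy; apply; apply/eqP.
 have [_ _ eo _ _] := hE k; apply: (conv_out eo) => z zy; apply: tr_out; first exact: ltW.
 have := lu z x; rewrite ux subr0 (ger0_norm (u0 z)) => /le_trans; apply.
 have := ler_distD y z x; have := hL k; move: yx zy; rewrite -/(h k) => yx zy hLk hd.
 have : L * `|z - x| <= L * (h k + h k) by rewrite ler_wpM2l//; lra.
 by pos.
have phi_near k x : `|phi k x - u x| <= 2 * step k.
 have [te e0 eo e1 _] := hE k.
 have h1 := conv_near te e0 eo e1 x L0 (lv k) (iv k).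
 have h2 := tr_near (ltW (step_gt0 k)) (u0 x).
 have := ler_distD (v k x) (phi k x) (u x); have := hL k; have := step_gt0 k.
 by move: h1 h2; rewrite -/(phi k) -/(v k); lra.
have [Cu Cu0 hCu] := lip_bounded L0 lu uM.
exists phi; split=> //.
have [iu ig _] := is_weak_grad_get hw.
have cA : (fun k => \int[mu]_(x in Omega) `|phi k x - u x|%:E)%E @ \oo --> 0%E.
 apply: (@dct_on _ _ (Cu + 2)); first by pos.
 - by move=> k; apply: measurable_funTS; exact: lip_meas (lphi k).
 - by apply: measurable_funTS; exact: lip_meas lu.
 - move=> k x _; have := phi_near k x; have := hCu x; have := ler_distD (u x) (phi k x) 0.
  by rewrite !subr0; have := step_le1 k; lra.
 apply: aeW => x _; apply/cvg_seqP => e e0.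
 have e2 : 0 < e / 2 by lra.
 have [N hN] := step_small e2; exists N => k /hN hk; apply: le_trans (phi_near k x) _; lra.
have cB i : (fun k => \int[mu]_(x in Omega) `|partial i (phi k) x - weak_grad Omega u x$i|%:E)%E @ \oo --> 0%E.
 apply: (@dct_on _ _ L) => //.
 - by move=> k; apply: measurable_funTS; apply: tfun_meas; exact: tfun_partial (test_tfun (tphi k)).
 - by have /measurable_int/measurable_EFinP := ig i.
 have hwl := weak_grad_lip lu uO hu; apply: filterS2 hu hwl => x hx hwx Ox.
 rewrite hwx//; apply/cvg_seqP => e e0.
 (* For large [k], [u] exceeds the truncation level on the whole ball of radius [h k] around [x];
    there the truncation only subtracts a constant. *)
 have ux := uO0 _ Ox; have eC : 0 < e / C by pos.
 have [d d0 hd] := hx Ox _ eC.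
 have m0 : 0 < min d (u x / 2) by pos.
 have [N hN] := step_small m0; exists N => k /hN; rewrite lt_min => /andP[k1 k2].
 have [te e0' eo e1 ed] := hE k; have s0 := step_gt0 k.
 have hloc (w : E) : `|w| <= h k -> `|v k (x + w) - v k x - dotv (lgrad u x) w| <= e / C * `|w|.
  move=> wh; have hLk := hL k.
  have Lw : L * `|w| <= step k / 2 by apply: le_trans hLk; rewrite ler_wpM2l.
  have := lu (x + w) x; rewrite addr_subK ler_norml => /andP[h1 _].
  rewrite /v !tr_in; [|by lra|by lra].
  rewrite opprB addrA subrK; apply: hd; apply: le_lt_trans wh _.
  by apply: le_lt_trans (hs k) _; lra.
 have := conv_partial_near te eo e1 i (iv k) (ltW eC) hloc.
 move=> /le_trans; apply.
 have eE : e = e / C * h k * (C / h k) by field; pos.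
 rewrite [leRHS]eE ler_wpM2l// mulr_ge0//; exact: ltW.
rewrite -[X in _ --> X]adde0; apply: cvgeD => //.
have := @cvg_nnesum _ \oo _ R 'I_n (index_enum 'I_n) _ (fun=> 0%E) xpredT _ (fun i _ => cB i).
rewrite big1// => h1; apply: h1 => i _; apply: nearW => k; exact: integral_ge0.
Qed.

End weak_lipschitz.

(** * Soft minima of barriers and averaged fields *)

Section softmin.
Implicit Types (x y z v : E).

(** The quantities of the last hypothesis, summed with the weights [th j * th l], give twice the
    covariance. *)
Lemma covariance_ge0 m (th : 'I_m -> R) (be : 'I_m -> 'I_m -> R) : (forall j, 0 <= th j) -> \sum_j th j = 1 ->
 (forall j l, 0 <= be j j - be j l - be l j + be l l) -> 0 <= \sum_j th j * (be j j - \sum_l th l * be j l).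
Proof.
move=> t0 t1 hb.
have T0 : 0 <= \sum_j \sum_l th j * (th l * (be j j - be j l - be l j + be l l)).
 by apply: sumr_ge0 => j _; apply: sumr_ge0 => l _; rewrite !mulr_ge0.
pose A := \sum_j th j * be j j; pose B := \sum_j th j * \sum_l th l * be j l.
have e1 : \sum_j th j * (be j j - \sum_l th l * be j l) = A - B.
 by rewrite /A /B -sumrB; apply: eq_bigr => j _; rewrite mulrBr.
have e2 : \sum_j \sum_l th j * (th l * (be j j - be j l - be l j + be l l)) = A - B - B + A.
 have -> : A - B - B + A = \sum_j th j * (be j j - \sum_l th l * be j l - \sum_l th l * be l j
   + \sum_l th l * be l l).
  have BE : B = \sum_j th j * \sum_l th l * be l j.
   rewrite /B; under eq_bigr do rewrite mulr_sumr.
   rewrite exchange_big/=; apply: eq_bigr => j _; rewrite mulr_sumr.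
   by apply: eq_bigr => l _; rewrite mulrCA.
  have AE : A = \sum_j th j * \sum_l th l * be l l by rewrite -mulr_suml t1 mul1r.
  rewrite {2}BE [in X in _ + X]AE /A /B -!sumrB -big_split/=.
  by apply: eq_bigr => j _; rewrite mulrDr !mulrBr.
 apply: eq_bigr => j _; rewrite -mulr_sumr; congr (_ * _).
 rewrite [in RHS](_ : be j j = \sum_l th l * be j j); last by rewrite -mulr_suml t1 mul1r.
 by rewrite -!sumrB -big_split/=; apply: eq_bigr => l _; rewrite mulrDr !mulrBr.
move: T0; rewrite e1 e2; lra.
Qed.

(** [w] is controlled on a ball only, beyond which [phi] vanishes; the mean value bound uses that
    the ball is convex. *)
Lemma lipfun_mul_loc (phi w : E -> R) (g : E -> E) (c : E) (r L C Cw Cg : R) :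
 0 <= L -> 0 <= C -> 0 <= Cw -> 0 <= Cg -> lipfun phi L -> (forall x, `|phi x| <= C) -> (forall x, r < `|x - c| -> phi x = 0) ->
 (forall x, `|x - c| <= r -> [/\ hgrad w x (g x), `|w x| <= Cw & `|g x| <= Cg]) ->
 lipfun (fun x => phi x * w x) (L * Cw + C * (n%:R * Cg)).
Proof.
move=> L0 C0 Cw0 Cg0 lp hC po hw.
have outer x y : `|x - c| <= r -> phi y = 0 -> `|phi x * w x - phi y * w y| <= (L * Cw + C * (n%:R * Cg)) * `|x - y|.
 move=> xr y0; have [_ w1 _] := hw x xr.
 rewrite y0 mul0r subr0 -[phi x]subr0 -y0 normrM.
 have h := lp x y; have k := ler_pM (normr_ge0 _) (normr_ge0 _) h w1.
 apply: le_trans k _; rewrite mulrDl mulrAC lerDl mulr_ge0// mulr_ge0// mulr_ge0//.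
move=> x y; have [xr|/po x0] := leP `|x - c| r; last first.
 have [yr|/po y0] := leP `|y - c| r; last first.
  by rewrite x0 y0 !mul0r subr0 normr0 mulr_ge0// addr_ge0// mulr_ge0// mulr_ge0.
 by rewrite distrC [`|x - y|]distrC; exact: outer.
have [yr|/po y0] := leP `|y - c| r; last exact: outer.
have cvx (t : R) : 0 <= t <= 1 -> `|y + t *: (x - y) - c| <= r.
 move=> /andP[t0 t1].
 have -> : y + t *: (x - y) - c = (1 - t) *: (y - c) + t *: (x - c).
  by apply/rowP => i; rewrite !mxE; ring.
 rewrite (le_trans (ler_normD _ _))// !normrZ (ger0_norm t0) ger0_norm ?subr_ge0//.
 have -> : r = (1 - t) * r + t * r by ring.
 by rewrite lerD// ler_wpM2l// subr_ge0.
have hg (t : R) : 0 <= t <= 1 -> hgrad w (y + t *: (x - y)) (g (y + t *: (x - y))).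
 by move=> /cvx/hw[].
have [s s01] := MVT_grad hg; rewrite (addrC y) subrK => hE.
have [_ _ gs] := hw _ (cvx s s01); have [_ w1 _] := hw _ xr.
have -> : phi x * w x - phi y * w y = w x * (phi x - phi y) + phi y * (w x - w y) by ring.
rewrite (le_trans (ler_normD _ _))// mulrDl !normrM lerD//.
 by rewrite (mulrC L) -mulrA ler_pM.
rewrite -mulrA ler_pM// hE (le_trans (dotv_le _ _))// -mulrA ler_wpM2l// ler_wpM2r//.
Qed.

Section fields.
Variables (m : nat) (s : R) (q : nat -> E -> R) (P Bf : nat -> E -> E) (A : nat -> E -> 'M[R]_n).
Variables (c : E) (r D : R) (kf : E -> R).
Hypotheses (s0 : 0 <= s) (D0 : 0 <= D) (hq : forall j z, `|z - c| <= r -> hgrad (q j) z (P j z))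
 (hB : forall j z i, `|z - c| <= r -> hgrad (fun y => Bf j y$i) z (row i (A j z)))
 (PD : forall j z, `|z - c| <= r -> `|P j z| <= D) (BD : forall j z, `|z - c| <= r -> `|Bf j z| <= D)
 (AD : forall j z k l, `|z - c| <= r -> `|A j z k l| <= D)
 (monoB : forall j l z, `|z - c| <= r -> 0 <= dotv (Bf j z - Bf l z) (P j z - P l z))
 (divA : forall j z, `|z - c| <= r -> \tr (A j z) <= - kf z).

Definition wexp j z : R := expR (- s * q j z).
Definition wsum z : R := \sum_(j < m.+1) wexp j z.
Definition wgt j z : R := wexp j z * (wsum z)^-1.
(** The weights are those of the gradient of the soft minimum [- (1 / s) log (sum_j exp (- s q_j))],
    which is [wmean]. They average the fields [Bf j], later [b (P j z)], instead of [b] being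
    applied to [wmean]: this is what makes the divergence computable. *)
Definition softfield z : E := \row_i \sum_(j < m.+1) wgt j z * Bf j z$i.
Definition wmean z : E := \sum_(l < m.+1) wgt l z *: P l z.
Definition soft_grad i z : E :=
 \sum_(j < m.+1) (wgt j z *: row i (A j z) + Bf j z$i *: ((- s * wgt j z) *: (P j z - wmean z))).

Lemma wexp_gt0 j z : 0 < wexp j z.
Proof. exact: expR_gt0. Qed.

Lemma wsum_gt0 z : 0 < wsum z.
Proof.
rewrite /wsum big_ord_recl ltr_wpDr ?wexp_gt0//; apply: sumr_ge0 => j _; exact/ltW/wexp_gt0.
Qed.

Lemma wgt_ge0 j z : 0 <= wgt j z.
Proof. by rewrite mulr_ge0 ?invr_ge0 ?ltW ?wexp_gt0 ?wsum_gt0. Qed.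

Lemma wgt_sum z : \sum_(j < m.+1) wgt j z = 1.
Proof. by rewrite -mulr_suml mulfV// gt_eqF// wsum_gt0. Qed.

Lemma hgrad_wexp j z : `|z - c| <= r -> hgrad (wexp j) z ((- s * wexp j z) *: P j z).
Proof.
move=> zr; have h := hgrad_comp1 (hgradZ (- s) (hq j zr)) (is_derive_expR (- s * q j z)).
by have := h; rewrite scalerA [expR _ * _]mulrC.
Qed.

Lemma hgrad_wgt j z : `|z - c| <= r -> hgrad (wgt j) z ((- s * wgt j z) *: (P j z - wmean z)).
Proof.
move=> zr; have hS : hgrad wsum z (\sum_(l < m.+1) (- s * wexp l z) *: P l z).
 by apply: hgrad_sum => l _; exact: hgrad_wexp.
have hV := hgradV (lt0r_neq0 (wsum_gt0 z)) hS.
have h := hgradM (hgrad_wexp j zr) hV.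
have -> : (- s * wgt j z) *: (P j z - wmean z) =
  wexp j z *: (- (wsum z) ^- 2 *: \sum_(l < m.+1) (- s * wexp l z) *: P l z)
  + (wsum z)^-1 *: ((- s * wexp j z) *: P j z); last exact: h.
rewrite scalerBr addrC; congr (_ + _); last by rewrite scalerA /wgt; congr (_ *: _); ring.
rewrite scalerA /wmean !scaler_sumr -sumrN; apply: eq_bigr => l _; rewrite !scalerA -scaleNr.
by congr (_ *: _); rewrite /wgt; field; rewrite gt_eqF// wsum_gt0.
Qed.

Lemma hgrad_softfield i z : `|z - c| <= r -> hgrad (fun y => softfield y$i) z (soft_grad i z).
Proof.
move=> zr; have -> : (fun y => softfield y$i) = (fun y => \sum_(j < m.+1) wgt j y * Bf j y$i).
 by apply/funext => y; rewrite mxE.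
apply: hgrad_sum => j _; apply: hgradM; [exact: hgrad_wgt | exact: hB].
Qed.

Lemma softfield_le z : `|z - c| <= r -> `|softfield z| <= D.
Proof.
move=> zr; apply: norm_le_coord => // i; rewrite mxE (le_trans (ler_norm_sum _ _ _))//.
rewrite -[leRHS]mul1r -(wgt_sum z) mulr_suml; apply: ler_sum => j _.
rewrite normrM ger0_norm ?wgt_ge0// ler_wpM2l ?wgt_ge0// (le_trans (coord_le_norm _ _))//.
exact: BD.
Qed.

Lemma wmean_le z : `|z - c| <= r -> `|wmean z| <= D.
Proof.
move=> zr; rewrite (le_trans (ler_norm_sum _ _ _))//.
rewrite -[leRHS]mul1r -(wgt_sum z) mulr_suml; apply: ler_sum => j _.
by rewrite normrZ ger0_norm ?wgt_ge0// ler_wpM2l ?wgt_ge0// PD.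
Qed.

Lemma soft_grad_le i z : `|z - c| <= r -> `|soft_grad i z| <= D + D * (s * (2 * D)).
Proof.
move=> zr; rewrite (le_trans (ler_norm_sum _ _ _))//.
rewrite -[leRHS]mul1r -[X in X * _](wgt_sum z) mulr_suml; apply: ler_sum => j _.
rewrite (le_trans (ler_normD _ _))// mulrDr lerD// normrZ.
 rewrite ger0_norm ?wgt_ge0// ler_wpM2l ?wgt_ge0// norm_le_coord// => k.
 by rewrite mxE AD.
rewrite normrZ normrM normrN (ger0_norm s0) (ger0_norm (wgt_ge0 j z)).
have h1 : `|Bf j z$i| <= D by rewrite (le_trans (coord_le_norm _ _))// BD.
have h2 : `|P j z - wmean z| <= 2 * D.
 by rewrite (le_trans (ler_normB _ _))// mulr2n mulrDl mul1r lerD ?PD ?wmean_le.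
have -> : wgt j z * (D * (s * (2 * D))) = D * (s * wgt j z * (2 * D)) by ring.
by apply: ler_pM => //; [rewrite mulr_ge0// mulr_ge0 ?wgt_ge0 | rewrite ler_wpM2l// mulr_ge0 ?wgt_ge0].
Qed.

(** The divergence is the average of the traces of [A j] minus [s] times the covariance of [Bf] and
    [P]. The monotonicity [monoB] makes the covariance nonnegative, so a large [s] does no harm. *)
Lemma soft_div z : `|z - c| <= r -> \sum_i soft_grad i z$i <= - kf z.
Proof.
move=> zr.
have -> : \sum_i soft_grad i z$i = \sum_(j < m.+1) wgt j z * \tr (A j z) -
  s * \sum_(j < m.+1) wgt j z * (dotv (Bf j z) (P j z) - \sum_(l < m.+1) wgt l z * dotv (Bf j z) (P l z)).
 rewrite mulr_sumr -sumrB.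
 transitivity (\sum_i \sum_(j < m.+1) (wgt j z *: row i (A j z) +
   Bf j z$i *: ((- s * wgt j z) *: (P j z - wmean z)))$i).
  by apply: eq_bigr => i _; rewrite summxE.
 rewrite exchange_big/=; apply: eq_bigr => j _.
 have -> : \sum_(l < m.+1) wgt l z * dotv (Bf j z) (P l z) = dotv (Bf j z) (wmean z).
  rewrite dotvC dotv_suml; apply: eq_bigr => l _; by rewrite dotvZl dotvC.
 rewrite -dotvBr /mxtrace /dotv !mulr_sumr -sumrB; apply: eq_bigr => i _; rewrite row_lin.
 move: (P j z - wmean z) => w; rewrite !mxE; ring.
have cov : 0 <= \sum_(j < m.+1) wgt j z * (dotv (Bf j z) (P j z) - \sum_(l < m.+1) wgt l z * dotv (Bf j z) (P l z)).
 apply: (covariance_ge0 (th := fun j : 'I_m.+1 => wgt j z)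
   (be := fun j l : 'I_m.+1 => dotv (Bf j z) (P l z))) => [j||j l]; first exact: wgt_ge0.
  exact: wgt_sum.
 have := monoB j l zr; rewrite !dotvBl !dotvBr; lra.
have := mulr_ge0 s0 cov; set X := s * _ => X0.
suff : \sum_(j < m.+1) wgt j z * \tr (A j z) <= - kf z by lra.
rewrite -[leRHS]mul1r -(wgt_sum z) mulr_suml; apply: ler_sum => j _.
by rewrite ler_wpM2l ?wgt_ge0// divA.
Qed.

Variables (phi : E -> R) (L : R).
Hypotheses (L0 : 0 <= L) (lphi : lipfun phi L) (phi_ge0 : forall x, 0 <= phi x)
 (phi_out : forall x, r < `|x - c| -> phi x = 0) (phi_diff : {ae mu, forall x, hgrad phi x (lgrad phi x)})
 (ikf : ible (fun x => kf x * phi x)).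

Lemma phi_out0 x : r + `|c| < `|x| -> phi x = 0.
Proof. by move=> h; apply: phi_out; have := ler_distD c x 0; rewrite !subr0; lra. Qed.

Lemma phi_out_hgrad x : r < `|x - c| -> hgrad phi x 0.
Proof.
move=> xr; have d0 : 0 < `|x - c| - r by lra.
apply: (hgrad_near d0 _ (hgrad_cst 0 x)) => z zx; rewrite phi_out//.
by have := ler_distD z x c; rewrite (distrC x z); lra.
Qed.

(* The functions [T] stands for are not known to be measurable, hence the comparison. *)
Lemma soft_inequality : exists T : E -> R, [/\ ible T, intg T = I{x, kf x * phi x} &
 {ae mu, forall x, (`|x - c| <= r -> T x <= dotv (softfield x) (lgrad phi x)) /\ (r < `|x - c| -> T x <= 0)}].
Proof.
have [C C0 hC] := lip_bounded L0 lphi phi_out0.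
pose F i x := phi x * softfield x$i.
have D1 : 0 <= D + D * (s * (2 * D)) by pos.
have lF i : lipfun (F i) (L * D + C * (n%:R * (D + D * (s * (2 * D))))).
 apply: (lipfun_mul_loc L0 C0 D0 D1 lphi hC phi_out (g := soft_grad i)) => x xr; split.
 - exact: hgrad_softfield.
 - by rewrite (le_trans (coord_le_norm _ _))// softfield_le.
 - exact: soft_grad_le.
have hF i : {ae mu, forall x, hgrad (F i) x (lgrad (F i) x) /\
  lgrad (F i) x = if `|x - c| <= r then phi x *: soft_grad i x + softfield x$i *: lgrad phi x else 0}.
 apply: filterS phi_diff => x hx; case: ifPn => xr.
  by have h := hgradM hx (hgrad_softfield i xr); rewrite (hgrad_lgrad h).
 rewrite -ltNge in xr; have h : hgrad (F i) x 0.
  have d0 : 0 < `|x - c| - r by lra.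
  apply: (hgrad_near d0 _ (hgrad_cst 0 x)) => z zx; rewrite /F phi_out ?mul0r//.
  by have := ler_distD z x c; rewrite (distrC x z); lra.
 by rewrite (hgrad_lgrad h).
have iF i : ible (fun x => lgrad (F i) x$i) /\ I{x, lgrad (F i) x$i} = 0.
 apply: (int_deriv (u := F i) (M := r + `|c|) (lF i)).
 - by move=> x /phi_out0 px; rewrite /F px mul0r.
 - by apply: meas_lgrad (lF i).
 - by apply: filterS (hF i) => x [h _]; exact: hgrad_dq.
have iS : ible (fun x => \sum_i lgrad (F i) x$i) by apply: ible_sum => i; exact: (iF i).1.
exists (fun x => \sum_i lgrad (F i) x$i + kf x * phi x); split.
- exact: ibleD.
- by rewrite intD// int_sum ?big1 ?add0r// => i; [move=> _; exact: (iF i).2|exact: (iF i).1].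
have hT : {ae mu, forall x, forall i, lgrad (F i) x = if `|x - c| <= r then phi x *: soft_grad i x + softfield x$i *: lgrad phi x else 0}.
 by apply: filter_forall => i; apply: filterS (hF i) => x [].
apply: filterS hT => x hx; split=> xr.
 have -> : \sum_i lgrad (F i) x$i = phi x * \sum_i soft_grad i x$i + dotv (softfield x) (lgrad phi x).
  rewrite mulr_sumr -big_split/=; apply: eq_bigr => i _; rewrite hx xr row_lin//.
 have h := ler_wpM2l (phi_ge0 x) (soft_div xr); move: h; rewrite mulrN mulrC; lra.
rewrite (phi_out xr) mulr0 addr0 big1// => i _; rewrite hx leNgt xr/= mxE//.
Qed.

End fields.

Section limit.
Variables (q : nat -> E -> R) (P : nat -> E -> E) (A : nat -> E -> 'M[R]_n) (be V : E -> E).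
Variables (c : E) (r D : R) (kf d : E -> R).
Let Bf j z := be (P j z).
Hypotheses (r0 : 0 < r) (D0 : 0 <= D) (hq : forall j z, `|z - c| <= r -> hgrad (q j) z (P j z))
 (hB : forall j z i, `|z - c| <= r -> hgrad (fun y => Bf j y$i) z (row i (A j z)))
 (PD : forall j z, `|z - c| <= r -> `|P j z| <= D) (BD : forall j z, `|z - c| <= r -> `|Bf j z| <= D)
 (AD : forall j z k l, `|z - c| <= r -> `|A j z k l| <= D)
 (monoB : forall j l z, `|z - c| <= r -> 0 <= dotv (Bf j z - Bf l z) (P j z - P l z))
 (divA : forall j z, `|z - c| <= r -> \tr (A j z) <= - kf z) (q_ge : forall j z, `|z - c| <= 2 * r -> d z <= q j z)
 (q_up : forall j z v, `|z - c| <= r -> q j (z + v) <= q j z + dotv (P j z) v + D * `|v| ^+ 2)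
 (q_dense : forall z (e : R), `|z - c| <= r -> 0 < e -> exists j, q j z <= d z + e).

(** A barrier almost touching [d] at [z] has almost the gradient of [d]: moving from [z] against
    [P j z - p] would otherwise bring it below [d], because of its quadratic upper bound. *)
Lemma active_gradient z p (dl : R) : `|z - c| <= r -> hgrad d z p -> 0 < dl ->
 exists2 et : R, 0 < et & forall j, q j z <= d z + et -> `|P j z - p| < dl.
Proof.
move=> zr hd dl0; have dl4 : 0 < dl / 4 by lra.
have [ro ro0 hro] := hd _ dl4.
have D1 : 0 < 4 * (D + 1) by pos.
(* A step for which the linear error of [d] and the quadratic error [D t] are each at most [dl / 4]
   per unit length; the gap [t * (dl / 4)] costs as much again. *)
pose t := min (ro / 2) (min r (dl / (4 * (D + 1)))).
have t0 : 0 < t by rewrite !lt_min r0 !divr_gt0.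
have t1 : t < ro by rewrite gt_min; apply/orP; left; lra.
have t2 : t <= r by rewrite !ge_min lexx !orbT.
have t3 : D * t <= dl / 4.
 have h3 : t <= dl / (4 * (D + 1)) by rewrite !ge_min lexx !orbT.
 have : (D + 1) * t <= dl / 4.
  have D2 : 0 < D + 1 by pos.
  apply: le_trans (ler_wpM2l (ltW D2) h3) _; apply: le_eq; field; pos.
 by pos.
exists (t * (dl / 4)); first by pos.
move=> j hj; have [->|w0] := eqVneq (P j z) p; first by rewrite subrr normr0.
set w := P j z - p; have wn : 0 < `|w| by rewrite normr_gt0 subr_eq0.
pose v := (- (t / `|w|)) *: w.
have nv : `|v| = t by rewrite normrZ normrN ger0_norm ?divfK ?gt_eqF// divr_ge0// ltW.
have h1 : q j (z + v) <= q j z + dotv (P j z) v + D * `|v| ^+ 2 by exact: q_up.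
have h2 : d (z + v) <= q j (z + v).
 by apply: q_ge; have := ler_distD z (z + v) c; rewrite addr_subK nv; lra.
have := hro v; rewrite nv => /(_ t1); rewrite ler_norml => /andP[h3 _].
have h4 : t * `|w| <= - dotv w v.
 have -> : - dotv w v = t / `|w| * dotv w w by rewrite /v dotvZr mulNr opprK.
 rewrite mulrAC ler_pdivlMr// -mulrA -expr2 ler_wpM2l ?(ltW t0)//; exact: norm_sq_le.
have h5 : dotv w v = dotv (P j z) v - dotv p v by rewrite dotvBl.
have h6 : t * `|w| <= t * (dl / 4 + dl / 4 + D * t) by move: h1; rewrite nv; lra.
by move: h6; rewrite ler_pM2l//; lra.
Qed.

(** The exponent is the square of the number of terms: an inactive term has weight at most
    [exp (- s et / 2) <= 2 / (s et)], so [m + 1] of them contribute [O(1 / m)]. *)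
Let sf m := softfield m (m.+1%:R ^+ 2) q Bf.

Lemma softfield_cvg z p : `|z - c| <= r -> hgrad d z p -> `|be p| <= D ->
 (forall e : R, 0 < e -> exists2 dl : R, 0 < dl & forall y, `|y - p| < dl -> `|be y - be p| <= e) ->
 forall e : R, 0 < e -> exists N, forall m, (N <= m)%N -> `|sf m z - be p| <= e.
Proof.
move=> zr hd bp cb e e0; have e2 : 0 < e / 2 by lra.
have [dl dl0 hdl] := cb _ e2; have [et et0 het] := active_gradient zr hd dl0.
have et2 : 0 < et / 2 by lra.
have [j0 hj0] := q_dense zr et2.
have k0 : 0 < (4 * D + 1) / et by pos.
have es : 0 < e / 2 / ((4 * D + 1) / et) by pos.
have [N0 hN0] := step_small es.
exists (maxn j0 N0) => m; rewrite geq_max => /andP[jm Nm].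
set s := (m.+1%:R ^+ 2 : R); have m0 : 0 < m.+1%:R :> R by [].
have s0 : 0 <= s by rewrite exprn_ge0.
pose X := expR (- (s * (et / 2))).
have wb (j : 'I_m.+1) : wgt m s q j z * `|Bf j z - be p| <= wgt m s q j z * (e / 2) + X * (2 * D).
 have wg := wgt_ge0 m s q j z; have X0 : 0 <= X by exact: expR_ge0.
 have [hj|hj] := leP (q j z) (d z + et).
  apply: ler_wpDr; first by pos.
  by rewrite ler_wpM2l// hdl// het.
 apply: ler_wpDl; first by pos.
 apply: ler_pM => //; last first.
  by rewrite (le_trans (ler_normB _ _))// mulr2n mulrDl mul1r lerD// BD.
 rewrite /wgt ler_pdivrMr ?wsum_gt0//.
 have hZ : wexp s q j0 z <= wsum m s q z.
  have jm' : (j0 < m.+1)%N by pos.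
  rewrite /wsum (bigD1 (Ordinal jm'))//= lerDl; apply: sumr_ge0 => l _; exact/ltW/wexp_gt0.
 apply: le_trans (ler_wpM2l X0 hZ); rewrite /wexp /X -expRD ler_expR.
 by have := ler_wpM2l s0 (ltW hj); have := ler_wpM2l s0 hj0; rewrite !mulrDr; lra.
have sE : sf m z - be p = \sum_(j < m.+1) wgt m s q j z *: (Bf j z - be p).
 apply/rowP => i; rewrite summxE mxE [sf m z _ _]mxE -[(- be p)$i]mul1r -[X in X * _](wgt_sum m s q z) mulr_suml.
 by rewrite -big_split/=; apply: eq_bigr => j _; rewrite !mxE mulrDr.
rewrite sE (le_trans (ler_norm_sum _ _ _))//.
apply: (@le_trans _ _ (\sum_(j < m.+1) (wgt m s q j z * (e / 2) + X * (2 * D)))).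
 by apply: ler_sum => j _; rewrite normrZ ger0_norm ?wb ?wgt_ge0.
rewrite big_split/= -mulr_suml wgt_sum mul1r sumr_const card_ord -mulr_natl.
have XX : X * (s * (et / 2)) <= 1.
 rewrite /X expRN mulrC ler_pdivrMr ?expR_gt0// mul1r.
 by apply: le_trans (expR_ge1Dx _); rewrite lerDr.
have hm : m.+1%:R * (X * (2 * D)) <= (4 * D + 1) / et * step m.
 rewrite /step ler_pdivlMr//.
 have -> : m.+1%:R * (X * (2 * D)) * m.+1%:R = X * (s * (et / 2)) * ((4 * D) / et).
  by rewrite /s; field; pos.
 apply: le_trans (_ : 1 * ((4 * D) / et) <= _); first by rewrite ler_wpM2r// divr_ge0 ?mulr_ge0// ltW.
 by rewrite mul1r ler_pM2r ?invr_gt0// lerDl.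
have : (4 * D + 1) / et * step m <= e / 2.
 by rewrite mulrC -ler_pdivlMr// ltW// hN0.
lra.
Qed.

Variables (phi : E -> R) (L : R).
Hypotheses (L0 : 0 <= L) (lphi : lipfun phi L) (phi_ge0 : forall x, 0 <= phi x)
 (phi_out : forall x, r < `|x - c| -> phi x = 0) (phi_diff : {ae mu, forall x, hgrad phi x (lgrad phi x)})
 (ikf : ible (fun x => kf x * phi x)) (mV : forall i, mfun (fun x => V x$i)).
Hypothesis hV : {ae mu, forall x, `|x - c| <= r -> exists p, [/\ hgrad d x p, V x = be p, `|be p| <= D &
 forall e : R, 0 < e -> exists2 dl : R, 0 < dl & forall y, `|y - p| < dl -> `|be y - be p| <= e]}.

Lemma ible_field : ible (fun x => dotv (V x) (lgrad phi x)).
Proof.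
have [g ig [gC g0]] := @ball_cutoff (n%:R * (D * L)) (r + `|c|).
have mU : mfun (fun x => dotv (V x) (lgrad phi x)).
 by apply: measurable_sum => i; apply: measurable_funM => //; apply: meas_lgrad lphi.
apply: ible_ae_le mU ig _; apply: filterS2 phi_diff hV => x hx hVx.
have [xr|xr] := leP `|x - c| r; last first.
 rewrite (hgrad_lgrad (phi_out_hgrad phi_out xr)) dotv0r normr0.
 have [h|h] := leP `|x| (r + `|c|); last by rewrite g0.
 by rewrite gC// mulr_ge0// mulr_ge0.
have [p [_ -> bp _]] := hVx xr; rewrite gC; last first.
 by have := ler_distD c x 0; rewrite !subr0; lra.
rewrite (le_trans (dotv_le _ _))// ler_wpM2l// ler_pM// norm_le_coord// => i.
exact: lip_grad_le lphi hx.
Qed.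

(** [soft_inequality] bounds the left side by integrals involving [sf m], and [sf m] tends to [V] at
    almost every point of the ball. *)
Lemma local_inequality : I{x, kf x * phi x} <= I{x, dotv (V x) (lgrad phi x)}.
Proof.
have iU := ible_field; set U := (fun x => dotv (V x) (lgrad phi x)) in iU *.
have hT m := soft_inequality m (exprn_ge0 2 (ler0n R m.+1)) D0 hq hB PD BD AD monoB divA L0 lphi phi_ge0 phi_out phi_diff ikf.
have [T hTm] := choice hT.
(* Only the positive part of [T m - U] is controlled; its dominated convergence to 0 is enough for
   an inequality. *)
pose pos m x := max (T m x - U x) 0.
have mpos m : mfun (pos m).
 have [iT _ _] := hTm m; apply: measurable_maxr; last exact: measurable_cst.
 apply: measurable_funB; [exact: ible_meas iT|exact: ible_meas iU].
have [g ig [gC g0]] := @ball_cutoff (n%:R * (D * L) + n%:R * (D * L)) (r + `|c|).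
have hle : {ae mu, forall x, forall m, (T m x - U x <= `|dotv (sf m x) (lgrad phi x) - U x| * (`|x - c| <= r)%R%:R)}.
 apply: ae_foralln => m; have [_ _ h] := hTm m; apply: filterS h => x [h1 h2].
 have [xr|xr] := leP `|x - c| r; first by rewrite mulr1 (le_trans _ (ler_norm _))// lerB// h1.
 by rewrite mulr0 /U (hgrad_lgrad (phi_out_hgrad phi_out xr)) dotv0r subr0 h2.
have hdl x : hgrad phi x (lgrad phi x) -> `|lgrad phi x| <= L.
 by move=> hx; apply: norm_le_coord => // i; exact: lip_grad_le lphi hx.
have hdom : {ae mu, forall x, forall m, `|pos m x| <= g x}.
 apply: filterS3 hle hV phi_diff => x h1 h2 h3 m; have dL := hdl x h3.
 have nDL : 0 <= n%:R * (D * L) by pos.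
 have bnd (w : E) : `|w| <= D -> `|dotv w (lgrad phi x)| <= n%:R * (D * L).
  by move=> wD; rewrite (le_trans (dotv_le _ _))// ler_wpM2l// ler_pM.
 rewrite ger0_norm ?le_max ?lexx ?orbT// ge_max; have := h1 m.
 have [xr|xr] := leP `|x - c| r.
  have xm : `|x| <= r + `|c| by have := ler_distD c x 0; rewrite !subr0; lra.
  rewrite mulr1 (gC _ xm) => /le_trans -> /=; first by pos.
  have [p [_ Vp bp _]] := h2 xr.
  rewrite (le_trans (ler_normB _ _))// lerD// bnd//; last by rewrite Vp.
  exact: (softfield_le _ _ _ D0 BD xr).
 rewrite mulr0 => h4; have g_ge0 : 0 <= g x.
  by have [/gC ->|/g0 ->//] := leP `|x| (r + `|c|); rewrite addr_ge0.
 by pos.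
have [] // := @int_dct pos (fun=> 0) g mpos.
- apply: filterS3 hle hV phi_diff => x h1 h2 h3; apply/cvg_seqP => e e0.
 have [xr|xr] := leP `|x - c| r; last first.
  exists 0 => m _; rewrite subr0 ger0_norm ?le_max ?lexx ?orbT// ge_max (ltW e0) andbT.
  by have := h1 m; rewrite (lt_geF xr) mulr0 => /le_trans -> //; exact: ltW.
 have [p [hd Vp bp cb]] := h2 xr.
 have ek : 0 < e / (n%:R * `|lgrad phi x| + 1) by pos.
 have [N hN] := softfield_cvg xr hd bp cb ek; exists N => m Nm.
 rewrite subr0 ger0_norm ?le_max ?lexx ?orbT// ge_max (ltW e0) andbT.
 apply: le_trans (h1 m) _; rewrite xr mulr1 /U Vp -dotvBl (le_trans (dotv_le _ _))//.
 rewrite mulrCA; apply: le_trans (ler_wpM2r _ (hN m Nm)) _; first by pos.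
 by rewrite mulrAC ler_pdivrMr// ler_wpM2l ?(ltW e0)// lerDl.
move=> _ _; rewrite int0 => hlim.
apply/ler_addgt0Pr => e e0; have /cvg_seqP/(_ _ e0)[N /(_ N (leqnn N))] := hlim.
rewrite subr0 => hN; have [iT IT _] := hTm N.
have ipos : ible (pos N) by apply: ible_ae_le (mpos N) ig _; apply: filterS hdom => x; exact.
rewrite -IT; apply: le_trans (_ : I{x, U x + pos N x} <= _).
 apply: int_le => //; first exact: ibleD.
 by move=> x; rewrite -lerBlDl le_max lexx.
by rewrite intD// lerD2l (le_trans (ler_norm _)).
Qed.

End limit.
End softmin.

(** * Powers and a smoothed positive part *)

Section calculus_ae.
Implicit Types (x y z v p : E) (f w : E -> R).

Definition adiff (phi : E -> R) := {ae mu, forall x, hgrad phi x (lgrad phi x)}.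

Lemma hgrad_pow f x g m : hgrad f x g -> hgrad (fun z => f z ^+ m) x ((m%:R * f x ^+ m.-1) *: g).
Proof.
move=> hf; have hX : is_derive (f x) 1 (fun s : R => s ^+ m) (m%:R * f x ^+ m.-1).
 have := @is_deriveX R R^o id m (f x) 1 1 (is_derive_id _ _).
 rewrite (_ : (fun s : R => s ^+ m) = id ^+ m); last by apply/funext => s; rewrite exprfctE.
 by rewrite /GRing.scale /= mulr1.
exact: (hgrad_comp1 hf hX).
Qed.

Lemma lipfunX f (L C : R) m : 0 <= L -> 0 <= C -> lipfun f L -> (forall x, `|f x| <= C) ->
 exists2 L' : R, 0 <= L' & lipfun (fun x => f x ^+ m) L'.
Proof.
move=> L0 C0 lf hC; have hCm k x : `|f x ^+ k| <= C ^+ k by rewrite normrX lerXn2r ?nnegrE.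
elim: m => [|m [L1 L10 hL1]].
 by exists 0 => // x y; rewrite !expr0 subrr normr0 mul0r.
exists (C * L1 + C ^+ m * L); first by pos.
have := lipfunM lf hL1 hC (hCm m).
by congr lipfun; apply/funext => x; rewrite exprS.
Qed.

(* A smooth-enough substitute for the positive part: [0 <= G' <= 1] and [s^+ - sig <= G s <= s^+]. *)
Definition spos (sig s : R) := Num.sqrt (max s 0 ^+ 2 + sig ^+ 2) - sig.

Lemma spos_den (sig s : R) : 0 < sig -> 0 < Num.sqrt (max s 0 ^+ 2 + sig ^+ 2).
Proof. by move=> h; rewrite sqrtr_gt0 ltr_wpDl ?sqr_ge0// exprn_gt0. Qed.

Lemma spos_neg (sig s : R) : 0 < sig -> s <= 0 -> spos sig s = 0.
Proof.
move=> sig0 /max_idPr s0; rewrite /spos s0 expr0n/= add0r sqrtr_sqr gtr0_norm// subrr//.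
Qed.

Lemma spos_bounds (sig s : R) : 0 < sig -> max s 0 - sig <= spos sig s <= max s 0.
Proof.
move=> sig0; have a0 : 0 <= max s 0 by rewrite le_max lexx orbT.
set a := max s 0 in a0 *; rewrite /spos -/a lerD2r lerBlDr; apply/andP; split.
 rewrite -{1}[a]ger0_norm// -sqrtr_sqr ler_sqrt ?addr_ge0 ?sqr_ge0// lerDl sqr_ge0//.
rewrite -[a + sig]ger0_norm ?addr_ge0 ?(ltW sig0)// -sqrtr_sqr ler_sqrt ?sqr_ge0//.
by rewrite sqrrD lerD2r lerDl mulrn_wge0// mulr_ge0// ltW.
Qed.

Lemma spos_ge0 (sig s : R) : 0 < sig -> 0 <= spos sig s.
Proof.
move=> sig0; rewrite /spos subr_ge0 -{1}[sig]gtr0_norm// -sqrtr_sqr ler_sqrt ?addr_ge0 ?sqr_ge0//.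
by rewrite lerDr sqr_ge0.
Qed.

(** With [X], [Y] the two square roots, [(X - Y) (X + Y) = (a - b) (a + b)] while [a <= X] and
    [b <= Y]. *)
Lemma spos_lip (sig s t : R) : 0 < sig -> `|spos sig s - spos sig t| <= `|s - t|.
Proof.
move=> sig0; apply: le_trans (max0_lip s t).
have a0 : 0 <= max s 0 by rewrite le_max lexx orbT.
have b0 : 0 <= max t 0 by rewrite le_max lexx orbT.
have X0 := spos_den s sig0; have Y0 := spos_den t sig0; rewrite /spos.
set a := max s 0 in a0 X0 *; set b := max t 0 in b0 Y0 *.
set X := Num.sqrt _ in X0 *; set Y := Num.sqrt (b ^+ 2 + _) in Y0 *.
have XX : X ^+ 2 = a ^+ 2 + sig ^+ 2 by rewrite sqr_sqrtr// addr_ge0 ?sqr_ge0.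
have YY : Y ^+ 2 = b ^+ 2 + sig ^+ 2 by rewrite sqr_sqrtr// addr_ge0 ?sqr_ge0.
have aX : a <= X by rewrite -[a]ger0_norm// -sqrtr_sqr ler_sqrt ?addr_ge0 ?sqr_ge0// lerDl sqr_ge0.
have bY : b <= Y by rewrite -[b]ger0_norm// -sqrtr_sqr ler_sqrt ?addr_ge0 ?sqr_ge0// lerDl sqr_ge0.
have -> : X - sig - (Y - sig) = X - Y by ring.
have XY : 0 < X + Y by pos.
rewrite -(ler_pM2r XY); have e1 : (X - Y) * (X + Y) = (a - b) * (a + b).
 have -> : (X - Y) * (X + Y) = X ^+ 2 - Y ^+ 2 by ring.
 by pos.
rewrite -{1}(gtr0_norm XY) -normrM e1 normrM ler_wpM2l// ger0_norm ?addr_ge0// lerD//.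
Qed.

Lemma hgrad_pos2 w x g : hgrad w x g -> hgrad (fun z => max (w z) 0 ^+ 2) x ((2 * max (w x) 0) *: g).
Proof.
move=> hw; have h2 := hgrad_pow 2 hw; rewrite /= expr1 in h2.
have /contNP cw := hgrad_cont hw.
case: (ltgtP (w x) 0) => wx.
- have m0 : 0 < - w x by pos.
 have [e e0 he] := cw _ m0; rewrite mulr0 scale0r.
 apply: (hgrad_near e0 _ (hgrad_cst 0 x)) => z /he; rewrite ltr_norml => /andP[_ h1].
 by rewrite max_r ?expr0n//; lra.
- have [e e0 he] := cw _ wx.
 apply: (hgrad_near e0 _ h2) => z /he; rewrite ltr_norml => /andP[h1 _].
 by rewrite max_l//; lra.
rewrite wx mulr0 scale0r; rewrite wx mulr0 scale0r in h2.
apply: (hgrad_squeeze (hgrad_cst 0 x) h2); rewrite ?wx ?maxxx ?expr0n//.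
exists 1 => // z _; rewrite sqr_ge0/=.
by case: (leP (w z) 0) => h; rewrite ?expr0n/= ?sqr_ge0.
Qed.

Lemma hgrad_spos (sig : R) w x g : 0 < sig -> hgrad w x g ->
 exists2 l : R, 0 <= l <= 1 & hgrad (fun z => spos sig (w z)) x (l *: g).
Proof.
move=> sig0 hw; have s2 : 0 < max (w x) 0 ^+ 2 + sig ^+ 2 by rewrite ltr_wpDl ?sqr_ge0// exprn_gt0.
have h1 := hgradD (hgrad_pos2 hw) (hgrad_cst (sig ^+ 2) x); rewrite addr0 in h1.
have h2 := hgradB (hgrad_comp1 h1 (is_derive1_sqrt s2)) (hgrad_cst sig x); rewrite subr0 scalerA in h2.
have a0 : 0 <= max (w x) 0 by rewrite le_max lexx orbT.
exists ((2 * Num.sqrt (max (w x) 0 ^+ 2 + sig ^+ 2))^-1 * (2 * max (w x) 0)); last exact: h2.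
have d0 := spos_den (w x) sig0; rewrite mulr_ge0 ?invr_ge0 ?mulr_ge0 ?(ltW d0)//=.
rewrite mulrC ler_pdivrMr ?mulr_gt0// mul1r ler_pM2l//.
by rewrite -{1}[max _ _]ger0_norm// -sqrtr_sqr ler_sqrt ?(ltW s2)// lerDl sqr_ge0.
Qed.

End calculus_ae.

(** * Extension by zero and independence of values off Omega *)

Section extension_by_zero.
Variable Omega : set E.

Definition ext0 (V : zmodType) (f : E -> V) x : V := if `[< Omega x >] then f x else 0.

Lemma ext0_in (V : zmodType) (f : E -> V) x : Omega x -> ext0 f x = f x.
Proof. by move=> h; rewrite /ext0 asboolT. Qed.

Lemma ext0_out (V : zmodType) (f : E -> V) x : ~ Omega x -> ext0 f x = 0.
Proof. by move=> h; rewrite /ext0 asboolF. Qed.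

End extension_by_zero.

Section extension.
Implicit Types (u v : E -> R).

Lemma is_weak_grad_ext (Omega : set E) u v : measurable Omega -> (forall x, Omega x -> u x = v x) ->
 is_weak_grad Omega u = is_weak_grad Omega v.
Proof.
move=> mO; suff imp u' v' g : (forall x, Omega x -> u' x = v' x) -> is_weak_grad Omega u' g -> is_weak_grad Omega v' g.
 move=> h; apply/funext => g; apply/propext; split; apply: imp => // x Ox; by rewrite h.
move=> h [iu ig hg]; split=> // [|phi i tp].
 by move: iu; apply: eq_integrable => // x; rewrite inE /= => Ox; rewrite h.
by rewrite -hg//; apply: eq_integral => x; rewrite inE => Ox; rewrite h.
Qed.

Lemma weak_grad_ext (Omega : set E) u v : measurable Omega -> (forall x, Omega x -> u x = v x) ->
 weak_grad Omega u = weak_grad Omega v.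
Proof. by move=> mO h; rewrite /weak_grad (is_weak_grad_ext mO h). Qed.

Lemma W11_0_ext (Omega : set E) u v : measurable Omega -> (forall x, Omega x -> u x = v x) -> W11_0 Omega u -> W11_0 Omega v.
Proof.
move=> mO h [[g hg] [phi [tp hphi]]]; split; first by exists g; rewrite -(is_weak_grad_ext mO h).
exists phi; split; first exact: tp.
rewrite -(weak_grad_ext mO h).
rewrite (_ : (fun k => _) = (fun k => \int[mu]_(x in Omega) `|phi k x - u x|%:E +
   \sum_(i < n) \int[mu]_(x in Omega) `|partial i (phi k) x - weak_grad Omega u x$i|%:E)%E); first exact: hphi.
apply/funext => k; congr (_ + _)%E; apply: eq_integral => x; rewrite inE => Ox; by rewrite h.
Qed.

Lemma functional_ext (Omega : set E) h f u v : measurable Omega -> (forall x, Omega x -> u x = v x) ->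
 functional h f Omega u = functional h f Omega v.
Proof.
move=> mO e; rewrite /functional -(weak_grad_ext mO e); apply: eq_integral => x; rewrite inE => Ox.
by rewrite e.
Qed.

(** [F] may take infinite values and fail to be integrable, so positive and negative parts are
    compared separately. *)
Lemma integral_ge_EFin (Omega : set E) (F : E -> \bar R) (L : E -> R) : measurable Omega ->
 measurable_fun Omega F -> mu.-integrable Omega (EFin \o L) -> (forall x, Omega x -> (L x)%:E <= F x)%E ->
 (\int[mu]_(x in Omega) (L x)%:E <= \int[mu]_(x in Omega) F x)%E.
Proof.
move=> mO mF iL LF; have mL : measurable_fun Omega (EFin \o L) by move/measurable_int : iL.
rewrite integralE [leRHS]integralE; apply: leeB.
 apply: ge0_le_integral => //; [exact: measurable_funepos|exact: measurable_funepos|].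
 by move=> x Ox; rewrite !funepos.unlock ge_max !le_max LF// lexx orbT.
apply: ge0_le_integral => //; [exact: measurable_funeneg|exact: measurable_funeneg|].
by move=> x Ox; rewrite !funeneg.unlock ge_max !le_max leeN2 LF// lexx orbT.
Qed.

End extension.

End euclidean_measure.

(** * Gauge and polar gauge of K *)

Section convex_body.
Notation "'I{' x , F }" := (intg (fun x => F)) (at level 0, x name).
Context {R : realType} {n : nat}.
Notation E := 'rV[R]_n.
Notation mu := (@lebesgue_rV R n).
Variable K : set E.
Hypotheses (HK : convex_body K) (KC2 : class_C2 K)
 (K_curv : forall y kappa, boundary K y -> principal_curvature K y kappa -> 0 < kappa).
Notation rho := (gauge K).
Notation rho0 := (gauge (polar K)).
Notation b := (grad (gauge K)).
Notation G := (hess (gauge K)).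

Section gauge.
Let Kc : compact K. Proof. by case: HK. Qed.
Let K0 : K° 0. Proof. by case: HK. Qed.
Let Kconv : forall x y (t : R), 0 <= t <= 1 -> K x -> K y -> K (t *: x + (1 - t) *: y). Proof. by case: HK. Qed.

Lemma K_ball : exists2 r : R, 0 < r & forall x, `|x| <= r -> K x.
Proof.
have /nbhs_rowP[e e0 he] := K0; exists (e / 2) => [|x xe]; first by pos.
by apply: he; rewrite subr0 (le_lt_trans xe)// ltr_pdivrMr// ltr_pMr// ltr1n.
Qed.

Lemma K_zero : K 0.
Proof. by have [r r0] := K_ball; apply; rewrite normr0 ltW. Qed.

Lemma gauge_le_scale (t : R) x : 0 <= t -> K x -> rho (t *: x) <= t.
Proof.
move=> t0 Kx; apply: ge_inf; last by split=> //; exists x.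
by exists 0 => s [].
Qed.

Lemma gauge_has_inf x : has_inf [set t | 0 <= t /\ exists2 y, K y & x = t *: y].
Proof.
split; last by exists 0 => s [].
have [r r0 hr] := K_ball; exists (`|x| / r); split; first by pos.
have [->|x0] := eqVneq x 0; first by exists 0; [exact: K_zero|rewrite scaler0].
have nx : 0 < `|x| by pos.
exists ((r / `|x|) *: x).
 by apply: hr; rewrite norm_rescale// ltW.
rewrite scalerA [X in X *: _](_ : _ = 1) ?scale1r//.
by field; pos.
Qed.

Lemma gauge_ge0 x : 0 <= rho x.
Proof. by apply: lb_le_inf; [have [] := gauge_has_inf x|move=> s []]. Qed.

Lemma gauge_lower : exists2 C : R, 0 < C & forall x, `|x| <= C * rho x.
Proof.
have [C C0 hC] := compact_bd Kc; exists C => // x.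
rewrite mulrC -ler_pdivrMr//; apply: lb_le_inf; first by have [] := gauge_has_inf x.
move=> s [s0 [y Ky ->]]; rewrite normrZ ger0_norm// ler_pdivrMr// ler_wpM2l//.
exact: hC.
Qed.

Lemma gauge_gt0 x : x != 0 -> 0 < rho x.
Proof.
move=> x0; have [C C0 hC] := gauge_lower; have := hC x.
by rewrite -(pmulr_rgt0 _ C0) => /lt_le_trans; apply; rewrite normr_gt0.
Qed.

Lemma gauge0 : rho 0 = 0.
Proof.
apply/le_anti; rewrite gauge_ge0 andbT -{1}(scale0r (0:E)).
by apply: gauge_le_scale => //; exact: K_zero.
Qed.

(** The infimum is attained: near-optimal points of [K] tend to [x / rho x], and [K] is closed. *)
Lemma gauge_decomp x : exists2 y, K y & x = rho x *: y.
Proof.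
have [->|x0] := eqVneq x 0; first by exists 0; [exact: K_zero|rewrite scaler0].
have g0 := gauge_gt0 x0; exists ((rho x)^-1 *: x); last first.
 by rewrite scalerA mulfV ?scale1r ?gt_eqF.
apply: closed_normP; first exact: compact_closed_row.
move=> e e0; pose d := e * rho x ^+ 2 / (`|x| + 1).
have d0 : 0 < d by rewrite divr_gt0 ?mulr_gt0 ?exprn_gt0// ltr_wpDl.
have [t [t0 [y Ky xE]] td] := inf_adherent d0 (gauge_has_inf x).
have gt : rho x <= t.
 by apply: ge_inf; [exists 0 => s []|split=> //; exists y].
have tp : 0 < t by pos.
exists y => //; have -> : y = t^-1 *: x by rewrite xE scalerA mulVf ?scale1r ?gt_eqF.
rewrite -scalerBl normrZ distrC.
have -> : (rho x)^-1 - t^-1 = (t - rho x) / (t * rho x) by field; pos.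
rewrite ger0_norm ?divr_ge0 ?subr_ge0 ?mulr_ge0// ?ltW//.
rewrite mulrAC ltr_pdivrMr ?mulr_gt0//.
have : t - rho x < d by pos.
rewrite /d ltr_pdivlMr ?ltr_wpDl// => h.
rewrite (@le_lt_trans _ _ ((t - rho x) * (`|x| + 1)))//.
 by pos.
apply: lt_le_trans h _; rewrite ler_pM2l// expr2 ler_pM2r//.
Qed.

Lemma gauge_le1 x : K x <-> rho x <= 1.
Proof.
split=> [Kx|h]; first by rewrite -[x]scale1r gauge_le_scale.
have [y Ky ->] := gauge_decomp x.
rewrite -[_ *: _]addr0 -(scaler0 _ (1 - rho x)); apply: Kconv => //.
 by rewrite gauge_ge0.
exact: K_zero.
Qed.

Lemma gaugeZ (s : R) x : 0 <= s -> rho (s *: x) = s * rho x.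
Proof.
have hle (t : R) y : 0 <= t -> rho (t *: y) <= t * rho y.
 move=> t0; have [z Kz {1}->] := gauge_decomp y; rewrite scalerA.
 by apply: gauge_le_scale => //; rewrite mulr_ge0// gauge_ge0.
move=> s0; apply/le_anti; rewrite hle//=.
move: s0; rewrite [0 <= s]le_eqVlt => /predU1P[<-|s0]; first by rewrite mul0r gauge_ge0.
rewrite mulrC -ler_pdivlMr// mulrC; apply: le_trans (hle _ _ _); last by pos.
by rewrite scalerA mulVf ?scale1r ?gt_eqF.
Qed.

Lemma gaugeD x y : rho (x + y) <= rho x + rho y.
Proof.
have [a Ka xE] := gauge_decomp x; have [b Kb yE] := gauge_decomp y.
have gx := gauge_ge0 x; have gy := gauge_ge0 y.
have [s0|s0] := eqVneq (rho x + rho y) 0.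
 have hx : rho x = 0 by pos.
 have hy : rho y = 0 by pos.
 by rewrite s0 {1}xE {1}yE hx hy !scale0r addr0 gauge0.
have sp : 0 < rho x + rho y by pos.
have -> : x + y = (rho x + rho y) *: ((rho x / (rho x + rho y)) *: a + (1 - rho x / (rho x + rho y)) *: b).
 rewrite scalerDr !scalerA mulrC divfK// mulrBr mulr1 mulrC divfK//.
 by rewrite addrAC subrr add0r -xE -yE.
apply: gauge_le_scale; first exact: ltW.
by apply: Kconv => //; rewrite divr_ge0 ?addr_ge0//= ler_pdivrMr// mul1r lerDl.
Qed.

Lemma gauge_upper : exists2 C : R, 0 < C & forall x, rho x <= C * `|x|.
Proof.
have [r r0 hr] := K_ball; exists r^-1; first by pos.
move=> x; have [->|x0] := eqVneq x 0; first by rewrite gauge0 normr0 mulr0.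
have nx : 0 < `|x| by pos.
have {1}-> : x = (r^-1 * `|x|) *: ((r / `|x|) *: x).
 rewrite scalerA [X in X *: _](_ : _ = 1) ?scale1r//.
 by field; pos.
apply: gauge_le_scale; first by pos.
by apply: hr; rewrite norm_rescale// ltW.
Qed.

Lemma gauge_lip : exists2 C : R, 0 < C & forall x y, `|rho x - rho y| <= C * `|x - y|.
Proof.
have [C C0 hC] := gauge_upper; exists C => // x y.
have h a b : rho a - rho b <= C * `|a - b|.
 by rewrite lerBlDr (le_trans _ (lerD (hC _) (lexx _)))// -{1}[a](subrK b) gaugeD.
by rewrite ler_norml h andbT lerNl opprB distrC h.
Qed.

Lemma gauge_continuous : continuous rho.
Proof. by have [C C0 hC] := gauge_lip; exact: lip_cont hC. Qed.

Lemma bd_gauge x : boundary K x <-> rho x = 1.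
Proof.
split=> [[cKx nKx]|h].
 have Kx : K x by apply: (compact_closed_row Kc).
 have := (gauge_le1 x).1 Kx; rewrite le_eqVlt => /orP[/eqP//|h].
 exfalso; apply: nKx; apply/nbhs_rowP.
 have /contNP/(_ (1 - rho x)) := @gauge_continuous x.
 rewrite subr_gt0 => /(_ h)[d d0 hd]; exists d => // y /hd.
 rewrite ltr_norml => /andP[_]; rewrite ltrD2r => /ltW hy.
 exact/gauge_le1.
split; first by apply: subset_closure; apply/gauge_le1; rewrite h.
move=> /nbhs_rowP[e e0 he]; have x0 : x != 0.
 by apply/eqP => x0; move: h; rewrite x0 gauge0 => /eqP; rewrite eq_sym oner_eq0.
have nx : 0 < `|x| by pos.
have d0 : 0 < e / (2 * `|x|) by pos.
have /he/gauge_le1 : `|(1 + e / (2 * `|x|)) *: x - x| < e.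
 rewrite scalerDl scale1r addr_subK normrZ ger0_norm ?ltW//.
 rewrite [X in X < _](_ : _ = e / 2); last by field; pos.
 by pos.
rewrite gaugeZ ?h ?mulr1; first by pos.
by pos.
Qed.

Lemma interior_gauge x : K° x <-> rho x < 1.
Proof.
split=> [h|h].
 have Kx : K x by exact: interior_subset.
 have := (gauge_le1 x).1 Kx; rewrite le_eqVlt => /orP[/eqP/bd_gauge[_ []]//|//].
have [//|nK] := pselect (K° x); have : boundary K x.
 by split=> //; apply/subset_closure/gauge_le1; rewrite ltW.
by move=> /bd_gauge e; move: h; rewrite e ltxx.
Qed.

Lemma boundaryK_compact : compact (boundary K).
Proof.
apply: subclosed_compact Kc _; first exact: boundary_closed.
by move=> x /bd_gauge h; apply/gauge_le1; rewrite h.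
Qed.

(** The gauge of the polar set is the support function of [K], attained by compactness. *)
Lemma polar_gaugeP x : exists2 p, K p /\ dotv p x = rho0 x & forall q, K q -> dotv q x <= rho0 x.
Proof.
have [||p Kp hp] := @compact_argmax _ _ K (dotv^~ x) _ Kc.
- by exists 0; exact: K_zero.
- move=> y _; rewrite (_ : dotv^~ x = dotv x); first exact: dotv_continuous.
 by apply/funext => z; exact: dotvC.
suff e : rho0 x = dotv p x by exists p; rewrite e.
have p0 : 0 <= dotv p x by rewrite -(dotv0l x); apply/hp/K_zero.
have lb t : 0 <= t -> (exists2 y, polar K y & x = t *: y) -> dotv p x <= t.
 by move=> t0 [y Py ->]; rewrite dotvZr ler_piMr// dotvC Py.
have posn : x != 0 -> 0 < dotv p x.
 move=> x0; have [r r0 hr] := K_ball; have nx : 0 < `|x| by pos.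
 have /hp : K ((r / `|x|) *: x).
  by apply: hr; rewrite norm_rescale// ltW.
 by apply: lt_le_trans; rewrite dotvZl mulr_gt0 ?divr_gt0// dotvv_gt0.
apply/le_anti/andP; split.
 apply: ge_inf; first by exists 0 => s [].
 split=> //; have [->|x0] := eqVneq x 0.
  by exists 0; [move=> y _; rewrite dotv0l ler01|rewrite scaler0].
 exists ((dotv p x)^-1 *: x); last first.
  by rewrite scalerA mulfV ?scale1r ?gt_eqF ?posn.
 by move=> q Kq; rewrite dotvZl mulrC ler_pdivrMr ?posn// mul1r dotvC hp.
apply: lb_le_inf; last by move=> t [t0 ht]; exact: lb.
have [x0|x0] := eqVneq x 0.
 exists 0; split=> //; exists 0; last by rewrite x0 scaler0.
 by move=> y _; rewrite dotv0l ler01.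
exists (dotv p x); split=> //; exists ((dotv p x)^-1 *: x); last first.
 by rewrite scalerA mulfV ?scale1r ?gt_eqF ?posn.
by move=> q Kq; rewrite dotvZl mulrC ler_pdivrMr ?posn// mul1r dotvC hp.
Qed.

Lemma dotv_polar p x : K p -> dotv p x <= rho0 x.
Proof. by have [q _ h] := polar_gaugeP x; exact: h. Qed.

Lemma dotv_gauge p x : dotv p x <= rho p * rho0 x.
Proof.
have [q Kq {1}->] := gauge_decomp p.
by rewrite dotvZl ler_wpM2l ?gauge_ge0// dotv_polar.
Qed.

Lemma polar_ge0 x : 0 <= rho0 x.
Proof. by rewrite -(dotv0l x) dotv_polar//; exact: K_zero. Qed.

Lemma polar0 : rho0 0 = 0.
Proof. by have [p [_ <-] _] := polar_gaugeP 0; rewrite dotv0r. Qed.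

Lemma polarZ (t : R) x : 0 <= t -> rho0 (t *: x) = t * rho0 x.
Proof.
move=> t0; have [p [Kp e] _] := polar_gaugeP (t *: x).
have [q [Kq e'] _] := polar_gaugeP x.
apply/le_anti/andP; split; first by rewrite -e dotvZr ler_wpM2l// dotv_polar.
by rewrite -e' -dotvZr dotv_polar.
Qed.

Lemma polarD x y : rho0 (x + y) <= rho0 x + rho0 y.
Proof.
have [p [Kp <-] _] := polar_gaugeP (x + y).
by rewrite dotvDr lerD// dotv_polar.
Qed.

Lemma polar_upper : exists2 C : R, 0 < C & forall x, rho0 x <= C * `|x|.
Proof.
have [C C0 hC] := compact_bd Kc; exists (n%:R * C + 1).
 by pos.
move=> x; have [p [Kp <-] _] := polar_gaugeP x.
rewrite (le_trans (ler_norm _))// (le_trans (dotv_le _ _))// mulrA ler_wpM2r//.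
by rewrite ler_wpDr// ler_wpM2l// hC.
Qed.

Lemma polar_lower : exists2 c : R, 0 < c & forall x, c * `|x| <= rho0 x.
Proof.
have [r r0 hr] := K_ball; exists r => // x.
have [->|x0] := eqVneq x 0; first by rewrite normr0 mulr0 polar_ge0.
have nx : 0 < `|x| by pos.
have /(@dotv_polar _ x) : K ((r / `|x|) *: x).
 by apply: hr; rewrite norm_rescale// ltW.
apply: le_trans; rewrite dotvZl mulrAC ler_pdivlMr// -mulrA -expr2 ler_pM2l//.
exact: norm_sq_le.
Qed.

Lemma polar_gt0 x : x != 0 -> 0 < rho0 x.
Proof.
move=> x0; have [c c0 hc] := polar_lower; apply: lt_le_trans (hc x).
by pos.
Qed.

Lemma polar_lip : exists2 C : R, 0 < C & forall x y, `|rho0 x - rho0 y| <= C * `|x - y|.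
Proof.
have [C C0 hC] := polar_upper; exists C => // x y.
have h a b : rho0 a - rho0 b <= C * `|a - b|.
 by rewrite lerBlDr (le_trans _ (lerD (hC _) (lexx _)))// -{1}[a](subrK b) polarD.
by rewrite ler_norml h andbT lerNl opprB distrC h.
Qed.

Lemma polar_continuous : continuous rho0.
Proof. by have [C C0 hC] := polar_lip; exact: lip_cont hC. Qed.

Lemma max_boundary p x : x != 0 -> K p -> dotv p x = rho0 x -> rho p = 1.
Proof.
move=> x0 Kp e; apply/le_anti; rewrite (gauge_le1 p).1//=.
have := dotv_gauge p x; rewrite e -{1}[rho0 x]mul1r ler_pM2r//; exact: polar_gt0.
Qed.

Let gg := gauge_gt0.

(** [K] contains a small multiple [w] of the gradient, and [phi] cannot increase at [p] towards [w],
    the segment being in [K]; hence [dotv g p >= dotv g w > 0]. *)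
Lemma defining_radial_gt0 (phi : E -> R) V p : open V -> V p -> K p -> hgrad phi p (grad phi p) ->
 (forall x, V x -> K x -> phi x <= 0) -> phi p = 0 -> grad phi p != 0 -> 0 < dotv (grad phi p) p.
Proof.
move=> /openNP oV Vp Kp hg le0 p0 g0; set g := grad phi p in hg g0 *.
have [r r0 hr] := K_ball.
have ng : 0 < `|g| by pos.
pose w := (r / `|g|) *: g.
have Kw : K w by apply: hr; rewrite norm_rescale// ltW.
suff : dotv g w <= dotv g p.
 by apply: lt_le_trans; rewrite dotvZr mulr_gt0 ?divr_gt0 ?dotvv_gt0.
rewrite -subr_le0 -dotvBr leNgt; apply/negP => h.
set v := w - p in h; have v0 : v != 0.
 by apply/eqP => v0; move: h; rewrite v0 dotv0r ltxx.
have nv : 0 < `|v| by pos.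
pose e := dotv g v / (2 * `|v|); have e0 : 0 < e by rewrite divr_gt0// mulr_gt0.
have [d d0 hd] := hg _ e0; have [d1 d10 hd1] := oV _ Vp.
pose m := min 1 (min d d1).
have m0 : 0 < m by rewrite !lt_min ltr01 d0.
have m1 : m <= 1 by rewrite ge_min lexx.
pose t := m / (2 * (`|v| + 1)).
have v1 : 0 < `|v| + 1 by pos.
have t0 : 0 < t by rewrite divr_gt0// mulr_gt0.
have tv : `|t *: v| < min d d1.
 apply: (@lt_le_trans _ _ m); last by rewrite ge_min lexx orbT.
 rewrite normrZ gtr0_norm// /t mulrAC ltr_pdivrMr ?mulr_gt0// ltr_pM2l//.
 by pos.
have t1 : t <= 1.
 rewrite ler_pdivrMr ?mulr_gt0// mul1r (le_trans m1)//.
 by have := normr_ge0 v; lra.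
move: tv; rewrite lt_min => /andP[tvd tvd1].
have Vt : V (p + t *: v) by apply: hd1; rewrite addr_subK.
have Kt : K (p + t *: v).
 have -> : p + t *: v = t *: w + (1 - t) *: p.
  by rewrite scalerBr scalerBl scale1r addrCA.
 by apply: Kconv => //; rewrite (ltW t0).
have := hd _ tvd; rewrite p0 subr0 ler_norml dotvZr normrZ (gtr0_norm t0) => /andP[+ _].
have -> : e * (t * `|v|) = t * dotv g v / 2 by rewrite /e; field; pos.
have := le0 _ Vt Kt; have := mulr_gt0 t0 h; lra.
Qed.

Definition rnorm (x : E) : E := (rho x)^-1 *: x.

Lemma gauge_rnorm x : x != 0 -> rho (rnorm x) = 1.
Proof.
move=> x0; rewrite gaugeZ ?invr_ge0 ?gauge_ge0// mulVf// gt_eqF//; exact: gg.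
Qed.

Lemma gauge_neq0 x : rho x = 1 -> x != 0.
Proof.
move=> h; apply/eqP => x0; move: h; rewrite x0 gauge0// => /eqP.
by rewrite eq_sym oner_eq0.
Qed.

(* Implicit differentiation of [phi (rnorm x) = 0]. *)
Lemma gauge_hgrad (phi : E -> R) V p : open V -> V p -> rho p = 1 ->
 hgrad phi p (grad phi p) -> (forall x, V x -> rho x = 1 -> phi x = 0) -> 0 < dotv (grad phi p) p ->
 hgrad rho p ((dotv (grad phi p) p)^-1 *: grad phi p).
Proof.
move=> /openNP oV Vp rp hg phi0; set g := grad phi p in hg *; set S := dotv g p => S0.
have [C C0 hC] := gauge_lip.
have [d1 d10 hd1] := oV _ Vp.
move=> e e0; pose L := 2 * (1 + C * `|p|).
have L0 : 0 < L by rewrite mulr_gt0// ltr_wpDr// mulr_ge0// ltW.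
pose e1 := e * S / (4 * L); have e10 : 0 < e1 by rewrite /e1 divr_gt0// mulr_gt0.
have [d d0 hd] := hg _ e10.
exists (min (2^-1 / C) (min (d / L) (d1 / L))).
 by pos.
move=> v; rewrite !lt_min => /and3P[vC vd vd1].
rewrite rp; set s := rho (p + v) - 1.
have rs : rho (p + v) = 1 + s by rewrite /s [1 + _]addrC subrK.
have sC : `|s| <= C * `|v| by have := hC (p + v) p; rewrite rp addr_subK.
have s2 : `|s| <= 2^-1.
 by rewrite (le_trans sC)// mulrC -ler_pdivlMr// ltW.
have s1 : 2^-1 <= 1 + s by move: s2; rewrite ler_norml => /andP[]; lra.
have s1p : 0 < 1 + s by lra.
pose w := (1 + s)^-1 *: (v - s *: p).
have wE : rnorm (p + v) = p + w.
 apply: (scalerI (lt0r_neq0 s1p)).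
 rewrite /rnorm rs scalerA mulfV ?gt_eqF// scale1r [RHS]scalerDr /w scalerA mulfV ?gt_eqF//.
 by rewrite scale1r scalerDl scale1r addrACA subrr addr0.
have is2 : (1 + s)^-1 <= 2 by rewrite -[2]invrK lef_pV2 ?posrE ?invr_gt0.
have wv : `|w| <= L * `|v|.
 rewrite normrZ gtr0_norm ?invr_gt0// /L -mulrA ler_pM ?invr_ge0 ?(ltW s1p)//.
 rewrite (le_trans (ler_normB _ _))// mulrDl mul1r lerD2l normrZ.
 by rewrite mulrAC ler_wpM2r.
have pv0 : p + v != 0.
 by apply/eqP => pv; move: rs; rewrite pv gauge0// => h; move: s1p; rewrite -h ltxx.
have wd (k : R) : `|v| < k / L -> `|w| < k.
 by rewrite ltr_pdivlMr// mulrC; exact: le_lt_trans.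
have Vw : V (p + w) by apply: hd1; rewrite addr_subK wd.
have := hd _ (wd _ vd); rewrite (phi0 _ Vp rp) subr0 -wE (phi0 (rnorm _)) ?gauge_rnorm ?wE//.
rewrite sub0r normrN /w dotvZr normrM gtr0_norm ?invr_gt0// dotvBr dotvZr -/S => h.
rewrite dotvZl -[S^-1 * _]opprK opprK.
have -> : s - S^-1 * dotv g v = - S^-1 * (dotv g v - s * S) by field; pos.
have iS0 : 0 < S^-1 by pos.
rewrite normrM normrN (gtr0_norm iS0) ler_pdivrMl//.
have h2 : `|dotv g v - s * S| <= (1 + s) * (e1 * `|w|).
 by rewrite -ler_pdivrMl.
rewrite (le_trans h2)//.
have s3 : 1 + s <= 2 by move: s2; rewrite ler_norml => /andP[]; lra.
rewrite (@le_trans _ _ (2 * (e1 * (L * `|v|))))//.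
 apply: ler_pM => //; [exact: ltW|by pos|].
 by apply: ler_wpM2l => //; exact: ltW.
have -> : 2 * (e1 * (L * `|v|)) = e * S * `|v| / 2 by rewrite /e1; field; pos.
have := mulr_ge0 (mulr_ge0 (ltW e0) (ltW S0)) (normr_ge0 v); lra.
Qed.

Lemma hgrad_gaugeZ x g (t : R) : 0 < t -> hgrad rho x g -> hgrad rho (t *: x) g.
Proof. by move=> t0; apply: hgrad_homog => // k z k0; exact: gaugeZ. Qed.

(** On the unit level set the gradient of [rho] is that of a defining function divided by its radial
    derivative; homogeneity extends it along rays through [rnorm]. Regularity is then
    bootstrapped. *)
Lemma gauge_C2 : classC 2 [set x | x != 0] rho.
Proof.
apply: classC_local => x /= x0; pose p := rnorm x.
have rp : rho p = 1 by exact: gauge_rnorm.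
have [phi [V0 [oV0 V0p cphi g0 hphi]]] := KC2 ((bd_gauge p).2 rp).
have phi0 y : V0 y -> rho y = 1 -> phi y = 0.
 by move=> V0y ry; apply/(hphi y V0y).2/bd_gauge.
have phile y : V0 y -> K y -> phi y <= 0.
 move=> V0y /gauge_le1; rewrite le_eqVlt => /predU1P[/phi0 ->//|h].
 by apply/ltW/(hphi y V0y).1/interior_gauge.
have c1 : classC 1 V0 phi by exact: classC_le cphi.
pose S z := \sum_i partial i phi z * z$i.
have SE z : S z = dotv (grad phi z) z.
 by apply: eq_bigr => i _; rewrite gradE.
have cS : classC 1 V0 S.
 apply: classC_sum => [//|i _]; apply: classCM; [exact: oV0| |exact: classC_coord].
 by have [] := cphi i.
pose V := V0 `&` [set z | 0 < S z].
have oV : open V.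
 apply/openNP => z [V0z Sz]; have [d d0 hd] := (openNP V0).1 oV0 _ V0z.
 have /contNP/(_ _ Sz)[d1 d10 hd1] := (classC_le oV0 (leq0n 1) cS : classC 0 V0 S) z V0z.
 exists (min d d1) => [|y]; first by pos.
 rewrite lt_min => /andP[yd /hd1]; rewrite ltr_norml => /andP[+ _].
 by rewrite ltrBrDl subrr => h; split=> //; exact: hd.
have Vp : V p.
 split=> //=; rewrite SE; apply: (defining_radial_gt0 oV0) => //.
 - by apply/gauge_le1; rewrite rp.
 - exact: (C1_hgrad oV0).
 - exact: phi0.
pose B i z := partial i phi z * (S z)^-1.
have cB i : classC 1 V (B i).
 have VV0 : V `<=` V0 by move=> z [].
 apply: classCM => //; first by apply: classC_sub VV0 _; have [] := cphi i.
 apply: classCV => //; last exact: classC_sub VV0 _.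
 by move=> z [_ /=]; exact: lt0r_neq0.
have inv_cont z : z != 0 -> {for z, continuous (fun z => (rho z)^-1)}.
 move=> z0; apply: continuousV; first by rewrite gt_eqF// gg.
 exact: gauge_continuous.
pose N := [set z : E | z != 0].
have oN : open N.
 apply/openNP => z z0; exists `|z|; first by pos.
 by move=> y; apply: contraTneq => ->; rewrite sub0r normrN ltxx.
have rn_cont i : classC 0 N (fun z => rnorm z$i).
 apply: (@classC_ext _ _ _ _ (fun z => (rho z)^-1 * z$i)) => //.
  by move=> z _; rewrite mxE.
 move=> z z0; apply: continuousM; first exact: inv_cont.
 exact: (@classC_coord _ _ 0 setT i z).
pose U := N `&` [set z | V (rnorm z)].
have oU : open U.
 apply/openNP => z [z0 Vz].
 have [d d0 hd] := (openNP V).1 oV _ Vz.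
 have [d1 d10 hd1] := (openNP N).1 oN _ z0.
 have h i : exists r : R, 0 < r /\ forall y, `|y - z| < r -> `|rnorm y$i - rnorm z$i| < d.
  by have /contNP/(_ _ d0)[r r0 hr] := rn_cont i z z0; exists r.
 have [D hD] := choice h.
 exists (min d1 (\big[min/1]_i D i)).
  by rewrite lt_min d10 /=; apply: lt_bigmin => // i _; have [] := hD i.
 move=> y; rewrite lt_min => /andP[/hd1 y0 yz]; split=> //=; apply: hd.
 apply: norm_lt_coord => // i; rewrite !mxE.
 have [_ /(_ y)] := hD i; rewrite !mxE; apply; apply: lt_le_trans yz _.
 exact: bigmin_le.
have hgrad z : U z -> hgrad rho z (\row_i B i (rnorm z)).
 move=> [z0 [V0z Sz]]; have rz := gauge_rnorm z0.
 have zE : z = rho z *: rnorm z by rewrite /rnorm scalerA mulfV ?scale1r// gt_eqF ?gg.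
 rewrite {1}zE; apply: hgrad_gaugeZ; first exact: gg.
 have := @gauge_hgrad phi V0 (rnorm z) oV0 V0z rz (C1_hgrad oV0 V0z c1) phi0.
 rewrite -SE => /(_ Sz); congr hgrad; apply/rowP => i.
 by rewrite [LHS]mxE [RHS]mxE gradE mulrC.
have part i z : U z -> (B i \o rnorm) z = partial i rho z.
 by move=> Uz; rewrite (partial_grad i (hgrad _ Uz)) mxE.
have der i z : U z -> derivable rho z (delta_mx ord0 i).
 by move=> Uz; have [] := hgrad_derive (delta_mx ord0 i) (hgrad _ Uz).
have rU : forall z, U z -> V (rnorm z) by move=> z [].
have UN : U `<=` N by move=> z [].
(* [rnorm] is so far only continuous, whence [rho] is C^1; this makes [rnorm] C^1, and the same
   formula then gives C^1 partial derivatives. *)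
have C1 : classC 1 U rho.
 move=> i; split=> [z|]; first exact: der.
 apply: (@classC_ext _ _ 0 U (B i \o rnorm)) => //; first exact: part.
 apply: (@classC_comp _ _ 0 V U) => // [|j]; first exact: classC_le (cB i).
 exact: classC_sub UN _.
exists U; split; [exact: oU|exact: (conj x0)|].
move=> i; split=> [z|]; first exact: der.
apply: (@classC_ext _ _ 1 U (B i \o rnorm)) => //; first exact: part.
apply: (@classC_comp _ _ 1 V U) => // j.
apply: (@classC_ext _ _ 1 U (fun z => (rho z)^-1 * z$j)) => //.
 by move=> z _; rewrite mxE.
apply: classCM => //; last exact: classC_coord.
by apply: classCV => // z [z0 _]; rewrite gt_eqF// gg.
Qed.

End gauge.

(** * Hessian of the gauge, uniform convexity and duality *)

Section K_curvature.
Notation N0 := [set x : E | x != 0].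
Implicit Types (x p q v t u w : E).

Lemma open_neq0 : open N0.
Proof.
apply/openNP => z z0; exists `|z|; first by pos.
by move=> y; apply: contraTneq => ->; rewrite sub0r normrN ltxx.
Qed.

Let cg := gauge_C2.

Lemma gauge_hgradE x : x != 0 -> hgrad rho x (b x).
Proof.
move=> x0; apply: (@C1_hgrad _ _ N0) => //; first exact: open_neq0.
exact: classC_le open_neq0 _ cg.
Qed.

Lemma ggrad_le x q : x != 0 -> dotv (b x) q <= rho q.
Proof.
move=> x0; apply: (hgrad_dir_le (gauge_hgradE x0)); exists 1 => // t /andP[t0 _].
by rewrite lerBlDl (le_trans (gaugeD _ _))// lerD2l gaugeZ// ltW.
Qed.

Lemma gauge_euler x : x != 0 -> dotv (b x) x = rho x.
Proof.
move=> x0; apply: (hgrad_dir_eq (gauge_hgradE x0)); exists 1 => // t /andP[t0 _].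
by rewrite -{1}[x]scale1r -scalerDl gaugeZ ?addr_ge0 ?(ltW t0)//; ring.
Qed.

Lemma ggradZ x (t : R) : 0 < t -> x != 0 -> b (t *: x) = b x.
Proof.
by move=> t0 x0; apply: hgrad_grad; apply: hgrad_gaugeZ => //; exact: gauge_hgradE.
Qed.

Lemma polar_grad x : x != 0 -> rho0 (b x) = 1.
Proof.
move=> x0; apply/le_anti/andP; split.
 have [p [Kp <-] _] := polar_gaugeP (b x).
 by rewrite dotvC (le_trans (ggrad_le _ x0))//; exact: (gauge_le1 p).1.
have := dotv_gauge x (b x); rewrite dotvC gauge_euler// -{1}[rho x]mulr1.
by rewrite ler_pM2l// gauge_gt0.
Qed.

Lemma ghessT x : x != 0 -> (G x)^T = G x.
Proof. by move=> x0; exact: (hess_sym open_neq0 x0 cg). Qed.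

Lemma ghess_radial x : x != 0 -> x *m G x = 0.
Proof.
move=> x0; apply/rowP => i; rewrite dotv_mulmx_row ?ghessT// [RHS]mxE.
apply: (hgrad_dir_eq (hgrad_gradi i open_neq0 x0 cg)); exists 1 => // t /andP[t0 _].
by rewrite mulr0 -{1}[x]scale1r -scalerDl ggradZ ?subrr// addr_gt0.
Qed.

Lemma ggrad_neq0 x : x != 0 -> b x != 0.
Proof.
move=> x0; apply/eqP => h; have := polar_grad x0; rewrite h polar0.
by move=> /eqP; rewrite eq_sym oner_eq0.
Qed.

Lemma gauge_defining p : rho p = 1 -> C2_defining K p (fun z => rho z - 1).
Proof.
move=> rp; have p0 := gauge_neq0 rp; exists N0; split; [exact: open_neq0|exact: p0| | |].
- by apply: classCD; [exact: open_neq0|exact: cg|exact: classC_cst].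
- rewrite (hgrad_grad (hgradD (gauge_hgradE p0) (hgrad_cst (-1) p))) addr0.
 exact: ggrad_neq0.
- move=> x _; split; first by rewrite subr_lt0; exact: interior_gauge.
 split=> [/bd_gauge->|/eqP]; first by pos.
 by rewrite subr_eq0 => /eqP/bd_gauge.
Qed.

Lemma ggrad_sub1 z : z != 0 -> grad (fun z => rho z - 1) z = b z.
Proof.
move=> z0; rewrite (hgrad_grad (hgradD (gauge_hgradE z0) (hgrad_cst (-1) z))).
exact: addr0.
Qed.

(** Differentiating the normalising factor produces a normal term that cancels [c *: b p]. *)
Lemma unit_normal_gauge p (t : E) (k c : R) : rho p = 1 -> dotv (b p) t = 0 -> t *m G p = k *: t + c *: b p ->
 'd (unit_normal (fun z => rho z - 1)) p t = (k / Num.sqrt (dotv (b p) (b p))) *: t.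
Proof.
move=> rp bt tG; have p0 := gauge_neq0 rp.
set u := dotv (b p) (b p); set r := Num.sqrt u.
have u0 : 0 < u by rewrite dotvv_gt0// ggrad_neq0.
have r0 : 0 < r by rewrite sqrtr_gt0.
have r2 : r ^+ 2 = u by rewrite sqr_sqrtr// ltW.
pose bi i z := b z$i.
have hb i : hgrad (bi i) p (row i (G p)) by exact: hgrad_gradi open_neq0 p0 cg.
pose gu := \sum_i (b p$i *: row i (G p) + b p$i *: row i (G p)).
have hu : hgrad (fun z => dotv (b z) (b z)) p gu.
 by apply: hgrad_sum => i _; exact: (hgradM (hb i) (hb i)).
have hs : hgrad (fun z => (Num.sqrt (dotv (b z) (b z)))^-1) p ((- r ^- 2) *: ((2 * r)^-1 *: gu)).
 apply: (@hgradV _ _ (fun z => Num.sqrt (dotv (b z) (b z)))); first by pos.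
 by apply: (@hgrad_comp1 _ _ (fun z => dotv (b z) (b z))) => //; exact: is_derive1_sqrt.
set gs := _ *: _ in hs.
pose A := \matrix_i (r^-1 *: row i (G p) + b p$i *: gs).
have hA i : hgrad (fun z => unit_normal (fun z => rho z - 1) z$i) p (row i A).
 rewrite rowK.
 have [d d0 hd] := (openNP N0).1 open_neq0 p p0.
 apply: (@hgrad_near _ _ (fun z => (Num.sqrt (dotv (b z) (b z)))^-1 * bi i z) _ _ _ d d0).
  by move=> z /hd z0; rewrite /unit_normal [RHS]mxE !ggrad_sub1.
 exact: hgradM.
have [_ ->] := hgrad_row hA.
apply/rowP => i; rewrite [LHS]mxE.
have -> : \sum_j t$j * A^T j i = dotv (row i A) t.
 by apply: eq_bigr => j _; rewrite [RHS]mulrC; congr (_ * _); rewrite [LHS]mxE [RHS]mxE.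
have dgu : dotv gu t = 2 * (c * u).
 rewrite /gu dotv_suml.
 have -> : \sum_i dotv (b p$i *: row i (G p) + b p$i *: row i (G p)) t = 2 * dotv (b p) (t *m G p).
  rewrite /dotv mulr_sumr; apply: eq_bigr => j _.
  rewrite -/(dotv _ _) dotvDl dotvZl dotv_mulmx_row ?ghessT//.
  by pos.
 by rewrite tG dotvDr !dotvZr bt mulr0 add0r.
rewrite rowK dotvDl !dotvZl dgu -dotv_mulmx_row ?ghessT// tG -r2.
rewrite ![in LHS]mxE [RHS]mxE; move: (b p$i) (t$i) => B T.
by field; pos.
Qed.

(** Minimise the quadratic form over unit tangent vectors: [k] is the least value and [c] the
    Lagrange multiplier of the constraint [dotv g t = 0]. *)
Lemma tangent_eigen (M : 'M[R]_n) g : g != 0 -> M^T = M -> (exists2 t : E, t != 0 & dotv g t = 0) ->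
 exists t k c, [/\ t != 0, dotv g t = 0, t *m M = k *: t + c *: g &
  forall v, dotv g v = 0 -> k * dotv v v <= bilin M v v].
Proof.
move=> g0 MT [t0 t00 gt0].
pose A : set E := [set t | dotv g t = 0 /\ dotv t t = 1].
have cdd : continuous (fun x : E => dotv x x).
 move=> x; have h : hgrad (fun z : E => dotv z z) x (\sum_i (x$i *: delta_mx ord0 i + x$i *: delta_mx ord0 i)).
  by apply: hgrad_sum => i _; apply: hgradM; exact: hgrad_coord.
 exact: hgrad_cont h.
have Ac : compact A.
 apply: bounded_closed_compact.
  exists 1; split=> // M1 M11 x [_ xx]; apply/ltW/(le_lt_trans _ M11).
  by rewrite -(@expr_le1 _ 2)// -xx norm_sq_le.
 have -> : A = (dotv g @^-1` [set 0]) `&` ((fun x : E => dotv x x) @^-1` [set 1]) by [].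
 by apply: closedI; apply: preimage_closed;
  do ?[exact: closed_eq|by move=> z _; exact: dotv_continuous|by move=> z _; exact: cdd].
have normalize v : dotv g v = 0 -> v != 0 -> A ((Num.sqrt (dotv v v))^-1 *: v).
 move=> gv v0; split; first by rewrite dotvZr gv mulr0.
 have vv : 0 < dotv v v by rewrite dotvv_gt0.
 rewrite dotvZl dotvZr mulrA -invfM -expr2 sqr_sqrtr ?ltW// mulVf// gt_eqF//.
have cq x : {for x, continuous (fun v => bilin M v v)}.
 have h := hgradZ 2 (hgrad_quad 0 x MT).
 have -> : (fun v => bilin M v v) = (fun z => 2 * (2^-1 * bilin M (z - 0) (z - 0))).
  by apply/funext => z; rewrite subr0 mulrA mulfV ?mul1r// pnatr_eq0.
 exact: hgrad_cont h.
have [|t [gt tt] tmin] := compact_argmin (ex_intro _ _ (normalize _ gt0 t00)) Ac (f := fun v => bilin M v v).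
 by move=> x _; exact: cq.
have t_neq0 : t != 0.
 by apply/eqP => h; move: tt; rewrite h dotv0l => /eqP; rewrite eq_sym oner_eq0.
pose k := bilin M t t.
have kmin v : dotv g v = 0 -> k * dotv v v <= bilin M v v.
 move=> gv; have [->|v0] := eqVneq v 0; first by pos.
 have := tmin _ (normalize _ gv v0); have vv : 0 < dotv v v by rewrite dotvv_gt0.
 rewrite bilinZl bilinZr mulrA -invfM -expr2 sqr_sqrtr ?(ltW vv)// => h.
 by rewrite -ler_pdivlMr// [X in _ <= X]mulrC.
pose w := t *m M - k *: t.
have worth v : dotv g v = 0 -> dotv w v = 0.
 move=> gv; set a := dotv w v; set q := bilin M v v - k * dotv v v.
 have q0 : 0 <= q by rewrite subr_ge0 kmin.
 have aE : a = bilin M t v - k * dotv t v by rewrite /a dotvBl dotvZl.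
 (* Minimality along [t + s *: v], where [dotv v v] has been absorbed in [q]: the linear coefficient
    [a] must vanish, as [s = - a / (q + 1)] shows. *)
 have poly (s : R) : 0 <= 2 * s * a + s ^+ 2 * q.
  have := kmin (t + s *: v); rewrite dotvDr dotvZr gt gv mulr0 addr0 => /(_ erefl).
  rewrite -subr_ge0 bilinDl !bilinDr !bilinZl !bilinZr dotvDl !dotvDr !dotvZl !dotvZr.
  rewrite (bilin_sym v t MT) (dotvC v t) -/k tt aE /q.
  by congr (0 <= _); ring.
 apply/eqP; case: (ltgtP a 0) => // ha; exfalso.
  have := poly (- a / (q + 1)); have q1 : 0 < q + 1 by lra.
  have -> : 2 * (- a / (q + 1)) * a + (- a / (q + 1)) ^+ 2 * q = (a ^+ 2 / (q + 1)) * (-2 + q / (q + 1)) by pos.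
  have h1 : 0 < a ^+ 2 / (q + 1) by rewrite divr_gt0// exprn_even_gt0//= lt_eqF.
  rewrite pmulr_rge0// => h2.
  have : q / (q + 1) <= 1 by rewrite ler_pdivrMr// mul1r lerDl.
  lra.
 have := poly (- a / (q + 1)); have q1 : 0 < q + 1 by lra.
 have -> : 2 * (- a / (q + 1)) * a + (- a / (q + 1)) ^+ 2 * q = (a ^+ 2 / (q + 1)) * (-2 + q / (q + 1)) by pos.
 have h1 : 0 < a ^+ 2 / (q + 1) by pos.
 rewrite pmulr_rge0// => h2.
 have : q / (q + 1) <= 1 by rewrite ler_pdivrMr// mul1r lerDl.
 lra.
have gg : 0 < dotv g g by rewrite dotvv_gt0.
pose c := dotv w g / dotv g g; exists t, k, c; split=> //.
pose z := w - c *: g.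
have gz : dotv g z = 0 by rewrite /z dotvBr dotvZr (dotvC g w) /c divfK ?subrr// gt_eqF.
have /eqP : dotv z z = 0 by rewrite {1}/z dotvBl dotvZl gz mulr0 subr0 worth.
by rewrite dotvv_eq0 /z subr_eq0 /w subr_eq addrC => /eqP.
Qed.

(** The least value of the form on unit tangent vectors is, up to the length of [b p], a principal
    curvature of [K], hence positive. *)
Lemma ghess_gt0 p t : rho p = 1 -> dotv (b p) t = 0 -> t != 0 -> 0 < bilin (G p) t t.
Proof.
move=> rp bt t0; have p0 := gauge_neq0 rp; have b0 := ggrad_neq0 p0.
have [||v [k [c [v0 bv vG kmin]]]] := @tangent_eigen (G p) (b p) b0.
- exact: ghessT.
- by exists t.
have dv := unit_normal_gauge rp bv vG.
have r0 : 0 < Num.sqrt (dotv (b p) (b p)) by rewrite sqrtr_gt0 dotvv_gt0.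
have kp : 0 < k.
 have := @K_curv p (k / Num.sqrt (dotv (b p) (b p))).
 rewrite pmulr_lgt0 ?invr_gt0//; apply; first exact/bd_gauge.
 exists (fun z => rho z - 1), v; split=> //; first exact: gauge_defining.
 by rewrite ggrad_sub1.
by apply: lt_le_trans (kmin _ bt); rewrite mulr_gt0// dotvv_gt0.
Qed.

(** On the level set [rho = 1] this is the Hessian of [rho ^ 2 / 2]. Unlike [G p] it is positive
    definite on the whole space. *)
Definition Ghat p : 'M[R]_n := G p + (b p)^T *m b p.

Lemma bilin_outer (w v v' : E) : bilin (w^T *m w) v v' = dotv w v * dotv w v'.
Proof.
rewrite /bilin mulmxA (_ : v *m w^T = (dotv w v)%:M); last first.
 apply/matrixP => i j; rewrite !ord1 !mxE eqxx mulr1n /dotv.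
 by apply: eq_bigr => k _; rewrite mxE mulrC.
by rewrite mul_scalar_mx dotvZl.
Qed.

Lemma bilin_Ghat p v v' : bilin (Ghat p) v v' = bilin (G p) v v' + dotv (b p) v * dotv (b p) v'.
Proof. by rewrite -bilin_outer /bilin /Ghat mulmxDr dotvDl. Qed.

Lemma Ghat_sym p : p != 0 -> (Ghat p)^T = Ghat p.
Proof. by move=> p0; rewrite /Ghat linearD /= trmx_mul trmxK ghessT. Qed.

Lemma Ghat_gt0 p v : rho p = 1 -> v != 0 -> 0 < bilin (Ghat p) v v.
Proof.
move=> rp v0; have p0 := gauge_neq0 rp.
pose t := v - dotv (b p) v *: p.
have bt : dotv (b p) t = 0 by rewrite dotvBr dotvZr gauge_euler// rp mulr1 subrr.
have pG w : bilin (G p) p w = 0 by rewrite /bilin ghess_radial// dotv0l.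
have GE : bilin (G p) v v = bilin (G p) t t.
 rewrite -[v in LHS](subrK (dotv (b p) v *: p)) -/t bilinDl !bilinDr !bilinZl !bilinZr !pG.
 by rewrite (bilin_sym t p (ghessT p0)) pG !mulr0 !addr0.
rewrite bilin_Ghat GE -expr2.
have [t0|t0] := eqVneq t 0; last first.
 by rewrite ltr_pwDl ?sqr_ge0// ghess_gt0.
rewrite t0 bilin0r add0r exprn_even_gt0//=; apply: contraNneq v0 => h.
by move: t0; rewrite /t h scale0r subr0 => ->.
Qed.

Let nz := gauge_neq0.

Lemma boundary_unif (P : R -> E -> Prop) : (forall d d' x, d' <= d -> P d x -> P d' x) ->
 (forall a, rho a = 1 -> exists2 d : R, 0 < d & forall b, rho b = 1 -> `|b - a| < d -> P d b) ->
 exists2 d : R, 0 < d & forall b, rho b = 1 -> P d b.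
Proof.
move=> mono loc.
have [a ba|d d0 hd] := compact_unif boundaryK_compact mono.
 have [d d0 hd] := loc a ((bd_gauge a).1 ba).
 by exists d => // c bc; apply: hd; exact: (bd_gauge c).1.
by exists d => // c rc; apply: hd; exact: (bd_gauge c).2.
Qed.

Lemma Ghat_cont p (e : R) : p != 0 -> 0 < e -> exists2 d : R, 0 < d & forall x, `|x - p| < d ->
  x != 0 /\ forall i j, `|Ghat x i j - Ghat p i j| <= e.
Proof.
move=> p0 e0; have e20 : 0 < e / 2 by pos.
have [d d0 hd] := hess_cont open_neq0 p0 cg e20.
have h ij : exists r : R, 0 < r /\ forall x, `|x - p| < r -> `|b x$ij.1 * b x$ij.2 - b p$ij.1 * b p$ij.2| <= e / 2.
 have hb i : hgrad (fun z => b z$i) p (row i (G p)).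
  exact: hgrad_gradi open_neq0 p0 cg.
 have /contNP/(_ _ e20)[r r0 hr] := hgrad_cont (hgradM (hb ij.1) (hb ij.2)).
 by exists r; split=> // x /hr/ltW.
have [D hD] := choice h.
exists (min d (\big[min/1]_ij D ij)).
 by rewrite lt_min d0 /=; apply: lt_bigmin => // i _; have [] := hD i.
move=> x; rewrite lt_min => /andP[/hd[x0 hG] xD]; split=> // i j.
have h1 := hG i j; have h2 : `|b x$i * b x$j - b p$i * b p$j| <= e / 2.
 have [_] := hD (i, j); apply; apply: lt_le_trans xD _; exact: bigmin_le.
have GE z : Ghat z i j = G z i j + b z$i * b z$j.
 by rewrite /Ghat [LHS]mxE; congr (_ + _); rewrite mxE big_ord1 mxE.
rewrite !GE opprD addrACA [e]splitr (le_trans (ler_normD _ _))// lerD//.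
Qed.

Lemma bilin_diff_le (A B : 'M[R]_n) (e : R) v v' : 0 <= e -> (forall i j, `|A i j - B i j| <= e) ->
 `|bilin A v v' - bilin B v v'| <= n%:R ^+ 2 * e * (`|v| * `|v'|).
Proof.
move=> e0 h; have -> : bilin A v v' - bilin B v v' = bilin (A - B) v v'.
 by rewrite /bilin mulmxBr dotvBl.
by apply: bilin_le => // i j; rewrite !mxE.
Qed.

Lemma Ghat_unif : exists2 m : R, 0 < m & forall p, rho p = 1 -> forall v, m * `|v| ^+ 2 <= bilin (Ghat p) v v.
Proof.
apply: boundary_unif => [d d' x dd h v|p rp].
 by apply: le_trans (h v); rewrite ler_wpM2r// exprn_ge0.
have p0 := nz rp.
have [n0|n0] := posnP n.
 exists 1 => // c _ _ v; rewrite (_ : v = 0) ?normr0 ?expr0n ?mulr0 ?bilin0r//.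
 by apply/rowP => i; have := ltn_ord i; rewrite {2}n0.
pose A : set E := [set v | `|v| = 1].
have A0 : A !=set0.
 by exists (delta_mx ord0 (Ordinal n0)); rewrite /A/= norm_delta.
have Ac : compact A.
 apply: bounded_closed_compact.
  by exists 1; split=> // M M1 x /= ->; exact: ltW.
 rewrite (_ : A = (fun x : E => `|x|) @^-1` [set 1])//.
 by apply: preimage_closed; do ?[exact: closed_eq|by move=> z _; exact: norm_continuous].
have GT := Ghat_sym p0.
have [v _|v v1 vmin] := @compact_argmin _ _ A (fun v => bilin (Ghat p) v v) A0 Ac.
 have -> : (fun v => bilin (Ghat p) v v) = (fun z => 2 * (2^-1 * bilin (Ghat p) (z - 0) (z - 0))).
  by apply/funext => z; rewrite subr0 mulrA mulfV ?mul1r// pnatr_eq0.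
 exact: hgrad_cont (hgradZ 2 (hgrad_quad 0 v GT)).
set m := bilin (Ghat p) v v in vmin.
have m0 : 0 < m.
 apply: (Ghat_gt0) => //; rewrite -normr_eq0 v1; exact: oner_neq0.
pose e := m / 2 / n%:R ^+ 2.
have nn : 0 < n%:R ^+ 2 :> R by pos.
have e0 : 0 < e by rewrite !divr_gt0.
have [d d0 hd] := Ghat_cont p0 e0.
exists (min d (m / 2)) => [|c rc]; first by pos.
rewrite lt_min => /andP[/hd[_ cp] _] w.
have [->|w0] := eqVneq w 0; first by rewrite normr0 expr0n/= mulr0 bilin0r.
have nw : 0 < `|w| by pos.
have h1 : m * `|w| ^+ 2 <= bilin (Ghat p) w w.
 have := vmin (`|w|^-1 *: w); rewrite /A/= normrZ normfV normr_id mulVf ?gt_eqF// => /(_ erefl).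
 rewrite bilinZl bilinZr mulrA -invfM -expr2 => h.
 by rewrite -ler_pdivlMr ?exprn_gt0// mulrC.
have := bilin_diff_le w w (ltW e0) cp.
have -> : n%:R ^+ 2 * e = m / 2 by rewrite /e mulrC divfK// gt_eqF.
rewrite -expr2 ler_norml => /andP[h2 _].
apply: (@le_trans _ _ (m / 2 * `|w| ^+ 2)).
 by rewrite ler_wpM2r ?exprn_ge0// ge_min lexx orbT.
exact: half_sub_le h1 h2.
Qed.

Lemma grad_bound : exists2 C : R, 0 < C & forall x, x != 0 -> `|b x| <= C.
Proof.
have [c c0 hc] := polar_lower; exists c^-1; first by pos.
move=> x x0; have := hc (b x); rewrite polar_grad// => h.
by rewrite -[c^-1]mulr1 ler_pdivlMl.
Qed.

Lemma gauge_taylor (e : R) : 0 < e -> exists2 d : R, 0 < d & forall p, rho p = 1 ->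
 forall v, `|v| < d -> [/\ p + v != 0, `|b (p + v) - b p - v *m G p| <= e * `|v|
  & `|rho (p + v) - 1 - dotv (b p) v - 2^-1 * bilin (G p) v v| <= e * `|v| ^+ 2].
Proof.
move=> e0; apply: boundary_unif => [d d' x dd h v vd|a ra].
 by apply: h; exact: lt_le_trans dd.
have [d d0 hd] := taylor2 open_neq0 (nz ra) cg e0.
exists d => // p rp pa v vd; have [h1 h2 h3] := hd _ _ pa vd.
by rewrite rp in h3; split.
Qed.

(** Near [p] this is the uniform Taylor expansion; beyond its radius the linear growth of [rho] is
    absorbed in the quadratic term. *)
Lemma gauge_upper2 : exists2 C : R, 0 < C & forall p, rho p = 1 ->
 forall q, rho (p + q) <= 1 + dotv (b p) q + C * `|q| ^+ 2.
Proof.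
have [d d0 hd] := gauge_taylor (@ltr01 R).
have [C1 C10 hC1] := gauge_upper.
have [Cb Cb0 hCb] := grad_bound.
have [D D0 hD] : exists2 D : R, 0 < D & forall p, rho p = 1 -> forall i j, `|G p i j| <= D.
 have [||d1 d10 hd1] := @boundary_unif (fun d p => d <= 0 \/ forall i j, `|G p i j| <= d^-1).
 - move=> r r' x rr [r0|h]; first by left; exact: le_trans r0.
  have [r'0|r'0] := leP r' 0; first by left.
  right=> i j; rewrite (le_trans (h i j))// lef_pV2 ?posrE// (lt_le_trans r'0)//.
 - move=> a ra; have [k k0 kG] := mx_entry_bound (G a).
  have [r r0 hr] := hess_cont open_neq0 (nz ra) cg (@ltr01 R).
  have k1 : 0 < k + 1 by pos.
  exists (min r (k + 1)^-1); first by pos.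
  move=> c rc; rewrite lt_min => /andP[/hr[_ hc] _]; right=> i j.
  apply: (@le_trans _ _ (k + 1)).
   rewrite -[X in `|X|](subrK (G a i j)) (le_trans (ler_normD _ _))// addrC lerD//.
  rewrite -[X in X <= _]invrK lef_pV2 ?posrE ?invr_gt0// ?ge_min ?lexx ?orbT//.
  by pos.
 exists d1^-1; first by pos.
 by move=> p rp; have [|//] := hd1 _ rp; rewrite leNgt d10.
pose C2 := n%:R ^+ 2 * D + 1; pose C3 := (C1 + n%:R * Cb) / d.
have C20 : 0 < C2 by rewrite ltr_wpDl// mulr_ge0 ?exprn_ge0// ltW.
have C30 : 0 <= C3 by rewrite divr_ge0 ?addr_ge0 ?mulr_ge0 ?(ltW C10) ?(ltW Cb0) ?(ltW d0).
exists (C2 + C3) => [|p rp q]; first by pos.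
have q2 : 0 <= `|q| ^+ 2 by pos.
have [qd|dq] := ltP `|q| d.
 have [_ _] := hd _ rp _ qd; rewrite ler_norml => /andP[_ h].
 have := bilin_le q q (ltW D0) (hD _ rp); rewrite ler_norml -expr2 => /andP[_ hb].
 have := mulr_ge0 C30 q2.
 have : 0 <= n%:R ^+ 2 * D * `|q| ^+ 2 by pos.
 by rewrite mulrDl /C2 mulrDl; lra.
have h1 : rho (p + q) <= 1 + C1 * `|q|.
 by rewrite (le_trans (gaugeD _ _))// rp lerD2l.
have h2 : - (n%:R * Cb * `|q|) <= dotv (b p) q.
 have := dotv_le (b p) q; rewrite ler_norml => /andP[+ _]; apply: le_trans.
 by rewrite lerN2 -mulrA ler_wpM2l// ler_wpM2r// hCb// nz.
have h3 : (C1 + n%:R * Cb) * `|q| <= C3 * `|q| ^+ 2.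
 rewrite /C3 expr2 mulrA ler_wpM2r// mulrAC ler_pdivlMr// ler_wpM2l//.
 by pos.
have := mulr_ge0 (ltW C20) q2; rewrite [(C2 + C3) * _]mulrDl; lra.
Qed.

(* Strong convexity of the polar body, from the upper bound on the gauge. *)
Lemma polar_strongly_convex : exists2 c : R, 0 < c & forall p, rho p = 1 ->
 forall w, rho0 w <= 1 -> c * `|w - b p| ^+ 2 <= dotv p (b p - w).
Proof.
have [C C0 hC] := gauge_upper2; exists (4 * C)^-1; first by pos.
move=> p rp w rw; set z := w - b p; pose s := (2 * C)^-1.
have s0 : 0 < s by rewrite invr_gt0 mulr_gt0.
have h1 := hC _ rp (s *: z).
have h2 : dotv (p + s *: z) w <= rho (p + s *: z).
 by rewrite (le_trans (dotv_gauge _ _))// ler_piMr// gauge_ge0.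
have h3 : dotv p (b p) = 1 by rewrite dotvC gauge_euler ?nz.
have -> : b p - w = - z by rewrite opprB.
rewrite dotvNr; have h4 := norm_sq_le z.
have h5 : dotv p w = 1 + dotv p z by rewrite -h3 -dotvDr /z addrC subrK.
have h6 : dotv z w = dotv (b p) z + dotv z z.
 by rewrite (dotvC (b p)) -dotvDr; congr dotv; rewrite /z addrC subrK.
move: h1 h2; rewrite dotvDl !dotvZr dotvZl normrZ gtr0_norm// exprMn h5 h6.
have -> : C * (s ^+ 2 * `|z| ^+ 2) = s / 2 * `|z| ^+ 2.
 by rewrite /s; field; pos.
have -> : (4 * C)^-1 = s / 2 by rewrite /s; field; pos.
have := ler_wpM2l (ltW s0) h4; lra.
Qed.

(** Uniform convexity of [K], quadratic for small [q]. A large [q] is shortened along the segment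
    from [p], which stays in [K]; only linear decay remains. *)
Lemma gauge_strongly_convex : exists m d : R, [/\ 0 < m, 0 < d & forall p q, rho p = 1 ->
 K (p + q) -> dotv (b p) q <= - (m * min (`|q| ^+ 2) (d * `|q|))].
Proof.
have [m0 m00 hm] := Ghat_unif.
have m40 : 0 < m0 / 4 by pos.
have [d1 d10 hd1] := gauge_taylor m40.
have [Cb Cb0 hCb] := grad_bound.
pose d := min (d1 / 2) (n%:R * Cb + 1)^-1.
have nC : 0 < n%:R * Cb + 1 by pos.
have d0 : 0 < d by rewrite lt_min invr_gt0 nC divr_gt0.
have dd1 : d < d1.
 apply: (@le_lt_trans _ _ (d1 / 2)); first by rewrite ge_min lexx.
 by pos.
have near p q : rho p = 1 -> K (p + q) -> `|q| <= d -> dotv (b p) q <= - (m0 / 6 * `|q| ^+ 2).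
 move=> rp /gauge_le1 Kpq qd; have p0 := nz rp.
 have [_ _] := hd1 _ rp _ (le_lt_trans qd dd1); rewrite ler_norml => /andP[h _].
 have hle : dotv (b p) q <= 0.
  have := ggrad_le (p + q) p0; rewrite dotvDr gauge_euler// rp.
  by move=> h'; have := le_trans h' Kpq; rewrite gerDl.
 have ha : - 1 <= dotv (b p) q.
  have := dotv_le (b p) q; rewrite ler_norml => /andP[+ _]; apply: le_trans.
  rewrite lerN2 (@le_trans _ _ ((n%:R * Cb + 1) * `|q|))//.
   by rewrite mulrA ler_wpM2r// ler_wpDr// ler_wpM2l// hCb.
  by rewrite mulrC -ler_pdivlMr// mul1r (le_trans qd)// ge_min lexx orbT.
 (* [dotv (b p) q] lies in [[-1, 0]], so its square, the difference between [Ghat] and [G], is at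
    most its opposite and can be absorbed. *)
 have hG := hm _ rp q; rewrite bilin_Ghat in hG.
 have hsq : dotv (b p) q * dotv (b p) q <= - dotv (b p) q.
  by rewrite -subr_ge0; have := mulr_ge0 (_ : 0 <= - dotv (b p) q) (_ : 0 <= 1 + dotv (b p) q); lra.
 by lra.
exists (m0 / 6), d; split=> // [|p q rp Kpq]; first by pos.
have m60 : 0 <= m0 / 6 by pos.
have [qd|dq] := leP `|q| d.
 apply: le_trans (near _ _ rp Kpq qd) _; rewrite lerN2 ler_wpM2l// ge_min lexx//.
have nq : 0 < `|q| by pos.
pose s := d / `|q|; have s0 : 0 < s by rewrite divr_gt0.
have s1 : s <= 1 by rewrite ler_pdivrMr// mul1r ltW.
have sq : `|s *: q| = d by rewrite normrZ gtr0_norm// divfK// gt_eqF.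
have Ks : K (p + s *: q).
 have -> : p + s *: q = s *: (p + q) + (1 - s) *: p.
  by rewrite scalerDr scalerBl scale1r addrAC addrCA subrr addr0 addrC.
 case: HK => _ _; apply=> //; first by pos.
 by apply/gauge_le1; rewrite rp.
have := near _ _ rp Ks; rewrite sq => /(_ (lexx _)).
rewrite dotvZr mulrC -ler_pdivlMr// => h; apply: le_trans h _.
rewrite mulNr lerN2 (_ : m0 / 6 * d ^+ 2 / s = m0 / 6 * (d * `|q|)); last first.
 by rewrite /s; field; pos.
by rewrite ler_wpM2l// ge_min lexx orbT.
Qed.

(** Optimality of [p'] for [b p + v] against the competitor [p] gives [- dotv (b p) q <= dotv q v];
    uniform convexity bounds the left side from below. *)
Lemma maximizer_near : exists C d : R, [/\ 0 < C, 0 < d & forall p p' v, rho p = 1 -> K p' ->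
 dotv p' (b p + v) = rho0 (b p + v) -> `|v| < d -> `|p' - p| <= C * `|v| /\ - dotv (b p) (p' - p) <= C * `|v| ^+ 2].
Proof.
have [m [d [m0 d0 hm]]] := gauge_strongly_convex.
pose C := (n%:R + 1) / m.
have C0 : 0 < C by rewrite divr_gt0.
pose C2 := n%:R * C + C; have C20 : 0 < C2 by rewrite ltr_wpDl// mulr_ge0// ltW.
exists C2, (m * d / (n%:R + 1)); split=> //; first by pos.
move=> p p' v rp Kp' e vd; set q := p' - p.
have Kpq : K (p + q) by rewrite /q addrC subrK.
have h := hm _ _ rp Kpq.
have Kp : K p by apply/gauge_le1; rewrite rp.
have h1 : - dotv (b p) q <= dotv q v.
 have := dotv_polar (b p + v) Kp; rewrite -e -subr_ge0 -dotvBl -/q dotvDr.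
 by rewrite (dotvC q); lra.
have h2 : dotv q v <= n%:R * (`|q| * `|v|) by exact: le_trans (ler_norm _) (dotv_le _ _).
have h3 : m * min (`|q| ^+ 2) (d * `|q|) <= n%:R * (`|q| * `|v|).
 by pos.
have qv : `|q| <= C * `|v|.
 have [->|q0] := eqVneq q 0; first by rewrite normr0 mulr_ge0// ltW.
 have nq : 0 < `|q| by pos.
 have [qq|qq] := leP (`|q| ^+ 2) (d * `|q|).
  have {}h3 : `|q| * (m * `|q|) <= `|q| * (n%:R * `|v|).
   by move: h3; rewrite (min_idPl qq); lra.
  move: h3; rewrite ler_pM2l// => h3; rewrite /C mulrAC ler_pdivlMr// mulrC (le_trans h3)// ler_wpM2r// lerDl//.
 exfalso; have {}h3 : `|q| * (m * d) <= `|q| * (n%:R * `|v|).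
  by move: h3; rewrite (min_idPr (ltW qq)); lra.
 move: h3; rewrite ler_pM2l//.
 rewrite leNgt => /negP; apply; apply: (@le_lt_trans _ _ ((n%:R + 1) * `|v|)).
  by rewrite ler_wpM2r// lerDl.
 by rewrite mulrC -ltr_pdivlMr.
have CC2 : C <= C2 by rewrite /C2 lerDr mulr_ge0// ltW.
split; first by apply: le_trans qv _; rewrite ler_wpM2r.
apply: le_trans h1 _; apply: le_trans h2 _; rewrite expr2 !mulrA ler_wpM2r//.
rewrite /C2 mulrDl -mulrA (le_trans (ler_wpM2l (ler0n _ n) qv))// mulrA lerDl.
by pos.
Qed.

(* Second order upper bound of the support function by Legendre duality. *)
Lemma polar_taylor (e : R) : 0 < e -> exists2 d : R, 0 < d & forall p u, rho p = 1 -> dotv p u = 0 -> `|u| < d ->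
 rho0 (b p + u) <= 1 + 2^-1 * bilin (invmx (Ghat p)) u u + e * `|u| ^+ 2.
Proof.
move=> e0; have [C [d1 [C0 d10 hC]]] := maximizer_near.
pose e1 := e / (2 * C ^+ 2); have e10 : 0 < e1 by rewrite divr_gt0// mulr_gt0// exprn_gt0.
have [d2 d20 hd2] := gauge_taylor e10.
pose d := min 1 (min d1 (min (d2 / C) (e / C ^+ 2))).
have d0 : 0 < d by rewrite !lt_min ltr01 d10 !divr_gt0// exprn_gt0.
exists d => // p u rp pu; rewrite !lt_min => /and4P[u1 ud1 ud2 ue].
have p0 := nz rp.
have [p' [Kp' e'] _] := polar_gaugeP (b p + u).
have [qu au] := hC _ _ _ rp Kp' e' ud1; have [q pE] : exists q, p' = p + q by exists (p' - p); rewrite addrC subrK.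
rewrite pE addr_subK in qu au.
have qd2 : `|q| < d2 by rewrite (le_lt_trans qu)// mulrC -ltr_pdivlMr.
have [_ _] := hd2 _ rp _ qd2; rewrite ler_norml => /andP[h _].
have rq : rho (p + q) <= 1 by apply/gauge_le1; rewrite -pE.
have bp : dotv (b p) p = 1 by rewrite gauge_euler.
have rE : rho0 (b p + u) = 1 + dotv (b p) q + dotv q u.
 by rewrite -e' pE dotvDl !dotvDr pu (dotvC p (b p)) bp (dotvC q (b p)); ring.
have hy := young_posdef q u (Ghat_sym p0) (fun v => @Ghat_gt0 p v rp).
rewrite bilin_Ghat in hy.
have hle : dotv (b p) q <= 0.
 have := ggrad_le (p + q) p0; rewrite dotvDr bp.
 by move=> h'; have := le_trans h' rq; rewrite gerDl.
have hq2 : e1 * `|q| ^+ 2 <= e / 2 * `|u| ^+ 2.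
 have -> : e / 2 = e1 * C ^+ 2 by rewrite /e1; field; pos.
 rewrite -mulrA -exprMn ler_pM2l// ler_pXn2r ?nnegrE ?mulr_ge0//; exact: ltW.
have ha2 : dotv (b p) q * dotv (b p) q <= e * `|u| ^+ 2.
 rewrite -mulrNN (@le_trans _ _ ((C * `|u| ^+ 2) * (C * `|u| ^+ 2)))//.
  by rewrite ler_pM// oppr_ge0.
 rewrite -expr2 exprMn -exprM -[(2 * 2)%N]/(1 + 3)%N.
 have -> : C ^+ 2 * `|u| ^+ (1 + 3) = C ^+ 2 * `|u| * `|u| * `|u| ^+ 2 by ring.
 rewrite ler_wpM2r ?exprn_ge0// (@le_trans _ _ (C ^+ 2 * `|u|))//.
  by rewrite ler_piMr ?mulr_ge0 ?exprn_ge0 ?(ltW C0)// ltW.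
 by rewrite mulrC -ler_pdivlMr ?exprn_gt0// ltW.
rewrite rE; lra.
Qed.

Lemma gauge_bound_unit : exists2 C : R, 0 < C & forall p, rho p <= 1 -> `|p| <= C.
Proof.
have [C C0 hC] := gauge_lower; exists C => // p rp.
by rewrite (le_trans (hC p))// ler_piMr// ltW.
Qed.

(** Write [b p + v = l *: (b p + u)] with [dotv p u = 0]: by homogeneity the tangential expansion
    [polar_taylor] suffices. *)
Lemma polar_upper2 : exists C d : R, [/\ 0 < C, 0 < d & forall p v, rho p = 1 -> `|v| < d ->
 rho0 (b p + v) <= 1 + dotv p v + C * `|v| ^+ 2].
Proof.
have [d1 d10 hd1] := polar_taylor (@ltr01 R).
have [m m0 hm] := Ghat_unif.
have [Cb Cb0 hCb] := grad_bound.
have [Cp Cp0 hCp] := gauge_bound_unit.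
pose L := 2 * (1 + n%:R * Cp * Cb).
have L0 : 0 < L by rewrite mulr_gt0// ltr_wpDr// !mulr_ge0// ltW.
pose C := 2 * ((2^-1 * (n%:R ^+ 2 / m) + 1) * L ^+ 2).
have C0 : 0 < C.
 rewrite mulr_gt0// mulr_gt0 ?exprn_gt0// ltr_wpDl// mulr_ge0// divr_ge0 ?exprn_ge0//.
 exact: ltW.
pose k := 2 * (n%:R * Cp + 1).
have k0 : 0 < k by rewrite mulr_gt0// ltr_wpDl// mulr_ge0// ltW.
exists C, (min (d1 / L) k^-1); split=> //; first by pos.
move=> p v rp; rewrite lt_min => /andP[vd vk]; have p0 := nz rp.
have rp1 : rho p <= 1 by pos.
have hpv : `|dotv p v| <= n%:R * Cp * `|v|.
 by rewrite (le_trans (dotv_le _ _))// mulrA ler_wpM2r// ler_wpM2l// hCp.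
have pv2 : `|dotv p v| <= 2^-1.
 rewrite (le_trans hpv)// (@le_trans _ _ (k / 2 * `|v|))//.
  have -> : k / 2 = n%:R * Cp + 1 by rewrite /k; field.
  by rewrite ler_wpM2r// lerDl.
 move: vk; rewrite -[k^-1]mul1r ltr_pdivlMr// => /ltW; lra.
set l := 1 + dotv p v.
have [l1 l2] : 2^-1 <= l /\ l <= 2.
 by move: pv2; rewrite ler_norml /l => /andP[? ?]; split; lra.
have l0 : 0 < l by pos.
pose u := l^-1 *: (v - dotv p v *: b p).
have pb : dotv p (b p) = 1 by rewrite dotvC gauge_euler.
have pu : dotv p u = 0 by rewrite dotvZr dotvBr dotvZr pb mulr1 subrr mulr0.
have wE : b p + v = l *: (b p + u).
 rewrite scalerDr /u scalerA mulfV ?gt_eqF// scale1r /l scalerDl scale1r.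
 by rewrite addrACA subrr addr0.
have uL : `|u| <= L * `|v|.
 rewrite normrZ gtr0_norm ?invr_gt0// /L -mulrA ler_pM ?invr_ge0 ?(ltW l0)//.
  by rewrite -[2]invrK lef_pV2 ?posrE ?invr_gt0.
 rewrite (le_trans (ler_normB _ _))// mulrDl mul1r lerD2l normrZ mulrAC.
 by rewrite ler_pM// hCb.
have ud : `|u| < d1 by rewrite (le_lt_trans uL)// mulrC -ltr_pdivlMr.
have h := hd1 _ _ rp pu ud.
have /andP[_ hN] := bilin_inv_le u m0 (Ghat_sym p0) (hm _ rp).
have u2 : `|u| ^+ 2 <= L ^+ 2 * `|v| ^+ 2.
 by rewrite -exprMn; exact: sqr_mono.
rewrite wE (polarZ _ (ltW l0)).
have a0 : 0 <= 2^-1 * (n%:R ^+ 2 / m) :> R.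
 by pos.
apply: (@le_trans _ _ (l * (1 + (2^-1 * (n%:R ^+ 2 / m) + 1) * `|u| ^+ 2))).
 rewrite ler_wpM2l ?(ltW l0)//; apply: (le_trans h); move: hN.
 by move: (bilin _ _ _) (n%:R ^+ 2 / m) (`|u| ^+ 2) => X Y Z; lra.
have A0 : 0 <= 2^-1 * (n%:R ^+ 2 / m) + 1 by pos.
rewrite mulrDr mulr1 lerD2l /C; move: A0; move: (2^-1 * _ + 1) => A A0.
apply: (@le_trans _ _ (2 * (A * (L ^+ 2 * `|v| ^+ 2)))); last by rewrite !mulrA.
apply: ler_pM => //; [exact: ltW|by pos|].
exact: ler_wpM2l.
Qed.

Lemma maximizer_eq x p : x != 0 -> K p -> dotv p x = rho0 x -> x = rho0 x *: b p.
Proof.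
move=> x0 Kp e; have rp := max_boundary x0 Kp e; have p0 := nz rp.
have r0 := polar_gt0 x0; pose w := (rho0 x)^-1 *: x.
have xE : x = rho0 x *: w by rewrite scalerA mulfV ?scale1r// gt_eqF.
have rw : rho0 w = 1 by rewrite polarZ ?invr_ge0 ?(ltW r0)// mulVf// gt_eqF.
rewrite {1}xE; congr (_ *: _).
apply: (hgrad_touch (hgrad_dotv p w) (gauge_hgradE p0)).
 by rewrite dotvC dotvZr e mulVf ?gt_eqF.
by exists 1 => // z _; rewrite dotvC (le_trans (dotv_gauge _ _))// rw mulr1.
Qed.

Lemma polar_hgrad x p : x != 0 -> K p -> dotv p x = rho0 x -> hgrad rho0 x p.
Proof.
move=> x0 Kp e; have rp := max_boundary x0 Kp e; have p0 := nz rp.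
rewrite (maximizer_eq x0 Kp e).
apply: hgrad_homog; first by move=> k z k0; exact: polarZ.
 exact: polar_gt0 _ x0.
have [C [d [C0 d0 hd]]] := polar_upper2.
move=> eps eps0; exists (min d (eps / C)) => [|v].
 by pos.
rewrite lt_min => /andP[vd vC].
rewrite polar_grad//.
have h1 := hd _ _ rp vd; have h2 := dotv_polar (b p + v) Kp.
have pb : dotv p (b p) = 1 by rewrite dotvC gauge_euler.
rewrite dotvDr pb in h2; rewrite ger0_norm; last by lra.
apply: (@le_trans _ _ (C * `|v| ^+ 2)); first by lra.
by rewrite expr2 mulrA ler_wpM2r// mulrC -ler_pdivlMr// ltW.
Qed.

(** For [x != 0] this is the gradient of [rho0] at [x], and also the only point of [K] whose scalar
    product with [x] is maximal. *)
Definition pmax x : E := get (fun p => K p /\ dotv p x = rho0 x).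

Lemma pmaxP x : K (pmax x) /\ dotv (pmax x) x = rho0 x.
Proof.
by have [p h _] := polar_gaugeP x; exact: (@getI _ (fun p => K p /\ dotv p x = rho0 x) p).
Qed.

Lemma pmax_gauge x : x != 0 -> rho (pmax x) = 1.
Proof. by move=> x0; have [h1 h2] := pmaxP x; exact: (max_boundary x0 h1 h2). Qed.

Lemma pmax_hgrad x : x != 0 -> hgrad rho0 x (pmax x).
Proof. by move=> x0; have [h1 h2] := pmaxP x; exact: polar_hgrad. Qed.

Lemma pmax_unique x p : x != 0 -> K p -> dotv p x = rho0 x -> p = pmax x.
Proof.
by move=> x0 h1 h2; exact: (hgrad_unique (polar_hgrad x0 h1 h2) (pmax_hgrad x0)).
Qed.

Lemma pmax_eq x : x != 0 -> x = rho0 x *: b (pmax x).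
Proof. by move=> x0; have [h1 h2] := pmaxP x; exact: maximizer_eq. Qed.

Lemma pmax_ggrad p (l : R) : rho p = 1 -> 0 < l -> pmax (l *: b p) = p.
Proof.
move=> rp l0; have p0 := nz rp; symmetry; apply: pmax_unique.
- by rewrite scaler_eq0 negb_or gt_eqF//= ggrad_neq0.
- by apply/gauge_le1; rewrite rp.
- by rewrite dotvZr dotvC gauge_euler// polarZ ?(ltW l0)// polar_grad// rp.
Qed.

Lemma pmax_cont x (e : R) : x != 0 -> 0 < e -> exists2 d : R, 0 < d &
 forall x', `|x' - x| < d -> `|pmax x' - pmax x| <= e.
Proof.
move=> x0 e0; have [C [d [C0 d0 hC]]] := maximizer_near.
have rp := pmax_gauge x0; have r0 := polar_gt0 x0.
exists (rho0 x * min d (e / C)); first by pos.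
move=> x' hx'; pose v := (rho0 x)^-1 *: (x' - x).
have : `|v| < min d (e / C).
 by rewrite normrZ gtr0_norm ?invr_gt0// mulrC ltr_pdivrMr// mulrC.
rewrite lt_min => /andP[vd ve].
have xE : x' = rho0 x *: (b (pmax x) + v).
 by rewrite scalerDr -pmax_eq// /v scalerA mulfV ?gt_eqF// scale1r addrC subrK.
have [h1 h2] := pmaxP x'.
have h3 : dotv (pmax x') (b (pmax x) + v) = rho0 (b (pmax x) + v).
 move: h2; rewrite {2 3}xE dotvZr polarZ ?(ltW r0)//.
 by apply: mulfI; rewrite gt_eqF.
have [h _] := hC _ _ _ rp h1 h3 vd.
by rewrite (le_trans h)// mulrC -ler_pdivlMr// ltW.
Qed.

(** [K] deprived of a unique maximiser of a linear form is still convex; if it contained [A], it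
    would contain the hull. *)
Lemma pmax_exposed (A : set E) x : K = conv_hull A -> x != 0 -> A (pmax x).
Proof.
move=> KA x0; have [//|nA] := pselect (A (pmax x)); exfalso.
have [h1 h2] := pmaxP x.
have : K (pmax x) /\ pmax x <> pmax x; last by case.
rewrite {1}KA in h1; move: h1.
apply: (@conv_hull_min _ _ A (fun q => K q /\ q <> pmax x)); last first.
 move=> q Aq; split; last by move=> qE; apply: nA; rewrite -qE.
 by rewrite KA => B [_]; exact.
move=> y z t t01 [Ky yp] [Kz zp]; split; first by case: HK => _ _; apply.
have lt_of q : K q -> q <> pmax x -> dotv q x < rho0 x.
 move=> Kq qp; rewrite lt_neqAle dotv_polar// andbT.
 by apply/eqP => e; apply: qp; exact: pmax_unique.
move=> e; have := h2; rewrite -e dotvDl !dotvZl.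
have := lt_of _ Ky yp; have := lt_of _ Kz zp; case/andP: t01 => t0 t1 a1 a2 a3.
have [t00|tp] := eqVneq t 0.
 by move: a3; rewrite t00 mul0r add0r subr0 mul1r => a3; rewrite a3 ltxx in a1.
have {}tp : 0 < t by pos.
have b1 : t * dotv y x < t * rho0 x by rewrite ltr_pM2l.
have b2 : (1 - t) * dotv z x <= (1 - t) * rho0 x by rewrite ler_wpM2l ?subr_ge0// ltW.
clear KA; lra.
Qed.

End K_curvature.

Lemma sub_subl (V : zmodType) (x y z : V) : x - z - (x - y) = - (z - y).
Proof. by rewrite !opprB addrC addrA subrK. Qed.

(** * Differentiability almost everywhere of minima of polar cones *)

Section profile.
Variables (Omega S : set E) (u phi : E -> R) (Lphi M : R).
Implicit Types (x y v p : E).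
Hypotheses (Omega_o : open Omega) (S_compact : compact S) (OmegaS : {ae mu, forall x, Omega x -> ~ S x})
 (u_lip : forall x y, u x <= u y + rho0 (x - y))
 (u_min : forall x, Omega x -> exists2 y, S y & u x = u y + rho0 (x - y)) (phi_lip : lipfun phi Lphi)
 (phi_ge0 : forall x, 0 <= phi x) (phi_gt0 : forall x, Omega x -> 0 < phi x)
 (phi_out : forall x, ~ Omega x -> phi x = 0) (Omega_M : forall x, Omega x -> `|x| <= M).

Lemma profile_lip : exists2 L : R, 0 < L & lipfun u L.
Proof.
have [L L0 hL] := polar_upper; exists L => // x y.
have h1 := u_lip x y; have h2 := u_lip y x.
have h3 := hL (x - y); have h4 := hL (y - x); rewrite (distrC y) in h4.
by rewrite ler_norml; apply/andP; split; lra.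
Qed.

(** [p] is the gradient at [x] of a cone [u y + rho0 (. - y)] that lies above [u] and touches it at
    [x]. The section serves for the distance, with [S] the boundary, and for the competitor, with
    one more vertex. *)
Definition prox x p := exists y, [/\ S y, x != y, u x = u y + rho0 (x - y) & p = pmax (x - y)].

Lemma prox_exists x : Omega x -> ~ S x -> exists p, prox x p.
Proof.
move=> Ox Sx; have [y Sy uE] := u_min Ox; exists (pmax (x - y)), y; split=> //.
by apply/eqP => e; apply: Sx; rewrite e.
Qed.

Lemma prox_le x p (e : R) : prox x p -> 0 < e -> exists2 d : R, 0 < d & forall v, `|v| < d ->
 u (x + v) - u x <= dotv p v + e * `|v|.
Proof.
move=> [y [Sy xy uE ->]] e0; have xy0 : x - y != 0 by rewrite subr_eq0.
have [d d0 hd] := pmax_hgrad xy0 e0; exists d => // v /hd.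
have := u_lip (x + v) y; rewrite uE addrAC.
by rewrite ler_norml => h /andP[_ h2]; lra.
Qed.

(** The same touching cone bounds the forward quotient from above and the backward quotient from
    below. *)
Lemma prox_dq x p i (e : R) : prox x p -> 0 < e -> exists N, forall k, (N <= k)%N ->
 dq i u k x <= p$i + e /\ p$i - e <= dq i u k (x - hstep k i).
Proof.
move=> hp e0; have [d d0 hd] := prox_le hp e0; have [N hN] := step_small d0.
exists N => k Nk; have k0 : 0 < k.+1%:R :> R by [].
have s1 : k.+1%:R * step k = 1 :> R by rewrite /step mulfV// gt_eqF.
have h1 := hd (hstep k i); have h2 := hd (- hstep k i).
rewrite normrN norm_hstep in h1 h2; have {}h1 := h1 (hN _ Nk); have {}h2 := h2 (hN _ Nk).
rewrite dotvNr dotvZr dotv_delta in h1 h2.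
split; rewrite /dq ?subrK.
 have := ler_wpM2l (ltW k0) h1.
 have -> : k.+1%:R * (step k * p$i + e * step k) = (k.+1%:R * step k) * (p$i + e) by ring.
 by rewrite s1 mul1r.
have := ler_wpM2l (ltW k0) h2.
have -> : k.+1%:R * (- (step k * p$i) + e * step k) = (k.+1%:R * step k) * (e - p$i) by ring.
by rewrite s1 mul1r mulrBr (mulrBr _ (u x)); lra.
Qed.

(** Two distinct gradients of touching cones would keep the backward quotient above the forward one
    by a fixed amount in some direction; the integral of this jump tends to 0. *)
Lemma prox_unique_ae : {ae mu, forall x, Omega x -> forall p p', prox x p -> prox x p' -> p = p'}.
Proof.
have [L L0 hL] := profile_lip; have mu0 := lip_meas hL.
have phiM x : M < `|x| -> phi x = 0.
 by move=> h; apply: phi_out => /Omega_M; rewrite leNgt h.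
have iphi := lip_ible phi_lip phiM.
have mphi := ible_meas iphi.
(* Backward minus forward quotient, weighted by [phi]. *)
pose s i k x := (dq i u k (x - hstep k i) - dq i u k x) * phi x.
have sb i k x : `|s i k x| <= 2 * L * phi x.
 rewrite normrM (ger0_norm (phi_ge0 x)) ler_wpM2r// (le_trans (ler_normB _ _))//.
 by have := lip_dq i k x hL; have := lip_dq i k (x - hstep k i) hL; lra.
have ms i k : mfun (s i k).
 apply: measurable_funM => //; apply: measurable_funB; last exact: meas_dq.
 by apply: meas_shift; exact: meas_dq.
have iB : ible (fun x => 2 * L * phi x) by exact: ibleZ.
have is_ i k : ible (s i k) by apply: ible_le iB _.
have [B iBB [B1 B2]] := @ball_cutoff R n 1 (M + 1).
(* A translation moves the difference onto [phi], whose Lipschitz bound makes the integral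
   [O(step k)]. *)
have cvs i : intg (s i k) @[k --> \oo] --> 0.
 have id1 k : ible (fun x => dq i u k x * phi x).
  apply: (ible_le _ (ibleZ L iphi)) => [|x].
   by apply: measurable_funM => //; exact: meas_dq.
  by rewrite normrM (ger0_norm (phi_ge0 x)) ler_wpM2r//; exact: lip_dq.
 have id2 k : ible (fun x => dq i u k x * phi (x + hstep k i)).
  apply: (ible_le _ (ibleZ L (ible_shift (hstep k i) iphi))) => [|x].
   apply: measurable_funM; [exact: meas_dq | exact: meas_shift].
  by rewrite normrM (ger0_norm (phi_ge0 _)) ler_wpM2r//; exact: lip_dq.
 have e k : intg (s i k) = I{x, dq i u k x * (phi (x + hstep k i) - phi x)}.
  have -> : s i k = (fun x => dq i u k (x - hstep k i) * phi x - dq i u k x * phi x).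
   by apply/funext => x; rewrite /s mulrBl.
  have sh : (fun x => dq i u k (x - hstep k i) * phi x) =
    (fun x => (fun z => dq i u k z * phi (z + hstep k i)) (x + - hstep k i)).
   by apply/funext => x /=; rewrite subrK.
  rewrite intB//; last by rewrite sh; exact: (ible_shift (- hstep k i) (id2 k)).
  rewrite sh; have -> := int_shift (- hstep k i) (id2 k); rewrite -intB//; congr intg; apply/funext => x; by pos.
 pose c := L * `|Lphi| * intg B + 1.
 have B0 : 0 <= intg B.
  apply: int_ge0 => x; have [/B1->//|/B2->//] := leP `|x| (M + 1).
 have c0 : 0 < c by rewrite ltr_wpDl// !mulr_ge0// ltW.
 apply/cvg_seqP => e0 e00; have [N hN] := step_small (divr_gt0 e00 c0).
 exists N => k /hN; rewrite ltr_pdivlMr// subr0 => hk.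
 have ib : ible (fun x => L * `|Lphi| * step k * B x) by exact: ibleZ.
 have ii : ible (fun x => dq i u k x * (phi (x + hstep k i) - phi x)).
  by have := ibleB (id2 k) (id1 k); under eq_fun do rewrite -mulrBr.
 rewrite e (le_trans (int_norm ii))//.
 apply: (@le_trans _ _ (I{x, L * `|Lphi| * step k * B x})).
  apply: int_le => // [|x]; first exact: ible_norm.
  have [xM|xM] := leP `|x| (M + 1).
   rewrite B1// mulr1 normrM -mulrA ler_pM//; first exact: lip_dq.
   have := phi_lip (x + hstep k i) x; rewrite addr_subK norm_hstep => /le_trans; apply.
   by rewrite ler_wpM2r ?ler_norm// ltW// step_gt0.
  rewrite B2// mulr0 (phiM x) ?(lt_trans _ xM) ?ltrDl// phiM ?subrr ?mulr0 ?normr0//.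
  have := ler_normB (x + hstep k i) (hstep k i); rewrite addrK norm_hstep.
  by have := @step_le1 R k; move: xM; lra.
 rewrite intZ// -mulrA mulrCA mulrA (le_trans _ (ltW hk))//.
 have := @step_gt0 R k; rewrite /c; move: (intg B) (step k) => I0 s0 s00.
 by pos.
(* By [prox_dq] the negative part of the jump tends to 0 almost everywhere; with the limit 0 of the
   integrals, the absolute value tends to 0 in mean. *)
pose neg i k x := (`|s i k x| - s i k x) / 2.
have mneg i k : mfun (neg i k).
 apply: measurable_funM; last exact: measurable_cst.
 by apply: measurable_funB => //; exact: measurableT_comp.
have negb i k x : `|neg i k x| <= 2 * L * phi x.
 rewrite /neg normrM [X in _ * X]ger0_norm// ler_pdivrMr//.
 rewrite (le_trans (ler_normB _ _))// normr_id; have := sb i k x; lra.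
have ineg i k : ible (neg i k) by apply: ible_le iB _.
have cvneg i : intg (neg i k) @[k --> \oo] --> 0.
 have cv0 : {ae mu, forall x, neg i k x @[k --> \oo] --> (0 : R)}.
  apply: filterS OmegaS => x Sx; apply/cvg_seqP => e e0.
  have [Ox|Ox] := pselect (Omega x); last first.
   by exists 0%N => k _; rewrite /neg /s phi_out// mulr0 normr0 subrr mul0r subrr normr0 ltW.
  have [p hp] := prox_exists Ox (Sx Ox).
  have e1 : 0 < e / (2 * phi x) by rewrite divr_gt0// mulr_gt0// phi_gt0.
  have [N hN] := prox_dq i hp e1; exists N => k /hN[h1 h2]; rewrite subr0.
  have s0 : - e <= s i k x.
   have -> : - e = (- (2 * (e / (2 * phi x)))) * phi x by field; rewrite gt_eqF// phi_gt0.
   by rewrite /s ler_wpM2r//; lra.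
  rewrite /neg; have [s1|s1] := leP 0 (s i k x).
   by rewrite (ger0_norm s1) subrr mul0r normr0 ltW.
  move: (s i k x) s0 s1 => t s0 s1; rewrite (ltr0_norm s1).
  have -> : (- t - t) / 2 = - t by field.
  by rewrite gtr0_norm ?oppr_gt0// lerNl.
 have hb : {ae mu, forall x, forall k, `|neg i k x| <= 2 * L * phi x} by exact: aeW.
 have mc : mfun (fun _ : E => 0 : R) by pos.
 by have [_ _] := int_dct (mneg i) mc cv0 iB hb; rewrite int0.
have cva i : I{x, `|s i k x|} @[k --> \oo] --> 0.
 apply/cvg_seqP => e e0; have e3 : 0 < e / 3 by pos.
 have [N1 h1] := (cvg_seqP _ _).1 (cvs i) _ e3.
 have [N2 h2] := (cvg_seqP _ _).1 (cvneg i) _ e3.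
 exists (maxn N1 N2) => k; rewrite geq_max => /andP[/h1 k1 /h2 k2].
 have -> : I{x, `|s i k x|} = intg (s i k) + 2 * intg (neg i k).
  rewrite -intZ// -intD//; last exact: ibleZ.
  by congr intg; apply/funext => x; rewrite /neg; field.
 move: k1 k2; rewrite !subr0 !ler_norml => /andP[? ?] /andP[? ?]; apply/andP; split; lra.
have fat i := fatou0 (fun k => ible_norm (is_ i k)) (fun k x => normr_ge0 _) (cva i).
have {}fat : {ae mu, forall x, forall i (dl : R) N, 0 < dl -> exists2 k, (N <= k)%N & `|s i k x| < dl}.
 by apply: filter_forall => i; exact: fat.
apply: filterS fat => x fat Ox.
(* With [e] a quarter of the gap, the jump would stay at least [2 e phi x] for all large [k],
   against [fatou0]. *)
have half p p' i : prox x p -> prox x p' -> p'$i <= p$i.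
 move=> hp hp'; rewrite leNgt; apply/negP => lt.
 pose e := (p'$i - p$i) / 4.
 have e0 : 0 < e by rewrite divr_gt0// subr_gt0.
 have [N1 h1] := prox_dq i hp e0; have [N2 h2] := prox_dq i hp' e0.
 have dl0 : 0 < 2 * e * phi x by apply: mulr_gt0; [rewrite mulr_gt0 | exact: phi_gt0].
 have [k] := fat i _ (maxn N1 N2) dl0; rewrite geq_max => /andP[/h1[a1 _] /h2[_ a2]].
 rewrite ltNge => /negP; apply; apply: le_trans (ler_norm _).
 by rewrite /s ler_wpM2r//; move: a1 a2; rewrite /e; lra.
by move=> p p' hp hp'; apply/rowP => i; apply/le_anti; rewrite !half.
Qed.

(** The upper bound comes from the touching cone at [x]. The lower one comes from the cone touching
    at [x + v], whose gradient at [x] is close to [p] because its vertex is almost optimal for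
    [x]. *)
Lemma prox_unique_hgrad x p : Omega x -> ~ S x -> prox x p -> (forall p', prox x p' -> p' = p) -> hgrad u x p.
Proof.
move=> Ox Sx hp up e e0.
have [d1 d10 h1] := prox_le hp e0.
have [C C0 hC] := polar_upper.
have [L L0 hL] := profile_lip.
have [r r0 hr] := (openNP Omega).1 Omega_o x Ox.
have [C2 C20 hC2] := polar_lip.
have e1 : 0 < e / (n%:R + 1) by pos.
(* Compactness of [S]: near an optimal vertex [pmax] is continuous, and near any other vertex the
   value exceeds [u x] by a fixed gap. *)
have [dl dl0 hdl] : exists2 dl : R, 0 < dl & forall y, S y -> u y + rho0 (x - y) < u x + dl ->
  `|pmax (x - y) - p| <= e / (n%:R + 1).
 apply: (@compact_unif _ _ S (fun dl y => u y + rho0 (x - y) < u x + dl ->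
   `|pmax (x - y) - p| <= e / (n%:R + 1)) S_compact) => [d d' y dd h h'|y Sy].
  by pos.
 have xy : x != y by apply/eqP => E1; apply: Sx; rewrite E1.
 have xy0 : x - y != 0 by rewrite subr_eq0.
 have [|uy] := leP (u y + rho0 (x - y)) (u x).
  move=> h; have uE : u x = u y + rho0 (x - y) by apply/le_anti; rewrite u_lip h.
  have pE : pmax (x - y) = p by apply: up; exists y.
  have [d d0 hd] := pmax_cont xy0 e1; exists d => // z Sz zy _.
  by rewrite -pE; apply: hd; rewrite sub_subl normrN.
 pose g := u y + rho0 (x - y) - u x; have g0 : 0 < g by rewrite subr_gt0.
 exists (min (g / 2) (g / 2 / (L + C2))); first by pos.
 move=> z Sz; rewrite lt_min => /andP[_ zy] h; exfalso.
 rewrite ltr_pdivlMr ?addr_gt0// in zy.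
 have g1 : min (g / 2) (g / 2 / (L + C2)) <= g / 2 by rewrite ge_min lexx.
 have := hL z y; have := hC2 (x - z) (x - y).
 rewrite sub_subl normrN !ler_norml => /andP[a1 a2] /andP[a3 a4].
 by move: h g1 zy a1 a3; rewrite /g; move: (min _ _) => mm; nra.
exists (min d1 (min r (dl / (2 * C)))).
 by pos.
move=> v; rewrite !lt_min => /and3P[v1 v2 v3].
have up1 := h1 _ v1.
have Oxv : Omega (x + v) by apply: hr; rewrite addr_subK.
have [y Sy uE] := u_min Oxv.
have xy : x != y by apply/eqP => E1; apply: Sx; rewrite E1.
have xy0 : x - y != 0 by rewrite subr_eq0.
have k1 := u_lip x y.
have k2 : dotv (pmax (x - y)) v <= rho0 (x + v - y) - rho0 (x - y).
 have [Kp <-] := pmaxP (x - y); have := dotv_polar (x + v - y) Kp.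
 by pos.
have k3 : `|pmax (x - y) - p| <= e / (n%:R + 1).
 apply: hdl => //; have h3 := u_lip (x + v) x; rewrite addr_subK in h3.
 have := polarD (x + v - y) (- v); rewrite addrAC addrK => h4.
 have h5 := hC v; have h6 := hC (- v); rewrite normrN in h6.
 by rewrite ltr_pdivlMr ?mulr_gt0// in v3; lra.
have k4 : `|dotv (pmax (x - y) - p) v| <= e * `|v|.
 rewrite (le_trans (dotv_le _ _))// mulrA ler_wpM2r//.
 rewrite (@le_trans _ _ (n%:R * (e / (n%:R + 1))))// ?ler_wpM2l//.
 by rewrite mulrCA ler_piMr ?(ltW e0)// ler_pdivrMr ?ltr_wpDl// mul1r lerDl.
rewrite dotvBl in k4; move: k4; rewrite !ler_norml => /andP[k4 k5].
by apply/andP; split; lra.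
Qed.

Lemma profile_hgrad : {ae mu, forall x, Omega x -> exists2 p, prox x p & hgrad u x p}.
Proof.
apply: filterS2 OmegaS prox_unique_ae => x Sx hu Ox.
have [p hp] := prox_exists Ox (Sx Ox); exists p => //.
by apply: prox_unique_hgrad => //; [exact: Sx | move=> p' hp'; exact: hu].
Qed.

End profile.

(** * The Minkowski distance, charts and the signed distance near the boundary *)

Section minkowski_distance.
Variables (Omega : set E).
Hypotheses (n2 : (2 <= n)%N) (Omega0 : Omega !=set0) (Omega_b : bounded_set Omega) (Omega_o : open Omega)
 (Omega_C2 : class_C2 Omega).
Notation d := (minkowski_dist K Omega).
Notation ds := (sdist K Omega).
Notation bd := (boundary Omega).
Notation r := (inradius K Omega).
Notation Sigma := (singular_set K Omega).
Notation ext0 := (ext0 Omega).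

Let n0 : (0 < n)%N. Proof. exact: ltn_trans n2. Qed.
Let nr0 : 0 < n%:R :> R. Proof. by pos. Qed.
Let nz := gauge_neq0.
Let mO : measurable Omega := open_meas Omega_o.

Section charts.
Implicit Types (x y z v p q : E) (phi : E -> R) (V : set E).

Lemma bd_openP x : bd x <-> closure Omega x /\ ~ Omega x.
Proof. by rewrite /boundary (interior_id Omega).1. Qed.

Lemma closure_bounded : exists2 M : R, 0 < M & forall x, closure Omega x -> `|x| <= M.
Proof.
have /ex_strict_bound_gt0[M M0 hM] := Omega_b; exists M => // x.
move=> /closureNP h; apply/ler_addgt0Pr => e e0; have [y /hM yM yx] := h _ e0.
rewrite -[x](subrK y) addrC (le_trans (ler_normD _ _))// lerD// ?ltW// distrC//.
Qed.

Lemma closure_compact : compact (closure Omega).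
Proof.
apply: bounded_closed_compact; last exact: closed_closure.
have [M M0 hM] := closure_bounded.
exists M; split=> [|M1 M11 x /hM h]; first exact: gtr0_real.
exact: le_trans h (ltW M11).
Qed.

Lemma bd_compact : compact bd.
Proof.
apply: subclosed_compact closure_compact _; first exact: boundary_closed.
by move=> x [].
Qed.

(** Take the supremum of the parameters whose point lies in the closure of [Omega]. *)
Lemma segment_crosses x z : closure Omega x -> ~ Omega z -> exists2 t : R, 0 <= t <= 1 & bd (x + t *: (z - x)).
Proof.
move=> cx nOz; pose A := [set t : R | 0 <= t <= 1 /\ closure Omega (x + t *: (z - x))].
have A0 : A 0 by split; [rewrite lexx ler01|rewrite scale0r addr0].
have Asup : has_sup A by split; [exists 0|exists 1 => t [/andP[]]].
set s := sup A.
have s0 : 0 <= s by exact: (sup_upper_bound Asup).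
have s1 : s <= 1 by apply: sup_le_ub; [exists 0|move=> t [/andP[]]].
have cs : closure Omega (x + s *: (z - x)).
 apply/closureNP => e e0; pose k := `|z - x| + 1.
 have k0 : 0 < k by rewrite ltr_wpDl.
 have ek : 0 < e / 2 / k by pos.
 have [t [/andP[t0 t1] /closureNP ct] ts] := sup_adherent ek Asup.
 have tA : A t by split; [rewrite t0|exact/closureNP].
 have tles : t <= s by exact: (sup_upper_bound Asup).
 have e20 : 0 < e / 2 by pos.
 have [y Oy yt] := ct _ e20; exists y => //.
 rewrite -[y](subrK (x + t *: (z - x))) -addrA [e]splitr (le_lt_trans (ler_normD _ _))//.
 rewrite ltr_leD// opprD addrACA subrr add0r -scalerBl normrZ distrC ger0_norm ?subr_ge0//.
 rewrite (@le_trans _ _ (e / 2 / k * k))//; last by rewrite divfK// gt_eqF.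
 rewrite ler_pM ?subr_ge0//; last by rewrite lerDl.
 by move: ts; rewrite -/s => ts; rewrite lerBlDr addrC -lerBlDr ltW.
exists s; first by pos.
apply/bd_openP; split=> // Os; have s1' : s < 1.
 rewrite lt_neqAle s1 andbT; apply/eqP => e; apply: nOz.
 by move: Os; rewrite e scale1r addrC subrK.
have [e e0 he] := (openNP Omega).1 Omega_o _ Os.
pose k := `|z - x| + 1; have k0 : 0 < k by rewrite ltr_wpDl.
pose t := min (1 - s) (e / (2 * k)).
have t0 : 0 < t by rewrite lt_min subr_gt0 s1' divr_gt0// mulr_gt0.
suff : s + t <= s by pos.
apply: (sup_upper_bound Asup); split.
 rewrite addr_ge0 ?(ltW t0)//= -lerBrDl ge_min lexx//.
apply: subset_closure; apply: he.
rewrite scalerDl addrA addr_subK normrZ gtr0_norm//.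
rewrite (@le_lt_trans _ _ (e / (2 * k) * k))//.
 by rewrite ler_pM ?(ltW t0)// ?ge_min ?lexx ?orbT// lerDl.
have -> : e / (2 * k) * k = e / 2 by field; pos.
by pos.
Qed.

Lemma bd_nonempty : bd !=set0.
Proof.
have [x Ox] := Omega0; have [M M0 hM] := closure_bounded.
pose z : E := (M + 1) *: delta_mx ord0 (Ordinal n0).
have nOz : ~ Omega z.
 move=> /subset_closure/hM; rewrite normrZ norm_delta mulr1 ger0_norm.
  by pos.
 by pos.
have [t _ h] := segment_crosses (subset_closure Ox) nOz.
by exists (x + t *: (z - x)).
Qed.

Lemma distP x : exists2 y, bd y /\ d x = rho0 (x - y) & forall y', bd y' -> d x <= rho0 (x - y').
Proof.
have [y _|y By hy] := @compact_argmin _ _ bd (fun y => rho0 (x - y)) bd_nonempty bd_compact.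
 have [C C0 hC] := polar_lip.
 apply: (@lip_cont _ _ _ C) => z w; rewrite (le_trans (hC _ _))//.
 have -> : x - z - (x - w) = w - z by rewrite opprB addrC addrA subrK.
 by rewrite distrC.
have e : d x = rho0 (x - y).
 apply/le_anti/andP; split.
  apply: ge_inf; last by exists y.
  by exists 0 => _ [z _ <-]; exact: polar_ge0.
 apply: lb_le_inf; first by exists (rho0 (x - y)), y.
 by move=> _ [z Bz <-]; exact: hy.
by exists y => // y' By'; rewrite e hy.
Qed.

Lemma dist_ge0 x : 0 <= d x.
Proof. by have [y [_ ->] _] := distP x; exact: polar_ge0. Qed.

Lemma dist_le x y : bd y -> d x <= rho0 (x - y).
Proof. by have [z _ h] := distP x; exact: h. Qed.

Lemma dist_bd y : bd y -> d y = 0.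
Proof.
move=> By; apply/le_anti; rewrite dist_ge0 andbT (le_trans (dist_le y By))//.
by rewrite subrr polar0.
Qed.

Lemma dist_gt0 x : ~ bd x -> 0 < d x.
Proof.
move=> nB; have [y [By ->] _] := distP x; apply: polar_gt0.
by rewrite subr_eq0; apply/eqP => e; apply: nB; rewrite e.
Qed.

Lemma Omega_not_bd x : Omega x -> ~ bd x.
Proof. by move=> Ox /bd_openP[]. Qed.

Lemma dist_sub x z : d x <= d z + rho0 (x - z).
Proof.
have [y [By ->] _] := distP z; rewrite (le_trans (dist_le x By))//.
by rewrite [X in _ <= X]addrC (le_trans _ (polarD _ _))// addrA subrK.
Qed.

Lemma dist_le_out x z : closure Omega x -> ~ Omega z -> d x <= rho0 (x - z).
Proof.
move=> cx nOz; have [t /andP[t0 t1] By] := segment_crosses cx nOz.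
apply: le_trans (dist_le x By) _.
have -> : x - (x + t *: (z - x)) = t *: (x - z) by rewrite opprD addNKr -scalerN opprB.
by rewrite polarZ// ler_piMl// polar_ge0.
Qed.

Lemma dist_inside x z : closure Omega x -> rho0 (x - z) < d x -> Omega z.
Proof.
move=> cx h; have [//|nOz] := pselect (Omega z).
by have := dist_le_out cx nOz; rewrite leNgt h.
Qed.

(** Unlike [C2_defining], which concerns one point, a chart has nonzero gradient on all of [V] and
    serves for all boundary points there. *)
Definition chart phi V := [/\ open V, classC 2 V phi, forall x, V x -> grad phi x != 0
 & forall x, V x -> (Omega x <-> phi x < 0) /\ (bd x <-> phi x = 0)].

Lemma grad_continuous phi V i x : open V -> classC 2 V phi -> V x -> {for x, continuous (fun z => grad phi z$i)}.
Proof. by move=> oV cphi Vx; exact: (hgrad_cont (hgrad_gradi i oV Vx cphi)). Qed.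

Lemma grad_near phi V x (e : R) : open V -> classC 2 V phi -> V x -> 0 < e ->
 exists2 r : R, 0 < r & forall z, `|z - x| < r -> V z /\ `|grad phi z - grad phi x| < e.
Proof.
move=> oV cphi Vx e0; have [r0 r00 hr0] := (openNP V).1 oV _ Vx.
have h i : exists r : R, 0 < r /\ forall z, `|z - x| < r -> `|grad phi z$i - grad phi x$i| < e.
 by have /contNP/(_ _ e0)[r rp hr] := (@grad_continuous phi V i x oV cphi Vx); exists r.
have [D hD] := choice h.
exists (min r0 (\big[min/1]_i D i)).
 by rewrite lt_min r00 /=; apply: lt_bigmin => // i _; have [] := hD i.
move=> z; rewrite lt_min => /andP[zr zD]; split; first exact: hr0.
apply: norm_lt_coord => // i.
have -> : (grad phi z - grad phi x)$i = grad phi z$i - grad phi x$i.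
 by move: (grad phi z) (grad phi x) => A B; rewrite !mxE.
by have [_] := hD i; apply; apply: lt_le_trans zD _; exact: bigmin_le.
Qed.

Lemma chartP y : bd y -> exists phi V, chart phi V /\ V y.
Proof.
move=> /Omega_C2[phi [V [oV Vy cphi gy hphi]]].
pose W := V `&` [set z | grad phi z != 0].
exists phi, W; split; last by split.
have WV : W `<=` V by move=> z [].
split=> [||z []//|z /WV Vz].
- apply/openNP => z [Vz /= gz].
 have gzp : 0 < `|grad phi z| by pos.
 have [r' r'0 hr'] := grad_near oV cphi Vz gzp.
 exists r' => // w /hr'[Vw h]; split=> //=; apply: contraTneq h => ->.
 by rewrite sub0r normrN ltxx.
- exact: classC_sub WV cphi.
- by have := hphi _ Vz; rewrite (interior_id Omega).1.
Qed.

Lemma chart_defining phi V y : chart phi V -> V y -> C2_defining Omega y phi.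
Proof.
move=> [oV cphi gphi hphi] Vy; exists V; split=> //; first exact: gphi.
by rewrite (interior_id Omega).1.
Qed.

Lemma defining_hgrad phi y : C2_defining Omega y phi -> hgrad phi y (grad phi y).
Proof.
move=> [V [oV Vy cphi _ _]]; apply: (C1_hgrad oV Vy); exact: (classC_le oV _ cphi).
Qed.

Lemma defining_0 phi y : C2_defining Omega y phi -> bd y -> phi y = 0.
Proof. by move=> [V [oV Vy cphi _ /(_ _ Vy)[_ h]]] /h. Qed.

Lemma defining_exit phi y v : C2_defining Omega y phi -> bd y -> 0 < dotv (grad phi y) v ->
 exists2 r : R, 0 < r & forall t, 0 < t < r -> ~ Omega (y + t *: v).
Proof.
move=> dphi By gv; have hg := defining_hgrad dphi.
have [r r0 hr] := hgrad_dir_pos hg gv.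
have p0 := defining_0 dphi By.
case: dphi => V [oV Vy cphi _ hphi]; have [r1 r10 hr1] := (openNP V).1 oV _ Vy.
have v1 : 0 < `|v| + 1 by pos.
exists (min r (r1 / (`|v| + 1))); first by pos.
move=> t /andP[t0]; rewrite lt_min => /andP[tr tr1] Ot.
have Vt : V (y + t *: v).
 apply: hr1; rewrite addr_subK normrZ gtr0_norm//.
 move: tr1; rewrite ltr_pdivlMr//; apply: le_lt_trans.
 by pos.
have := hr t; rewrite t0 tr p0 => /(_ isT) h.
have [h1 _] := hphi _ Vt; move: Ot; rewrite -(interior_id Omega).1// => /h1.
by move=> /(lt_trans h); rewrite ltxx.
Qed.

Lemma defining_enter phi y v : C2_defining Omega y phi -> bd y -> dotv (grad phi y) v < 0 ->
 exists2 r : R, 0 < r & forall t, 0 < t < r -> Omega (y + t *: v).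
Proof.
move=> dphi By gv; have hg := defining_hgrad dphi.
have gv' : 0 < dotv (- grad phi y) v by rewrite dotvNl oppr_gt0.
have [r r0 hr] := hgrad_dir_pos (hgradN hg) gv'.
have p0 := defining_0 dphi By.
case: dphi => V [oV Vy cphi _ hphi]; have [r1 r10 hr1] := (openNP V).1 oV _ Vy.
have v1 : 0 < `|v| + 1 by pos.
exists (min r (r1 / (`|v| + 1))); first by pos.
move=> t /andP[t0]; rewrite lt_min => /andP[tr tr1].
have Vt : V (y + t *: v).
 apply: hr1; rewrite addr_subK normrZ gtr0_norm//.
 move: tr1; rewrite ltr_pdivlMr//; apply: le_lt_trans.
 by pos.
have := hr t; rewrite t0 tr p0 oppr0 oppr_gt0 => /(_ isT) h.
by have [h1 _] := hphi _ Vt; rewrite -(interior_id Omega).1//; exact/h1.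
Qed.

(** [tangent_space] quantifies over all defining functions; this makes it independent of their
    choice. A direction leaving [Omega] for one function cannot enter it for another. *)
Lemma defining_colinear phi1 phi2 y : bd y -> C2_defining Omega y phi1 ->
 C2_defining Omega y phi2 -> exists2 c, 0 <= c & grad phi2 y = c *: grad phi1 y.
Proof.
move=> By d1 d2; have g1 : grad phi1 y != 0 by case: d1 => V [].
apply: halfspace_colinear => // v h1; rewrite leNgt; apply/negP => h2.
have [r r0 hr] := defining_exit d1 By h1.
have [s s0 hs] := defining_enter d2 By h2.
pose t := min r s / 2.
have m0 : 0 < min r s by pos.
have : t < min r s by rewrite ltr_pdivrMr// ltr_pMr// ltr1n.
have t0 : 0 < t by rewrite divr_gt0.
rewrite lt_min => /andP[tr ts]; apply: (hr t); first by pos.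
by apply: hs; rewrite t0.
Qed.

(* The inner conormal, normalized on [boundary K]. *)
Definition conormal phi y : E := rnorm (- grad phi y).

Lemma conormal_gauge phi y : grad phi y != 0 -> rho (conormal phi y) = 1.
Proof. by move=> g0; apply: gauge_rnorm; rewrite oppr_eq0. Qed.

Lemma conormalE phi y : grad phi y != 0 -> grad phi y = - (rho (- grad phi y) *: conormal phi y).
Proof.
move=> g0; rewrite /conormal /rnorm scalerA mulfV ?scale1r ?opprK//.
by rewrite gt_eqF// gauge_gt0// oppr_eq0.
Qed.

Lemma tangent_spaceE phi y v : C2_defining Omega y phi -> bd y ->
 tangent_space Omega y v <-> dotv (conormal phi y) v = 0.
Proof.
move=> dphi By; have g0 : grad phi y != 0 by case: dphi => V [].
have r0 : 0 < rho (- grad phi y) by apply: gauge_gt0; rewrite oppr_eq0.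
have e : dotv (conormal phi y) v = - (rho (- grad phi y))^-1 * dotv (grad phi y) v.
 by rewrite /conormal /rnorm dotvZl dotvNl mulrN mulNr.
split=> [[phi2 d2 h2]|/eqP].
 have [c c0 gE] := defining_colinear By d2 dphi.
 by rewrite e gE dotvZl h2 !mulr0.
rewrite e mulf_eq0 oppr_eq0 invr_eq0 gt_eqF//= => /eqP h.
by exists phi.
Qed.

(* A boundary point nearest to an inner point: the conormal is the gradient of the distance. *)
Lemma touching_inner phi x y : C2_defining Omega y phi -> closure Omega x -> bd y ->
 x != y -> d x = rho0 (x - y) -> pmax (x - y) = conormal phi y.
Proof.
move=> dphi cx By xy e; have g0 : grad phi y != 0 by case: dphi => V [].
have xy0 : x - y != 0 by rewrite subr_eq0.
have hp := hgrad_sub_l (pmax_hgrad xy0).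
have [c c0 pE] : exists2 c, 0 <= c & - pmax (x - y) = c *: grad phi y.
 apply: halfspace_colinear => // v gv; rewrite leNgt; apply/negP => pv.
 have pv' : 0 < dotv (- - pmax (x - y)) v by rewrite dotvNl oppr_gt0.
 have [r r0 hr] := hgrad_dir_pos (hgradN hp) pv'.
 have [s s0 hs] := defining_exit dphi By gv.
 have m0 : 0 < min r s by pos.
 have [t t0 tm] : exists2 t, 0 < t & t < min r s.
  by exists (min r s / 2); rewrite ?divr_gt0// ltr_pdivrMr// ltr_pMr// ltr1n.
 move: tm; rewrite lt_min => /andP[tr ts].
 have := hr t; rewrite t0 tr ltrN2 => /(_ isT); rewrite -e ltNge.
 by move=> /negP; apply; apply: (dist_le_out cx); apply: hs; rewrite t0.
have rp := pmax_gauge xy0.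
have pE' : pmax (x - y) = c *: - grad phi y by rewrite scalerN -pE opprK.
have c1 : c * rho (- grad phi y) = 1 by rewrite -gaugeZ// -pE'.
rewrite pE' /conormal /rnorm; congr (_ *: _).
have r0 : 0 < rho (- grad phi y) by apply: gauge_gt0; rewrite oppr_eq0.
by apply: (mulIf (lt0r_neq0 r0)); rewrite c1 mulVf// gt_eqF.
Qed.

(** Same argument from outside: a direction entering [Omega] cannot decrease [rho0 (. - x)] at the
    nearest point. *)
Lemma touching_outer phi x y : C2_defining Omega y phi -> bd y ->
 x != y -> (forall z, closure Omega z -> rho0 (y - x) <= rho0 (z - x)) -> pmax (y - x) = conormal phi y.
Proof.
move=> dphi By xy hmin; have g0 : grad phi y != 0 by case: dphi => V [].
have xy0 : y - x != 0 by rewrite subr_eq0 eq_sym.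
have hp := hgrad_sub_r (pmax_hgrad xy0).
have [c c0 pE] : exists2 c, 0 <= c & - pmax (y - x) = c *: grad phi y.
 apply: halfspace_colinear => // v gv; rewrite leNgt; apply/negP => pv.
 have pv' : 0 < dotv (- pmax (y - x)) (- v) by pos.
 have [r r0 hr] := hgrad_dir_pos (hgradN hp) pv'.
 have gv' : dotv (grad phi y) (- v) < 0 by pos.
 have [s s0 hs] := defining_enter dphi By gv'.
 have m0 : 0 < min r s by pos.
 have [t t0 tm] : exists2 t, 0 < t & t < min r s.
  by exists (min r s / 2); rewrite ?divr_gt0// ltr_pdivrMr// ltr_pMr// ltr1n.
 move: tm; rewrite lt_min => /andP[tr ts].
 have := hr t; rewrite t0 tr ltrN2 => /(_ isT); rewrite ltNge.
 by move=> /negP; apply; apply/hmin/subset_closure/hs; rewrite t0.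
have rp := pmax_gauge xy0.
have pE' : pmax (y - x) = c *: - grad phi y by rewrite scalerN -pE opprK.
have c1 : c * rho (- grad phi y) = 1 by rewrite -gaugeZ// -pE'.
rewrite pE' /conormal /rnorm; congr (_ *: _).
have r0 : 0 < rho (- grad phi y) by apply: gauge_gt0; rewrite oppr_eq0.
by apply: (mulIf (lt0r_neq0 r0)); rewrite c1 mulVf// gt_eqF.
Qed.

Lemma chart_bounds phi V y0 : chart phi V -> V y0 -> exists r C, [/\ 0 < r, 0 < C &
 forall y, `|y - y0| < r -> [/\ V y, C^-1 <= rho (- grad phi y), (forall i j, `|hess phi y i j| <= C)
  & forall z, `|z| < r -> V (y + z) /\ `|phi (y + z) - phi y - dotv (grad phi y) z| <= C * `|z| ^+ 2]].
Proof.
move=> [oV cphi gphi hphi] Vy0.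
have [r1 r10 h1] := hess_cont oV Vy0 cphi (@ltr01 R).
have [r2 r20 h2] := taylor2 oV Vy0 cphi (@ltr01 R).
have [k k0 hk] := mx_entry_bound (hess phi y0).
have g0 := gphi _ Vy0; have m0 : 0 < rho (- grad phi y0).
 by apply: gauge_gt0; rewrite oppr_eq0.
have [L L0 hL] := gauge_lip.
have e0 : 0 < rho (- grad phi y0) / 2 / L by pos.
have [r3 r30 h3] := grad_near oV cphi Vy0 e0.
pose C0 := n%:R ^+ 2 * (k + 1) + 1.
pose C := C0 + (k + 1) + (rho (- grad phi y0) / 2)^-1.
have k1 : 0 < k + 1 by pos.
have C00 : 0 < C0 by rewrite ltr_wpDl// mulr_ge0 ?exprn_ge0// ltW.
have iv : 0 < (rho (- grad phi y0) / 2)^-1 by pos.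
have Cp : 0 < C by rewrite /C addr_gt0// addr_gt0.
exists (min r1 (min r2 r3)), C; split=> //; first by rewrite !lt_min r10 r20.
move=> y; rewrite !lt_min => /and3P[/h1[Vy hy] yr2 /h3[_ yr3]].
have hH i j : `|hess phi y i j| <= k + 1.
 rewrite -[X in `|X|](subrK (hess phi y0 i j)) (le_trans (ler_normD _ _))// addrC lerD//.
split; [exact: Vy| | |].
- apply: (@le_trans _ _ (rho (- grad phi y0) / 2)).
  rewrite -[X in _ <= X]invrK lef_pV2 ?posrE// lerDr addr_ge0// ltW//.
 have : `|rho (- grad phi y) - rho (- grad phi y0)| <= rho (- grad phi y0) / 2.
  rewrite (le_trans (hL _ _))// -opprD normrN.
  by rewrite mulrC -ler_pdivlMr// ltW.
 exact: half_dist_le.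
- by move=> i j; rewrite (le_trans (hH i j))// /C -addrA addrCA lerDl addr_ge0 ?ltW.
- move=> z; rewrite !lt_min => /and3P[_ zr2 _].
 have [Vz _ ht] := h2 _ _ yr2 zr2; split=> //.
 have hb := bilin_le z z (ltW k1) hH.
 rewrite -[X in `|X|](subrK (2^-1 * bilin (hess phi y) z z)).
 rewrite (le_trans (ler_normD _ _))// (@le_trans _ _ (C0 * `|z| ^+ 2))//; last first.
  by rewrite ler_wpM2r ?exprn_ge0// /C -addrA lerDl addr_ge0 ?ltW.
 rewrite /C0 mulrDl addrC lerD// normrM ger0_norm ?invr_ge0// expr2.
 rewrite (le_trans _ hb)// ler_piMl// invf_le1// ler1n//.
Qed.

Lemma scaled_chart (phi : E -> R) y p (u : E) (m c C t s : R) :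
 grad phi y = - (m *: p) -> phi y = 0 -> C^-1 <= m -> 0 < C -> 0 < c -> 0 < t -> C * t < c / C ->
 c * `|u| ^+ 2 <= dotv p u -> u != 0 -> s = t \/ s = - t ->
 `|phi (y + s *: u) - phi y - dotv (grad phi y) (s *: u)| <= C * `|s *: u| ^+ 2 ->
 if s == t then phi (y + s *: u) < 0 else 0 < phi (y + s *: u).
Proof.
move=> gE p0 Cm C0 c0 t0 Ct cu u0 st.
have ns : `|s| = t by case: st => ->; rewrite ?normrN gtr0_norm.
have nu : 0 < `|u| ^+ 2 by pos.
rewrite p0 subr0 gE dotvNl dotvZl dotvZr opprK normrZ ns ler_norml => /andP[h1 h2].
have Ci : 0 < C^-1 by pos.
have mpu : C * (t * `|u|) ^+ 2 < m * (t * dotv p u).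
 apply: (@lt_le_trans _ _ (t * (c / C * `|u| ^+ 2))).
  rewrite exprMn expr2 -mulrA (mulrCA C) ltr_pM2l// mulrA.
  by rewrite ltr_pM2r.
 rewrite (mulrCA m) ler_pM2l// (mulrC c) -mulrA ler_pM ?(ltW Ci)// ?mulr_ge0// ltW//.
move: h1 h2 mpu; move: (C * _) => A; case: st => sE.
 by rewrite sE eqxx => h1 h2 h3; rewrite -subr_lt0; move: h2 h3; set X := phi _; set Y := m * _; lra.
have -> : (s == t) = false by apply/negbTE/eqP => E1; rewrite E1 in sE; clear gE; lra.
by rewrite sE mulNr mulrN => h1 h2 h3; move: h1 h3; set X := phi _; set Y := m * _; lra.
Qed.

(** Inner and outer touching balls for [rho0], of a radius uniform near [y0]. A point of such a ball
    is [y] plus or minus [t *: (b p - w)] with [rho0 w < 1], and [polar_strongly_convex] beats the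
    curvature of the chart. *)
Lemma wulff_balls phi V y0 : chart phi V -> V y0 -> exists t r : R, [/\ 0 < t, 0 < r &
 forall y, bd y -> `|y - y0| < r -> [/\ V y, (forall z, rho0 (y + t *: b (conormal phi y) - z) < t -> Omega z)
 & (forall z, rho0 (z - (y - t *: b (conormal phi y))) < t -> ~ closure Omega z)]].
Proof.
move=> ch Vy0; have [r [C [r0 C0 h]]] := chart_bounds ch Vy0.
have [oV cphi gphi hphi] := ch.
have [c c0 hc] := polar_strongly_convex.
have [Cb Cb0 hCb] := grad_bound.
have [c1 c10 hc1] := polar_lower.
pose U := Cb + c1^-1; have U0 : 0 < U by rewrite addr_gt0// invr_gt0.
pose t := min (r / (2 * U)) (c / (2 * C ^+ 2)).
have t0 : 0 < t by rewrite lt_min !divr_gt0// mulr_gt0// exprn_gt0.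
have tU : t * U < r.
 apply: (@le_lt_trans _ _ (r / (2 * U) * U)); first by rewrite ler_wpM2r ?(ltW U0)// ge_min lexx.
 have -> : r / (2 * U) * U = r / 2 by field; pos.
 by pos.
have Ct : C * t < c / C.
 apply: (@le_lt_trans _ _ (C * (c / (2 * C ^+ 2)))).
  by rewrite ler_wpM2l ?(ltW C0)// ge_min lexx orbT.
 have -> : C * (c / (2 * C ^+ 2)) = c / C / 2 by field; pos.
 by rewrite ltr_pdivrMr// ltr_pMr ?ltr1n// divr_gt0.
exists t, r; split=> // y By yr; have [Vy hm _ ht] := h _ yr.
have py : rho (conormal phi y) = 1 by apply: conormal_gauge; exact: gphi.
have gE := conormalE (gphi _ Vy).
have w1 : rho0 (b (conormal phi y)) = 1 by apply: (polar_grad (nz py)).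
have phi0 : phi y = 0 by apply/(hphi _ Vy).2.
move: (conormal phi y) py gE w1 hm => p py gE w1 hm.
have key w : rho0 w < 1 -> [/\ b p - w != 0, c * `|b p - w| ^+ 2 <= dotv p (b p - w) & `|t *: (b p - w)| < r].
 move=> w'; split.
 - by apply: contraTneq w' => /eqP; rewrite subr_eq0 => /eqP <-; rewrite w1 ltxx.
 - by rewrite distrC; apply: hc => //; rewrite ltW.
 - rewrite normrZ gtr0_norm//; apply: le_lt_trans tU; rewrite ler_pM2l//.
  rewrite (le_trans (ler_normB _ _))// lerD ?hCb ?(nz py)//.
  by rewrite -[c1^-1]mul1r ler_pdivlMr// mulrC (le_trans (hc1 _))// ltW.
have tn : t != 0 by pos.
split=> // z zt.
- pose w := t^-1 *: (y + t *: b p - z).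
 have /key[u0 cu ru] : rho0 w < 1.
  by rewrite polarZ ?invr_ge0 ?(ltW t0)// mulrC ltr_pdivrMr// mul1r.
 have zE : z = y + t *: (b p - w).
  rewrite scalerBr scalerA mulfV// scale1r !opprD opprK addrCA addrA.
  by apply/rowP => i; rewrite !mxE; ring.
 have [Vz hz] := ht _ ru.
 have := scaled_chart gE phi0 hm C0 c0 t0 Ct cu u0 (or_introl erefl) hz.
 by rewrite eqxx -zE => hh; apply/(hphi z _).1 => //; rewrite zE.
- pose w := t^-1 *: (z - (y - t *: b p)).
 have /key[u0 cu ru] : rho0 w < 1.
  by rewrite polarZ ?invr_ge0 ?(ltW t0)// mulrC ltr_pdivrMr// mul1r.
 have zE : z = y + (- t) *: (b p - w).
  rewrite scaleNr scalerBr scalerA mulfV// scale1r.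
  by apply/rowP => i; rewrite !mxE; ring.
 have ru' : `|- t *: (b p - w)| < r by rewrite scaleNr normrN.
 have [Vz hz] := ht _ ru'.
 have := scaled_chart gE phi0 hm C0 c0 t0 Ct cu u0 (or_intror erefl) hz.
 have -> : (- t == t) = false by apply/negbTE/eqP => E1; have := t0; lra.
 rewrite -zE => hh cz; have Vz' : V z by rewrite zE.
 have [h1 h2] := hphi _ Vz'.
 have [Oz|Oz] := pselect (Omega z); first by have := h1.1 Oz; rewrite ltNge (ltW hh).
 have : bd z by apply/bd_openP.
 by move=> /h2.1 e; move: hh; rewrite e ltxx.
Qed.

Lemma out_distP x : exists z, [/\ closure Omega z, inf [set rho0 (z - x) | z in closure Omega] = rho0 (z - x)
 & forall z', closure Omega z' -> rho0 (z - x) <= rho0 (z' - x)].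
Proof.
have cO := closure_compact.
have ne : closure Omega !=set0 by case: Omega0 => o Oo; exists o; exact: subset_closure.
have [z cz hz] : exists2 z, closure Omega z & forall z', closure Omega z' -> rho0 (z - x) <= rho0 (z' - x).
 apply: (compact_argmin ne cO) => z _.
 apply/contNP => e e0; have /contNP/(_ _ e0)[r r0 hr] := @polar_continuous (z - x).
 exists r => // z' zr; apply: hr; rewrite opprB addrA subrK//.
exists z; split=> //; apply/eqP; rewrite eq_le; apply/andP; split.
 apply: ge_inf; last by exists z.
 by exists 0 => _ [z' _ <-]; exact: polar_ge0.
apply: lb_le_inf; first by exists (rho0 (z - x)), z.
by move=> _ [z' cz' <-]; exact: hz.
Qed.

Lemma sdist_in x : closure Omega x -> ds x = d x.
Proof. by move=> cx; rewrite /sdist asboolT. Qed.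

Lemma sdist_out x : ~ closure Omega x -> exists z, [/\ closure Omega z, ds x = - rho0 (z - x)
 & forall z', closure Omega z' -> rho0 (z - x) <= rho0 (z' - x)].
Proof.
move=> cx; have [z [cz zE hz]] := out_distP x.
by exists z; split=> //; rewrite /sdist asboolF// zE.
Qed.

Lemma rho0_scale x z (t : R) : 0 <= t -> rho0 (x - (x + t *: (z - x))) = t * rho0 (x - z).
Proof. by move=> t0; rewrite opprD addrA subrr sub0r -scalerN opprB polarZ. Qed.

Lemma rho0_scale' x z (t : R) : t <= 1 -> rho0 ((x + t *: (z - x)) - z) = (1 - t) * rho0 (x - z).
Proof.
move=> t1; rewrite -polarZ ?subr_ge0//; congr rho0.
by apply/rowP => i; rewrite !mxE; ring.
Qed.

Lemma sdist_ge x1 (t : R) : 0 < t -> (forall z, rho0 (x1 - z) < t -> Omega z) -> forall x, t - rho0 (x1 - x) <= ds x.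
Proof.
move=> t0 hin x; have [cx|cx] := pselect (closure Omega x).
 rewrite sdist_in//; have [y [By dE] _] := distP x.
 have : t <= rho0 (x1 - y).
  by rewrite leNgt; apply/negP => /hin; have [_] := (bd_openP y).1 By.
 have -> : x1 - y = (x1 - x) + (x - y) by rewrite addrA subrK.
 by have := polarD (x1 - x) (x - y); rewrite dE; lra.
have [z [cz -> hz]] := sdist_out cx.
have Ox1 : closure Omega x1 by apply/subset_closure/hin; rewrite subrr polar0.
have nOx : ~ Omega x by move=> /(@subset_closure _ Omega).
have [s /andP[s0 s1] By] := segment_crosses Ox1 nOx.
have [cy nOy] := (bd_openP _).1 By.
have h1 : t <= rho0 (x1 - (x1 + s *: (x - x1))) by rewrite leNgt; apply/negP => /hin.
have h2 := hz _ cy.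
by move: h1 h2; rewrite rho0_scale// rho0_scale'// mulrBl mul1r; lra.
Qed.

Lemma sdist_le x2 (t : R) : 0 < t -> (forall z, rho0 (z - x2) < t -> ~ closure Omega z) ->
 forall x, ds x <= rho0 (x - x2) - t.
Proof.
move=> t0 hout x; have [cx|cx] := pselect (closure Omega x); last first.
 have [z [cz -> hz]] := sdist_out cx.
 have : t <= rho0 (z - x2) by rewrite leNgt; apply/negP => /hout.
 have -> : z - x2 = (z - x) + (x - x2) by rewrite addrA subrK.
 by have := polarD (z - x) (x - x2); lra.
rewrite sdist_in//.
have nO : ~ Omega x2.
 by move=> /(@subset_closure _ Omega); apply: hout; rewrite subrr polar0.
have [s /andP[s0 s1] By] := segment_crosses cx nO.
have [cy nOy] := (bd_openP _).1 By.
have h1 : t <= rho0 ((x + s *: (x2 - x)) - x2) by rewrite leNgt; apply/negP => /hout.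
have h2 := dist_le x By.
by move: h1 h2; rewrite rho0_scale// rho0_scale'// mulrBl mul1r; lra.
Qed.

(** The touching balls squeeze the signed distance between two cones, both with gradient [p] along
    the normal segment through [y]. *)
Lemma sdist_hgrad y p x (t : R) : rho p = 1 -> 0 < t -> (forall z, rho0 (y + t *: b p - z) < t -> Omega z) ->
 (forall z, rho0 (z - (y - t *: b p)) < t -> ~ closure Omega z) ->
 x = y + ds x *: b p -> `|ds x| < t -> hgrad ds x p.
Proof.
move=> p1 t0 hin hout xE; rewrite ltr_norml => /andP[s1 s2].
have e1 : y + t *: b p - x = (t - ds x) *: b p.
 by rewrite {1}xE scalerBl opprD addrACA subrr add0r.
have e2 : x - (y - t *: b p) = (ds x + t) *: b p.
 rewrite {1}xE; move: (ds x) (b p) => s w.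
 by apply/rowP => i; rewrite !mxE; ring.
have t1 : 0 < t - ds x by pos.
have t2 : 0 < ds x + t by pos.
have w1 : rho0 (b p) = 1 by apply: (polar_grad (nz p1)).
have b0 := ggrad_neq0 (nz p1).
have h1 : hgrad (fun z => t - rho0 (y + t *: b p - z)) x p.
 suff h : hgrad (fun z => rho0 (y + t *: b p - z)) x (- p).
  by have := hgradB (hgrad_cst t x) h; rewrite sub0r opprK.
 apply: hgrad_sub_l; rewrite -[X in hgrad _ _ X](pmax_ggrad p1 t1) -e1.
 by apply: pmax_hgrad; rewrite e1 scaler_eq0 gt_eqF//=.
have h2 : hgrad (fun z => rho0 (z - (y - t *: b p)) - t) x p.
 suff h : hgrad (fun z => rho0 (z - (y - t *: b p))) x p.
  by have := hgradB h (hgrad_cst t x); rewrite subr0.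
 apply: hgrad_sub_r; rewrite -[X in hgrad _ _ X](pmax_ggrad p1 t2) -e2.
 by apply: pmax_hgrad; rewrite e2 scaler_eq0 gt_eqF//=.
apply: (hgrad_squeeze h1 h2).
- by rewrite e1 polarZ ?(ltW t1)// w1 mulr1; ring.
- by rewrite e2 polarZ ?(ltW t2)// w1 mulr1; ring.
- by exists 1 => // z _; rewrite sdist_ge// sdist_le.
Qed.

(** [y] is a nearest boundary point of [x], found from inside or from outside; the touching lemmas
    put [x] on the normal line of [y]. *)
Lemma tube_point phi V y0 : bd y0 -> chart phi V -> V y0 ->
 exists C r : R, [/\ 0 < C, 0 < r & forall x, `|x - y0| < r -> exists y,
  [/\ bd y, V y, `|y - y0| <= C * `|x - y0|, x = y + ds x *: b (conormal phi y) & `|ds x| <= C * `|x - y0|]].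
Proof.
move=> By0 ch Vy0; have [oV cphi gphi hphi] := ch.
have [c1 c10 hc1] := polar_lower.
have [C1 C10 hC1] := polar_upper.
have [r0 r00 hr0] := (openNP V).1 oV _ Vy0.
pose C := 1 + C1 / c1 + C1.
have cc : 0 < C1 / c1 by pos.
have C0 : 0 < C by rewrite !addr_gt0.
exists C, (r0 / C); split=> //; first by pos.
move=> x xr.
have nb z s : rho0 z = s -> s <= C1 * `|x - y0| -> `|z| <= C1 / c1 * `|x - y0|.
 move=> <- h; rewrite mulrAC ler_pdivlMr// mulrC; exact: le_trans h.
have nC k : k <= C1 / c1 -> (1 + k) * `|x - y0| <= C * `|x - y0|.
 by move=> h; rewrite ler_wpM2r// /C; lra.
have close y : `|x - y| <= C1 / c1 * `|x - y0| -> `|y - y0| <= C * `|x - y0|.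
 move=> h; have -> : y - y0 = - (x - y) + (x - y0) by rewrite opprB addrA subrK.
 rewrite (le_trans (ler_normD _ _))// normrN (le_trans (lerD h (lexx _)))//.
 by rewrite -[X in _ + X]mul1r -mulrDl addrC nC.
have vy y : `|y - y0| <= C * `|x - y0| -> V y.
 by move=> h; apply: hr0; apply: le_lt_trans h _; rewrite mulrC -ltr_pdivlMr.
have C1C : C1 * `|x - y0| <= C * `|x - y0| by rewrite ler_wpM2r// /C lerDr addr_ge0// ltW.
have [cx|cx] := pselect (closure Omega x).
 have [y [By dE] hy] := distP x.
 have dl : d x <= C1 * `|x - y0| by apply: le_trans (hy _ By0) (hC1 _).
 have hxy : `|x - y| <= C1 / c1 * `|x - y0| by apply: nb (esym dE) dl.
 exists y; have Vy := vy _ (close _ hxy); split=> //; first exact: close.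
 - rewrite sdist_in//; have [xy|xy] := eqVneq x y.
   by rewrite {1 2}xy dist_bd// scale0r addr0.
  rewrite -(touching_inner (chart_defining ch Vy) cx By xy dE) dE.
  by rewrite -pmax_eq ?subr_eq0// addrC subrK.
 - by rewrite sdist_in// ger0_norm ?dist_ge0// (le_trans dl).
have [z [cz dE hz]] := sdist_out cx.
have xz : x != z by apply/eqP => e; apply: cx; rewrite e.
have zx0 : z - x != 0 by rewrite subr_eq0 eq_sym.
have Bz : bd z.
 have nOx : ~ Omega x by move=> /(@subset_closure _ Omega).
 have [s /andP[s0 s1] By] := segment_crosses cz nOx.
 have [cy nOy] := (bd_openP _).1 By.
 have := hz _ cy; rewrite rho0_scale'// mulrBl mul1r lerBrDl gerDr => h.
 have sz : s = 0.
  by apply/le_anti; rewrite s0 andbT; move: h; rewrite pmulr_lle0// polar_gt0.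
 by move: By; rewrite sz scale0r addr0.
have dl : rho0 (z - x) <= C1 * `|x - y0|.
 by rewrite distrC; apply: le_trans (hC1 _); apply: hz; have [] := (bd_openP _).1 By0.
have hxy : `|x - z| <= C1 / c1 * `|x - y0| by rewrite distrC; apply: nb dl.
exists z; have Vz := vy _ (close _ hxy); split=> //; first exact: close.
- rewrite dE -(touching_outer (chart_defining ch Vz) Bz xz hz).
 by rewrite scaleNr -pmax_eq// opprB addrC subrK.
- by rewrite dE normrN ger0_norm ?polar_ge0// (le_trans dl).
Qed.

Lemma hgrad_scale (f : E -> R) x g (t : R) : 0 < t -> hgrad f (t *: x) g -> hgrad (fun z => f (t *: z)) x (t *: g).
Proof.
move=> t0 h e e0; have et : 0 < e / t by pos.
have [r r0 hr] := h _ et; exists (r / t); first by pos.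
move=> v; rewrite ltr_pdivlMr// => vr; have := hr (t *: v).
rewrite normrZ gtr0_norm// mulrC => /(_ vr).
rewrite scalerDr dotvZl dotvZr => /le_trans; apply.
by rewrite mulrA mulrAC divfK// gt_eqF.
Qed.

Lemma ghessZ x (t : R) : 0 < t -> x != 0 -> G (t *: x) = t^-1 *: G x.
Proof.
move=> t0 x0; have cg := gauge_C2.
have tx0 : t *: x != 0 by rewrite scaler_eq0 gt_eqF.
apply/row_matrixP => i.
have h1 := hgrad_gradi i open_neq0 x0 cg.
have h2 := hgrad_scale t0 (hgrad_gradi i open_neq0 tx0 cg).
have [r r0 hr] := (openNP _).1 open_neq0 _ x0.
have h3 : hgrad (fun z => b z$i) x (t *: row i (G (t *: x))).
 by apply: (hgrad_near r0 _ h2) => z /hr z0; rewrite ggradZ.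
have e := hgrad_unique h3 h1.
by rewrite linearZ /= -e scalerA mulVf ?scale1r// gt_eqF.
Qed.

Lemma sum_rowM m (A : 'M[R]_(m, n)) (D : 'M[R]_n) i : \sum_j (row i A)$j *: row j D = row i (A *m D).
Proof.
apply/rowP => k; rewrite summxE !mxE; apply: eq_bigr => j _.
by rewrite !mxE.
Qed.

(** The signed distance is not shown to be C^2. Near [y] its gradient at [x] is the conormal at the
    projection [Y x], so only the derivative of [Y] at the single point [y] is needed. *)
Lemma cahn_hoffman_jacobian phi V y : bd y -> chart phi V -> V y -> 'J (cahn_hoffman K Omega) y =
 (1%:M - (conormal phi y)^T *m b (conormal phi y)) *m ((rho (- grad phi y))^-1 *: hess phi y) *m G (conormal phi y).
Proof.
move=> By ch Vy; have [oV cphi gphi hphi] := ch.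
have [C [r [C0 r0 ht]]] := tube_point By ch Vy.
have [t [r' [t0 r'0 hw]]] := wulff_balls ch Vy.
have [Y hY] : exists Y : E -> E, forall x, `|x - y| < r ->
  [/\ bd (Y x), V (Y x), `|Y x - y| <= C * `|x - y|, x = Y x + ds x *: b (conormal phi (Y x))
   & `|ds x| <= C * `|x - y|].
 have h x : exists z, `|x - y| < r -> [/\ bd z, V z, `|z - y| <= C * `|x - y|, x = z + ds x *: b (conormal phi z)
   & `|ds x| <= C * `|x - y|].
  have [/ht[z hz]|h] := pselect (`|x - y| < r); first by exists z.
  by exists 0.
 by have [Y hY] := choice h; exists Y.
have /hY[_ _] : `|y - y| < r by rewrite subrr normr0.
rewrite subrr normr0 !mulr0 !normr_le0 subr_eq0 => /eqP Yy _ /eqP dsy.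
have np z : V z -> rho (conormal phi z) = 1 by move=> Vz; apply: conormal_gauge; exact: gphi.
have bE z : V z -> b (conormal phi z) = b (- grad phi z).
 move=> Vz; have g0 : - grad phi z != 0 by rewrite oppr_eq0 gphi.
 by rewrite /conormal /rnorm ggradZ// invr_gt0 gauge_gt0.
pose g := - grad phi y; have g0 : g != 0 by rewrite oppr_eq0 gphi.
have [r2 r20 dsg] : exists2 r2 : R, 0 < r2 & forall x, `|x - y| < r2 -> `|x - y| < r /\
  hgrad ds x (conormal phi (Y x)).
 exists (min r (min (r' / C) (t / C))); first by pos.
 move=> x; rewrite !lt_min !ltr_pdivlMr// => /and3P[xr x1 x2]; split=> //.
 have [By' Vy' yx xE sx] := hY _ xr.
 have yr' : `|Y x - y| < r' by pos.
 have [_ hin hout] := hw _ By' yr'.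
 apply: (sdist_hgrad (np _ Vy') t0 hin hout xE).
 by pos.
have /dsg[_] : `|y - y| < r2 by rewrite subrr normr0.
rewrite Yy => dsy'.
pose H := hess phi y; pose w := b (conormal phi y); pose p := conormal phi y.
have hF i : hgrad (fun z => b (- grad phi z)$i) y (- row i (G g *m H)).
 have h1 : hgrad (fun q => b q$i) (- grad phi y) (row i (G g)).
  exact: (hgrad_gradi i open_neq0 g0 gauge_C2).
 have h2 j : hgrad (fun z => (- grad phi z)$j) y (- row j H).
  have -> : (fun z => (- grad phi z)$j) = (fun z => - (grad phi z$j)).
   by apply/funext => z; move: (grad phi z) => A; rewrite mxE.
  exact: hgradN (hgrad_gradi j oV Vy cphi).
 have := @hgrad_comp _ _ _ (fun z => - grad phi z) _ _ _ h1 h2; rewrite -sum_rowM -sumrN.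
 by under eq_bigr do rewrite scalerN.
have hk i : {for y, continuous (fun x => b (- grad phi (Y x))$i)}.
 apply/contNP => e e0.
 have /contNP/(_ _ e0)[s s0 hs] := hgrad_cont (hF i).
 exists (min r (s / C)); first by pos.
 move=> x; rewrite lt_min ltr_pdivlMr// => /andP[xr xs]; rewrite Yy; apply: hs.
 by have [_ _ h _ _] := hY _ xr; apply: le_lt_trans h _; rewrite mulrC.
(* [Y x = x - ds x *: b (conormal phi (Y x))]: as [ds y = 0], the second factor need only be
   continuous at [y]. *)
have hYc i : hgrad (fun x => Y x$i) y (delta_mx ord0 i - w$i *: p).
 have h1 := hgradM0 dsy' dsy (hk i).
 have h2 := hgradB (hgrad_coord y i) h1.
 rewrite Yy -bE// in h2; apply: (hgrad_near r0 _ h2) => x xr.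
 have [_ Vx _ xE _] := hY _ xr; rewrite {1}xE -bE//.
 by move: (b _) => B; rewrite !mxE addrK.
have hA i : hgrad (fun x => cahn_hoffman K Omega x$i) y (row i (G g *m H *m (1%:M - w^T *m p))).
 have h1 : hgrad (fun z => b (- grad phi z)$i) (Y y) (- row i (G g *m H)).
  by rewrite Yy; exact: hF.
 have h2 := hgradN (hgrad_comp h1 hYc).
 have -> : row i (G g *m H *m (1%:M - w^T *m p)) = - (\sum_j (- row i (G g *m H))$j *: (delta_mx ord0 j - w$j *: p)).
  rewrite -sum_rowM -sumrN; apply: eq_bigr => j _.
  move: (G g *m H) => A; apply/rowP => k; rewrite !mxE big_ord1 !mxE eqxx/= [k == j]eq_sym; ring.
 apply: (hgrad_near r20 _ h2) => x xr; have [xr' hx] := dsg _ xr.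
 rewrite /cahn_hoffman (hgrad_grad hx) /=; have [_ Vx _ _ _] := hY _ xr'.
 by rewrite bE//; move: (b _) => B; rewrite mxE.
have [_ dE] := hgrad_row hA.
have -> : 'J (cahn_hoffman K Omega) y = (G g *m H *m (1%:M - w^T *m p))^T.
 by apply/matrixP => i j; rewrite mxE dE -rowE mxE.
have m0 : 0 < rho (- grad phi y) by exact: gauge_gt0.
rewrite !trmx_mul ghessT// (hess_sym oV Vy cphi).
rewrite linearB /= trmx1 trmx_mul trmxK -/H -/w -/p.
have -> : G g = (rho (- grad phi y))^-1 *: G p.
 rewrite /p /conormal /rnorm ghessZ ?invr_gt0// scalerA invrK mulVf ?scale1r// gt_eqF//.
by rewrite -!scalemxAr -!scalemxAl mulmxA.
Qed.

End charts.

(** * Mean curvature as a trace *)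

Section mean_curvature.
Implicit Types (x y z v p q t : E) (phi : E -> R) (V : set E).

(** The second fundamental form relative to the conormal, which has gauge 1; hence the division by
    the gauge of the gradient. *)
Definition sform phi y := (rho (- grad phi y))^-1 *: hess phi y.

Section at_point.
Variables (phi : E -> R) (V : set E) (y : E).
Hypotheses (By : bd y) (ch : chart phi V) (Vy : V y).
Notation p := (conormal phi y).

Let p1 : rho p = 1.
Proof. by case: ch => _ _ gphi _; apply: conormal_gauge; exact: gphi. Qed.
Let pw : dotv p (b p) = 1.
Proof. by rewrite dotvC (gauge_euler (nz p1)). Qed.
Let pG : p *m G p = 0. Proof. exact: (ghess_radial (nz p1)). Qed.
Let Gs : (G p)^T = G p. Proof. exact: (ghessT (nz p1)). Qed.
Let Hs : (sform phi y)^T = sform phi y.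
Proof. by case: ch => oV cphi _ _; rewrite /sform linearZ /= (hess_sym oV Vy cphi). Qed.
Let Ghp v : v != 0 -> 0 < bilin (Ghat p) v v.
Proof. exact: (Ghat_gt0). Qed.
Let JE := cahn_hoffman_jacobian By ch Vy.
Let TE v : tangent_space Omega y v <-> dotv p v = 0.
Proof. exact: (tangent_spaceE _ (chart_defining ch Vy) By). Qed.

(** [get] returns genuine curvatures, as the shape operator is self-adjoint for the metric inverse
    to [Ghat]. *)
Let curvP : is_rho_curvatures K Omega y (rho_curvatures K Omega y).
Proof.
rewrite /rho_curvatures; apply: getPex.
have [B [Bf BT]] := tangent_basis pw n0.
have [M [hM [kappa hk]]] := shape_matrix pw pG Gs Hs Ghp Bf BT.
exists kappa, B, M; split=> //; last by rewrite JE.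
by move=> v; rewrite TE BT.
Qed.

Lemma mean_curvature_trace : n.-1%:R * mean_rho_curvature K Omega y = \tr (sform phi y *m G p).
Proof.
have [B [M [Bf BT hM hk]]] := curvP.
have BT' v : (v <= B)%MS <-> dotv p v = 0 by rewrite BT TE.
rewrite JE in hM.
rewrite /mean_rho_curvature mulrA mulfV ?mul1r; last by rewrite pnatr_eq0; case: (n) n2 => [|[]].
by rewrite -(mxtrace_char_poly hk) (shape_trace pG Gs Bf BT' hM).
Qed.

Lemma mean_curvature_le (k : R) :
 (forall t, dotv p t = 0 -> bilin (sform phi y) t t <= k * bilin (invmx (Ghat p)) t t) ->
 mean_rho_curvature K Omega y <= k.
Proof.
move=> h; have [B [M [Bf BT hM hk]]] := curvP.
have BT' v : (v <= B)%MS <-> dotv p v = 0 by rewrite BT TE.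
rewrite JE in hM.
have m0 : 0 < (n.-1)%:R :> R by rewrite ltr0n; case: (n) n2 => [|[]].
rewrite /mean_rho_curvature mulrC ler_pdivrMr//.
have -> : k * n.-1%:R = \sum_(i < n.-1) k by rewrite sumr_const card_ord mulr_natr.
apply: ler_sum => i _.
have := shape_eigen_le pw pG Gs Ghp Bf BT' i hM hk h; exact.
Qed.

Lemma trace_inv_Ghat : \tr (G p *m invmx (Ghat p)) = n.-1%:R.
Proof. by rewrite (trace_metric pw pG Ghp) -subn1 natrB. Qed.

End at_point.

Lemma ghess_bound : exists2 C : R, 0 < C & forall p, rho p = 1 -> forall i j, `|G p i j| <= C.
Proof.
have cB := boundaryK_compact.
have h ij : exists C : R, forall p, boundary K p -> `|G p ij.1 ij.2| <= C.
 apply: (compact_sup_bound cB) => a /bd_gauge a1.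
 have [d d0 hd] := hess_cont open_neq0 (nz a1) gauge_C2 (@ltr01 R).
 exists d, (`|G a ij.1 ij.2| + 1); split=> // q _ /hd[_ hq].
 rewrite -[G q _ _](subrK (G a ij.1 ij.2)) (le_trans (ler_normD _ _))// addrC lerD//.
have [C hC] := choice h.
exists (1 + \sum_ij `|C ij|); first by rewrite ltr_wpDr// sumr_ge0.
move=> p p1 i j; have /bd_gauge Bp := p1.
rewrite (le_trans (hC (i, j) _ Bp))// (le_trans (ler_norm _))//.
by rewrite (bigD1 (i, j))//= addrCA lerDl addr_ge0// sumr_ge0.
Qed.

Lemma trace_mulmx_le (A D : 'M[R]_n) (c1 c2 : R) : 0 <= c1 -> (forall i j, `|A i j| <= c1) ->
 (forall i j, `|D i j| <= c2) -> `|\tr (A *m D)| <= n%:R ^+ 2 * (c1 * c2).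
Proof.
move=> c10 hA hD.
have -> : n%:R ^+ 2 * (c1 * c2) = \sum_(i < n) \sum_(j < n) c1 * c2.
 by rewrite !sumr_const !card_ord -mulrnA -[RHS]mulr_natl natrM expr2.
rewrite (le_trans (ler_norm_sum _ _ _))// ler_sum// => i _.
by rewrite mxE (le_trans (ler_norm_sum _ _ _))// ler_sum// => j _; rewrite normrM ler_pM.
Qed.

(** The infimum in [min_mean_rho_curvature] is a lower bound only if the set of values is bounded
    below. *)
Lemma mean_curvature_lbound : exists m : R, forall y, bd y -> m <= mean_rho_curvature K Omega y.
Proof.
have [CG CG0 hG] := ghess_bound.
have [C hC] : exists C : R, forall y, bd y -> - (n.-1%:R * mean_rho_curvature K Omega y) <= C.
 apply: (compact_sup_bound bd_compact) => y0 By0.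
 have [phi [V [ch Vy0]]] := chartP By0.
 have [r [C [r0 C0 h]]] := chart_bounds ch Vy0.
 exists r, (n%:R ^+ 2 * ((C * C) * CG)); split=> // y By yr.
 have [Vy hm hH _] := h _ yr.
 rewrite (mean_curvature_trace By ch Vy) (le_trans (ler_norm _))// normrN.
 apply: trace_mulmx_le; first by pos.
  move=> i j; rewrite mxE normrM ler_pM//.
  have m0 : 0 < rho (- grad phi y).
   by apply: lt_le_trans hm; rewrite invr_gt0.
  by rewrite ger0_norm ?invr_ge0 ?(ltW m0)// -[C]invrK lef_pV2// posrE invr_gt0.
 apply: hG; case: ch => _ _ gphi _; exact: (conormal_gauge (gphi _ Vy)).
have m0 : 0 < (n.-1)%:R :> R by rewrite ltr0n; case: (n) n2 => [|[]].
exists (- (C / n.-1%:R)) => y /hC; rewrite lerNl => h.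
by rewrite -mulNr ler_pdivrMr// mulrC.
Qed.

Lemma min_mean_le y : bd y -> min_mean_rho_curvature K Omega <= mean_rho_curvature K Omega y.
Proof.
move=> By; apply: ge_inf; last by exists y.
by have [m hm] := mean_curvature_lbound; exists m => _ [z Bz <-]; exact: hm.
Qed.

End mean_curvature.

(** * Quadratic upper barriers of the distance *)

Section exit.
Notation N p := (invmx (Ghat p)).
Implicit Types (x y z v p q t u : E) (phi : E -> R) (V : set E).

(* [y + sigma + kappa w] stays outside [Omega] for [kappa] slightly below the osculating paraboloid. *)
Lemma exit_local phi V y0 (e : R) : chart phi V -> V y0 -> 0 < e ->
 exists dl C : R, [/\ 0 < dl, 0 < C & forall y, bd y -> `|y - y0| < dl ->
  [/\ V y, forall i j, `|sform phi y i j| <= C & forall s l, dotv (conormal phi y) s = 0 ->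
   `|s| <= l -> 0 < l < dl ->
   ~ Omega (y + (s + (2^-1 * bilin (sform phi y) s s - e * l ^+ 2) *: b (conormal phi y)))]].
Proof.
move=> ch Vy0 e0; have [oV cphi gphi hphi] := ch.
have [r [C [r0 C0 hb]]] := chart_bounds ch Vy0.
have [Cb Cb0 hCb] := grad_bound.
have CC0 : 0 < C * C by pos.
pose A := n%:R ^+ 2 * (C * C) + e; have A0 : 0 < A by rewrite addr_gt0// mulr_gt0// exprn_gt0.
pose D := 1 + A * Cb; have D0 : 0 < D by rewrite addr_gt0// mulr_gt0.
pose e1 := e / (4 * C * D ^+ 2); have e10 : 0 < e1 by rewrite divr_gt0// !mulr_gt0// exprn_gt0.
have [r1 r10 ht] := taylor2 oV Vy0 cphi e10.
pose F := n%:R ^+ 2 * C * (A * Cb * (1 + D)) + 1.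
have F0 : 0 < F.
 by rewrite /F; posn.
pose dl := min 1 (min r (min r1 (min (r1 / D) (e / (4 * C * F))))).
have dl0 : 0 < dl by rewrite !lt_min ltr01 r0 r10 !divr_gt0// !mulr_gt0.
exists dl, (C * C); split=> // y By; rewrite !lt_min => /and5P[y1 yr yr1 _ _].
have [Vy hm hH _] := hb _ yr.
have m0 : 0 < rho (- grad phi y) by apply: lt_le_trans hm; rewrite invr_gt0.
have hS i j : `|sform phi y i j| <= C * C.
 rewrite mxE normrM ler_pM//.
 by rewrite ger0_norm ?invr_ge0 ?(ltW m0)// -[C]invrK lef_pV2// posrE invr_gt0.
split=> // s l ps sl /andP[l0]; rewrite !lt_min => /and5P[l1 _ _ lr1 lF].
have py := conormal_gauge (gphi _ Vy).
have gE := conormalE (gphi _ Vy).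
have phi0 : phi y = 0 by apply/(hphi _ Vy).2.
have SE : hess phi y = rho (- grad phi y) *: sform phi y.
 by rewrite scalerA mulfV ?scale1r// gt_eqF.
have l20 : 0 <= l ^+ 2 by pos.
pose k := 2^-1 * bilin (sform phi y) s s - e * l ^+ 2.
have kA : `|k| <= A * l ^+ 2.
 rewrite /k (le_trans (ler_normB _ _))// /A mulrDl lerD//; last first.
  by rewrite ger0_norm// mulr_ge0// ltW.
 rewrite normrM ger0_norm// (le_trans (ler_wpM2l _ (bilin_le _ _ (ltW CC0) hS)))//.
 rewrite -expr2 (@le_trans _ _ (1 * (n%:R ^+ 2 * (C * C) * `|s| ^+ 2)))//.
  by rewrite ler_wpM2r ?mulr_ge0 ?exprn_ge0// ?invf_le1 ?ler1n// ltW.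
 by rewrite mul1r; apply: ler_wpM2l; [posn | apply: sqr_mono].
have [w [wE wb]] : exists w, b (conormal phi y) = w /\ `|w| <= Cb.
 by exists (b (conormal phi y)); split=> //; apply: hCb; exact: nz.
have pw : dotv (conormal phi y) w = 1.
 by rewrite -wE dotvC (gauge_euler (nz py)).
rewrite -/k wE; move: (conormal phi y) ps pw gE => p ps pw gE.
have kw : `|k *: w| <= A * Cb * l.
 rewrite normrZ (le_trans (ler_pM _ _ kA wb))// mulrAC; apply: ler_wpM2l; first posn.
 by rewrite expr2 ler_piMl// ltW.
have kw2 : `|k *: w| <= A * Cb * l ^+ 2.
 by rewrite normrZ (le_trans (ler_pM _ _ kA wb))// mulrAC.
have zD : `|s + k *: w| <= D * l.
 by rewrite (le_trans (ler_normD _ _))// mulrDl mul1r lerD.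
have zr1 : `|s + k *: w| < r1 by apply: le_lt_trans zD _; rewrite mulrC -ltr_pdivlMr.
have [Vz _ hz] := ht _ _ yr1 zr1.
have hHz : bilin (hess phi y) s s - n%:R ^+ 2 * C * (A * Cb * (1 + D)) * (l * l ^+ 2) <=
  bilin (hess phi y) (s + k *: w) (s + k *: w).
 set z := s + k *: w; have -> : bilin (hess phi y) z z = bilin (hess phi y) s s +
   (bilin (hess phi y) (k *: w) z + bilin (hess phi y) s (k *: w)).
  by rewrite /z !bilinDl !bilinDr; ring.
 rewrite lerD2l lerNl opprD.
 have b1 := bilin_le (k *: w) z (ltW C0) hH.
 have b2 := bilin_le s (k *: w) (ltW C0) hH.
 apply: (@le_trans _ _ (`|bilin (hess phi y) (k *: w) z| + `|bilin (hess phi y) s (k *: w)|)).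
  by rewrite lerD// -normrN ler_norm.
 rewrite (le_trans (lerD b1 b2))// -mulrDr -[X in _ <= X]mulrA; apply: ler_wpM2l; first posn.
 apply: (@le_trans _ _ (A * Cb * l ^+ 2 * (D * l) + l * (A * Cb * l ^+ 2))).
  by rewrite lerD// ler_pM.
 by apply: le_eq; ring.
have zz : `|s + k *: w| ^+ 2 <= D ^+ 2 * l ^+ 2 by rewrite -exprMn sqr_mono.
move=> Oz; have /(hphi _ Vz).1 pz := Oz.
move: hz hHz; rewrite phi0 subr0 gE dotvNl dotvZl dotvDr ps add0r dotvZr pw mulr1 opprK SE !bilin_scale.
rewrite ler_norml => /andP[hz _] hHz.
have e1z : e1 * `|s + k *: w| ^+ 2 <= e / (4 * C) * l ^+ 2.
 apply: (@le_trans _ _ (e1 * (D ^+ 2 * l ^+ 2))); first by rewrite ler_wpM2l// ltW.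
 by rewrite /e1; apply: le_eq; field; pos.
have Fl : n%:R ^+ 2 * C * (A * Cb * (1 + D)) * (l * l ^+ 2) <= e / (4 * C) * l ^+ 2.
 rewrite mulrA ler_wpM2r// (@le_trans _ _ (F * l))//.
  by rewrite ler_wpM2r ?(ltW l0)// /F lerDl.
 rewrite mulrC -ler_pdivlMr//; have -> : e / (4 * C) / F = e / (4 * C * F).
  by field; pos.
 exact: ltW.
have em : e / C * l ^+ 2 <= e * rho (- grad phi y) * l ^+ 2.
 by rewrite ler_wpM2r// ler_wpM2l// ltW.
have el : 0 < e / (4 * C) * l ^+ 2 by pos.
have eq4 : e / C * l ^+ 2 = 4 * (e / (4 * C) * l ^+ 2) by field; pos.
have kE : rho (- grad phi y) * k = rho (- grad phi y) * bilin (sform phi y) s s / 2 -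
  e * rho (- grad phi y) * l ^+ 2 by rewrite /k; ring.
rewrite bilin_scale in kE.
exact: (exit_scalar hz hHz e1z Fl em el eq4 kE pz).
Qed.

Lemma exit_unif (e : R) : 0 < e -> exists2 dl : R, 0 < dl & forall y, bd y -> exists phi V,
  [/\ chart phi V, V y, forall i j, `|sform phi y i j| <= dl^-1 &
   forall s l, dotv (conormal phi y) s = 0 -> `|s| <= l -> 0 < l < dl ->
   ~ Omega (y + (s + (2^-1 * bilin (sform phi y) s s - e * l ^+ 2) *: b (conormal phi y)))].
Proof.
move=> e0.
(* The premise [0 < dl] makes the property hold trivially for nonpositive parameters, as
   monotonicity over all reals demands. *)
pose P (dl : R) (y : E) := 0 < dl -> exists phi V, [/\ chart phi V, V y, forall i j, `|sform phi y i j| <= dl^-1 &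
   forall s l, dotv (conormal phi y) s = 0 -> `|s| <= l -> 0 < l < dl ->
   ~ Omega (y + (s + (2^-1 * bilin (sform phi y) s s - e * l ^+ 2) *: b (conormal phi y)))].
have [|y0 By0|dl dl0 h] := @compact_unif _ _ bd P bd_compact.
- move=> d1 d2 y d21 h d20; have d10 := lt_le_trans d20 d21.
 have [phi [V [ch Vy h1 h2]]] := h d10; exists phi, V; split=> //.
  by move=> i j; rewrite (le_trans (h1 i j))// lef_pV2.
 by move=> s l ps sl /andP[l0 ld]; apply: h2 => //; rewrite l0 (lt_le_trans ld).
- have [phi [V [ch Vy0]]] := chartP By0.
 have [dl [C [dl0 C0 h]]] := exit_local ch Vy0 e0.
 exists (min dl C^-1); first by pos.
 move=> y By; rewrite lt_min => /andP[yd _] m0.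
 have [Vy h1 h2] := h _ By yd; exists phi, V; split=> //.
  move=> i j; rewrite (le_trans (h1 i j))// -[X in X <= _]invrK lef_pV2 ?posrE ?invr_gt0//.
  by rewrite ge_min lexx orbT.
 by move=> s l ps sl /andP[l0]; rewrite lt_min => /andP[ld _]; apply: h2 => //; rewrite l0.
- by exists dl => // y By; exact: h.
Qed.

(** [polar_taylor] rescaled to length [r]; the quadratic terms acquire the factor [1 / r]. *)
Lemma polar_shift (e : R) : 0 < e -> exists2 dl : R, 0 < dl & forall p u (r : R),
 rho p = 1 -> dotv p u = 0 -> 0 < r -> `|u| < dl * r ->
 rho0 (r *: b p + u) <= r + 2^-1 * bilin (N p) u u / r + e * `|u| ^+ 2 / r.
Proof.
move=> e0; have [dl dl0 h] := polar_taylor e0; exists dl => // p u r p1 pu r0 ur.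
have rn : r != 0 by pos.
have -> : r *: b p + u = r *: (b p + r^-1 *: u) by rewrite scalerDr scalerA mulfV// scale1r.
rewrite polarZ ?(ltW r0)//.
have := h p (r^-1 *: u) p1; rewrite dotvZr pu mulr0 => /(_ erefl).
rewrite normrZ ger0_norm ?invr_ge0 ?(ltW r0)// mulrC ltr_pdivrMr// => /(_ ur).
rewrite bilinZl bilinZr -(ler_pM2l r0) => /le_trans; apply.
by apply: le_eq; field.
Qed.

Lemma projection_ray phi V x y : Omega x -> chart phi V -> V y -> bd y -> d x = rho0 (x - y) ->
 x = y + d x *: b (conormal phi y).
Proof.
move=> Ox ch Vy By dE; have cx := @subset_closure _ Omega x Ox.
have xy : x != y.
 by apply/eqP => e; have [_] := (bd_openP y).1 By; rewrite -e.
rewrite dE -(touching_inner (chart_defining ch Vy) cx By xy dE).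
by rewrite -pmax_eq ?subr_eq0// addrC subrK.
Qed.

Lemma Ghat_inv_bound : exists2 C : R, 0 < C & forall p, rho p = 1 -> forall u, 0 <= bilin (N p) u u <= C * `|u| ^+ 2.
Proof.
have [m m0 hm] := Ghat_unif.
exists (n%:R ^+ 2 / m); first by pos.
move=> p p1 u; apply: bilin_inv_le => //; first exact: (Ghat_sym (nz p1)).
exact: hm.
Qed.

(** Arithmetic of [curvature_touch], after which the factor [s ^ 2] has been divided out. *)
Lemma touch_scalar (r k B N0 q s e e2 eta : R) : 0 < r -> 0 < s -> 0 < q -> 0 <= N0 ->
 0 < e -> 0 < e2 -> 0 < eta <= 1 -> k = 2^-1 * (s ^+ 2 * B) - e * (s ^+ 2 * q) ->
 k <= r * eta / 2 -> r <= (r - k) + 2^-1 * (s ^+ 2 * N0) / (r - k) + e2 * (s ^+ 2 * q) / (r - k) ->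
 B <= N0 / r + eta * N0 / r + 4 * e2 * q / r + 2 * e * q.
Proof.
move=> r0 s0 q0 N00 e0 e20 /andP[eta0 eta1] kE kr h.
have s2 : 0 < s ^+ 2 by pos.
have re : r * eta <= r by rewrite ler_piMr// ltW.
have rk : 0 < r - k by lra.
have i1 : (r - k)^-1 <= (1 + eta) / r.
 rewrite -[_ / r]invrK lef_pV2 ?posrE// ?invr_gt0 ?divr_gt0//; last lra.
 rewrite invf_div ler_pdivrMr; last lra.
 have : r * eta * eta <= r * eta by rewrite ler_piMr// mulr_ge0// ltW.
 rewrite mulrDr mulr1 mulrBl; have : k * eta <= r * eta / 2 * 1 by nra.
 nra.
have i2 : (r - k)^-1 <= 2 / r by rewrite (le_trans i1)// ler_pM2r ?invr_gt0//; lra.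
have h1 : s ^+ 2 * (2^-1 * B - e * q) <= s ^+ 2 * (2^-1 * N0 * ((1 + eta) / r) + e2 * q * (2 / r)).
 apply: (@le_trans _ _ (2^-1 * (s ^+ 2 * N0) / (r - k) + e2 * (s ^+ 2 * q) / (r - k))).
  by move: h; rewrite kE; lra.
 rewrite mulrDr lerD//.
  rewrite [X in _ <= X](_ : _ = 2^-1 * (s ^+ 2 * N0) * ((1 + eta) / r)); last by ring.
  by apply: ler_wpM2l => //; posn.
 rewrite [X in _ <= X](_ : _ = e2 * (s ^+ 2 * q) * (2 / r)); last by ring.
 by apply: ler_wpM2l => //; posn.
rewrite ler_pM2l// in h1.
have -> : N0 / r + eta * N0 / r = 2 * (2^-1 * N0 * ((1 + eta) / r)) by pos.
have -> : 4 * e2 * q / r = 2 * (e2 * q * (2 / r)) by pos.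
by lra.
Qed.

(** The boundary cannot bend more than the ball of radius [d x] around [x]. The point displaced by
    [s *: t] and lifted to the osculating paraboloid is outside [Omega], hence at distance at least
    [d x]; the terms of order [s ^ 2] give the inequality. *)
Lemma curvature_touch phi V x y : Omega x -> bd y -> d x = rho0 (x - y) -> chart phi V -> V y ->
 forall t, dotv (conormal phi y) t = 0 -> bilin (sform phi y) t t <= (d x)^-1 * bilin (N (conormal phi y)) t t.
Proof.
move=> Ox By dE ch Vy t pt; have xE := projection_ray Ox ch Vy By dE.
have cx := @subset_closure _ Omega x Ox.
have r0 : 0 < d x by apply: dist_gt0; exact: (Omega_not_bd).
have [->|t0] := eqVneq t 0; first by pos.
have nt : 0 < `|t| by pos.
have q0 : 0 < `|t| ^+ 2 by pos.
have py : rho (conormal phi y) = 1.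
 by case: ch => _ _ gphi _; exact: (conormal_gauge (gphi _ Vy)).
have [CN CN0 hN] := Ghat_inv_bound.
have N0 : 0 <= bilin (N (conormal phi y)) t t by have /andP[] := hN _ py t.
have [r dr] : exists r, d x = r by exists (d x).
rewrite dr in r0 *.
apply/ler_addgt0Pr => e e0; rewrite [_^-1 * _]mulrC.
set N1 := bilin _ _ _ in N0 *.
pose eta := min 1 (e / 3 * r / (N1 + 1)).
have N11 : 0 < N1 + 1 by pos.
have eta0 : 0 < eta by rewrite lt_min ltr01 !divr_gt0// mulr_gt0// divr_gt0.
pose e2 := e / 12 * r / `|t| ^+ 2; have e20 : 0 < e2 by rewrite divr_gt0// mulr_gt0// divr_gt0.
pose e1 := e / 6 / `|t| ^+ 2; have e10 : 0 < e1 by rewrite !divr_gt0.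
have [dl [C [dl0 C0 hx]]] := exit_local ch Vy e10.
have yy : `|y - y| < dl by rewrite subrr normr0.
have {yy}[_ hS hex] := hx _ By yy.
have [d2 d20 hp] := polar_shift e20.
pose B := bilin (sform phi y) t t.
pose s := min 1 (min (dl / 2 / `|t|) (min (d2 * (r / 2) / (2 * `|t|)) (r * eta / (2 * (`|B| + 1))))).
have s0 : 0 < s by rewrite !lt_min ltr01 !divr_gt0 ?mulr_gt0 ?divr_gt0.
have s1 : s <= 1 by rewrite ge_min lexx.
have sd : s * `|t| < dl.
 have : s <= dl / 2 / `|t| by rewrite !ge_min lexx !orbT.
 by rewrite ler_pdivlMr// => /le_lt_trans; apply; rewrite ltr_pdivrMr// ltr_pMr// ltr1n.
have sd2 : s * `|t| < d2 * (r / 2).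
 have : s <= d2 * (r / 2) / (2 * `|t|) by rewrite !ge_min lexx !orbT.
 rewrite ler_pdivlMr ?mulr_gt0// => h; have : 0 < s * `|t| by pos.
 by move: h; rewrite mulrCA; lra.
have sB : s * (2 * (`|B| + 1)) <= r * eta.
 have : s <= r * eta / (2 * (`|B| + 1)) by rewrite !ge_min lexx !orbT.
 by rewrite ler_pdivlMr// mulr_gt0.
pose k := 2^-1 * (s ^+ 2 * B) - e1 * (s ^+ 2 * `|t| ^+ 2).
have kr : k <= r * eta / 2.
 have s2 : s ^+ 2 <= s by rewrite expr2 ler_piMl// ltW.
 have h1 : s ^+ 2 * B <= s * (`|B| + 1).
  apply: (@le_trans _ _ (s ^+ 2 * `|B|)); first by rewrite ler_wpM2l ?exprn_ge0 ?ler_norm// ltW.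
  by rewrite ler_pM ?exprn_ge0// ?lerDl// ltW.
 have h2 : 0 <= e1 * (s ^+ 2 * `|t| ^+ 2) by posn.
 have h3 : 0 <= s * (`|B| + 1) by pos.
 by move: sB h1 h2; rewrite /k mulrCA; move: (e1 * _) (s ^+ 2 * B) h3 => X Y h3; lra.
have re : r * eta <= r by rewrite ler_piMr ?ge_min ?lexx// ltW.
have rk : r / 2 <= r - k by lra.
have rk0 : 0 < r - k by apply: lt_le_trans rk; rewrite divr_gt0.
have st : `|s *: t| = s * `|t| by rewrite normrZ gtr0_norm.
have := hex (s *: t) (s * `|t|); rewrite dotvZr pt mulr0 st lexx mulr_gt0// sd => /(_ erefl isT isT).
rewrite bilinZl bilinZr -/B (mulrA s s B) -expr2 exprMn -/k => nO.
have := dist_le_out cx nO.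
have -> : x - (y + (s *: t + k *: b (conormal phi y))) = (r - k) *: b (conormal phi y) + - (s *: t).
 rewrite {1}xE dr; move: (b _) => w; by apply/rowP => i; rewrite !mxE; ring.
have pst : dotv (conormal phi y) (- (s *: t)) = 0 by rewrite dotvNr dotvZr pt mulr0 oppr0.
have ust : `|- (s *: t)| < d2 * (r - k).
 by rewrite normrN st (lt_le_trans sd2)// ler_pM2l.
move=> h; have {h} := le_trans h (hp _ _ _ py pst rk0 ust).
rewrite normrN st exprMn -scaleNr bilinZl bilinZr mulrA mulrNN -expr2 -/N1 dr => h.
have eta1 : 0 < eta <= 1 by rewrite eta0 ge_min lexx.
have := touch_scalar r0 s0 q0 N0 e10 e20 eta1 (erefl k) kr h => /le_trans; apply.
have h1 : eta * N1 / r <= e / 3.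
 rewrite ler_pdivrMr//; have : eta <= e / 3 * r / (N1 + 1) by rewrite ge_min lexx orbT.
 rewrite ler_pdivlMr// mulrDr mulr1; have := eta0; lra.
have h2 : 4 * e2 * `|t| ^+ 2 / r = e / 3 by rewrite /e2; field; pos.
have h3 : 2 * e1 * `|t| ^+ 2 = e / 3 by rewrite /e1; field; pos.
by rewrite h2 h3; lra.
Qed.

(** Ensures [1 - d H > 0] for every [H] below the minimal mean curvature. *)
Lemma min_mean_inv_dist x : Omega x -> min_mean_rho_curvature K Omega <= (d x)^-1.
Proof.
move=> Ox; have [y [By dE] _] := distP x.
have [phi [V [ch Vy]]] := chartP By.
apply: le_trans (min_mean_le By) _.
apply: (mean_curvature_le By ch Vy).
by move=> t pt; exact: (curvature_touch Ox By dE ch Vy).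
Qed.

(** Arithmetic of [barrier]: each of the three second order errors costs at most [eh / 3] times the
    square of the displacement. *)
Lemma barrier_scalar (r k vw c2 Nt t2 l2 v2 a2B e e2 eh A2 T2 CN eta tau dx D : R) :
 0 < tau <= r -> 0 < eta <= tau / 2 -> 0 <= v2 -> 0 < e -> 0 < e2 -> 0 <= c2 <= A2 ->
 0 <= Nt <= CN * t2 -> 0 <= t2 <= T2 * v2 -> l2 = A2 * T2 * v2 -> 0 <= CN -> 0 <= T2 ->
 k = 2^-1 * a2B - e * l2 -> `|vw - k| <= eta -> e * (A2 * T2) <= eh / 3 ->
 A2 * CN * T2 * (eta / tau ^+ 2) <= eh / 3 -> e2 * (A2 * T2) * (2 / tau) <= eh / 3 -> v2 <= D ->
 dx <= (r + vw - k) + 2^-1 * (c2 * Nt) / (r + vw - k) + e2 * (c2 * t2) / (r + vw - k) ->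
 dx <= r + vw + 2^-1 * (c2 / r * Nt - a2B) + eh * D.
Proof.
move=> /andP[tau0 tr] /andP[eta0 et] v20 e0 e20 /andP[c20 cA] /andP[N0 NC] /andP[t20 tT] lE CN0 T20 kE.
rewrite ler_norml => /andP[k1 k2] h1 h2 h3 vD h.
have r0 : 0 < r by pos.
have [S SE] : exists S, S = r + vw - k by exists (r + vw - k).
have S2 : r / 2 <= S by pos.
have S0 : 0 < S by lra.
have A20 : 0 <= A2 by apply: le_trans cA.
rewrite -SE in h.
have NT : Nt <= CN * T2 * v2 by rewrite (le_trans NC)// -mulrA ler_wpM2l.
have cN : c2 * Nt <= A2 * CN * T2 * v2.
 by apply: le_trans (ler_pM c20 N0 cA NT) _; rewrite !mulrA.
have ct : c2 * t2 <= A2 * T2 * v2 by apply: le_trans (ler_pM c20 t20 cA tT) _; rewrite mulrA.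
have i1 : S^-1 <= 2 / r by rewrite -[2 / r]invrK lef_pV2 ?posrE// ?invf_div ?divr_gt0.
have i2 : S^-1 - r^-1 <= 2 * (eta / tau ^+ 2).
 have -> : S^-1 - r^-1 = (r - S) * S^-1 * r^-1 by field; pos.
 apply: (@le_trans _ _ (eta * (2 / r) * r^-1)).
  rewrite ler_wpM2r ?invr_ge0 ?(ltW r0)//.
  apply: (@le_trans _ _ (eta * S^-1)); first by rewrite ler_wpM2r ?invr_ge0 ?(ltW S0)// SE; lra.
  by rewrite ler_wpM2l// ltW.
 have -> : eta * (2 / r) * r^-1 = 2 * (eta / r ^+ 2) by field; pos.
 by rewrite ler_pM2l// ler_pM2l// lef_pV2 ?posrE ?exprn_gt0// sqr_mono// ltW.
have E1 : e * l2 <= eh / 3 * v2 by rewrite lE mulrA ler_wpM2r.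
have E2 : 2^-1 * (c2 * Nt) * (S^-1 - r^-1) <= eh / 3 * v2.
 have g0 : 0 <= eta / tau ^+ 2 by posn.
 apply: (@le_trans _ _ (c2 * Nt * (eta / tau ^+ 2))).
  have := ler_wpM2l (mulr_ge0 c20 N0) i2; lra.
 apply: (@le_trans _ _ (A2 * CN * T2 * v2 * (eta / tau ^+ 2))); first by rewrite ler_wpM2r.
 by rewrite mulrAC ler_wpM2r.
have E3 : e2 * (c2 * t2) / S <= eh / 3 * v2.
 apply: (@le_trans _ _ (e2 * (A2 * T2 * v2) * (2 / tau))).
  apply: ler_pM; [posn|posn| |].
   by rewrite ler_wpM2l// ltW.
  by rewrite (le_trans i1)// ler_wpM2l// lef_pV2.
 have -> : e2 * (A2 * T2 * v2) * (2 / tau) = e2 * (A2 * T2) * (2 / tau) * v2 by ring.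
 by rewrite ler_wpM2r.
have g0 : 0 <= e * (A2 * T2) by posn.
have eh0 : 0 <= eh by move: g0 h1; lra.
have vD' : eh * v2 <= eh * D by rewrite ler_wpM2l.
have c2r : 2^-1 * (c2 * Nt) / r = 2^-1 * (c2 / r * Nt) by ring.
apply: le_trans h _.
have -> : 2^-1 * (c2 * Nt) / S = 2^-1 * (c2 * Nt) * (S^-1 - r^-1) + 2^-1 * (c2 * Nt) / r by ring.
rewrite c2r; move: E1 E2 E3 vD' SE kE.
set X1 := 2^-1 * (c2 * Nt) * (S^-1 - r^-1); set X2 := e2 * (c2 * t2) / S; set X4 := c2 / r * Nt.
by move: X1 X2 X4 (e * l2) (eh * D) => X1 X2 X4 X3 X5; lra.
Qed.

Lemma outer_entry p (w : E) k l : (1%:M - p^T *m w) k l = (k == l)%:R - p$k * w$l.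
Proof. by rewrite !mxE big_ord1 !mxE. Qed.

Lemma trace_tangent p (X : 'M[R]_n) : rho p = 1 ->
 \tr (G p *m ((1%:M - p^T *m b p) *m X *m (1%:M - p^T *m b p)^T)) = \tr (G p *m X).
Proof.
move=> p1; have Gs := ghessT (nz p1).
have pG := ghess_radial (nz p1).
have Gp : G p *m p^T = 0 by apply: trmx_inj; rewrite trmx_mul trmxK Gs pG trmx0.
have GPi : G p *m (1%:M - p^T *m b p) = G p by rewrite mulmxBr mulmx1 mulmxA Gp mul0mx subr0.
have PiG : (1%:M - p^T *m b p)^T *m G p = G p.
 by apply: trmx_inj; rewrite trmx_mul trmxK Gs GPi.
by rewrite !mulmxA GPi mxtrace_mulC mulmxA PiG.
Qed.

(** [d (x + v)] is at most the [rho0]-distance from [x + v] to any point off [Omega]. The point used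
    is the projection of [x], moved by [a] times the tangential part of [v] and lifted to the
    osculating paraboloid. The gap [Hs - H] leaves a margin [s] independent of [x]. *)
Theorem barrier (Hs H tau : R) : Hs <= min_mean_rho_curvature K Omega -> H < Hs -> 0 < tau ->
 exists dl C s : R, [/\ 0 < dl, 0 < C, 0 < s & forall x, Omega x -> tau <= d x ->
  0 < 1 - d x * H /\ exists p (Q : 'M[R]_n), [/\ rho p = 1, Q^T = Q, forall i j, `|Q i j| <= C,
   \tr (G p *m Q) <= - (n.-1%:R * H / (1 - d x * H)) - s & forall v, `|v| < dl -> Omega (x + v) /\
    d (x + v) <= d x + dotv p v + 2^-1 * bilin Q v v]].
Proof.
move=> HsM HHs tau0.
have [M M0 hM] := closure_bounded.
have [Dm Dm0 hDm] : exists2 D : R, 0 < D & forall x, Omega x -> d x <= D.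
 have [C1 C10 hC1] := polar_upper; have [y0 By0] := bd_nonempty.
 exists (C1 * (M + M)); first by pos.
 move=> x Ox; rewrite (le_trans (dist_le x By0))// (le_trans (hC1 _))//.
 rewrite ler_pM2l// (le_trans (ler_normB _ _))// lerD// hM//; first exact: subset_closure.
 by have [] := (bd_openP y0).1 By0.
have [Kp Kp0 hKp] := gauge_bound_unit.
have [Kb Kb0 hKb] := grad_bound.
have [CG CG0 hCG] := ghess_bound.
have [CN CN0 hCN] := Ghat_inv_bound.
have [C1 C10 hC1] := polar_upper.
have nr : 0 < n%:R :> R by pos.
have nr1 : 0 < n.-1%:R :> R by rewrite ltr0n; case: (n) n2 => [|[]].
have HsH : 0 < Hs - H by rewrite subr_gt0.
(* As [r Hs <= 1] and [tau <= r], one has [1 - r H >= r (Hs - H) >= al]. Hence [A] bounds both [a]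
   and [1 - a]. *)
pose al := tau * (Hs - H); have al0 : 0 < al by rewrite mulr_gt0.
pose A1 := 1 + Dm * `|H|; have A10 : 0 < A1 by rewrite ltr_wpDr// mulr_ge0// ltW.
pose A := 1 + al^-1; have A0 : 0 < A by rewrite addr_gt0// invr_gt0.
pose T := 1 + n%:R * Kp * Kb; have T0 : 0 < T by rewrite /T; posn.
pose s0 := n.-1%:R * (Hs - H) / A1 ^+ 2; have s00 : 0 < s0 by rewrite divr_gt0 ?mulr_gt0// exprn_gt0.
(* Chosen so that the correction [2 eh] on the diagonal of [Q] uses at most half of the gain
   [s0]. *)
pose eh := s0 / (4 * n%:R * CG); have eh0 : 0 < eh by rewrite divr_gt0// !mulr_gt0.
have AT0 : 0 < A ^+ 2 * T ^+ 2 by pos.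
pose e := eh / 3 / (A ^+ 2 * T ^+ 2); have e0 : 0 < e by rewrite /e; posn.
pose e2 := eh / 3 / (A ^+ 2 * T ^+ 2) * (tau / 2); have e20 : 0 < e2 by rewrite /e2; posn.
pose F := A ^+ 2 * CN * T ^+ 2 / tau ^+ 2.
have F0 : 0 < F by rewrite /F; posn.
pose eta := min (tau / 2) (eh / 3 / F); have eta0 : 0 < eta by rewrite /eta lt_min; apply/andP; split; posn.
have [dl0 dl00 hex] := exit_unif e0.
have [dl2 dl20 hps] := polar_shift e20.
pose C4 := n%:R * Kp + (n%:R ^+ 2 * dl0^-1 + e) * (A ^+ 2 * T ^+ 2).
have C40 : 0 < C4 by rewrite /C4; posn.
have ATp : 0 < A * T by pos.
pose dl := min 1 (min (eta / C4) (min (dl0 / (A * T)) (min (dl2 * (tau / 2) / (A * T)) (tau / C1)))).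
have dlp : 0 < dl by rewrite /dl !lt_min ltr01 /=; do !(apply/andP; split); posn.
pose Pi0 := 1 + Kp * Kb; have Pi00 : 0 < Pi0 by rewrite /Pi0; posn.
pose X0 := A ^+ 2 / tau * CN + A ^+ 2 * dl0^-1.
have X00 : 0 < X0 by rewrite /X0; posn.
pose C := n%:R * (n%:R * (Pi0 * X0) * Pi0) + 2 * eh.
have C0 : 0 < C by rewrite /C; posn.
exists dl, C, (s0 / 2); split=> //; first by pos.
move=> x Ox tx; have cx := @subset_closure _ Omega x Ox.
have [r dr] : exists r, d x = r by exists (d x).
have rD := hDm _ Ox.
have := min_mean_inv_dist Ox; rewrite dr in tx rD * => hmin.
have r0 : 0 < r by apply: lt_le_trans tx.
have Hr : r * Hs <= 1 by rewrite -ler_pdivlMl// mulr1 (le_trans HsM).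
have a1 : al <= 1 - r * H.
 have : tau * (Hs - H) <= r * (Hs - H) by rewrite ler_wpM2r// ltW.
 by rewrite /al mulrBr (mulrBr r); lra.
have a0 : 0 < 1 - r * H by apply: lt_le_trans a1.
have a2 : 1 - r * H <= A1.
 rewrite /A1 lerD2l -mulrN; apply: (@le_trans _ _ (r * `|H|)); last by rewrite ler_wpM2r.
 by rewrite ler_wpM2l ?(ltW r0)// -normrN ler_norm.
split=> //; have [y [By dE] _] := distP x.
have [phi [V [ch Vy hS hexy]]] := hex _ By.
have xE := projection_ray Ox ch Vy By dE; rewrite dr in xE.
have mean := min_mean_le By.
have trM := mean_curvature_trace By ch Vy.
have trN := trace_inv_Ghat ch Vy.
have p1 : rho (conormal phi y) = 1.
 by case: ch => _ _ gphi _; exact: (conormal_gauge (gphi _ Vy)).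
have Ss : (sform phi y)^T = sform phi y.
 by case: ch => oV cphi _ _; rewrite /sform linearZ /= (hess_sym oV Vy cphi).
move: (sform phi y) (conormal phi y) hS hexy xE trM trN p1 Ss => S p hS hexy xE trM trN p1 Ss.
pose w := b p.
have pw : dotv p w = 1 by rewrite dotvC (gauge_euler (nz p1)).
have pb : `|p| <= Kp by apply: hKp; rewrite p1.
have wb : `|w| <= Kb by apply: hKb; exact: nz.
(* The derivative of the projection if all curvatures at the foot point were [H]. Being one scalar
   for all tangent directions, it lets the curvatures enter only through their mean. *)
pose a := (1 - r * H)^-1; have ap : 0 < a by rewrite invr_gt0.
have aal : a <= al^-1 by rewrite lef_pV2.
have aA : a <= A by rewrite /A (le_trans aal)// lerDr.
have a1A : `|1 - a| <= A by apply: one_sub_abs => //; rewrite /A lerDl invr_ge0 ltW.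
have c2A : 0 <= (1 - a) ^+ 2 <= A ^+ 2.
 by rewrite sqr_ge0 /= -real_normK ?num_real// sqr_mono.
have aA2 : a ^+ 2 <= A ^+ 2 by rewrite sqr_mono// ltW.
pose Pi : 'M[R]_n := 1%:M - p^T *m w.
pose X : 'M[R]_n := ((1 - a) ^+ 2 / r) *: N p - a ^+ 2 *: S.
(* The first part is the exact second order term of the comparison; the multiple of the identity
   absorbs the errors of [polar_shift] and [exit_unif]. *)
pose Q : 'M[R]_n := Pi *m X *m Pi^T + (2 * eh)%:M.
have Ns : (N p)^T = N p by apply: invmx_sym; exact: (Ghat_sym (nz p1)).
have Xs : X^T = X by rewrite /X linearB /= !linearZ /= Ns Ss.
have QE v : bilin Q v v = (1 - a) ^+ 2 / r * bilin (N p) (v - dotv p v *: w) (v - dotv p v *: w)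
  - a ^+ 2 * bilin S (v - dotv p v *: w) (v - dotv p v *: w) + 2 * eh * dotv v v.
 have vPi : v *m Pi = v - dotv p v *: w.
  by rewrite /Pi mulmxBr mulmx1 mulmxA mul_row_tr mul_scalar_mx dotvC.
 rewrite /bilin /Q mulmxDr mul_mx_scalar dotvDl dotvZl; congr (_ + _).
 rewrite !mulmxA dotv_mulmx_rect trmxK vPi -/(bilin X _ _) /X.
 by rewrite /bilin mulmxBr dotvBl -!/(bilin _ _ _) !bilin_scale.
exists p, Q; split=> //.
- by rewrite /Q linearD /= tr_scalar_mx !trmx_mul trmxK Xs mulmxA.
- move=> i j; have hPi k l : `|Pi k l| <= Pi0.
  rewrite outer_entry (le_trans (ler_normB _ _))// lerD//.
   by case: (_ == _); rewrite ?normr1 ?normr0.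
  by rewrite normrM ler_pM//; apply: le_trans (coord_le_norm _ _) _.
 have hX k l : `|X k l| <= X0.
  have hNkl := psd_entry_le Ns (hCN _ p1) k l.
  have -> : X k l = (1 - a) ^+ 2 / r * N p k l - a ^+ 2 * S k l by rewrite !mxE.
  have /andP[c0 cA] := c2A; have a20 : 0 <= a ^+ 2 by pos.
  move: ((1 - a) ^+ 2) (a ^+ 2) c0 cA a20 aA2 => c2 a22 c0 cA a20 aA2'.
  rewrite (le_trans (ler_normB _ _))// lerD// normrM.
   rewrite ler_pM// normrM ger0_norm// gtr0_norm ?invr_gt0//.
   by apply: ler_pM => //; rewrite ?invr_ge0 ?(ltW r0)// lef_pV2.
  by rewrite ler_pM// ger0_norm.
 have hPt k l : `|Pi^T k l| <= Pi0 by rewrite mxE.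
 rewrite /Q mxE (le_trans (ler_normD _ _))// lerD//.
  apply: mulmx_entry_le => //; first by pos.
  by apply: mulmx_entry_le => //; rewrite ltW.
 have ehp : 0 <= 2 * eh by pos.
 by rewrite mxE; case: (_ == _); rewrite ?mulr1n ?mulr0n ?normr0// ger0_norm.
- have -> : \tr (G p *m Q) = (1 - a) ^+ 2 / r * n.-1%:R
   - a ^+ 2 * (n.-1%:R * mean_rho_curvature K Omega y) + 2 * eh * \tr (G p).
  rewrite /Q mulmxDr mxtraceD mul_mx_scalar mxtraceZ trace_tangent// /X.
  rewrite mulmxDr -scaleNr -!scalemxAr mxtraceD !mxtraceZ trN.
  by rewrite [\tr (G p *m S)]mxtrace_mulC -trM mulNr.
 have trG : \tr (G p) <= n%:R * CG.
  have -> : n%:R * CG = \sum_(i < n) CG by rewrite sumr_const card_ord mulr_natl.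
  by apply: ler_sum => i _; rewrite (le_trans (ler_norm _))// hCG.
 have h1 : 2 * eh * \tr (G p) <= s0 / 2.
  apply: (@le_trans _ _ (2 * eh * (n%:R * CG))); first by rewrite ler_wpM2l// mulr_ge0// ltW.
  by rewrite /eh; apply: le_eq; field; pos.
 have Hm : Hs <= mean_rho_curvature K Omega y by apply: le_trans HsM mean.
 move: (mean_rho_curvature K Omega y) Hm => m Hm.
 have h2 : n.-1%:R * a ^+ 2 * Hs <= n.-1%:R * a ^+ 2 * m by rewrite ler_wpM2l// mulr_ge0 ?sqr_ge0.
 have h3 : s0 <= n.-1%:R * (Hs - H) * a ^+ 2.
  rewrite /s0 ler_wpM2l ?mulr_ge0 ?(ltW HsH)// /a -exprVn sqr_mono ?invr_ge0 ?(ltW A10)//.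
  by rewrite lef_pV2.
 (* Since [1 - a = - r H a], the trace is [(n - 1) a ^ 2 (r H ^ 2 - m)], which for [m = H] is
    exactly [- (n - 1) H / (1 - r H)]. *)
 have aE : (1 - a) ^+ 2 / r * n.-1%:R = n.-1%:R * a ^+ 2 * (r * H ^+ 2).
  by rewrite /a; field; pos.
 have aE2 : n.-1%:R * H / (1 - r * H) = n.-1%:R * a ^+ 2 * (H - r * H ^+ 2).
  by rewrite /a; field; pos.
 rewrite aE aE2; move: h1 h2 h3.
 set W := 2 * eh * _; move: W (n.-1%:R) (a ^+ 2) (s0) => W k1 a22 s1.
 have -> : a22 * (k1 * m) = k1 * a22 * m by ring.
 have -> : k1 * (Hs - H) * a22 = k1 * a22 * Hs - k1 * a22 * H by ring.
 by rewrite !(mulrBr (k1 * a22)); exact: trace_scalar.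
- move=> v; rewrite !lt_min => /and5P[v1 v2 v3 v4 v5].
 have Oxv : Omega (x + v).
  apply: (dist_inside cx).
  rewrite opprD addrA subrr sub0r (le_lt_trans (hC1 _))// normrN dr.
  by apply: lt_le_trans tx; rewrite mulrC -ltr_pdivlMr.
 split=> //; have [->|v0] := eqVneq v 0.
  by rewrite addr0 dotv0r bilin0r mulr0 !addr0 dr.
 have nv : 0 < `|v| by pos.
 pose t := v - dotv p v *: w.
 have pt : dotv p t = 0 by rewrite /t dotvBr dotvZr pw mulr1 subrr.
 have tT : `|t| <= T * `|v|.
  rewrite /t (le_trans (ler_normB _ _))// /T mulrDl mul1r lerD2l normrZ.
  rewrite (@le_trans _ _ (n%:R * (Kp * `|v|) * Kb))//.
   rewrite ler_pM// (le_trans (dotv_le _ _))// ler_wpM2l// ler_wpM2r//.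
  by apply: le_eq; ring.
 pose l := A * T * `|v|.
 have l0 : 0 < l < dl0 by rewrite /l !mulr_gt0//= mulrC -ltr_pdivlMr.
 have atl : `|a *: t| <= l.
  by rewrite normrZ gtr0_norm// /l -mulrA ler_pM// ltW.
 have pat : dotv p (a *: t) = 0 by rewrite dotvZr pt mulr0.
 have := hexy _ _ pat atl l0.
 (* The height reached at the tangential displacement [a *: t], slightly below the osculating
    paraboloid. *)
 pose k := 2^-1 * bilin S (a *: t) (a *: t) - e * l ^+ 2.
 rewrite -/k => nO.
 have l2E : l ^+ 2 = A ^+ 2 * T ^+ 2 * `|v| ^+ 2 by rewrite /l !exprMn.
 have vk : `|dotv p v - k| <= eta.
  apply: (@le_trans _ _ (C4 * `|v|)); last by rewrite mulrC -ler_pdivlMr// ltW.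
  rewrite (le_trans (ler_normB _ _))// /C4 mulrDl lerD//.
   by rewrite (le_trans (dotv_le _ _))// mulrA ler_wpM2r// ler_wpM2l.
  apply: (@le_trans _ _ ((n%:R ^+ 2 * dl0^-1 + e) * l ^+ 2)); last first.
   rewrite l2E -[X in _ <= X]mulrA; apply: ler_wpM2l; first by posn.
   by apply: ler_wpM2l; [posn | rewrite expr2 ler_piMl// ltW].
  rewrite /k (le_trans (ler_normB _ _))// mulrDl lerD//; last first.
   have el0 : 0 <= e * l ^+ 2 by apply: mulr_ge0; [exact: ltW | exact: sqr_ge0].
   by rewrite ger0_norm.
  rewrite normrM ger0_norm//.
  have d0 : 0 <= dl0^-1 by posn.
  have := bilin_le (a *: t) (a *: t) d0 hS; rewrite -expr2 => h.
  apply: (@le_trans _ _ (`|bilin S (a *: t) (a *: t)|)).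
   by rewrite ler_piMl// invf_le1 ?ler1n.
  by rewrite (le_trans h)//; apply: ler_wpM2l; [posn | apply: sqr_mono].
 have et : eta <= tau / 2 by rewrite ge_min lexx.
 have rk : tau / 2 <= r + dotv p v - k.
  exact: (shift_half tx et vk).
 have rk0 : 0 < r + dotv p v - k by apply: lt_le_trans rk; rewrite divr_gt0.
 have put : dotv p ((1 - a) *: t) = 0 by rewrite dotvZr pt mulr0.
 have ut : `|(1 - a) *: t| < dl2 * (r + dotv p v - k).
  rewrite normrZ; apply: (@le_lt_trans _ _ (A * T * `|v|)); first by rewrite -mulrA ler_pM.
  by rewrite mulrC -ltr_pdivlMr//; apply: lt_le_trans v4 _; rewrite ler_wpM2r ?invr_ge0 ?(ltW ATp)// ler_pM2l.
 have := dist_le_out (@subset_closure _ Omega _ Oxv) nO.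
 have -> : x + v - (y + (a *: t + k *: b p)) = (r + dotv p v - k) *: b p + (1 - a) *: t.
  rewrite {1}xE /t -/w; move: (w) (dotv p v) (k) => w1 c k1.
  by apply/rowP => i; rewrite !mxE; ring.
 move=> /le_trans/(_ (hps _ _ _ p1 put rk0 ut)).
 have nt2 : 0 <= `|t| ^+ 2 <= T ^+ 2 * `|v| ^+ 2 by rewrite exprn_ge0//= -exprMn sqr_mono.
 rewrite bilinZl bilinZr mulrA -expr2 normrZ exprMn real_normK ?num_real// => h.
 have := @barrier_scalar r k (dotv p v) ((1 - a) ^+ 2) (bilin (N p) t t) (`|t| ^+ 2) (l ^+ 2)
  (`|v| ^+ 2) (a ^+ 2 * bilin S t t) e e2 eh (A ^+ 2) (T ^+ 2) CN eta tau (d (x + v)) (dotv v v).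
 rewrite tau0 tx eta0 et (hCN _ p1) h norm_sq_le QE -/t => hh.
 apply: (@le_trans _ _ (r + dotv p v + 2^-1 * ((1 - a) ^+ 2 / r * bilin (N p) t t
   - a ^+ 2 * bilin S t t) + eh * dotv v v)); last first.
  by apply: le_eq; field; posn.
 apply: hh => //.
 + exact: ltW.
 + by posn.
 + by rewrite /k bilinZl bilinZr mulrA -expr2.
 + by rewrite /e divfK// gt_eqF.
 + apply: (@le_trans _ _ (F * (eh / 3 / F))); last by rewrite mulrC divfK// gt_eqF.
  have -> : A ^+ 2 * CN * T ^+ 2 * (eta / tau ^+ 2) = F * eta by rewrite /F; ring.
  by rewrite ler_pM2l// ge_min lexx orbT.
 + by rewrite /e2; apply: le_eq; field; posn.
Qed.

End exit.

(** * The weak lower bound of minus the divergence *)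

Section divergence.
Implicit Types (x y z v p : E).

(** [minkowski_dist] is positive outside the closure of [Omega]; the extension by zero is the
    function that lies in the Sobolev space of the whole argument. *)
Definition dist0 x : R := if `[< Omega x >] then d x else 0.

Lemma dist0_in x : Omega x -> dist0 x = d x.
Proof. by move=> h; rewrite /dist0 asboolT. Qed.

Lemma dist0_out x : ~ Omega x -> dist0 x = 0.
Proof. by move=> h; rewrite /dist0 asboolF. Qed.

Lemma dist0_ge0 x : 0 <= dist0 x.
Proof. by rewrite /dist0; case: ifP => // _; exact: dist_ge0. Qed.

Lemma dist0_gt0 x : Omega x -> 0 < dist0 x.
Proof. by move=> h; rewrite dist0_in// dist_gt0//; exact: Omega_not_bd. Qed.

Lemma dist0_sub x z : dist0 x <= dist0 z + rho0 (x - z).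
Proof.
have [Ox|Ox] := pselect (Omega x); last by rewrite (dist0_out Ox) addr_ge0 ?dist0_ge0 ?polar_ge0.
rewrite (dist0_in Ox); have [Oz|Oz] := pselect (Omega z).
 by rewrite (dist0_in Oz); exact: dist_sub.
by rewrite (dist0_out Oz) add0r dist_le_out//; exact: subset_closure.
Qed.

Lemma dist0_min x : Omega x -> exists2 y, bd y & dist0 x = dist0 y + rho0 (x - y).
Proof.
move=> Ox; have [y [yb dy] _] := distP x.
exists y => //; rewrite dist0_in// dy (dist0_out (x := y)) ?add0r//.
by have [] := (bd_openP y).1 yb.
Qed.

Lemma dist0_lip : exists2 L : R, 0 < L & lipfun dist0 L.
Proof. exact: profile_lip dist0_sub. Qed.

Lemma Omega_norm : exists2 M : R, 0 < M & forall x, Omega x -> `|x| <= M.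
Proof.
have [M M0 hM] := closure_bounded; exists M => // x Ox; apply: hM; exact: subset_closure.
Qed.

Lemma dist0_hgrad : {ae mu, forall x, Omega x -> exists2 p, rho p = 1 & hgrad dist0 x p}.
Proof.
have [L L0 hL] := dist0_lip; have [M M0 hM] := Omega_norm.
have hO : {ae mu, forall x, Omega x -> ~ bd x} by apply: aeW => x; exact: Omega_not_bd.
have := profile_hgrad Omega_o bd_compact hO dist0_sub dist0_min hL dist0_ge0 dist0_gt0 dist0_out hM.
apply: filterS => x hx Ox; have [p [y [_ xy _ ->]] hp] := hx Ox.
by exists (pmax (x - y)) => //; apply: pmax_gauge => //; rewrite subr_eq0.
Qed.

(** A version of [b(Dd)] that is defined and measurable everywhere, with [lgrad] in place of both
    gradients. *)
Definition field x : E := lgrad rho (lgrad dist0 x).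

Lemma measurable_field i : mfun (fun x => field x$i).
Proof.
have [Lr _ hLr] := gauge_lip; have [L _ hL] := dist0_lip.
apply: (measurableT_comp (f := fun y : E => lgrad rho y$i)).
 by apply: (meas_lgrad (L := Lr)) => x y; exact: hLr.
by apply: meas_row => // j; apply: meas_lgrad hL.
Qed.

Lemma field_eq x p : rho p = 1 -> hgrad dist0 x p -> field x = b p.
Proof.
move=> rp hp; rewrite /field (hgrad_lgrad hp) (hgrad_lgrad (gauge_hgradE (nz rp)))//.
Qed.

Lemma ggrad_mono p p' : p != 0 -> p' != 0 -> 0 <= dotv (b p - b p') (p - p').
Proof.
move=> h h'; have e1 := gauge_euler h; have e2 := gauge_euler h'.
have l1 := ggrad_le p' h; have l2 := ggrad_le p h'.
by rewrite !dotvBl !dotvBr e1 e2; lra.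
Qed.

Lemma ghess_unif (e : R) : 0 < e -> exists2 dl : R, 0 < dl & forall p, rho p = 1 ->
 forall v, `|v| < dl -> p + v != 0 /\ forall i j, `|G (p + v) i j - G p i j| <= e.
Proof.
move=> e0; apply: (boundary_unif (P := fun dl p => forall v, `|v| < dl -> p + v != 0 /\
  forall i j, `|G (p + v) i j - G p i j| <= e)).
 by move=> dl dl' p h hp v vd; apply: hp; exact: lt_le_trans h.
move=> a ra; have e2 : 0 < e / 2 by lra.
have [dl dl0 hdl] := hess_cont (V := [set x | x != 0]) open_neq0 (nz ra) gauge_C2 e2.
have d2 : 0 < dl / 2 by lra.
exists (dl / 2) => // p rp pa v vd.
have pd : `|p - a| < dl by lra.
have vdl : `|p + v - a| < dl by rewrite addrAC (le_lt_trans (ler_normD _ _))//; lra.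
have [h1 h2] := hdl _ vdl; have [_ h3] := hdl _ pd; split=> // i j.
have := h2 i j; have := h3 i j; have := ler_distD (G a i j) (G (p + v) i j) (G p i j).
by rewrite (distrC (G a i j)); lra.
Qed.

Lemma ggrad_unif : exists C dl : R, [/\ 0 < C, 0 < dl & forall p, rho p = 1 ->
 forall v, `|v| < dl -> `|b (p + v) - b p| <= C * `|v|].
Proof.
have [dl dl0 h] := gauge_taylor ltr01; have [C C0 hC] := ghess_bound.
exists (1 + n%:R * C), dl; split=> //; first by pos.
move=> p rp v vd; have [_ h1 _] := h p rp v vd.
have h2 := norm_mulmx_le v (ltW C0) (hC p rp).
have := ler_normD (b (p + v) - b p - v *m G p) (v *m G p); rewrite subrK mulrDl; lra.
Qed.

Variables (Hs H : R).
Hypotheses (Hs_le : Hs <= min_mean_rho_curvature K Omega) (H_lt : H < Hs).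

(** For [H > 0] the bound [1 - H / Hs] comes from [d <= 1 / Hs], that is, from
    [min_mean_inv_dist]. *)
Lemma one_sub_gt0 : exists2 k : R, 0 < k & forall x, k <= 1 - dist0 x * H.
Proof.
have [H0|H0] := leP H 0.
 by exists 1 => // x; rewrite lerBrDr gerDl; apply: mulr_ge0_le0 => //; exact: dist0_ge0.
have Hs0 : 0 < Hs by exact: lt_trans H_lt.
have HHs : H / Hs < 1 by rewrite ltr_pdivrMr// mul1r.
exists (1 - H / Hs); first by lra.
move=> x; rewrite lerB// mulrC ler_pM2l//.
have [Ox|Ox] := pselect (Omega x); last by rewrite dist0_out// invr_ge0 ltW.
have dx := dist0_gt0 Ox; rewrite -[dist0 x]invrK lef_pV2 ?posrE ?invr_gt0//.
apply: le_trans Hs_le _; rewrite dist0_in//; exact: min_mean_inv_dist.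
Qed.

Definition kf x : R := n.-1%:R * H / (1 - dist0 x * H).

Lemma kf_lip : exists2 L : R, 0 < L & lipfun kf L.
Proof.
have [k k0 hk] := one_sub_gt0; have [L L0 hL] := dist0_lip.
exists (`|n.-1%:R * H * H| / (k * k) * L + 1); first by pos.
move=> x y; have k1 := lt_le_trans k0 (hk x); have k2 := lt_le_trans k0 (hk y).
have -> : kf x - kf y = (n.-1%:R * H * H) / ((1 - dist0 x * H) * (1 - dist0 y * H)) * (dist0 x - dist0 y).
 by rewrite /kf; field; pos.
have hh : `|n.-1%:R * H * H / ((1 - dist0 x * H) * (1 - dist0 y * H))| <= `|n.-1%:R * H * H| / (k * k).
 rewrite normrM normfV (gtr0_norm (mulr_gt0 k1 k2)) ler_wpM2l// lef_pV2 ?posrE ?mulr_gt0//.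
 by apply: ler_pM; rewrite ?(ltW k0).
rewrite [leLHS]normrM; apply: le_trans (ler_pM (normr_ge0 _) (normr_ge0 _) hh (hL x y)) _.
by rewrite [leRHS]mulrDl mul1r mulrA lerDl.
Qed.

Lemma kf_bound : exists2 C : R, 0 < C & forall x, `|kf x| <= C.
Proof.
have [k k0 hk] := one_sub_gt0; exists (`|n.-1%:R * H| / k + 1); first by pos.
move=> x; apply: ler_wpDr => //; have k1 := lt_le_trans k0 (hk x).
by rewrite /kf normrM normfV (gtr0_norm k1) ler_wpM2l// lef_pV2 ?posrE.
Qed.

Lemma ible_kf phi : ible phi -> ible (fun x => kf x * phi x).
Proof.
move=> ip; have [C _ hC] := kf_bound; have [L _ hL] := kf_lip.
have := ibleM_bdd ip (lip_meas hL) hC.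
by congr ible; apply/funext => x; rewrite mulrC.
Qed.

(** On a small ball the barriers at a countable dense set of points satisfy the hypotheses of
    [local_inequality]. The margin [s] of [barrier] pays, half each, for the variation of the
    Hessian of the gauge and for that of [kf] over the ball. *)
Lemma local_divergence (tau : R) : 0 < tau -> exists2 r : R, 0 < r & forall c phi L,
 Omega c -> 2 * tau <= dist0 c -> 0 <= L -> lipfun phi L -> (forall x, 0 <= phi x) ->
 (forall x, r < `|x - c| -> phi x = 0) -> adiff phi -> I{x, kf x * phi x} <= I{x, dotv (field x) (lgrad phi x)}.
Proof.
move=> tau0.
have [dl [C [s [dl0 C0 s0 hbar]]]] := barrier Hs_le H_lt tau0.
have [Ld Ld0 hLd] := dist0_lip; have [Lk Lk0 hLk] := kf_lip.
have [CG CG0 hCG] := ghess_bound.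
have [Cp Cp0 hCp] := gauge_bound_unit.
have [Cb Cb0 hCb] := grad_bound.
pose N : R := n%:R; have N0 : 0 < N by pos.
have e0 : 0 < s / (2 * (N ^+ 2 * C)) by pos.
set e1 := s / _ in e0.
have [dG dG0 hdG] := ghess_unif e0.
pose r := min (dl / 4) (min (tau / Ld) (min (dG / (4 * (N * C))) (min (s / (4 * Lk)) 1))).
have r0 : 0 < r by rewrite !lt_min /N; repeat (apply/andP; split); posn.
have r1 : r <= dl / 4 by rewrite !ge_min lexx.
have r2 : r * Ld <= tau by rewrite -ler_pdivlMr// !ge_min lexx !orbT.
have r3 : N * C * (2 * r) < dG.
 have NC : 0 < N * C by pos.
 have h : r <= dG / (4 * (N * C)) by rewrite !ge_min lexx !orbT.
 have : N * C * (2 * r) <= dG / 2.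
  apply: le_trans (_ : N * C * (2 * (dG / (4 * (N * C)))) <= _).
   by rewrite ler_pM2l// ler_pM2l.
  by apply: le_eq; field; pos.
 lra.
have r4 : Lk * (2 * r) <= s / 2.
 have h : r <= s / (4 * Lk) by rewrite !ge_min lexx !orbT.
 apply: le_trans (_ : Lk * (2 * (s / (4 * Lk))) <= _); first by rewrite ler_pM2l// ler_pM2l.
 by apply: le_eq; field; pos.
have r5 : r <= 1 by rewrite !ge_min lexx !orbT.
exists r => // c phi L Oc dc L0 lphi phi0 phi_out dphi.
have inb z : `|z - c| <= r -> Omega z /\ tau <= d z.
 move=> zc; have dc' : tau <= d c by rewrite -dist0_in//; lra.
 have [_ [p [Q [_ _ _ _ hv]]]] := hbar c Oc dc'.
 have zd : `|z - c| < dl by lra.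
 have [Oz _] := hv _ zd; rewrite (addrC c) subrK in Oz; split=> //.
 rewrite -dist0_in//; have h := hLd c z; rewrite (distrC c z) in h.
 have h2 : Ld * `|z - c| <= r * Ld by rewrite mulrC ler_pM2r.
 have := ler_norm (dist0 c - dist0 z); lra.
have [cc [rr [rr0 hcr]]] := @rational_balls R n.
(* Rational centres outside the ball are replaced by [c], so that every index yields a barrier
   centred in the ball. *)
pose X j := if `|cc j - c| <= r then cc j else c.
have Xr j : `|X j - c| <= r by rewrite /X; case: ifP => // _; rewrite subrr normr0 ltW.
have hXj j : exists pQ : E * 'M[R]_n, [/\ rho pQ.1 = 1, pQ.2^T = pQ.2, forall i k, `|pQ.2 i k| <= C,
  \tr (G pQ.1 *m pQ.2) <= - kf (X j) - s &
  forall v, `|v| < dl -> dist0 (X j + v) <= dist0 (X j) + dotv pQ.1 v + 2^-1 * bilin pQ.2 v v].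
 have [Ox dx] := inb _ (Xr j); have [_ [p [Q [h1 h2 h3 h4 h5]]]] := hbar _ Ox dx.
 exists (p, Q); split=> //; first by rewrite /kf dist0_in.
 by move=> v /h5[Ov h]; rewrite !dist0_in.
have [pQ hpQ] := choice hXj; pose p j := (pQ j).1; pose Q j := (pQ j).2.
have p1 j : rho (p j) = 1 by have [] := hpQ j.
have Qs j : (Q j)^T = Q j by have [] := hpQ j.
have QC j : forall i k, `|Q j i k| <= C by have [] := hpQ j.
(* The quadratic barrier itself, with gradient [P j]; [A j] is the Jacobian of [b (P j z)]. *)
pose q j z := dist0 (X j) + dotv (p j) (z - X j) + 2^-1 * bilin (Q j) (z - X j) (z - X j).
pose P j z := p j + (z - X j) *m Q j.
have zX j z : `|z - c| <= r -> `|(z - X j) *m Q j| <= N * C * (2 * r).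
 move=> zc; apply: le_trans (norm_mulmx_le _ (ltW C0) (QC j)) _.
 rewrite ler_wpM2l ?mulr_ge0 ?(ltW C0)//.
 by have := ler_distD c z (X j); have := Xr j; rewrite (distrC c); lra.
have Pd j z : `|z - c| <= r -> P j z != 0 /\ forall i k, `|G (P j z) i k - G (p j) i k| <= e1.
 by move=> zc; apply: hdG => //; apply: le_lt_trans r3; exact: zX.
pose A j z := G (P j z) *m Q j.
have NC : 0 <= N * C by pos.
have D2 : 0 <= N * ((CG + e1) * C) by pos.
have D3 : 0 <= N ^+ 2 * C by pos.
pose D := Cp + N * C * 2 + Cb + N * ((CG + e1) * C) + N ^+ 2 * C.
have Dp : Cp + N * C * 2 <= D by rewrite /D; lra.
have Db : Cb <= D by rewrite /D; lra.
have DA : N * ((CG + e1) * C) <= D by rewrite /D; lra.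
have DQ : N ^+ 2 * C <= D by rewrite /D; lra.
have D0 : 0 <= D by lra.
apply: (@local_inequality R n q P A b field c r D kf dist0 r0 D0 _ _ _ _ _ _ _ _ _ _ phi L L0 lphi phi0 phi_out dphi).
- move=> j z zc.
 have h := hgradD (hgradD (hgrad_cst (dist0 (X j)) z)
   (hgradB (hgrad_dotv z (p j)) (hgrad_cst (dotv (p j) (X j)) z))) (hgrad_quad (X j) z (Qs j)).
 rewrite add0r subr0 in h.
 by apply: (hgrad_near ltr01 _ h) => y _; rewrite /q dotvBr.
- move=> j z i zc; have [Pz _] := Pd j z zc.
 have h1 := hgrad_gradi i open_neq0 Pz gauge_C2.
 have h2 k : hgrad (fun y => P j y$k) z (row k (Q j)).
  have h3 := hgradD (hgrad_cst (p j$k) z)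
   (hgradB (hgrad_dotv z (row k (Q j))) (hgrad_cst (dotv (row k (Q j)) (X j)) z)).
  rewrite add0r subr0 in h3; apply: (hgrad_near ltr01 _ h3) => y _.
  by rewrite -dotvBr mxE (dotv_mulmx_row _ _ (Qs j)).
 have := hgrad_comp h1 h2; congr hgrad; apply/rowP => l.
 by rewrite summxE /A !mxE; apply: eq_bigr => k _; rewrite !mxE.
- move=> j z zc; apply: le_trans (ler_normD _ _) _; apply: le_trans Dp.
 apply: lerD; first by apply: hCp; rewrite p1.
 by apply: le_trans (zX j z zc) _; rewrite ler_wpM2l//; lra.
- by move=> j z zc; have [Pz _] := Pd j z zc; apply: le_trans (hCb _ Pz) _.
- move=> j z k l zc; apply: le_trans DA; have [_ hG] := Pd j z zc.
 apply: mulmx_entry_le; [by pos| |exact: QC] => i m.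
 have := hG i m; have := hCG _ (p1 j) i m; have := ler_normD (G (P j z) i m - G (p j) i m) (G (p j) i m).
 by rewrite subrK; lra.
- by move=> j l z zc; apply: ggrad_mono; [exact: (Pd j z zc).1|exact: (Pd l z zc).1].
- move=> j z zc; have [_ hG] := Pd j z zc; have [_ _ _ htr _] := hpQ j.
 have hD : forall i k, `|(G (P j z) - G (p j)) i k| <= e1.
  by move=> i k; move: (hG i k); move: (G _) (G _) => A1 A2; rewrite !mxE.
 have := trace_mulmx_le (ltW e0) hD (QC j).
 have -> : (n%:R ^+ 2 * (e1 * C) : R) = s / 2 by rewrite -/N /e1; field; pos.
 rewrite mulmxBl raddfB/= -/(A j z) => h1; have h2 := hLk z (X j).
 have h3 : Lk * `|z - X j| <= Lk * (2 * r).
  by rewrite ler_pM2l//; have := ler_distD c z (X j); have := Xr j; rewrite (distrC c); lra.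
 move: htr; rewrite -/(p j) -/(Q j).
 by have := ler_norm (\tr (A j z) - \tr (G (p j) *m Q j)); have := ler_norm (kf z - kf (X j)); lra.
- move=> j z zc; have [_ _ _ _ hv] := hpQ j.
 have zd : `|z - X j| < dl.
  by have := ler_distD c z (X j); have := Xr j; rewrite (distrC c); lra.
 by have := hv _ zd; rewrite (addrC (X j)) subrK.
- move=> j z v zc; rewrite /q /P (addrAC z); move: (z - X j) => w.
 have -> : bilin (Q j) (w + v) (w + v) = bilin (Q j) w w + 2 * bilin (Q j) w v + bilin (Q j) v v.
  by rewrite bilinDl !bilinDr (bilin_sym v w (Qs j)); ring.
 have := bilin_le v v (ltW C0) (QC j); rewrite -expr2 => h.
 have h2 : N ^+ 2 * C * `|v| ^+ 2 <= D * `|v| ^+ 2 by rewrite ler_wpM2r// sqr_ge0.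
 rewrite dotvDl dotvDr -/(bilin (Q j) w v).
 have h3 := ler_norm (bilin (Q j) v v); have h4 := normr_ge0 (bilin (Q j) v v); rewrite -/N in h.
 lra.
- move=> z e zc ee.
 pose M0 := Ld + N * Cp + N ^+ 2 * C.
 have M00 : 0 < M0 by rewrite /M0 /N; posn.
 pose del := min 1 (e / M0).
 have del0 : 0 < del by rewrite lt_min ltr01 divr_gt0.
 have del1 : del <= 1 by rewrite ge_min lexx.
 have del2 : M0 * del <= e by rewrite mulrC -ler_pdivlMr// ge_min lexx orbT.
 have [j hj] : exists j, `|z - X j| < del.
  (* [z] may lie on the edge of the ball: the rational centre is sought near a point moved slightly
     towards [c]. *)
  pose t := min 1 (del / (2 * r)).
  have t0 : 0 < t by rewrite lt_min ltr01/= divr_gt0// mulr_gt0.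
  have t1 : t <= 1 by rewrite ge_min lexx.
  have t2 : 2 * (t * r) <= del.
   by rewrite mulrCA -ler_pdivlMr ?mulr_gt0// ge_min lexx orbT.
  have tr0 : 0 < t * r by pos.
  have [k [_ hk]] := hcr (z + t *: (c - z)) _ tr0.
  have := hk (cc k); rewrite subrr normr0 => /(_ (ltW (rr0 k))) ck.
  have a1 : `|z + t *: (c - z) - c| <= (1 - t) * r.
   have -> : z + t *: (c - z) - c = (1 - t) *: (z - c) by apply/rowP => i; rewrite !mxE; ring.
   by rewrite normrZ ger0_norm ?subr_ge0// ler_wpM2l// subr_ge0.
  have a2 : `|z + t *: (c - z) - z| <= t * r.
   by rewrite addr_subK normrZ (ger0_norm (ltW t0)) distrC ler_wpM2l// ltW.
  exists k; rewrite /X; set z' := z + _ in ck a1 a2.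
  have b1 := ler_distD z' (cc k) c; have b2 := ler_distD z' z (cc k).
  have -> : `|cc k - c| <= r by lra.
  by move: b2; rewrite (distrC z z') (distrC z' (cc k)); lra.
 exists j; rewrite /q; have w0 := normr_ge0 (z - X j); set w := z - X j in hj w0 *.
 have h1 := hLd (X j) z; rewrite (distrC (X j)) -/w in h1.
 have h2 : dotv (p j) w <= N * Cp * `|w|.
  apply: le_trans (ler_norm _) _; apply: le_trans (dotv_le _ _) _.
  by rewrite -/N -mulrA ler_pM2l// ler_wpM2r// hCp// p1.
 have h3 : bilin (Q j) w w <= N ^+ 2 * C * `|w|.
  apply: le_trans (ler_norm _) _; apply: le_trans (bilin_le _ _ (ltW C0) (QC j)) _.
  by rewrite -/N ler_wpM2l// ler_piMl//; lra.
 have h4 : M0 * `|w| <= M0 * del by rewrite ler_pM2l// ltW.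
 have h5 := ler_norm (dist0 (X j) - dist0 z).
 have h6 : 0 <= N ^+ 2 * C * `|w| by pos.
 have h7 : Ld * `|w| + N * Cp * `|w| + N ^+ 2 * C * `|w| <= e by rewrite -!mulrDl -/M0; lra.
 lra.
- apply: ible_kf; apply: (lip_ible lphi (M := r + `|c|)); exact: phi_out0.
- exact: measurable_field.
apply: filterS dist0_hgrad => x hx xc; have [Ox _] := inb x xc.
have [p' rp hp] := hx Ox; exists p'; split=> //; first exact: field_eq.
 by apply: le_trans (hCb _ (nz rp)) _.
move=> e ee; have [C1 [dl1 [C10 dl10 h1]]] := ggrad_unif.
have m0 : 0 < min dl1 (e / C1) by rewrite lt_min dl10 divr_gt0.
exists (min dl1 (e / C1)) => // y; rewrite lt_min => /andP[y1 y2].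
have := h1 _ rp _ y1; rewrite (addrC p') subrK => /le_trans; apply.
by rewrite mulrC -ler_pdivlMr// ltW.
Qed.

End divergence.

Let d0_ge0 := dist0_ge0.
Let d0_gt0 := dist0_gt0.
Let sub0 := dist0_sub.

Section main_inequality.
Notation d0 := dist0.
Implicit Types (x y z v p : E).

Variables (Hs H : R).
Hypotheses (Hs_le : Hs <= min_mean_rho_curvature K Omega) (H_lt : H < Hs).
Notation kf := (kf H).

Section divergence.
Variables (tau : R).
Hypothesis tau0 : 0 < tau.

(** The margin [2 tau] on the support leaves a distance at least [tau] on the balls of
    [local_divergence]. *)
Definition inner (phi : E -> R) := forall x, phi x != 0 -> 2 * tau <= d0 x.

Lemma inner_out phi x : inner phi -> d0 x < 2 * tau -> hgrad phi x 0.
Proof.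
move=> ip h; have [L L0 hL] := dist0_lip.
have e0 : 0 < (2 * tau - d0 x) / L by pos.
apply: (hgrad_near e0 _ (hgrad_cst 0 x)) => z; rewrite ltr_pdivlMr// mulrC => zx.
apply/esym/eqP; apply: contraTT isT => /ip h2.
by have := hL z x; have := ler_norm (d0 z - d0 x); lra.
Qed.

Lemma inner_Omega x : 2 * tau <= d0 x -> Omega x.
Proof. move=> h; apply: contrapT => Ox; have t0 := tau0; rewrite (dist0_out Ox) in h; lra. Qed.

Lemma ible_divergence phi (L : R) : 0 <= L -> lipfun phi L -> inner phi -> adiff phi ->
 ible (fun x => dotv (field x) (lgrad phi x)).
Proof.
move=> L0 lp ip dp; have [M M0 hM] := Omega_norm.
have [Cb Cb0 hCb] := grad_bound.
have [g ig [gC g0]] := @ball_cutoff R n (n%:R * (Cb * L)) M.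
have mU : mfun (fun x => dotv (field x) (lgrad phi x)).
 apply: measurable_sum => i; apply: measurable_funM.
  exact: measurable_field.
 by apply: meas_lgrad lp.
apply: ible_ae_le mU ig _.
apply: filterS2 dp dist0_hgrad => x hx hd.
have nn : 0 <= n%:R * (Cb * L) by pos.
have [xd|xd] := leP (2 * tau) (d0 x); last first.
 rewrite (hgrad_lgrad (inner_out ip xd)) dotv0r normr0.
 by have [/gC ->|/g0 ->] := leP `|x| M.
have Ox := inner_Omega xd; have [p rp hp] := hd Ox.
rewrite (field_eq rp hp) gC ?hM// (le_trans (dotv_le _ _))// ler_wpM2l// ler_pM//.
 by apply: le_trans (hCb _ (nz rp)) _.
by apply: norm_le_coord => // i; exact: lip_grad_le lp hx.
Qed.

Lemma inner_supp phi x : inner phi -> (forall M, (forall y, Omega y -> `|y| <= M) -> M < `|x| -> phi x = 0).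
Proof.
move=> ip M hM xM; apply/eqP; apply: contraTT isT => /ip/inner_Omega/hM; by pos.
Qed.

Lemma ible_kfphi phi (L : R) : lipfun phi L -> inner phi -> ible (fun x => kf x * phi x).
Proof.
move=> lp ip; have [M M0 hM] := Omega_norm.
apply: (ible_kf Hs_le H_lt).
by apply: (lip_ible lp (M := M)) => x; exact: inner_supp.
Qed.

(** The local inequality is globalised by peeling off bumps along a finite cover of the compact set
    where [d0] is at least [2 tau]. *)
Lemma divergence_inequality phi (L : R) : 0 <= L -> lipfun phi L -> (forall x, 0 <= phi x) ->
 inner phi -> adiff phi -> I{x, kf x * phi x} <= I{x, dotv (field x) (lgrad phi x)}.
Proof.
have [rr rr0 hloc] := local_divergence Hs_le H_lt tau0.
have rr2 : 0 < rr / 2 by lra.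
have [M M0 hM] := Omega_norm.
pose S := [set x | 2 * tau <= d0 x].
have [Ld Ld0 hLd] := dist0_lip.
have Sc : compact S.
 apply: bounded_closed_compact.
  exists M; split; [exact: num_real | move=> t Mt x /= /inner_Omega/hM xM]; exact: le_trans xM (ltW Mt).
 apply: (@closed_comp _ _ d0 [set t | 2 * tau <= t]); last exact: closed_ge.
 by move=> x _; exact: (lip_cont hLd).
move: Sc; rewrite compact_cover => /(_ _ S (fun c => ball c (rr / 2))) [c _|x Sx|D' D'S hcov].
- exact: ball_open.
- by exists x => //; exact: ballxx.
suff aux (cs : seq E) : (forall c, c \in cs -> S c) -> forall phi (L : R), 0 <= L -> lipfun phi L ->
  (forall x, 0 <= phi x) -> inner phi -> adiff phi ->
  (forall x, phi x != 0 -> exists2 c, c \in cs & `|x - c| <= rr / 2) ->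
  I{x, kf x * phi x} <= I{x, dotv (field x) (lgrad phi x)}.
 move=> L0 lp p0 ip dp; apply: (aux (finmap.enum_fset D') _ phi L L0 lp p0 ip dp _).
  by move=> c /D'S; rewrite inE.
 move=> x /ip Sx; have [c /= cD /ball_rowP h] := hcov x Sx; exists c => //; exact: ltW.
elim: cs => [|c cs IH] hS {}phi {}L L0 lp p0 ip dp hc.
 have z0 x : phi x = 0 by apply/eqP; apply: contraTT isT => /hc[].
 have hg x : hgrad phi x 0 by apply: (hgrad_near ltr01 _ (hgrad_cst 0 x)) => y _; rewrite z0.
 rewrite (_ : (fun x => kf x * phi x) = fun=> 0); last by apply/funext => x; rewrite z0 mulr0.
 rewrite (_ : (fun x => dotv (field x) (lgrad phi x)) = fun=> 0)//.
 by apply/funext => x; rewrite (hgrad_lgrad (hg x)) dotv0r.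
have Sc : S c by apply: hS; rewrite mem_head.
have tb := bump_tfun c rr0; have [Lb Lb0 hLb] := tfun_lip tb.
have pM x : M < `|x| -> phi x = 0 by exact: inner_supp.
have [C C0 hC] := lip_bounded L0 lp pM.
have bb x : `|cbump c rr x| <= 1 by rewrite ger0_norm ?bump_ge0 ?bump_le1.
have bb' x : `|1 - cbump c rr x| <= 1.
 by have h1 := bump_ge0 c rr x; have h2 := bump_le1 c rr x; rewrite ger0_norm; lra.
have lb' : lipfun (fun x => 1 - cbump c rr x) Lb.
 by move=> x y; rewrite opprB addrC addrA subrK distrC; exact: hLb.
(* [f1] lives in the ball of radius [rr] around [c]. [f2] vanishes where the bump is 1, hence is
   covered by the remaining centres. *)
pose f1 x := phi x * cbump c rr x; pose f2 x := phi x * (1 - cbump c rr x).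
have l1 : lipfun f1 (C * Lb + 1 * L) by exact: lipfunM lp hLb hC bb.
have l2 : lipfun f2 (C * Lb + 1 * L) by exact: lipfunM lp lb' hC bb'.
have CL : 0 <= C * Lb + 1 * L by posn.
have i1 : inner f1 by move=> x; rewrite mulf_eq0 negb_or => /andP[/ip].
have i2 : inner f2 by move=> x; rewrite mulf_eq0 negb_or => /andP[/ip].
have hsum : {ae mu, forall x, [/\ hgrad f1 x (lgrad f1 x), hgrad f2 x (lgrad f2 x) &
  lgrad phi x = lgrad f1 x + lgrad f2 x]}.
 apply: filterS dp => x hx.
 have g1 := hgradM hx (smooth_grad x tb.1).
 have g2 := hgradM hx (hgradB (hgrad_cst 1 x) (smooth_grad x tb.1)).
 rewrite (hgrad_lgrad g1) (hgrad_lgrad g2); split=> //.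
 have := hgradD g1 g2; rewrite (_ : (fun z => _) = phi); first by move=> /hgrad_lgrad.
 by apply/funext => z; ring.
have d1 : adiff f1 by apply: filterS hsum => x [].
have d2 : adiff f2 by apply: filterS hsum => x [].
have q1 x : 0 <= f1 x by rewrite mulr_ge0 ?bump_ge0.
have q2 x : 0 <= f2 x by rewrite mulr_ge0// subr_ge0 bump_le1.
have I1 : I{x, kf x * f1 x} <= I{x, dotv (field x) (lgrad f1 x)}.
 apply: (hloc c f1 _ (inner_Omega Sc) Sc CL l1 q1 _ d1) => x xr.
 by rewrite /f1 bump_out ?mulr0// ltW.
have I2 : I{x, kf x * f2 x} <= I{x, dotv (field x) (lgrad f2 x)}.
 apply: (IH _ f2 _ CL l2 q2 i2 d2) => [c' c'cs|x]; first by apply: hS; rewrite inE c'cs orbT.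
 rewrite /f2 mulf_eq0 negb_or subr_eq0 => /andP[/hc[c'] ]; rewrite inE => /orP[/eqP->|h1 h2 _].
  by move=> h1; rewrite bump_in// eqxx.
 by exists c'.
have b1 := ible_divergence CL l1 i1 d1; have b2 := ible_divergence CL l2 i2 d2.
have -> : (fun x => kf x * phi x) = (fun x => kf x * f1 x + kf x * f2 x).
 by apply/funext => x; rewrite /f1 /f2; ring.
rewrite intD; [|exact: ible_kfphi l1 i1|exact: ible_kfphi l2 i2].
have -> : I{x, dotv (field x) (lgrad phi x)} = I{x, dotv (field x) (lgrad f1 x) + dotv (field x) (lgrad f2 x)}.
 apply: int_ae_eq; [exact: ible_meas (ible_divergence L0 lp ip dp)|exact: ible_meas (ibleD b1 b2)|].
 by apply: filterS hsum => x [_ _ ->]; rewrite dotvDr.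
apply: le_trans (lerD I1 I2) _; have e := intD b1 b2; rewrite -e; exact: lexx.
Qed.

End divergence.
End main_inequality.

(** * The weighted inequality for test functions *)

Section test_inequality.
Notation d0 := dist0.
Implicit Types (x y z v p : E) (phi : E -> R).

Lemma dist0_le_r x : d0 x <= r.
Proof.
have [L L0 hL] := dist0_lip; have [M M0 hM] := Omega_norm.
have oM y : M < `|y| -> d0 y = 0.
 by move=> yM; apply: dist0_out => /hM; rewrite leNgt yM.
have [C C0 hC] := lip_bounded (ltW L0) hL oM.
have hub : has_ubound [set minkowski_dist K Omega x | x in Omega].
 by exists C => _ [y Oy <-]; rewrite -dist0_in// (le_trans (ler_norm _)).
have hle y : Omega y -> d0 y <= r.
 by move=> Oy; rewrite dist0_in//; apply: ub_le_sup => //; exists y.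
have [/hle//|Ox] := pselect (Omega x).
have [y Oy] := Omega0; rewrite (dist0_out Ox); exact: le_trans (d0_ge0 y) (hle y Oy).
Qed.

Definition rpos (g : E -> E) x := max (rho (g x) - 1) 0.

Lemma rpos_ge0 g x : 0 <= rpos g x.
Proof. by rewrite le_max lexx orbT. Qed.

Lemma rpos0 g x : g x = 0 -> rpos g x = 0.
Proof. by move=> gx; rewrite /rpos gx gauge0// max_r//; lra. Qed.

Lemma measurable_rpos (g : E -> E) : (forall i, mfun (fun x => g x$i)) -> mfun (rpos g).
Proof.
move=> mg; have [C _ hC] := gauge_lip.
apply: measurable_maxr; last exact: measurable_cst.
apply: measurable_funB; last exact: measurable_cst.
apply: (measurableT_comp (f := rho)); last exact: meas_row.
by apply: (lip_meas (L := C)) => x y; exact: hC.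
Qed.

Lemma ible_rpos (g : E -> E) : (forall i, ible (fun x => g x$i)) -> ible (rpos g).
Proof.
move=> ig; have [C C0 hC] := gauge_upper.
apply: (@ible_le _ _ _ (fun x => C * \sum_i `|g x$i|)).
- by apply: measurable_rpos => i; exact: ible_meas (ig i).
- by apply: ibleZ; apply: ible_sum => i; exact: ible_norm.
move=> x; rewrite ger0_norm ?rpos_ge0// ge_max mulr_ge0 ?(ltW C0) ?sumr_ge0// andbT.
have h1 : C * `|g x| <= C * \sum_i `|g x$i|.
 rewrite ler_wpM2l ?(ltW C0)//; apply: norm_le_coord => [|i]; first by rewrite sumr_ge0.
 by rewrite (bigD1 i)//= lerDl sumr_ge0.
by have := hC (g x); lra.
Qed.

Lemma rpos_lip : exists2 C : R, 0 < C & forall g g' x, `|rpos g x - rpos g' x| <= C * \sum_i `|g x$i - g' x$i|.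
Proof.
have [C C0 hC] := gauge_lip; exists C => // g g' x.
apply: le_trans (max0_lip _ _) _; rewrite opprB addrA subrK (le_trans (hC _ _))//.
rewrite ler_wpM2l ?(ltW C0)//; apply: norm_le_coord => [|i]; first by rewrite sumr_ge0.
by rewrite !mxE (bigD1 i)//= lerDl sumr_ge0.
Qed.

Lemma ible_dist0M (f : E -> R) : ible f -> ible (fun x => d0 x * f x).
Proof.
move=> hf; have [L _ hL] := dist0_lip.
have hb x : `|d0 x| <= r by rewrite ger0_norm// dist0_le_r.
have := ibleM_bdd hf (lip_meas hL) hb.
by congr ible; apply/funext => x; rewrite mulrC.
Qed.

Lemma test_inner phi : test_function Omega phi -> exists2 tau : R, 0 < tau & forall x, phi x != 0 -> 2 * tau <= d0 x.
Proof.
move=> [_ cp cl]; have [L L0 hL] := dist0_lip.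
have [h0|h0] := pselect (closure [set x | phi x != 0] !=set0); last first.
 by exists 1 => // x px; exfalso; apply: h0; exists x; exact: subset_closure.
have [c cS hc] := compact_argmin (f := d0) h0 cp (fun x _ => @lip_cont _ _ _ _ hL x).
have dc : 0 < d0 c by apply: dist0_gt0; exact: cl.
exists (d0 c / 2); first by lra.
move=> x px; have sx : closure [set x | phi x != 0] x by exact: subset_closure.
have := hc x sx; lra.
Qed.

Section fixed_curvature.
Variables (Hs H : R).
Hypotheses (Hs_le : Hs <= min_mean_rho_curvature K Omega) (H_lt : H < Hs) (H_neq0 : H != 0).
Notation kf := (kf H).
Let m := n.-1.
Let mn : n = m.+1. Proof. by rewrite /m prednK. Qed.
Let B := 1 - r * H.

Definition recip x : R := (1 - d0 x * H)^-1.
(* Solves [(n - 1) H / (1 - t H) * Phi - Phi' = 1] along [t = d0 x]. *)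
Definition weight x : R := (1 - d0 x * H - B ^+ n * recip x ^+ m) / (n%:R * H).

Lemma B_gt0 : 0 < B.
Proof.
have [k k0 hk] := one_sub_gt0 Hs_le H_lt.
have [x0 Ox0] := Omega0.
have r0 : 0 <= r by exact: le_trans (d0_ge0 x0) (dist0_le_r x0).
have [H0|H0] := leP H 0; first by have := mulr_ge0_le0 r0 H0; rewrite /B; lra.
apply: lt_le_trans k0 _; rewrite /B lerBrDl -lerBrDr -ler_pdivlMr//.
apply: ge_sup; first by exists (minkowski_dist K Omega x0); exists x0.
by move=> _ [x Ox <-]; rewrite -dist0_in// ler_pdivlMr//; have := hk x; lra.
Qed.

(** With [A = 1 - d0 x H], one has [A - B = H (r - d0 x)]. Factoring [A ^ n - B ^ n] cancels the
    sign of [H] in the lower bound; in the upper one the difference of the two sides is an explicit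
    nonnegative product. *)
Lemma weight_bounds x : 0 <= weight x <= cfun n H r - d0 x / n%:R.
Proof.
have [k k0 hk] := one_sub_gt0 Hs_le H_lt.
have A0 := lt_le_trans k0 (hk x); have B0 := B_gt0.
have w0 : 0 < recip x by rewrite invr_gt0.
rewrite /cfun (negbTE H_neq0) /weight.
set A := 1 - d0 x * H in A0 *; set w := recip x in w0 *.
have wA : w ^+ m * A ^+ m = 1 by rewrite -exprMn mulVf ?gt_eqF// expr1n.
have nH : n%:R * H != 0 by rewrite mulf_neq0// gt_eqF.
have AH : A - B = H * (r - d0 x) by rewrite /A /B; ring.
have e1 : A - B ^+ n * w ^+ m = w ^+ m * (A ^+ n - B ^+ n).
 by rewrite mulrBr {2}mn exprS mulrCA wA mulr1 [w ^+ m * _]mulrC.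
have S1 : 0 <= \sum_(i < n) A ^+ (n.-1 - i) * B ^+ i.
 by apply: sumr_ge0 => i _; rewrite mulr_ge0// exprn_ge0// ltW.
have S2 : 0 <= \sum_(i < m) A ^+ i by apply: sumr_ge0 => i _; rewrite exprn_ge0// ltW.
apply/andP; split.
 rewrite e1 subrXX AH.
 have -> : w ^+ m * (H * (r - d0 x) * \sum_(i < n) A ^+ (n.-1 - i) * B ^+ i) / (n%:R * H) =
  w ^+ m * ((r - d0 x) * \sum_(i < n) A ^+ (n.-1 - i) * B ^+ i) / n%:R.
  by field; posn.
 by rewrite divr_ge0 ?(ltW nr0)// mulr_ge0 ?exprn_ge0 ?(ltW w0)// mulr_ge0// subr_ge0 dist0_le_r.
rewrite -subr_ge0; have e2 : A ^+ m - 1 = - (d0 x * H) * \sum_(i < m) A ^+ i.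
 by rewrite subrX1 /A; congr (_ * _); ring.
have -> : (1 - (1 - H * r) ^+ n) / (n%:R * H) - d0 x / n%:R - (A - B ^+ n * w ^+ m) / (n%:R * H) =
  B ^+ n * (w ^+ m * (d0 x * \sum_(i < m) A ^+ i)) / n%:R.
 have -> : 1 - H * r = B by rewrite /B; ring.
 have e3 : w ^+ m = 1 + w ^+ m * (d0 x * H * \sum_(i < m) A ^+ i).
  by rewrite -[X in X + _]wA -mulrDr; move: e2; rewrite mulNr => e2; rewrite -[d0 x * H * _]opprK -e2; ring.
 by rewrite [X in _ - (_ - _ * X) / _]e3 /A; field; posn.
rewrite divr_ge0 ?(ltW nr0)// mulr_ge0 ?exprn_ge0 ?(ltW B0)// mulr_ge0 ?exprn_ge0 ?(ltW w0)//.
by posn.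
Qed.

Lemma hgrad_weight x p : hgrad d0 x p -> exists2 l, hgrad weight x (l *: p) & kf x * weight x - l = 1.
Proof.
move=> hd; have [k k0 hk] := one_sub_gt0 Hs_le H_lt.
have A0 := lt_le_trans k0 (hk x).
have hA : hgrad (fun z => 1 - d0 z * H) x (- (H *: p)).
 have h := hgradB (hgrad_cst 1 x) (hgradZ H hd); rewrite sub0r in h.
 by apply: (hgrad_near ltr01 _ h) => z _; rewrite mulrC.
have hw := hgrad_pow m (hgradV (lt0r_neq0 A0) hA).
have h := hgradZ (n%:R * H)^-1 (hgradB hA (hgradZ (B ^+ n) hw)).
exists ((n%:R * H)^-1 * (- H - B ^+ n * (m%:R * recip x ^+ m.-1 * (recip x ^+ 2 * H)))).
 have -> : ((n%:R * H)^-1 * (- H - B ^+ n * (m%:R * recip x ^+ m.-1 * (recip x ^+ 2 * H)))) *: p =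
  (n%:R * H)^-1 *: (- (H *: p) - B ^+ n *: ((m%:R * (1 - d0 x * H)^-1 ^+ m.-1) *: (- (1 - d0 x * H) ^- 2 *: - (H *: p)))).
  rewrite -/(recip x) -exprVn -/(recip x).
  by apply/rowP => i; rewrite !mxE; ring.
 by apply: (hgrad_near ltr01 _ h) => z _; rewrite /weight [RHS]mulrC.
rewrite /kf /weight; have wA : (1 - d0 x * H) = (recip x)^-1 by rewrite /recip invrK.
have w0 : recip x != 0 by rewrite invr_eq0 gt_eqF.
have m0 : (0 < m)%N by rewrite /m -ltnS prednK.
have eN : n%:R = m%:R + 1 :> R by rewrite {1}mn -natr1.
have N0 : m%:R + 1 != 0 :> R by posn.
have eX : recip x ^+ m = recip x * recip x ^+ m.-1 by rewrite -exprS prednK.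
rewrite eX wA invrK eN -/m; set X := recip x ^+ m.-1; set Y := B ^+ n.
by field; posn.
Qed.

Lemma weight_lip : exists2 L : R, 0 <= L & lipfun weight L.
Proof.
have [k k0 hk] := one_sub_gt0 Hs_le H_lt.
have [L L0 hL] := dist0_lip.
have lA : lipfun (fun x => 1 - d0 x * H) (`|H| * L).
 move=> x y; have -> : 1 - d0 x * H - (1 - d0 y * H) = H * (d0 y - d0 x) by ring.
 by rewrite normrM -mulrA ler_wpM2l// distrC hL.
have A0 x := lt_le_trans k0 (hk x).
have wb x : `|recip x| <= k^-1.
 by rewrite normfV gtr0_norm// lef_pV2 ?posrE.
have lw : lipfun recip (k^-1 * k^-1 * (`|H| * L)).
 move=> x y; have -> : recip x - recip y = recip x * recip y * ((1 - d0 y * H) - (1 - d0 x * H)).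
  by rewrite /recip; field; posn.
 have h1 : `|recip x * recip y| <= k^-1 * k^-1 by rewrite normrM ler_pM.
 rewrite [leLHS]normrM; apply: le_trans (ler_pM _ _ h1 (lA y x)) _ => //.
 by rewrite (distrC y) !mulrA.
have HL : 0 <= `|H| * L by posn.
have ki : 0 <= k^-1 by posn.
have [L1 L10 hL1] := lipfunX m (mulr_ge0 (mulr_ge0 ki ki) HL) ki lw wb.
exists (`|(n%:R * H)^-1| * (`|H| * L + `|B ^+ n| * L1)); first by posn.
move=> x y; have -> : weight x - weight y = (n%:R * H)^-1 * ((1 - d0 x * H - (1 - d0 y * H)) -
  B ^+ n * (recip x ^+ m - recip y ^+ m)) by rewrite /weight; ring.
rewrite normrM -mulrA ler_wpM2l// (le_trans (ler_normB _ _))// mulrDl lerD ?lA//.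
by rewrite normrM -mulrA ler_wpM2l.
Qed.

(** The divergence inequality is tested with [weight * spos (phi - d0)]. The equation for [weight]
    isolates [spos] itself, and the smoothed positive part keeps the test function differentiable
    almost everywhere. *)
Lemma spos_inequality phi (sig : R) : test_function Omega phi -> 0 < sig -> I{x, spos sig (phi x - d0 x)} <=
 I{x, (cfun n H r - d0 x / n%:R) * rpos (grad phi) x}.
Proof.
move=> tp sig0; have tf := test_tfun tp.
have [Lp Lp0 hLp] := tfun_lip tf; have [Ld Ld0 hLd] := dist0_lip.
have [Lw Lw0 hLw] := weight_lip; have [M M0 hM] := Omega_norm.
have [C C0 hC] := tfun_bounded tf; have [tau tau0 hin] := test_inner tp.
have ig i : ible (fun x => grad phi x$i).
 by have := tfun_ible (tfun_partial i tf); congr ible; apply/funext => x; rewrite gradE.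
have iR := ible_rpos ig.
pose s x := spos sig (phi x - d0 x).
have ls : lipfun s (Lp + Ld).
 move=> x y; apply: le_trans (spos_lip _ _ sig0) _.
 have -> : phi x - d0 x - (phi y - d0 y) = (phi x - phi y) - (d0 x - d0 y) by ring.
 by rewrite (le_trans (ler_normB _ _))// mulrDl lerD.
have s_le x : 0 <= s x <= C.
 rewrite spos_ge0//=; have /andP[_ h] := spos_bounds (phi x - d0 x) sig0; apply: le_trans h _.
 rewrite ge_max (ltW C0) andbT; have := le_trans (ler_norm _) (hC x); have := d0_ge0 x; lra.
have s_out x : phi x = 0 -> s x = 0.
 by move=> px; rewrite /s px spos_neg// sub0r oppr_le0.
have sC x : `|s x| <= C by have /andP[h1 h2] := s_le x; rewrite ger0_norm.
pose Cw := `|cfun n H r|.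
have wC x : `|weight x| <= Cw.
 have /andP[h1 h2] := weight_bounds x; rewrite ger0_norm// (le_trans h2)// (le_trans _ (ler_norm _))//.
 by rewrite gerBl divr_ge0.
pose f x := weight x * s x.
have lf : lipfun f (Cw * (Lp + Ld) + C * Lw) by exact: lipfunM hLw ls wC sC.
have L0 : 0 <= Cw * (Lp + Ld) + C * Lw by apply: addr_ge0; apply: mulr_ge0; rewrite ?normr_ge0 ?(ltW C0)// addr_ge0// ltW.
have f0 x : 0 <= f x.
 by have /andP[h1 _] := s_le x; have /andP[h2 _] := weight_bounds x; rewrite mulr_ge0.
have fin : inner tau f.
 by move=> x fx; apply: hin; apply: contra fx => /eqP px; rewrite /f s_out// mulr0.
have hf : {ae mu, forall x, hgrad f x (lgrad f x) /\
  s x - weight x * rpos (grad phi) x <= kf x * f x - dotv (field x) (lgrad f x)}.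
 apply: filterS dist0_hgrad => x hd.
 have [Ox|Ox] := pselect (Omega x); last first.
  have h : hgrad f x 0.
   by apply: (inner_out fin); rewrite (dist0_out Ox) mulr_gt0.
  have px := test_out0 tp Ox; rewrite (hgrad_lgrad h) dotv0r /f s_out// !mulr0.
  by rewrite rpos0 ?mulr0 ?subr0// (hgrad_grad (test_hgrad0 tp Ox)).
 have [p rp hp] := hd Ox; have [l hl el] := hgrad_weight hp.
 have hs := hgradB (smooth_grad x tf.1) hp.
 have [l1 /andP[l10 l11] hl1] := hgrad_spos sig0 hs.
 have h := hgradM hl hl1; rewrite (hgrad_lgrad h); split=> //.
 rewrite (field_eq rp hp) dotvDr !dotvZr dotvBr.
 rewrite (gauge_euler (nz rp)) rp -/(s x).
 have g1 := ggrad_le (grad phi x) (nz rp).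
 have /andP[w1 _] := weight_bounds x; have /andP[s1 _] := s_le x.
 have rp1 : rho (grad phi x) - 1 <= rpos (grad phi) x by rewrite le_max lexx.
 (* Euler's identity gives [b(Dd) . Dd = 1], and [b(Dd) . D phi] is at most the gauge of [D phi]. *)
 have h3 : l1 * (dotv (b p) (grad phi x) - 1) <= rpos (grad phi) x.
  apply: (@le_trans _ _ (l1 * rpos (grad phi) x)); first by rewrite ler_wpM2l//; lra.
  by rewrite ler_piMl// rpos_ge0.
 have h4 := ler_wpM2l w1 h3.
 have -> : kf x * f x = s x + s x * l.
  rewrite /f; have -> : kf x * (weight x * s x) = (kf x * weight x) * s x by ring.
  by have -> : kf x * weight x = 1 + l by [lra]; ring.
 by rewrite !mulr1; lra.
have af : adiff f by apply: filterS hf => x [].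
have hdiv := divergence_inequality Hs_le H_lt tau0 L0 lf f0 fin af.
have i1 := ible_kfphi Hs_le H_lt tau0 lf fin.
have i2 := ible_divergence tau0 L0 lf fin af.
have i3 : ible s.
 apply: (lip_ible ls (M := M)) => x xM; apply: s_out; apply: (test_out0 tp) => /hM.
 by rewrite leNgt xM.
have i4 : ible (fun x => weight x * rpos (grad phi) x).
 have := ibleM_bdd iR (lip_meas hLw) wC; congr ible; apply/funext => x.
 by rewrite mulrC.
have i5 : ible (fun x => (cfun n H r - d0 x / n%:R) * rpos (grad phi) x).
 have := ibleB (ibleZ (cfun n H r) iR) (ibleZ n%:R^-1 (ible_dist0M iR)).
 by congr ible; apply/funext => x; ring.
have h1 : intg s - I{x, weight x * rpos (grad phi) x} <= I{x, kf x * f x} - I{x, dotv (field x) (lgrad f x)}.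
 rewrite -(intB i3 i4) -(intB i1 i2); apply: int_ae_le (ibleB i3 i4) (ibleB i1 i2) _.
 by apply: filterS hf => x [].
have h2 : I{x, weight x * rpos (grad phi) x} <= I{x, (cfun n H r - d0 x / n%:R) * rpos (grad phi) x}.
 apply: int_le i4 i5 _ => x; have /andP[_ h] := weight_bounds x.
 by rewrite ler_wpM2r// rpos_ge0.
by rewrite -/s; lra.
Qed.

End fixed_curvature.
End test_inequality.

(** * Passage to Sobolev functions *)

Section sobolev_inequality.
Notation d0 := dist0.
Implicit Types (x y z v p : E) (phi : E -> R).

(** The polynomial form removes the case distinction at [t = 0], and with it any discontinuity
    there. *)
Lemma cfun_sum (t s : R) : cfun n t s = s / n%:R * \sum_(k < n) (1 - t * s) ^+ k.
Proof.
rewrite /cfun; case: eqVneq => [->|t0].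
 under eq_bigr do rewrite mul0r subr0 expr1n.
 by rewrite sumr_const card_ord divfK// gt_eqF.
have -> : 1 - (1 - t * s) ^+ n = t * s * \sum_(k < n) (1 - t * s) ^+ k.
 by rewrite -opprB subrX1; ring.
by field; posn.
Qed.

Lemma cfun_near (s a e : R) : 0 < e -> exists2 dl : R, 0 < dl & forall t, `|t - a| < dl ->
 `|cfun n t s - cfun n a s| <= e.
Proof.
move=> e0; pose p : {poly R} := (s / n%:R)%:P * \sum_(k < n) (1 - s *: 'X) ^+ k.
have hp t : cfun n t s = p.[t].
 rewrite cfun_sum /p hornerM hornerC horner_sum; congr (_ * _); apply: eq_bigr => k _.
 by rewrite horner_exp !hornerE mulrC.
have /cvgrPdist_le/(_ _ e0) := @continuous_horner R p a.
move=> /nbhs_ballP[dl /= dl0 h]; exists dl => // t ta; rewrite !hp distrC; apply: h.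
by rewrite /ball/= distrC.
Qed.

Lemma ible_grad_test phi i : test_function Omega phi -> ible (fun x => grad phi x$i).
Proof.
move=> /test_tfun tf; have := tfun_ible (tfun_partial i tf); congr ible.
by apply/funext => x; rewrite gradE.
Qed.

Lemma ible_pos (f : E -> R) : ible f -> ible (fun x => max (f x) 0).
Proof.
move=> hf; apply: (ible_le _ (ible_norm hf)).
 by apply: measurable_maxr; [exact: ible_meas hf|exact: measurable_cst].
by move=> x; rewrite ger0_norm ?le_max ?lexx ?orbT// ge_max ler_norm normr_ge0.
Qed.

Lemma ible_d0 : ible d0.
Proof.
have [L L0 hL] := dist0_lip; have [M M0 hM] := Omega_norm.
by apply: (lip_ible hL (M := M)) => y yM; apply: dist0_out => /hM; rewrite leNgt yM.
Qed.

Variable Hst : R.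
Hypothesis Hst_le : Hst <= min_mean_rho_curvature K Omega.
Notation cst := (cfun n Hst r).

(** Limit of [spos_inequality] as the smoothing vanishes and [H] increases to [Hst]. The values [H]
    avoid 0, by which [weight] divides; two candidates suffice, as at most one of them vanishes. *)
Lemma test_inequality phi : test_function Omega phi -> I{x, max (phi x - d0 x) 0} <=
 cst * intg (rpos (grad phi)) - n%:R^-1 * I{x, d0 x * rpos (grad phi) x}.
Proof.
move=> tp; have [M M0 hM] := Omega_norm.
have iR := ible_rpos (fun i => ible_grad_test i tp).
have iP := tfun_ible (test_tfun tp).
have [g ig [gC g0]] := @ball_cutoff R n 1 M.
have I0 : 0 <= intg (rpos (grad phi)) by apply: int_ge0 => x; exact: rpos_ge0.
have g_ge0 x : 0 <= g x by have [/gC ->|/g0 ->] := leP `|x| M.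
have J0 : 0 <= intg g by exact: int_ge0.
apply/ler_addgt0Pr => e e0.
have I1 : 0 < 2 * (intg (rpos (grad phi)) + 1) by posn.
have J1 : 0 < 2 * (intg g + 1) by posn.
have e1 : 0 < e / (2 * (intg (rpos (grad phi)) + 1)) by posn.
have s0 : 0 < e / (2 * (intg g + 1)) by posn.
have [dl dl0 hdl] := cfun_near r Hst e1.
have [H [H1 H2 H3]] : exists H, [/\ H < Hst, H != 0 & `|H - Hst| < dl].
 have [h|h] := eqVneq (Hst - dl / 2) 0.
  exists (Hst - dl / 3); split; [lra | apply/eqP; lra |].
  by rewrite addrAC subrr add0r normrN gtr0_norm; lra.
 by exists (Hst - dl / 2); split=> //; [lra | rewrite addrAC subrr add0r normrN gtr0_norm; lra].
have := spos_inequality Hst_le H1 H2 tp s0.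
set sg := e / (2 * (intg g + 1)) in s0 *.
have -> : (fun x => (cfun n H r - d0 x / n%:R) * rpos (grad phi) x) =
  (fun x => cfun n H r * rpos (grad phi) x - n%:R^-1 * (d0 x * rpos (grad phi) x)).
 by apply/funext => x; ring.
rewrite (intB (ibleZ _ iR) (ibleZ _ (ible_dist0M iR))).
rewrite (intZ _ iR) (intZ _ (ible_dist0M iR)) => h1.
have iD := ible_pos (ibleB iP ible_d0).
have iS : ible (fun x => spos sg (phi x - d0 x)).
 apply: (ible_le _ iD).
  have [L L0 hL] := dist0_lip.
  have [Lp Lp0 hLp] := tfun_lip (test_tfun tp).
  apply: (lip_meas (L := Lp + L)) => x y; apply: le_trans (spos_lip _ _ s0) _.
  have -> : phi x - d0 x - (phi y - d0 y) = (phi x - phi y) - (d0 x - d0 y) by ring.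
  by rewrite (le_trans (ler_normB _ _))// mulrDl lerD.
 by move=> x; rewrite ger0_norm ?spos_ge0//; have /andP[] := spos_bounds (phi x - d0 x) s0.
have h2 : I{x, max (phi x - d0 x) 0} <= I{x, spos sg (phi x - d0 x)} + sg * intg g.
 rewrite -(intZ _ ig) -(intD iS (ibleZ _ ig)); apply: int_le iD (ibleD iS (ibleZ _ ig)) _ => x.
 have /andP[h _] := spos_bounds (phi x - d0 x) s0.
 have [xM|xM] := leP `|x| M; first by rewrite (gC _ xM); lra.
 have Ox : ~ Omega x by move=> /hM; rewrite leNgt xM.
 by rewrite (g0 _ xM) (test_out0 tp Ox) (dist0_out Ox) subrr spos_neg// max_r// mulr0 addr0.
have h3 : (cfun n H r - cst) * intg (rpos (grad phi)) <= e / 2.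
 apply: (@le_trans _ _ (e / (2 * (intg (rpos (grad phi)) + 1)) * intg (rpos (grad phi)))).
  by rewrite ler_wpM2r// (le_trans (ler_norm _))// hdl.
 rewrite mulrAC ler_pdivrMr//; have := ltW e0; nra.
have h4 : sg * intg g <= e / 2.
 by rewrite /sg mulrAC ler_pdivrMr//; have := ltW e0; nra.
move: h3; rewrite mulrBl; lra.
Qed.

Lemma int_pos_ae (f : E -> R) : ible (fun x => max (f x) 0) -> I{x, max (f x) 0} <= 0 -> {ae mu, forall x, f x <= 0}.
Proof.
move=> i0 h; have := int_eq0_ae i0 _ h; move=> /(_ (aeW _ _)) ae0.
have {}ae0 : {ae mu, forall x, max (f x) 0 = 0} by apply: ae0 => x; rewrite le_max lexx orbT.
by apply: filterS ae0 => x <-; rewrite le_max lexx.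
Qed.

Lemma rpos_near (g g' : E -> E) : (forall i, ible (fun x => g x$i)) -> (forall i, ible (fun x => g' x$i)) ->
 ible (fun x => \sum_i `|g x$i - g' x$i|).
Proof. by move=> h h'; apply: ible_sum => i; apply: ible_norm; exact: ibleB. Qed.

Lemma rpos_int_near (g g' : E -> E) (C : R) : 0 < C ->
 (forall x, `|rpos g x - rpos g' x| <= C * \sum_i `|g x$i - g' x$i|) ->
 (forall i, ible (fun x => g x$i)) -> (forall i, ible (fun x => g' x$i)) ->
 `|intg (rpos g) - intg (rpos g')| <= C * I{x, \sum_i `|g x$i - g' x$i|}.
Proof.
move=> C0 hC ig ig'; have iR := ibleB (ible_rpos ig) (ible_rpos ig'); have iN := rpos_near ig ig'.
rewrite -intB; [|exact: ible_rpos..]; rewrite (le_trans (int_norm iR))// -(intZ _ iN).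
by apply: int_le (ible_norm iR) (ibleZ _ iN) _.
Qed.

(** Violation of the Lipschitz bound for [rho0] in the direction [v]; it is an integrable quantity,
    stable under convergence in mean. *)
Definition shift_excess v (f : E -> R) x := max (f (x + v) - f x - rho0 v) 0.

Lemma ible_shift_excess v f : ible f -> ible (shift_excess v f).
Proof.
move=> jf; have is1 := ible_shift v jf.
apply: (ible_le _ (ibleD (ible_norm is1) (ible_norm jf))).
 apply: measurable_maxr; last exact: measurable_cst.
 by apply: measurable_funB; [exact: ible_meas (ibleB is1 jf)|exact: measurable_cst].
move=> x; rewrite ger0_norm ?le_max ?lexx ?orbT// ge_max addr_ge0// andbT.
by have := ler_norm (f (x + v)); have := ler_norm (- f x); have := polar_ge0 v; rewrite normrN; lra.
Qed.

(** [v] is cut into [N + 1] equal steps. On each the increment is at most [rho0] of the step times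
    the gauge of the gradient, up to a quadratic error; translation invariance adds up the steps. *)
Lemma shift_test phi v : test_function Omega phi -> intg (shift_excess v phi) <= rho0 v * intg (rpos (grad phi)).
Proof.
move=> tp; have tf := test_tfun tp; have [M M0 hM] := Omega_norm.
have iR := ible_rpos (fun i => ible_grad_test i tp); have iP := tfun_ible tf.
have [C C0 hC] := tfun_taylor tf.
have [g ig [gC g0]] := @ball_cutoff R n 1 (M + `|v|).
have g_ge0 x : 0 <= g x by have [/gC ->|/g0 ->] := leP `|x| (M + `|v|).
have J0 : 0 <= intg g by exact: int_ge0.
have v0 := polar_ge0 v.
apply/ler_addgt0Pr => e e0.
have Q0 : 0 <= C * `|v| ^+ 2 * intg g by posn.
have Q1 : 0 < C * `|v| ^+ 2 * intg g + 1 by posn.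
have e1 : 0 < e / (C * `|v| ^+ 2 * intg g + 1) by posn.
have [N /(_ N (leqnn N)) hN] := step_small e1.
have s0 := @step_gt0 R N; pose w := step N *: v.
have Nw : N.+1%:R *: w = v by rewrite scalerA /step mulfV ?scale1r// pnatr_eq0.
have hx x : phi (x + v) - phi x - rho0 v <=
  rho0 v * step N * \sum_(j < N.+1) rpos (grad phi) (x + j%:R *: w) + C * `|v| ^+ 2 * step N.
 have -> : phi (x + v) - phi x = \sum_(j < N.+1) (phi (x + j.+1%:R *: w) - phi (x + j%:R *: w)).
  by rewrite -(big_mkord xpredT (fun j => phi (x + j.+1%:R *: w) - phi (x + j%:R *: w)))
   telescope_sumr// Nw scale0r addr0.
 have rv : rho0 v = \sum_(j < N.+1) rho0 v * step N.
  by rewrite sumr_const card_ord -mulr_natr -mulrA /step mulVf ?mulr1// pnatr_eq0.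
 have cv : C * `|v| ^+ 2 * step N = \sum_(j < N.+1) C * `|w| ^+ 2.
  rewrite sumr_const card_ord -mulr_natr /w normrZ (gtr0_norm s0) /step exprMn; field.
  by posn.
 rewrite {1}rv cv mulr_sumr -sumrB -big_split/=; apply: ler_sum => j _.
 have := hC (x + j%:R *: w) w.
 have -> : x + j%:R *: w + w = x + j.+1%:R *: w by rewrite -addrA -natr1 scalerDl scale1r.
 move=> h1; have h2 := dotv_gauge (grad phi (x + j%:R *: w)) w.
 have h3 : rho0 w = rho0 v * step N by rewrite /w polarZ ?(ltW s0)// mulrC.
 have h4 : rho (grad phi (x + j%:R *: w)) * rho0 w <= (rpos (grad phi) (x + j%:R *: w) + 1) * rho0 w.
  by rewrite ler_wpM2r ?polar_ge0// -lerBlDr le_max lexx.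
 rewrite h3 mulrDl mul1r in h4; rewrite h3 in h2; have h5 := le_trans (ler_norm _) h1.
 rewrite [rho0 v * step N * _]mulrC; lra.
have iL := ible_shift_excess v iP.
have iS : ible (fun x => \sum_(j < N.+1) rpos (grad phi) (x + j%:R *: w)).
 by apply: ible_sum => j; exact: ible_shift iR.
have iT := ibleD (ibleZ (rho0 v * step N) iS) (ibleZ (C * `|v| ^+ 2 * step N) ig).
have h1 : intg (shift_excess v phi) <=
  I{x, rho0 v * step N * \sum_(j < N.+1) rpos (grad phi) (x + j%:R *: w) + C * `|v| ^+ 2 * step N * g x}.
 apply: int_le iL iT _ => x; rewrite /shift_excess.
 have S0 : 0 <= rho0 v * step N * \sum_(j < N.+1) rpos (grad phi) (x + j%:R *: w).
  rewrite mulr_ge0 ?mulr_ge0 ?(ltW s0)// sumr_ge0// => j _; exact: rpos_ge0.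
 have C2 : 0 <= C * `|v| ^+ 2 * step N by posn.
 have [xM|xM] := leP `|x| (M + `|v|).
  by rewrite (gC _ xM) mulr1 ge_max hx addr_ge0.
 have O1 : ~ Omega x by move=> /hM; have := normr_ge0 v; lra.
 have O2 : ~ Omega (x + v).
  by move=> /hM; have := ler_normB (x + v) v; rewrite addrK; lra.
 by rewrite (g0 _ xM) (test_out0 tp O1) (test_out0 tp O2) subrr sub0r max_r ?oppr_le0// mulr0 addr0.
apply: le_trans h1 _; rewrite (intD (ibleZ _ iS) (ibleZ _ ig)) (intZ _ iS) (intZ _ ig) int_sum; last first.
 by move=> j; exact: ible_shift iR.
under eq_bigr => j _ do rewrite (int_shift (j%:R *: w) iR).
rewrite sumr_const card_ord -mulr_natr.
have -> : rho0 v * step N * (intg (rpos (grad phi)) * N.+1%:R) = rho0 v * intg (rpos (grad phi)).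
 by rewrite /step; field; posn.
rewrite lerD2l mulrAC mulrC; move: hN; rewrite ltr_pdivlMr// mulrDr mulr1 => hN.
by have := ltW s0; lra.
Qed.

Lemma ext0_restrict (f : E -> R) : f \_ Omega = ext0 f.
Proof.
apply/funext => x; rewrite patchE; have [h|h] := pselect (Omega x).
 by posn.
by posn.
Qed.

Lemma W11_0_seq u : W11_0 Omega u -> [/\ ible (ext0 u), forall i, ible (fun x => ext0 (weak_grad Omega u) x$i) &
  exists phi : nat -> E -> R, (forall k, test_function Omega (phi k)) /\
  forall e : R, 0 < e -> exists k, I{x, `|phi k x - ext0 u x|} <= e /\
   I{x, \sum_i `|grad (phi k) x$i - ext0 (weak_grad Omega u) x$i|} <= e].
Proof.
move=> [[g0 hg] [phi [tp hcv]]]; have [iu ig _] := is_weak_grad_get hg.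
have iu' : ible (ext0 u) by rewrite -ext0_restrict; exact/(ible_restrict _ mO).
have coordE i : (fun x => ext0 (weak_grad Omega u) x$i) = (fun x => weak_grad Omega u x$i) \_ Omega.
 rewrite ext0_restrict; apply/funext => x; rewrite /ext0; case: ifP => // _; by rewrite mxE.
have ig' i : ible (fun x => ext0 (weak_grad Omega u) x$i).
 by rewrite coordE; apply/(ible_restrict _ mO); exact: ig.
split=> //; exists phi; split=> //.
have i1 k : ible (fun x => `|phi k x - ext0 u x|).
 exact/ible_norm/ibleB/iu'/tfun_ible/test_tfun.
have i2 k i : ible (fun x => `|grad (phi k) x$i - ext0 (weak_grad Omega u) x$i|).
 by apply: ible_norm; apply: ibleB => //; exact: ible_grad_test.
pose a k := I{x, `|phi k x - ext0 u x|} + \sum_i I{x, `|grad (phi k) x$i - ext0 (weak_grad Omega u) x$i|}.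
have aE : (fun k => \int[mu]_(x in Omega) `|phi k x - u x|%:E + \sum_(i < n) \int[mu]_(x in Omega)
    `|partial i (phi k) x - weak_grad Omega u x$i|%:E)%E = (fun k => (a k)%:E).
 apply/funext => k; rewrite /a EFinD -sumEFin; congr (_ + _)%E.
  rewrite -(int_on (Omega := Omega) (i1 k)); last first.
   by move=> x Ox; rewrite ext0_out// (test_out0 (tp k) Ox) subrr normr0.
  by apply: eq_integral => x; rewrite inE => Ox; rewrite ext0_in.
 apply: eq_bigr => i _; rewrite -(int_on (Omega := Omega) (i2 k i)); last first.
  move=> x Ox; rewrite ext0_out// (hgrad_grad (test_hgrad0 (tp k) Ox)) subrr normr0//.
 by apply: eq_integral => x; rewrite inE => Ox; rewrite ext0_in// gradE.
rewrite aE in hcv; move/fine_cvgP : hcv => [_ /cvg_seqP hcv] e e0.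
have [N /(_ N (leqnn N))] := hcv e e0; rewrite subr0 /= => hN; exists N.
have a1 : 0 <= I{x, `|phi N x - ext0 u x|} by exact: int_ge0.
have a2 : 0 <= \sum_i I{x, `|grad (phi N) x$i - ext0 (weak_grad Omega u) x$i|}.
 by apply: sumr_ge0 => i _; exact: int_ge0.
by rewrite int_sum//; have := le_trans (ler_norm _) hN; rewrite /a; split; lra.
Qed.

Section function.
Variable u : E -> R.
Hypothesis hu : W11_0 Omega u.
Notation uu := (ext0 u).
Notation G := (ext0 (weak_grad Omega u)).

(** Both sides are Lipschitz for the Sobolev norm; [k0] collects their constants. *)
Lemma sobolev_inequality : I{x, max (uu x - d0 x) 0} <= cst * intg (rpos G) - n%:R^-1 * I{x, d0 x * rpos G x}.
Proof.
have [iu iG [phi [tp hphi]]] := W11_0_seq hu; have iR := ible_rpos iG.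
have [C C0 hC] := rpos_lip.
have r0 : 0 <= r by exact: le_trans (d0_ge0 0) (dist0_le_r 0).
pose k0 := 1 + (`|cst| + n%:R^-1 * r) * C.
have k00 : 0 < k0 by rewrite ltr_pwDl// !mulr_ge0 ?addr_ge0 ?mulr_ge0 ?invr_ge0 ?(ltW C0).
apply/ler_addgt0Pr => e e0; have ek : 0 < e / k0 by posn.
have [k [h1 h2]] := hphi _ ek; have hk := test_inequality (tp k).
have ip i := ible_grad_test i (tp k).
have iRk := ible_rpos ip; have iN := rpos_near ip iG.
have iP := tfun_ible (test_tfun (tp k)).
have a1 : I{x, max (uu x - d0 x) 0} <= I{x, max (phi k x - d0 x) 0} + I{x, `|phi k x - uu x|}.
 have j1 := ible_pos (ibleB iP ible_d0); have j2 := ible_norm (ibleB iP iu).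
 rewrite -(intD j1 j2); apply: int_le (ible_pos (ibleB iu ible_d0)) (ibleD j1 j2) _ => x.
 have := max0_lip (uu x - d0 x) (phi k x - d0 x).
 have -> : uu x - d0 x - (phi k x - d0 x) = uu x - phi k x by ring.
 by rewrite (distrC (uu x)); have := ler_norm (max (uu x - d0 x) 0 - max (phi k x - d0 x) 0); lra.
have i3 : ible (fun x => C * \sum_i `|grad (phi k) x$i - G x$i|) by exact: ibleZ.
have a2 : `|intg (rpos (grad (phi k))) - intg (rpos G)| <= C * (e / k0).
 by apply: le_trans (rpos_int_near C0 (hC _ _) ip iG) _; rewrite ler_wpM2l// ltW.
have a3 : `|I{x, d0 x * rpos (grad (phi k)) x} - I{x, d0 x * rpos G x}| <= r * (C * (e / k0)).
 have j1 := ible_dist0M iRk; have j2 := ible_dist0M iR.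
 rewrite -(intB j1 j2) (le_trans (int_norm (ibleB j1 j2)))//.
 apply: (@le_trans _ _ (I{x, r * (C * \sum_i `|grad (phi k) x$i - G x$i|)})).
  apply: int_le (ible_norm (ibleB j1 j2)) (ibleZ r i3) _ => x.
  rewrite -mulrBr normrM ger0_norm// ler_pM//; exact: dist0_le_r.
 by rewrite (intZ _ i3) (intZ _ iN) ler_wpM2l// ler_wpM2l// ltW.
have a4 : cst * intg (rpos (grad (phi k))) <= cst * intg (rpos G) + `|cst| * (C * (e / k0)).
 rewrite -lerBlDl -mulrBr (le_trans (ler_norm _))// normrM ler_wpM2l//.
have a5 : - (n%:R^-1 * I{x, d0 x * rpos (grad (phi k)) x}) <=
  - (n%:R^-1 * I{x, d0 x * rpos G x}) + n%:R^-1 * (r * (C * (e / k0))).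
 rewrite -lerBlDl opprK addrC -mulrBr ler_wpM2l ?invr_ge0// (le_trans (ler_norm _))// distrC//.
have ek' : e = e / k0 + `|cst| * (C * (e / k0)) + n%:R^-1 * (r * (C * (e / k0))).
 transitivity (e / k0 * k0); first by rewrite divfK// gt_eqF.
 by rewrite {2}/k0; ring.
lra.
Qed.

Lemma shift_inequality v : intg (shift_excess v uu) <= rho0 v * intg (rpos G).
Proof.
have [iu iG [phi [tp hphi]]] := W11_0_seq hu; have iR := ible_rpos iG.
have [C C0 hC] := rpos_lip; have v0 := polar_ge0 v.
pose k0 := 2 + rho0 v * C.
have k00 : 0 < k0 by rewrite ltr_pwDl// mulr_ge0// ltW.
apply/ler_addgt0Pr => e e0; have ek : 0 < e / k0 by posn.
have [k [h1 h2]] := hphi _ ek; have hk := shift_test v (tp k).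
have ip i := ible_grad_test i (tp k).
have iRk := ible_rpos ip; have iN := rpos_near ip iG.
have iP := tfun_ible (test_tfun (tp k)).
have ish := ible_shift_excess v.
have j2 := ible_norm (ibleB iP iu); have j3 := ible_shift v j2.
have a1 : intg (shift_excess v uu) <= intg (shift_excess v (phi k)) + 2 * (e / k0).
 apply: (@le_trans _ _ (intg (shift_excess v (phi k)) +
   (I{x, `|phi k (x + v) - uu (x + v)|} + I{x, `|phi k x - uu x|}))); last first.
  have e2 := int_shift v j2; by rewrite lerD2l e2; lra.
 rewrite -(intD j3 j2) -(intD (ish _ iP) (ibleD j3 j2)).
 apply: int_le (ish _ iu) (ibleD (ish _ iP) (ibleD j3 j2)) _ => x.
 have := max0_lip (uu (x + v) - uu x - rho0 v) (phi k (x + v) - phi k x - rho0 v).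
 have -> : uu (x + v) - uu x - rho0 v - (phi k (x + v) - phi k x - rho0 v) =
   (uu (x + v) - phi k (x + v)) + (phi k x - uu x) by ring.
 have := ler_normD (uu (x + v) - phi k (x + v)) (phi k x - uu x); rewrite (distrC (uu (x + v))).
 by have := ler_norm (shift_excess v uu x - shift_excess v (phi k) x); rewrite /shift_excess; lra.
have a2 : intg (rpos (grad (phi k))) <= intg (rpos G) + C * (e / k0).
 rewrite -lerBlDl (le_trans (ler_norm _))// (le_trans (rpos_int_near C0 (hC _ _) ip iG))//.
 by rewrite ler_wpM2l// ltW.
have a3 := ler_wpM2l v0 a2.
have ek' : e = 2 * (e / k0) + rho0 v * (C * (e / k0)).
 transitivity (e / k0 * k0); first by rewrite divfK// gt_eqF.
 by rewrite {2}/k0; ring.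
rewrite mulrDr in a3; lra.
Qed.

End function.
End sobolev_inequality.

(** * Transport rays and the singular set *)

Section rays.
Notation d0 := dist0.
Implicit Types (x y z v p : E).

Lemma hgrad_polar_sub x y : x != y -> hgrad (fun z => rho0 (z - y)) x (pmax (x - y)).
Proof. by move=> xy; apply: hgrad_sub_r; apply: pmax_hgrad => //; rewrite subr_eq0. Qed.

Lemma dist0_grad x p : Omega x -> hgrad d0 x p -> rho p = 1.
Proof.
move=> Ox hp; have [y yb dy] := dist0_min Ox.
have y0 : d0 y = 0 by apply: dist0_out; have [] := (bd_openP y).1 yb.
have xy : x != y.
 apply/eqP => xy; have := dist0_gt0 Ox; by rewrite xy y0 ltxx.
rewrite (hgrad_touch hp (hgrad_polar_sub xy)) ?pmax_gauge ?subr_eq0//; first by rewrite dy y0 add0r.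
by exists 1 => // z _; have := sub0 z y; rewrite y0 add0r.
Qed.

Lemma nonsingular_hgrad x : Omega x -> ~ Sigma x -> exists p, hgrad d0 x p.
Proof.
move=> Ox hx; have hd : differentiable (minkowski_dist K Omega) x by apply: contrapT => h; apply: hx.
have [e e0 he] := (openNP Omega).1 Omega_o _ Ox.
exists (grad (minkowski_dist K Omega) x).
by apply: (hgrad_near e0 _ (differentiable_hgrad hd)) => z /he Oz; rewrite dist0_in.
Qed.

Lemma singular_nohgrad x p : Sigma x -> ~ hgrad d0 x p.
Proof.
move=> [Ox hx] hp; apply: hx; have [e e0 he] := (openNP Omega).1 Omega_o _ Ox.
by apply: (@hgrad_differentiable _ _ _ _ p); apply: (hgrad_near e0 _ hp) => z /he Oz; rewrite dist0_in.
Qed.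

Lemma d0_cont : continuous d0.
Proof. by have [L _ hL] := dist0_lip; exact: lip_cont hL. Qed.

Lemma polar_sub_cont y : continuous (fun z => rho0 (z - y)).
Proof.
have [C _ hC] := polar_lip; apply: (@lip_cont _ _ _ C) => a c.
by have := hC (a - y) (c - y); rewrite opprB addrA subrK.
Qed.

Lemma slope_cont s x : continuous (fun z => d0 z - s * rho0 (z - x)).
Proof.
have [L _ hL] := dist0_lip; have [C _ hC] := polar_lip.
apply: (@lip_cont _ _ _ (L + `|s| * C)) => a c.
have -> : d0 a - s * rho0 (a - x) - (d0 c - s * rho0 (c - x)) =
 (d0 a - d0 c) - s * (rho0 (a - x) - rho0 (c - x)) by ring.
rewrite (le_trans (ler_normB _ _))// mulrDl lerD// normrM -mulrA ler_wpM2l//.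
by have := hC (a - x) (c - x); rewrite opprB addrA subrK.
Qed.

Lemma norm_sub_compact x (e : R) (T : set R) : closed T -> (forall t, T t -> t <= e) ->
 compact [set z : E | T `|z - x|].
Proof.
move=> cT hT; apply: bounded_closed_compact.
 exists (e + `|x|); split; [exact: num_real | move=> t Mt z /= /hT zx].
 by have := ler_normD (z - x) x; rewrite subrK; lra.
apply: (@closed_comp _ _ (fun z => `|z - x|) T) => // z _.
apply: (@lip_cont _ _ _ 1) => a c; rewrite mul1r (le_trans (ler_dist_dist _ _))//.
by rewrite opprB addrA subrK.
Qed.

(* Below slope one, [d0 - s rho0 (. - x)] has no maximum at a point where [d0] is differentiable. *)
Lemma slope_one x z (s e : R) p : Omega z -> 0 <= s < 1 -> 0 < e -> hgrad d0 z p ->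
 ~ (forall y, `|y - z| < e -> d0 y - s * rho0 (y - x) <= d0 z - s * rho0 (z - x)).
Proof.
move=> Oz /andP[s0 s1] e0 hp hmax; have rp := dist0_grad Oz hp.
have [zx|zx] := eqVneq z x; last first.
 have h2 := hgradD (hgradZ s (hgrad_polar_sub zx)) (hgrad_cst (d0 z - s * rho0 (z - x)) z).
 rewrite addr0 in h2.
 have pe : p = s *: pmax (z - x).
  apply: (hgrad_touch hp h2); first by rewrite addrC subrK.
  by exists e => // y /hmax; lra.
 by move: rp; rewrite pe gaugeZ// pmax_gauge ?subr_eq0// mulr1 => s1'; move: s1; rewrite s1' ltxx.
have pn : p != 0 := gauge_neq0 rp.
have : dotv p (grad rho p) <= s * rho0 (grad rho p).
 have bn : 0 < `|grad rho p| by rewrite normr_gt0 ggrad_neq0.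
 apply: (hgrad_dir_le hp); exists (e / `|grad rho p|); first by posn.
 move=> t /andP[t0]; rewrite ltr_pdivlMr// => te.
 have := hmax (z + t *: grad rho p); rewrite addr_subK normrZ gtr0_norm// => /(_ te).
 rewrite zx addr_subK subrr polar0 mulr0 polarZ ?(ltW t0)// mulrCA; lra.
by rewrite dotvC (gauge_euler pn) rp (polar_grad pn) mulr1 leNgt s1.
Qed.

(** A point on the sphere attains slope one. Otherwise, with a slope slightly below one, the maximum
    over the closed ball would be interior, against [slope_one]. *)
Lemma slope_escape x0 (e : R) : 0 < e -> (forall y, `|y - x0| < e -> Omega y /\ exists p, hgrad d0 y p) ->
 exists2 z, `|z - x0| = e / 2 & d0 x0 + rho0 (z - x0) <= d0 z.
Proof.
move=> e0 hb; apply: contrapT => hn; have e2 : 0 < e / 2 by lra.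
have Sc : compact [set z : E | `|z - x0| = e / 2].
 by apply: (@norm_sub_compact x0 (e / 2) [set e / 2]) => [|t ->//]; exact: closed_eq.
have S0 : [set z : E | `|z - x0| = e / 2] !=set0.
 exists (x0 + (e / 2) *: delta_mx ord0 (Ordinal n0)) => /=.
 by rewrite addr_subK normrZ norm_delta mulr1 gtr0_norm.
have [c cS hc] := compact_argmax S0 Sc (fun z _ => slope_cont (s := 1) (x := x0) (x0 := z)).
have [c' c'S hc'] := compact_argmax S0 Sc (fun z _ => polar_sub_cont (y := x0) (x := z)).
set m := d0 x0 - (d0 c - 1 * rho0 (c - x0)).
have m0 : 0 < m.
 by rewrite subr_gt0 mul1r ltNge; apply/negP => h; apply: hn; exists c => //; lra.
set Mx := rho0 (c' - x0) in hc'; have M0 : 0 <= Mx by exact: polar_ge0.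
(* Lowering the slope by [ta] changes values on the sphere by less than the gap [m], so they stay
   below the value at the centre. *)
pose ta := min 1 (m / (2 * (Mx + 1))).
have ta0 : 0 < ta by rewrite lt_min ltr01 divr_gt0// mulr_gt0// ltr_wpDl.
have ta1 : ta <= 1 by rewrite ge_min lexx.
have ta2 : ta * Mx < m.
 have h : ta <= m / (2 * (Mx + 1)) by rewrite ge_min lexx orbT.
 have h2 : ta * (2 * (Mx + 1)) <= m by rewrite -ler_pdivlMr// mulr_gt0// ltr_wpDl.
 have := mulr_ge0 (ltW ta0) M0; lra.
have B0 : [set z : E | `|z - x0| <= e / 2] !=set0 by exists x0; rewrite /= subrr normr0 ltW.
have Bc : compact [set z : E | `|z - x0| <= e / 2].
 by apply: (@norm_sub_compact x0 (e / 2) [set t | t <= e / 2]) => //; exact: closed_le.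
have [z zB hz] := compact_argmax B0 Bc (fun z _ => slope_cont (s := 1 - ta) (x := x0) (x0 := z)).
have zx : d0 x0 <= d0 z - (1 - ta) * rho0 (z - x0).
 by have := hz x0; rewrite /= subrr normr0 polar0 mulr0 subr0; apply; exact: ltW.
have zS : `|z - x0| < e / 2.
 rewrite lt_neqAle zB andbT; apply/eqP => zS; have h1 := hc z zS; have h2 := hc' z zS.
 have h3 : ta * rho0 (z - x0) <= ta * Mx by rewrite ler_wpM2l// ltW.
 by move: zx h1; rewrite /m in ta2; lra.
have ze : `|z - x0| < e by lra.
have [Oz [p hp]] := hb z ze; have de : 0 < e / 2 - `|z - x0| by rewrite subr_gt0.
apply: (@slope_one x0 z (1 - ta) _ p Oz _ de hp); first by apply/andP; split; lra.
move=> y yz; apply: hz => /=; have := ler_distD z y x0; lra.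
Qed.

(** Maximise [d0] over the points reached from [x] with slope one. If the maximiser had a
    neighbourhood free of singular points, [slope_escape] would prolong the ray. *)
Lemma ray_end x : Omega x -> exists x0, [/\ Omega x0, closure Sigma x0 & d0 x0 = d0 x + rho0 (x0 - x)].
Proof.
move=> Ox; pose A := closure Omega `&` [set z | d0 x <= d0 z - 1 * rho0 (z - x)].
have Ac : compact A.
 apply: compact_closedI; first exact: closure_compact.
 apply: (@closed_comp _ _ (fun z => d0 z - 1 * rho0 (z - x)) [set t | d0 x <= t]); last exact: closed_ge.
 by move=> z _; exact: slope_cont.
have A0 : A !=set0.
 by exists x; split; [exact: subset_closure | rewrite /= subrr polar0 mulr0 subr0].
have [x0 [_ /= x0A] hmax] := compact_argmax A0 Ac (fun z _ => d0_cont (x := z)).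
have rx : 0 <= rho0 (x0 - x) := polar_ge0 _.
have dx := dist0_gt0 Ox.
have Ox0 : Omega x0 by apply: contrapT => h; rewrite (dist0_out h) in x0A; lra.
have eq0 : d0 x0 = d0 x + rho0 (x0 - x) by apply: le_anti; rewrite sub0/=; lra.
exists x0; split=> //; apply: contrapT => /nclosureP[e1 e10 he1].
have [e2 e20 he2] := (openNP Omega).1 Omega_o _ Ox0.
have m0 : 0 < min e1 e2 by posn.
have [|z zx hz] := slope_escape (x0 := x0) m0.
 by move=> y; rewrite lt_min => /andP[/he1 y1 /he2 Oy]; split=> //; exact: nonsingular_hgrad.
have zx0 : z - x0 != 0 by rewrite -normr_gt0 zx divr_gt0.
have rz := polar_gt0 zx0.
have tri := polarD (z - x0) (x0 - x); rewrite addrA subrK in tri.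
have Oz : Omega z by apply: contrapT => h; rewrite (dist0_out h) in hz; have := d0_ge0 x0; lra.
have := hmax z; suff hzA : A z by move/(_ hzA); lra.
by split; [exact: subset_closure | rewrite /=; lra].
Qed.

Lemma singular_nonempty : Sigma !=set0.
Proof.
have [x Ox] := Omega0; have [x0 [_ /closureNP h _]] := ray_end Ox.
by have [y Sy _] := h 1 ltr01; exists y.
Qed.

Lemma ae_shift x (P : E -> Prop) : {ae mu, forall v, P (v + x)} -> {ae mu, forall z, P z}.
Proof.
move=> [A [mA A0 PA]]; exists (shiftv (- x) @^-1` A); split.
- by rewrite -[X in measurable X]setTI; exact: meas_shiftv.
- by rewrite lebesgue_shift.
by move=> z /= Pz; apply: PA => /=; rewrite /shiftv subrK.
Qed.

(** Tonelli's theorem exchanges the quantifiers: from almost every [x] for each [v], to almost every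
    [z] for almost every [x]. *)
Lemma shift_fubini (w : E -> R) : mfun w -> (forall v, {ae mu, forall x, w (x + v) - w x <= rho0 v}) ->
 {ae mu, forall x, {ae mu, forall z, w z - w x <= rho0 (z - x)}}.
Proof.
move=> mw hw; pose F (q : E * E) : \bar R := (max (w (q.1 + q.2) - w q.1 - rho0 q.2) 0)%:E.
have F0 q : (0 <= F q)%E by rewrite lee_fin le_max lexx orbT.
have mF : mfun F.
 apply/measurable_EFinP; apply: measurable_maxr; last exact: measurable_cst.
 have m1 : mfun (fun q : E * E => q.1 + q.2).
  apply: meas_row => // i; rewrite (_ : (fun q => _) = (fun q : E * E => q.1 ord0 i + q.2 ord0 i)).
   apply: measurable_funD.
    exact: measurableT_comp (meas_coord i) measurable_fst.
   exact: measurableT_comp (meas_coord i) measurable_snd.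
  by apply/funext => q; rewrite mxE.
 apply: measurable_funB; first apply: measurable_funB.
 - exact: measurableT_comp mw m1.
 - exact: measurableT_comp mw measurable_fst.
 - apply: (measurableT_comp (f := rho0)) measurable_snd.
  by have [C _ hC] := polar_lip; apply: (@lip_meas _ _ _ C) => a c; exact: hC.
have hFv v : (\int[mu]_x F (x, v) = 0)%E.
 rewrite (ae_eq_integral (cst 0%E) (fun x => F (x, v)) measurableT (measurable_fun_pair1 v mF)) ?integral0//.
 by apply: filterS (hw v) => x hx _; rewrite /F /= max_r// subr_le0.
have := fubini_tonelli (m1 := mu) (m2 := mu) F mF F0.
under [in X in _ = X -> _]eq_integral do rewrite hFv.
rewrite integral0 => h0.
have mI := measurable_fun_fubini_tonelli_F (m2 := mu) F mF F0.
have I0 x : (0 <= \int[mu]_v F (x, v))%E by apply: integral_ge0.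
have /(ae_eq_integral_abs mu measurableT mI) hae : (\int[mu]_x `|\int[mu]_v F (x, v)| = 0)%E.
 by rewrite -[RHS]h0; apply: eq_integral => x _; rewrite gee0_abs.
apply: filterS hae => x /(_ I) hx; apply: (@ae_shift x (fun z => w z - w x <= rho0 (z - x))).
have mFx : mfun (fun v => F (x, v)) := measurable_fun_pair2 x mF.
have /(ae_eq_integral_abs mu measurableT mFx) : (\int[mu]_v `|F (x, v)| = 0)%E.
 by rewrite -[RHS]hx; apply: eq_integral => v _; rewrite gee0_abs.
apply: filterS => v /(_ I) /= [hv]; rewrite addrK (addrC v) -subr_le0 -hv le_max lexx//.
Qed.

End rays.

(** * Minimality, uniqueness and the competitor *)

Section theorem.
Notation d0 := dist0.
Implicit Types (x y z p : E) (u v : E -> R).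

Variables (f : E -> R) (h : E -> \bar R) (Hst : R).
Hypotheses (f_measurable : measurable_fun Omega f) (f_Linfty : (Linfty_norm Omega f < +oo)%E)
 (f_ge0 : {ae mu, forall x, Omega x -> 0 <= f x}) (h_borel : mfun h) (h_ge0 : forall xi, (0 <= h xi)%E)
 (K_def : K = conv_hull [set xi | h xi = 0%E]) (Hst_le : Hst <= min_mean_rho_curvature K Omega).
Notation cst := (cfun n Hst r).
Hypothesis f_small : (cst%:E * Linfty_norm Omega f <= growth_constant h K)%E.

Let M := fine (Linfty_norm Omega f).
Let ff := ext0 f.
Let J := functional h f Omega.

Lemma Linfty_ge0 : (0 <= Linfty_norm Omega f)%E.
Proof. exact: Lnorm_ge0. Qed.

Lemma LinftyE : Linfty_norm Omega f = M%:E.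
Proof. by rewrite /M fineK// ge0_fin_numE// Linfty_ge0. Qed.

Lemma M_ge0 : 0 <= M.
Proof. by rewrite fine_ge0// Linfty_ge0. Qed.

Lemma ff_bound : {ae mu, forall x, 0 <= ff x <= M}.
Proof.
have mT : (0 < mu setT)%E by apply: (lebesgue_open_gt0 (x := 0)) => //; exact: openT.
have := LinftyE; rewrite /Linfty_norm unlock mT => LE.
have := ess_sup_inf.ess_sup_ge mu (abse \o (EFin \o (f \_ Omega))); rewrite LE => hM.
apply: filterS2 f_ge0 hM => x h0 /=; rewrite ext0_restrict -/ff lee_fin => h1.
apply/andP; split; last exact: le_trans (ler_norm _) h1.
by rewrite /ff; have [Ox|Ox] := pselect (Omega x); [rewrite ext0_in// h0|rewrite ext0_out].
Qed.

Lemma measurable_ff : mfun ff.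
Proof. by rewrite /ff -ext0_restrict; exact/(measurable_restrictT _ mO). Qed.

Lemma ible_ff (w : E -> R) : ible w -> ible (fun x => ff x * w x).
Proof.
move=> hw; apply: (ible_ae_le _ (ibleZ M (ible_norm hw))).
 by apply: measurable_funM; [exact: measurable_ff|exact: ible_meas hw].
by apply: filterS ff_bound => x /andP[h1 h2]; rewrite normrM ger0_norm// ler_wpM2r.
Qed.

(** [growth_constant] is a supremum that need not be attained and may be infinite: a failure at [xi]
    would leave room for an admissible [l] contradicting it. *)
Lemma growth xi : ((cst * M * max (rho xi - 1) 0)%:E <= h xi)%E.
Proof.
have [h1|h1] := leP (rho xi - 1) 0; first by rewrite mulr0.
rewrite leNgt; apply/negP => hlt; have := h_ge0 xi; case hE : (h xi) hlt => [t| |] // hlt t0.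
rewrite lte_fin -ltr_pdivrMr// in hlt.
have : ((t / (rho xi - 1))%:E < growth_constant h K)%E.
 by apply: lt_le_trans f_small; rewrite LinftyE -EFinM lte_fin.
move=> /ereal_sup_gt[_ [l [l0 hl] <-]]; rewrite lte_fin ltr_pdivrMr// => tl.
by have := hl xi; rewrite hE lee_fin leNgt tl.
Qed.

Lemma ext0_d0 : ext0 d0 = d0.
Proof.
by apply/funext => x; have [Ox|Ox] := pselect (Omega x); [rewrite ext0_in|rewrite ext0_out// dist0_out].
Qed.

Lemma functional_ge u : W11_0 Omega u ->
 ((cst * M * intg (rpos (ext0 (weak_grad Omega u))) - I{x, ff x * ext0 u x})%:E <= J u)%E.
Proof.
move=> hu; have [iu iG _] := W11_0_seq hu; have iR := ible_rpos iG.
have [[g hg] _] := hu; have [iu' ig' _] := is_weak_grad_get hg.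
have i1 := ibleB (ibleZ (cst * M) iR) (ible_ff iu).
rewrite -(intZ _ iR) -(intB (ibleZ _ iR) (ible_ff iu)) -(int_on (Omega := Omega) i1); last first.
 by move=> x Ox; rewrite /ff !(ext0_out _ Ox) mulr0 rpos0// ?ext0_out// mulr0 subrr.
apply: integral_ge_EFin => //.
- apply: emeasurable_funB.
  apply: (measurableT_comp h_borel); apply: meas_row => // i.
  by have /measurable_int/measurable_EFinP := ig' i.
 apply/measurable_EFinP; apply: measurable_funM => //.
 by have /measurable_int/measurable_EFinP := iu'.
- by have := integrableS measurableT mO (@subsetT _ _) i1.
move=> x Ox; rewrite /rpos /ff !ext0_in// EFinB leeB//; exact: growth.
Qed.

Lemma functional_eq u : W11_0 Omega u -> {ae mu, forall x, Omega x -> h (weak_grad Omega u x) = 0%E} ->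
 J u = (- I{x, ff x * ext0 u x})%:E.
Proof.
move=> hu h0; have [iu _ _] := W11_0_seq hu.
have [[g hg] _] := hu; have [iu' ig' _] := is_weak_grad_get hg.
have mfu : measurable_fun Omega (fun x => (f x * u x)%:E).
 apply/measurable_EFinP; apply: measurable_funM => //.
 by have /measurable_int/measurable_EFinP := iu'.
have i1 := ibleN (ible_ff iu).
rewrite -(intN (ible_ff iu)) -(int_on (Omega := Omega) i1); last first.
 by move=> x Ox; rewrite /ff (ext0_out _ Ox) mul0r oppr0.
apply: ae_eq_integral => //.
- apply: emeasurable_funB => //.
 apply: (measurableT_comp h_borel); apply: meas_row => // i.
 by have /measurable_int/measurable_EFinP := ig' i.
- by have /measurable_int := integrableS measurableT mO (@subsetT _ _) i1.
by apply: filterS h0 => x hx Ox; rewrite hx// sub0e /ff !ext0_in.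
Qed.

(** The gradient of a minimum of cones is almost everywhere some [pmax], a point of [K] where [h]
    vanishes by [pmax_exposed]; only the linear term of the functional remains. *)
Lemma profile_W11_0 (S : set E) u : compact S -> {ae mu, forall x, Omega x -> ~ S x} ->
 (forall x y, u x <= u y + rho0 (x - y)) -> (forall x, Omega x -> exists2 y, S y & u x = u y + rho0 (x - y)) ->
 (forall x, Omega x -> 0 < u x) -> (forall x, ~ Omega x -> u x = 0) ->
 W11_0 Omega u /\ J u = (- I{x, ff x * u x})%:E.
Proof.
move=> cS OS u_lip u_min u_gt0 u_out.
have [L L0 hL] := dist0_lip; have [M1 M0 hM] := Omega_norm.
have [Lu Lu0 hLu] := profile_lip u_lip.
have hg := profile_hgrad Omega_o cS OS u_lip u_min hL d0_ge0 d0_gt0 (fun x => dist0_out (x := x)) hM.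
have hl : {ae mu, forall x, Omega x -> hgrad u x (lgrad u x)}.
 by apply: filterS hg => x hx Ox; have [p _ hp] := hx Ox; rewrite (hgrad_lgrad hp).
have W := lip_W11_0 Omega_o hM (ltW Lu0) hLu u_out u_gt0 hl; split=> //.
have ue : ext0 u = u.
 by apply/funext => x; have [Ox|Ox] := pselect (Omega x); [rewrite ext0_in|rewrite ext0_out// u_out].
rewrite functional_eq ?ue//.
apply: filterS2 hg (weak_grad_lip Omega_o hM hLu u_out hl) => x hx hw Ox.
have [p [y [_ xy _ ->]] hp] := hx Ox; rewrite hw// (hgrad_lgrad hp).
by apply: (pmax_exposed K_def); rewrite subr_eq0.
Qed.

Lemma dist0_W11_0 : W11_0 Omega d0 /\ J d0 = (- I{x, ff x * d0 x})%:E.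
Proof.
apply: (profile_W11_0 bd_compact) => //.
- by apply: aeW => x; exact: Omega_not_bd.
- exact: dist0_min.
- by move=> x; exact: dist0_out.
Qed.

(** [M] times the Sobolev inequality. Both terms on the left are nonnegative, which gives
    minimality; for a minimizer both must vanish. *)
Lemma excess u : W11_0 Omega u -> M / n%:R * I{x, d0 x * rpos (ext0 (weak_grad Omega u)) x} +
 I{x, M * max (ext0 u x - d0 x) 0 - ff x * (ext0 u x - d0 x)} <=
 cst * M * intg (rpos (ext0 (weak_grad Omega u))) - I{x, ff x * ext0 u x} + I{x, ff x * d0 x}.
Proof.
move=> hu; have [iu iG _] := W11_0_seq hu.
have id := ible_d0.
have i1 := ible_pos (ibleB iu id).
have hs := ler_wpM2l M_ge0 (sobolev_inequality Hst_le hu).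
rewrite (intB (ibleZ _ i1) (ible_ff (ibleB iu id))) (intZ _ i1).
have -> : (fun x => ff x * (ext0 u x - d0 x)) = (fun x => ff x * ext0 u x - ff x * d0 x).
 by apply/funext => x; rewrite mulrBr.
rewrite (intB (ible_ff iu) (ible_ff id)).
move: hs; rewrite mulrBr !mulrA; rewrite [M * cst]mulrC; lra.
Qed.

Lemma excess_ge0 u : {ae mu, forall x, 0 <= M * max (ext0 u x - d0 x) 0 - ff x * (ext0 u x - d0 x)}.
Proof.
apply: filterS ff_bound => x /andP[h1 h2]; set t := ext0 u x - d0 x.
rewrite subr_ge0; have [t0|t0] := leP t 0; first by rewrite mulr0 mulr_ge0_le0.
by rewrite ler_wpM2r// ltW.
Qed.

Lemma dist0_minimal u : W11_0 Omega u -> (J d0 <= J u)%E.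
Proof.
move=> hu; apply: le_trans (functional_ge hu); rewrite dist0_W11_0.2 lee_fin.
have := excess hu; have [iu iG _] := W11_0_seq hu.
have id := ible_d0.
have i1 := ibleB (ibleZ M (ible_pos (ibleB iu id))) (ible_ff (ibleB iu id)).
have := int_ae_ge0 i1 (excess_ge0 u).
have : 0 <= M / n%:R * I{x, d0 x * rpos (ext0 (weak_grad Omega u)) x}.
 rewrite mulr_ge0 ?divr_ge0 ?M_ge0//; apply: int_ge0 => x; rewrite mulr_ge0//; exact: rpos_ge0.
lra.
Qed.

(** The closed set tested in the definition of the support is the closure of [Omega] minus an open
    ball around [x0]. *)
Lemma supp_pos x0 (dl : R) : ess_support Omega f x0 -> 0 < dl ->
 ~ {ae mu, forall x, Omega x -> `|x - x0| < dl -> f x = 0}.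
Proof.
move=> sx dl0 h0; have := sx (closure Omega `&` [set x | dl <= `|x - x0|]).
case; last by rewrite /= subrr normr0 leNgt dl0.
split; [apply: closedI; first exact: closed_closure | exact: subIsetl |].
 apply: (@closed_comp _ _ (fun z => `|z - x0|) [set t | dl <= t]); last exact: closed_ge.
 move=> z _; apply: (@lip_cont _ _ _ 1) => a c; rewrite mul1r (le_trans (ler_dist_dist _ _))//.
 by rewrite opprB addrA subrK.
apply: filterS h0 => x hx [Ox nx]; apply: hx => //; rewrite ltNge; apply/negP => h1; apply: nx.
by split=> //; exact: subset_closure.
Qed.

(** Vanishing of the two excess terms gives the gradient constraint and equality with [d0] where [f]
    is nonzero; the constraint carries the equality back along a ray to [x]. *)
Lemma minimizer_eq u : Sigma `<=` ess_support Omega f -> W11_0 Omega u -> (J u <= J d0)%E ->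
 {ae mu, forall x, Omega x -> u x = d0 x}.
Proof.
move=> Ssupp hu Jle; have [iu iG _] := W11_0_seq hu.
have id := ible_d0; have iR := ible_rpos iG.
have idR := ible_dist0M iR.
have iP := ible_pos (ibleB iu id).
have i1 := ibleB (ibleZ M iP) (ible_ff (ibleB iu id)).
(* If [M = 0] then [f] vanishes almost everywhere and no singular point, of which there is one, lies
   in its support. *)
have M0 : 0 < M.
 rewrite lt_neqAle M_ge0 andbT; apply/eqP => M0.
 have [x Sx] := singular_nonempty.
 apply: (supp_pos (Ssupp x Sx) ltr01); apply: filterS ff_bound => y; rewrite -M0 => /andP[y1 y2] Oy _.
 by apply: le_anti; rewrite -(ext0_in f Oy) y1 y2.
have := le_trans (functional_ge hu) Jle; rewrite dist0_W11_0.2 lee_fin => h1.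
have h2 := excess hu; have h3 := int_ae_ge0 i1 (excess_ge0 u).
set G := ext0 (weak_grad Omega u) in iG iR idR h1 h2.
have h4 : 0 <= I{x, d0 x * rpos G x}.
 by apply: int_ge0 => x; rewrite mulr_ge0//; exact: rpos_ge0.
have Mn : 0 < M / n%:R by posn.
have h5 : I{x, d0 x * rpos G x} <= 0 by rewrite -(pmulr_rle0 _ Mn); lra.
have dR0 : {ae mu, forall x, rpos G x = 0}.
 have := int_eq0_ae idR _ h5; move=> /(_ (aeW _ (fun x => mulr_ge0 (d0_ge0 x) (rpos_ge0 G x)))).
 apply: filterS => x /eqP; rewrite mulf_eq0 => /orP[/eqP dx|/eqP//]; apply: rpos0 => //.
 by rewrite /G ext0_out// => Ox; have := d0_gt0 Ox; rewrite dx ltxx.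
have R0 : intg (rpos G) = 0.
 rewrite -[RHS](@int0 R n); apply: int_ae_eq => //; exact: ible_meas iR.
have s0 := sobolev_inequality Hst_le hu.
have n1 : 0 <= n%:R^-1 :> R by posn.
rewrite -/G R0 mulr0 sub0r in s0; have n2' := mulr_ge0 n1 h4.
have u_le : {ae mu, forall x, ext0 u x <= d0 x}.
 have h6 : I{x, max (ext0 u x - d0 x) 0} <= 0 by lra.
 by apply: filterS (int_pos_ae iP h6) => x; rewrite subr_le0.
have u_supp : {ae mu, forall x, ff x != 0 -> ext0 u x = d0 x}.
 have h6 : I{x, M * max (ext0 u x - d0 x) 0 - ff x * (ext0 u x - d0 x)} <= 0.
  have := mulr_ge0 (ltW Mn) h4; lra.
 apply: filterS2 u_le (int_eq0_ae i1 (excess_ge0 u) h6) => x ux.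
 rewrite max_r ?subr_le0// mulr0 sub0r => /eqP; rewrite oppr_eq0 mulf_eq0 => /orP[->//|].
 by rewrite subr_eq0 => /eqP.
have ush (v : E) : {ae mu, forall x, ext0 u (x + v) - ext0 u x <= rho0 v}.
 have := shift_inequality hu v; rewrite -/G R0 mulr0 => hv.
 by apply: filterS (int_pos_ae (ible_shift_excess v iu) hv) => x; rewrite subr_le0.
have uu := shift_fubini (ible_meas iu) ush.
(* Near the end [x0] of the ray through a bad point [x], [d0 z - rho0 (z - x)] stays above
   [ext0 u x]. Where [f z != 0], [u z = d0 z], against the Lipschitz bound; so [f] would vanish
   around [x0]. *)
apply: filterS2 u_le uu => x ux hx Ox; rewrite -(ext0_in u Ox); apply: le_anti; rewrite ux/=.
rewrite leNgt; apply/negP => ult; have et : 0 < d0 x - ext0 u x by rewrite subr_gt0.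
have [x0 [Ox0 Sx0 dx0]] := ray_end Ox.
have sx0 : ess_support Omega f x0.
 move=> C hC; have [cC _ _] := hC; apply: (closed_normP cC) => e e0.
 by have [y Sy yx] := (closureNP _ _).1 Sx0 e e0; exists y => //; exact: (Ssupp y Sy).
have /contNP/(_ _ et)[dl dl0 hdl] := slope_cont (s := 1) (x := x) (x0 := x0).
apply: (supp_pos sx0 dl0); apply: filterS2 hx u_supp => z hz hfz Oz /hdl hzd.
apply/eqP; apply: contraTT isT => fz.
have := hfz; rewrite /ff (ext0_in f Oz) => /(_ fz) uz.
move: hzd; rewrite ltr_norml dx0 => /andP[hzd _]; rewrite uz in hz.
suff : ext0 u x < ext0 u x by rewrite ltxx.
lra.
Qed.

Lemma ae_neq x0 : {ae mu, forall x, x != x0}.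
Proof.
apply: (@ae_shift x0 (fun x => x != x0)).
have m0 : measurable [set (0 : E)] by apply: closed_meas; apply: compact_closed_row; exact: compact_set1.
have i0 : ible (\1_[set (0 : E)] : E -> R).
 have [i1 _] := @ball_ible R n 1 ltr01; apply: ible_le i1 _; first exact: measurable_indic.
 move=> x; rewrite !indicE; case: (boolP (x \in _)) => [|_]; last by rewrite normr0; case: (_ \in _).
 by rewrite inE => ->; rewrite normr1 mem_set//; apply: ballxx.
have le0 : intg (\1_[set (0 : E)] : E -> R) <= 0.
 apply/ler_addgt0Pr => e e0; rewrite add0r.
 pose t := min (1 / 2) (e / 2).
 have t0 : 0 < t by rewrite lt_min; apply/andP; split; lra.
 have t1 : 2 * t <= 1 by have : t <= 1 / 2 by [rewrite ge_min lexx]; lra.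
 have t2 : 2 * t <= e by have : t <= e / 2 by [rewrite ge_min lexx orbT]; lra.
 have [i1 I1] := @ball_ible R n t t0.
 apply: (@le_trans _ _ ((2 * t) ^+ n)).
  rewrite -I1; apply: int_le i0 i1 _ => x; rewrite !indicE.
  case: (boolP (x \in [set _])) => [|_]; last by posn.
  by rewrite inE => ->; rewrite mem_set//; exact: ballxx.
 apply: le_trans t2; by apply: ler_iXnr => //; lra.
have := int_eq0_ae i0 _ le0; move=> /(_ (aeW _ _)) hae.
have {}hae : {ae mu, forall x : E, (\1_[set (0 : E)] x : R) = 0}.
 by apply: hae => x; rewrite indicE; case: (_ \in _).
apply: filterS hae => x; rewrite indicE => hx; rewrite -subr_eq0 addrK.
apply/eqP => x0'; move: hx; rewrite x0' mem_set// => /eqP; by rewrite oner_eq0.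
Qed.

(** No ray passes through a singular point: equality would squeeze [d0] at [x0] between a cone from
    [z] below and one from the boundary above, and make it differentiable. *)
Lemma singular_strict x0 z : Sigma x0 -> z != x0 -> d0 z < d0 x0 + rho0 (z - x0).
Proof.
move=> Sx zx; rewrite lt_neqAle sub0 andbT; apply/eqP => dz.
have [Ox _] := Sx; have [y yb dy] := dist0_min Ox.
have y0 : d0 y = 0 by apply: dist0_out; have [] := (bd_openP y).1 yb.
have xy : x0 != y by apply/eqP => xy; have := d0_gt0 Ox; rewrite xy y0 ltxx.
have zx' : z - x0 != 0 by rewrite subr_eq0.
have h1 := hgradB (hgrad_cst (d0 z) x0) (hgrad_sub_l (pmax_hgrad zx')).
have h2 := hgrad_polar_sub xy.
rewrite sub0r opprK in h1.
have lo : d0 z - rho0 (z - x0) = d0 x0 by rewrite dz addrK.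
have up : rho0 (x0 - y) = d0 x0 by rewrite dy y0 add0r.
have le1 w : d0 z - rho0 (z - w) <= d0 w <= rho0 (w - y).
 by rewrite lerBlDr sub0/=; have := sub0 w y; rewrite y0 add0r.
have e : pmax (z - x0) = pmax (x0 - y).
 apply: (hgrad_touch h1 h2); first by rewrite lo up.
 by exists 1 => // w _; have /andP[a c] := le1 w; exact: le_trans c.
rewrite e in h1; apply: (singular_nohgrad Sx (p := pmax (x0 - y))).
by apply: (hgrad_squeeze h1 h2); rewrite ?lo ?up//; exists 1.
Qed.

(** The distance is lowered near [x0] only, where [f] vanishes, so the functional keeps its
    value. *)
Lemma competitor x0 : Sigma x0 -> ~ ess_support Omega f x0 ->
 exists v : E -> R, [/\ W11_0 Omega v, J v = J d0 & ~ {ae mu, forall x, Omega x -> v x = d0 x}].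
Proof.
move=> Sx nsupp; have [Ox _] := Sx; have dx := d0_gt0 Ox.
have [C [cC fC nCx]] : exists C : set E, [/\ closed C, {ae mu, forall x, (Omega `\` C) x -> f x = 0} & ~ C x0].
 apply: contrapT => h0; apply: nsupp => C [h1 h2 h3]; apply: contrapT => nC.
 by apply: h0; exists C.
have [dl dl0 hdl] : exists2 dl : R, 0 < dl & forall y, `|y - x0| < dl -> ~ C y.
 by apply: nclosureP; rewrite -(closure_id C).1.
pose Q := closure Omega `&` [set z | dl <= `|z - x0|].
have cQ : compact Q.
 apply: compact_closedI; first exact: closure_compact.
 apply: (@closed_comp _ _ (fun z => `|z - x0|) [set t | dl <= t]); last exact: closed_ge.
 move=> z _; apply: (@lip_cont _ _ _ 1) => a c; rewrite mul1r (le_trans (ler_dist_dist _ _))//.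
 by rewrite opprB addrA subrK.
(* By [singular_strict] and compactness, the cone lowered by [ep] still lies above [d0] outside the
   ball of radius [dl]. *)
have [ep [ep0 epd hep]] : exists ep : R, [/\ 0 < ep, ep < d0 x0 &
  forall z, Omega z -> dl <= `|z - x0| -> d0 z <= d0 x0 - ep + rho0 (z - x0)].
 have [Q0|Q0] := pselect (Q !=set0); last first.
  exists (d0 x0 / 2); split; [lra|lra|] => z Oz zx; exfalso; apply: Q0; exists z.
  by split=> //; exact: subset_closure.
 have [c [_ cdl] hc] := compact_argmax Q0 cQ (fun z _ => slope_cont (s := 1) (x := x0) (x0 := z)).
 have cx : c != x0 by apply/eqP => cx; move: cdl; rewrite /= cx subrr normr0 leNgt dl0.
 have sc := singular_strict Sx cx.
 pose m := min (d0 x0 / 2) (d0 x0 - (d0 c - 1 * rho0 (c - x0))).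
 have m0 : 0 < m by rewrite lt_min; apply/andP; split; lra.
 have m1 : m <= d0 x0 / 2 by rewrite ge_min lexx.
 have m2 : m <= d0 x0 - (d0 c - 1 * rho0 (c - x0)) by rewrite ge_min lexx orbT.
 exists m; split=> //; first lra.
 by move=> z Oz zx; have := hc z (conj (subset_closure Oz) zx); lra.
pose w z := d0 x0 - ep + rho0 (z - x0); pose v z := min (d0 z) (w z).
have w0 z : 0 < w z by rewrite /w; have := polar_ge0 (z - x0); lra.
have v_out z : ~ Omega z -> v z = 0.
 by move=> Oz; rewrite /v (dist0_out Oz); apply: min_l; exact: ltW.
have v_far z : Omega z -> dl <= `|z - x0| -> v z = d0 z by move=> Oz zx; apply: min_l; exact: hep.
have v_x0 : v x0 = d0 x0 - ep by rewrite /v /w subrr polar0 addr0; apply: min_r; lra.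
have v_lip x y : v x <= v y + rho0 (x - y).
 rewrite /v addr_minl le_min; apply/andP; split; first by rewrite ge_min sub0.
 rewrite ge_min; apply/orP; right; have := polarD (x - y) (y - x0).
 by rewrite addrA subrK /w; lra.
have v_min x : Omega x -> exists2 y, (boundary Omega `|` [set x0]) y & v x = v y + rho0 (x - y).
 move=> Ox'; have [h1|h1] := leP (d0 x) (w x); last first.
  by exists x0; [right|rewrite v_x0 /v min_r//; exact: ltW].
 have [y yb dy] := dist0_min Ox'; exists y; first by left.
 have Oy : ~ Omega y by have [] := (bd_openP y).1 yb.
 have -> : v x = d0 x by exact: min_l.
 by rewrite v_out// dy (dist0_out Oy).
have v_gt0 x : Omega x -> 0 < v x by move=> Ox'; rewrite lt_min d0_gt0// w0.
have hS : {ae mu, forall x, Omega x -> ~ (boundary Omega `|` [set x0]) x}.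
 apply: filterS (ae_neq x0) => x xx0 Ox' [|/= e]; first exact: Omega_not_bd.
 by move: xx0; rewrite e eqxx.
have cS : compact (boundary Omega `|` [set x0]).
 by apply: compactU; [exact: bd_compact|exact: compact_set1].
have [Wv Jv] := profile_W11_0 cS hS v_lip v_min v_gt0 v_out.
have [Wd Jd] := dist0_W11_0.
exists v; split=> //.
 have [iv _ _] := W11_0_seq Wv; have [id _ _] := W11_0_seq Wd.
 rewrite ext0_d0 in id.
 have ve : ext0 v = v.
  by apply/funext => x; have [Ox'|Ox'] := pselect (Omega x); [rewrite ext0_in|rewrite ext0_out// v_out].
 rewrite ve in iv; rewrite Jv Jd; congr (- _)%:E; apply: int_ae_eq.
 - exact: ible_meas (ible_ff iv).
 - exact: ible_meas (ible_ff id).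
 apply: filterS fC => x hx; have [Ox'|Ox'] := pselect (Omega x); last by rewrite /ff ext0_out// !mul0r.
 have [xd|xd] := leP dl `|x - x0|; first by rewrite v_far.
 by rewrite /ff ext0_in// hx ?mul0r//; split=> //; exact: hdl.
move=> [A [mA A0 hA]].
have [Lv Lv0 hLv] := profile_lip v_lip.
have [Ld Ld0 hLd] := dist0_lip.
have [e2 e20 he2] := (openNP Omega).1 Omega_o _ Ox.
(* At [x0] the two functions differ by [ep]; their Lipschitz constants keep them distinct on this
   ball, which has positive measure. *)
pose e := min e2 (ep / (Lv + Ld)).
have e0 : 0 < e by rewrite lt_min e20 divr_gt0// addr_gt0.
have BA : ball x0 e `<=` A.
 move=> y /ball_rowP; rewrite lt_min => /andP[/he2 Oy].
 rewrite ltr_pdivlMr ?addr_gt0// => ye; apply: hA => /= /(_ Oy) vy.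
 have := hLv y x0; have := hLd x0 y; rewrite (distrC x0 y) vy v_x0.
 have := ler_norm (d0 y - (d0 x0 - ep)); have := ler_norm (d0 x0 - d0 y).
 move: ye; rewrite mulrDr ![_ * `|y - x0|]mulrC; lra.
have oB : open (ball x0 e) by exact: ball_open.
have := lebesgue_open_gt0 oB (ballxx x0 e0); rewrite ltNge => /negP; apply.
by rewrite -A0; apply: le_measure => //; rewrite inE//; exact: open_meas.
Qed.

Lemma unique_minimizer_dist :
 unique_minimizer Omega (functional h f Omega) (minkowski_dist K Omega) <-> Sigma `<=` ess_support Omega f.
Proof.
have e x : Omega x -> d0 x = minkowski_dist K Omega x by exact: dist0_in.
have [Wd _] := dist0_W11_0; have Je := functional_ext h f mO e.
split=> [[_ _ hu] x0 Sx|Ss].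
 apply: contrapT => nsupp; have [v [Wv Jv nv]] := competitor Sx nsupp.
 apply: nv; have := hu v Wv _.
 case=> [u Wu|A hA]; first by rewrite -/J Jv; exact: dist0_minimal.
 by exists A; case: hA => mA A0 hA; split=> // y ny; apply: hA => /= hy; apply: ny => Oy; rewrite (e _ Oy) hy.
split.
- exact: W11_0_ext mO e Wd.
- by move=> u Wu; rewrite -Je; exact: dist0_minimal.
move=> v Wv hv; have := minimizer_eq Ss Wv (hv _ Wd).
by apply: filterS => x hx Ox; rewrite hx// e.
Qed.

End theorem.

End minkowski_distance.
End convex_body.

Theorem theorem4p1 (R : realType) (n : nat) (hn : (2 <= n)%N)
  (Omega : set 'rV[R]_n) (Omega_nonempty : Omega !=set0)
  (Omega_bounded : bounded_set Omega) (Omega_open : open Omega)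
  (Omega_connected : connected Omega) (Omega_C2 : class_C2 Omega)
  (f : 'rV[R]_n -> R) (f_measurable : measurable_fun Omega f)
  (f_Linfty : (Linfty_norm Omega f < +oo)%E)
  (f_ge0 : {ae lebesgue_rV, forall x, Omega x -> 0 <= f x})
  (h : 'rV[R]_n -> \bar R) (h_borel : measurable_fun setT h)
  (h_ge0 : forall xi, (0 <= h xi)%E)
  (K : set 'rV[R]_n) (K_def : K = conv_hull [set xi | h xi = 0%E])
  (K_compact : compact K) (K_0 : K° 0) (K_C2 : class_C2 K)
  (K_curv : forall y kappa, boundary K y -> principal_curvature K y kappa ->
    0 < kappa)
  (hyp : exists Hstar : R, Hstar <= min_mean_rho_curvature K Omega /\
    ((cfun n Hstar (inradius K Omega))%:E * Linfty_norm Omega f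
      <= growth_constant h K)%E) :
  unique_minimizer Omega (functional h f Omega) (minkowski_dist K Omega) <->
  singular_set K Omega `<=` ess_support Omega f.
Proof.
case: hyp => Hst [Hst_le f_small].
have HK : convex_body K.
  by split=> // x y t t01; rewrite K_def => Kx Ky; exact: (conv_hull_convex t01 Kx Ky).
exact: (unique_minimizer_dist HK K_C2 K_curv hn Omega_nonempty Omega_bounded Omega_open Omega_C2
  f_measurable f_Linfty f_ge0 h_borel h_ge0 K_def Hst_le f_small).
Qed.
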